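(* Let $X=(X_t)_{t\ge0}$ be a real L\'evy process with no Gaussian component ($\sigma^2=0$), of bounded variation ($X\in bv$), with drift $\delta=0$, and let $\kappa>1$. Then $$\lim_{t\downarrow0}\frac{X_t}{t^\kappa}=+\infty\quad\text{a.s.}$$ if and only if both $$K_X(d):=\int_0^1\frac{dy}{y}\exp\left\{-d\,\frac{(A_+(y))^{\frac{\kappa}{\kappa-1}}}{y}\right\}<\infty\quad\text{for all } d>0,$$ and $$\int_{(0,1]}\frac{x}{A_+(x)}\,\Pi^{(-)}(dx)<\infty.$$
   Context: The L\'evy process $X$ ($X_0=0$) has characteristic triplet $(\gamma,\sigma^2,\Pi)$ with $\sigma^2=0$, $\gamma\in\mathbb{R}$, and the L\'evy measure $\Pi$ is carried by $[-1,1]\setminus\{0\}$ with $\int x^2\,\Pi(dx)<\infty$; that is, $E[e^{i\theta X_t}]=e^{t\Psi(\theta)}$ with $$\Psi(\theta)=i\gamma\theta+\int_{[-1,1]}(e^{i\theta x}-1-i\theta x)\,\Pi(dx),\quad \theta\in\mathbb{R}.$$ $X\in bv$ if and only if $\int_{|x|\le1}|x|\,\Pi(dx)<\infty$ (given $\sigma^2=0$), and then the drift is $\delta=\gamma-\int_{[-1,1]}x\,\Pi(dx)$. $\Pi^{(-)}$ is the restriction to $[0,\infty)$ of the L\'evy measure of $-X$ (the image of $\Pi|_{(-\infty,0)}$ under $x\mapsto-x$); $\overline{\Pi}^{(+)}(x)=\Pi((x,\infty))$ for $x>0$; and $A_+(x)=\int_0^x\overline{\Pi}^{(+)}(y)\,dy$.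 *)

(* Defs.v *)
From HB Require Import structures.
From mathcomp Require Import all_boot all_order all_algebra.
From mathcomp Require Import all_classical all_reals all_analysis.
From mathcomp Require Import complex.

Set Implicit Arguments.
Unset Strict Implicit.
Unset Printing Implicit Defensive.

Import Order.TTheory GRing.Theory Num.Theory.
Import numFieldNormedType.Exports.

Local Open Scope classical_set_scope.
Local Open Scope ring_scope.
Local Open Scope complex_scope.

Definition cexp (R : realType) (z : R[i]) : R[i] :=
  (expR (complex.Re z))%:C *
    (cos (complex.Im z) +i* sin (complex.Im z)).

Definition cintegral d (T : measurableType d) (R : realType)
    (mu : {measure set T -> \bar R}) (D : set T) (f : T -> R[i]) : R[i] :=
  (\int[mu]_(x in D) complex.Re (f x)) +i*
  (\int[mu]_(x in D) complex.Im (f x)).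

Definition levy_exponent (R : realType) (gamma sigma2 : R)
    (Pi : {measure set (measurableTypeR R) -> \bar R}) (theta : R) : R[i] :=
  'i * (gamma * theta)%:C - (sigma2 * theta ^+ 2 / 2)%:C +
  cintegral Pi `[-1, 1]
    (fun x : R => cexp ('i * (theta * x)%:C) - 1 - 'i * (theta * x)%:C).

Definition bounded_levy_measure (R : realType)
    (Pi : {measure set (measurableTypeR R) -> \bar R}) : Prop :=
  Pi (~` (`[-1, 1] `\ (0 : R))) = 0%E /\
  (\int[Pi]_x (x ^+ 2)%:E < +oo)%E.

(* The events range over all coordinates; subfamilies are covered by taking
   B i = setT. *)
Definition mutually_independent d (T : measurableType d) (R : realType)
    (P : probability T R) (n : nat) (Y : 'I_n -> T -> R) : Prop :=
  forall B : 'I_n -> set (measurableTypeR R), (forall i, measurable (B i)) ->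
    P (\bigcap_i (Y i @^-1` B i)) = (\prod_(i < n) P (Y i @^-1` B i))%E.

Definition cadlag (R : realType) (f : R -> R) : Prop :=
  (forall t, 0 <= t -> f u @[u --> t^'+] --> f t) /\
  (forall t, 0 < t -> cvg (f u @[u --> t^'-])).

(* The time set is [0, +oo[: the values X t for t < 0 are irrelevant and are
   never constrained. *)
Record levy_process d (T : measurableType d) (R : realType)
    (P : probability T R) (X : R -> {RV P >-> measurableTypeR R}) : Prop := {
  levy_start : {ae P, forall w, X 0 w = 0};
  levy_indep : forall (n : nat) (t : nat -> R),
    0 <= t 0%N -> {homo t : i j / (i <= j)%N >-> i <= j} ->
    mutually_independent P (fun (i : 'I_n) w => X (t i.+1) w - X (t i) w);
  levy_stationary : forall s t : R, 0 <= s -> 0 <= t ->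
    forall B : set (measurableTypeR R), measurable B ->
    P ((fun w => X (s + t) w - X s w) @^-1` B) = P (X t @^-1` B);
  levy_cadlag : {ae P, forall w, cadlag (fun t => X t w)} }.

Definition has_triplet d (T : measurableType d) (R : realType)
    (P : probability T R) (X : R -> {RV P >-> measurableTypeR R})
    (gamma sigma2 : R) (Pi : {measure set (measurableTypeR R) -> \bar R})
    : Prop :=
  forall t theta : R, 0 <= t ->
    cintegral P setT (fun w => cexp ('i * (theta * X t w)%:C)) =
    cexp (t%:C * levy_exponent gamma sigma2 Pi theta).

Definition bv d (T : measurableType d) (R : realType)
    (P : probability T R) (X : R -> {RV P >-> measurableTypeR R}) : Prop :=
  {ae P, forall w, forall t : R, 0 <= t ->
     bounded_variation 0 t (fun s => X s w)}.

(* Meaningful when \int |x| Pi(dx) < +oo, which holds for a bounded variation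
   process. *)
Definition drift (R : realType) (gamma : R)
    (Pi : {measure set (measurableTypeR R) -> \bar R}) : R :=
  gamma - \int[Pi]_(x in `[-1, 1]) x.

Definition Pi_minus (R : realType)
    (Pi : {measure set (measurableTypeR R) -> \bar R}) :
    set (measurableTypeR R) -> \bar R :=
  pushforward (mrestr Pi (measurable_itv `]-oo, (0 : R)[))
    (fun x : R => - x).

Definition tail_plus (R : realType)
    (Pi : {measure set (measurableTypeR R) -> \bar R}) (x : R) : \bar R :=
  Pi `]x, +oo[%classic.

(* [fine] loses nothing when \int |x| Pi(dx) < +oo: the integral is then
   finite. *)
Definition A_plus (R : realType)
    (Pi : {measure set (measurableTypeR R) -> \bar R}) (x : R) : R :=
  fine (\int[lebesgue_measure]_(y in `]0%R, x]) tail_plus Pi y)%E.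

Definition K_X (R : realType) (kappa : R)
    (Pi : {measure set (measurableTypeR R) -> \bar R}) (d : R) : \bar R :=
  (\int[lebesgue_measure]_(y in `]0%R, 1%R])
    (y^-1 * expR (- d * (A_plus Pi y `^ (kappa / (kappa - 1)) / y)))%:E)%E.

(* Main.v *)
(** The law of [X] enters through its characteristic function only. The function
[tri] is an average of cosines (a consequence of
[\int_0^oo (1 - cos (u x)) / u^2 du = c |x|]); this turns the exponential formula
into the convergence of [P (X_h \in dx) / h] to [Pi] away from 0, and, the drift being
zero, into [limsup E |X_h| / h <= \int |x| Pi(dx)]. Hence the sum of the positive parts
of the increments over a grid of [0, t] has, as the mesh vanishes, a Laplace transform
converging to [exp (- t phi(la))], [phi(la) = \int (1 - exp (- la x^+)) Pi(dx)] being
comparable to [la A_+(1 / la)]; the same holds for the negative parts.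

Necessity of the first condition. Let [y_n = 2^-n], [t_n = (eps A_+(y_n))^(1/(kappa-1))]
and [v_n = t_n A_+(y_n) / y_n]. The path lies below [C t_n^kappa] at time [t_n] with
probability at least about [exp (- v_n)], also jointly with its being large at all times
[t_m <= t_n / (4 v_n)]. The latter events hardly overlap, whence
[\sum_n exp (- 2 v_n) < oo].

Necessity of the second condition. The path has to stay positive, so a negative
increment exceeding the positive variation accumulated so far happens essentially once;
summing the probabilities of these increments along a grid bounds the integral.

Sufficiency. It is enough that, at all small dyadic scales [s], the negative variation
over either half of a dyadic interval is at most a quarter of the positive variation
over the other half, and that the latter exceeds [C s^kappa]. The two variations are
independent. Splitting according to the dyadic level of the positive variation, and
using Chebyshev's inequality for the exponential of the negative one, the probabilities
of the exceptional events are summable over scales, and Borel-Cantelli applies. *)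
Require Import Defs.
From HB Require Import structures.
From mathcomp Require Import all_boot all_order all_algebra.
From mathcomp Require Import all_classical all_reals all_analysis.
From mathcomp Require Import measurable_realfun.
From mathcomp Require Import complex ring lra.

Set Implicit Arguments.
Unset Strict Implicit.
Unset Printing Implicit Defensive.

Import Order.TTheory GRing.Theory Num.Theory.
Import numFieldNormedType.Exports.

Local Open Scope classical_set_scope.
Local Open Scope ring_scope.

(** * Triangular kernel and averages of cosines *)

(** No decomposition of the paths into jumps is used: the sums of [posp] and of [negp] of the
    increments along a grid stand for the two one-sided jump processes. Over one block the two sums
    are dependent at a fixed mesh, which is why a positive sum over one half of a block is compared
    with a negative sum over the other half. Expectations are first controlled from below only, by
    finite combinations of hat functions; upper bounds follow by applying this to [L * |x| - g], so
    they rest on the limsup of [E |X_h| / h], where the absence of drift enters. The times [t_n]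
    solve [t_n ^ kappa = eps * t_n * A(y_n)]: at the Laplace parameter [1 / y_n], a level
    proportional to [t_n ^ kappa] becomes a multiple of [v_n], and a large enough multiple makes the
    error of the exponential bound small against [exp (- v_n)]. In the sufficiency part the bounds
    for small positive variations charge each time scale to one level of a geometric grid; distinct
    scales get distinct levels, which turns the integral conditions into summable series. *)

Lemma tonelli_sigma_finite d1 d2 (T1 : measurableType d1) (T2 : measurableType d2)
    (R : realType) (m1 : {measure set T1 -> \bar R}) (m2 : {measure set T2 -> \bar R})
    (f : (T1 * T2)%type -> \bar R) :
  sigma_finite setT m1 -> sigma_finite setT m2 ->
  measurable_fun [set: T1 * T2] f -> (forall z, 0 <= f z)%E ->
  (\int[m1]_x \int[m2]_y f (x, y) = \int[m2]_y \int[m1]_x f (x, y))%E.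
Proof.
move=> s1 s2 mf f0.
pose a1 := isSigmaFinite.Build _ _ _ (m1 : set T1 -> \bar R) s1.
pose b1 := isSFinite.Build _ _ _ (m1 : set T1 -> \bar R) (sfinite_measure_sigma_finite s1).
pose a2 := isSigmaFinite.Build _ _ _ (m2 : set T2 -> \bar R) s2.
pose b2 := isSFinite.Build _ _ _ (m2 : set T2 -> \bar R) (sfinite_measure_sigma_finite s2).
pose n1 : {sigma_finite_measure set T1 -> \bar R} := HB.pack (Measure.sort m1) b1 a1.
pose n2 : {sigma_finite_measure set T2 -> \bar R} := HB.pack (Measure.sort m2) b2 a2.
exact: (@fubini_tonelli _ _ _ _ _ n1 n2 f mf f0).
Qed.

Definition push_measure d d' (T1 : measurableType d) (T2 : measurableType d')
    (R : realType) (m : {measure set T1 -> \bar R}) (f : T1 -> T2)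
    (mf : measurable_fun setT f) : {measure set T2 -> \bar R} :=
  measure_function_pushforward__canonical__measure_function_Measure m mf.

Section Tri.
Context {R : realType}.
Implicit Types x y : R.

(** The hat function $(1-|y|)^+$, written as half of a second difference of the absolute value: this
    is the form that [integral_tri_kernel] produces, and it makes sums of translates telescope. *)
Definition tri y : R := (`|y + 1| + `|y - 1| - 2 * `|y|) / 2.

Lemma tri_ge0 y : 0 <= tri y.
Proof. by rewrite /tri; case: (ger0P (y + 1)); case: (ger0P (y - 1)); case: (ger0P y); lra. Qed.

Lemma tri_le1 y : tri y <= 1.
Proof. by rewrite /tri; case: (ger0P (y + 1)); case: (ger0P (y - 1)); case: (ger0P y); lra. Qed.

Lemma tri_eq0 y : 1 <= `|y| -> tri y = 0.
Proof. by rewrite /tri; case: (ger0P (y + 1)); case: (ger0P (y - 1)); case: (ger0P y); lra. Qed.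

(** A second difference is a difference of consecutive first differences, so the sum telescopes. *)
Lemma sum_tri a m x : (a <= m)%N ->
  \sum_(a <= k < m) tri (x - k%:R) =
  (`|x - a%:R + 1| - `|x - a%:R|) / 2 - (`|x - m%:R + 1| - `|x - m%:R|) / 2.
Proof.
move=> am; rewrite (eq_bigr (fun k : nat =>
  - ((`|x - k.+1%:R + 1| - `|x - k.+1%:R|) / 2) - - ((`|x - k%:R + 1| - `|x - k%:R|) / 2))).
  by rewrite telescope_sumr//; ring.
move=> k _; rewrite /tri; have -> : k.+1%:R = k%:R + 1 :> R by rewrite -natr1.
have -> : x - (k%:R + 1) + 1 = x - k%:R by ring.
have -> : x - (k%:R + 1) = x - k%:R - 1 by ring.
by ring.
Qed.

Lemma sum_tri_le1 a m x : (a <= m)%N -> \sum_(a <= k < m) tri (x - k%:R) <= 1.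
Proof.
move=> am; rewrite sum_tri//; move: (x - a%:R) (x - m%:R) => u v.
by case: (ger0P (u + 1)); case: (ger0P u); case: (ger0P (v + 1)); case: (ger0P v); lra.
Qed.

Lemma sum_tri_eq1 a m x : (a <= m)%N -> a%:R <= x -> x <= m%:R - 1 ->
  \sum_(a <= k < m) tri (x - k%:R) = 1.
Proof.
move=> am xa xm; rewrite sum_tri//.
have : 0 <= x - a%:R by rewrite subr_ge0.
have : x - m%:R <= -1 by rewrite lerBlDr; lra.
move: (x - a%:R) (x - m%:R) => u v.
by case: (ger0P (u + 1)); case: (ger0P u); case: (ger0P (v + 1)); case: (ger0P v); lra.
Qed.

End Tri.

(** * Measurability of pointwise operations *)

Section MeasurableFunctions.
Context d (T : measurableType d) (R : realType) (D : set T).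
Implicit Types f g : T -> R.

Lemma measurable_fun_add f g : measurable_fun D f -> measurable_fun D g ->
  measurable_fun D (fun x => f x + g x).
Proof. exact: measurable_funD. Qed.

Lemma measurable_fun_sub f g : measurable_fun D f -> measurable_fun D g ->
  measurable_fun D (fun x => f x - g x).
Proof. exact: measurable_funB. Qed.

Lemma measurable_fun_opp f : measurable_fun D f -> measurable_fun D (fun x => - f x).
Proof. exact: measurable_funN. Qed.

Lemma measurable_fun_mul f g : measurable_fun D f -> measurable_fun D g ->
  measurable_fun D (fun x => f x * g x).
Proof. exact: measurable_funM. Qed.

Lemma measurable_fun_norm f : measurable_fun D f -> measurable_fun D (fun x => `|f x|).
Proof. by move=> mf; exact: measurableT_comp. Qed.

Lemma measurable_fun_cos f : measurable_fun D f -> measurable_fun D (fun x => cos (f x)).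
Proof.
by move=> mf; apply: (measurableT_comp (f := @cos R)) => //;
  apply: continuous_measurable_fun; exact: continuous_cos.
Qed.

Lemma measurable_fun_sin f : measurable_fun D f -> measurable_fun D (fun x => sin (f x)).
Proof.
by move=> mf; apply: (measurableT_comp (f := @sin R)) => //;
  apply: continuous_measurable_fun; exact: continuous_sin.
Qed.

Lemma measurable_fun_exp f : measurable_fun D f -> measurable_fun D (fun x => expR (f x)).
Proof. by move=> mf; apply: (measurableT_comp (f := @expR R)). Qed.

Lemma measurable_fun_max f g : measurable_fun D f -> measurable_fun D g ->
  measurable_fun D (fun x => Num.max (f x) (g x)).
Proof. exact: measurable_maxr. Qed.

Lemma measurable_fun_min f g : measurable_fun D f -> measurable_fun D g ->
  measurable_fun D (fun x => Num.min (f x) (g x)).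
Proof. exact: measurable_minr. Qed.

Lemma measurable_fun_powR f p : measurable_fun D f -> measurable_fun D (fun x => f x `^ p).
Proof. by move=> mf; apply: (measurableT_comp (f := (@powR R)^~ p)). Qed.

Lemma measurable_fun_inv f : measurable_fun D f -> measurable_fun D (fun x => (f x)^-1).
Proof.
move=> mf.
have mi : measurable_fun [set: R] (@GRing.inv R).
  (* The inverse of [x] is [x] times the power -1 of its square; at 0 both sides vanish by
     convention. *)
  rewrite (_ : @GRing.inv R = fun x => x * (x ^+ 2) `^ (-1)); last first.
    apply/funext => x; rewrite powR_inv1 ?sqr_ge0// expr2 invfM mulrA.
    by have [->|x0] := eqVneq x 0; rewrite ?invr0 ?mulr0// divff// mul1r.
  apply: measurable_funM => //.
  by apply: (measurableT_comp (f := (@powR R)^~ (-1))) => //; exact: measurable_powR.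
exact: (measurableT_comp mi).
Qed.

Lemma measurable_fun_tri f : measurable_fun D f -> measurable_fun D (fun x => tri (f x)).
Proof.
move=> mf; apply: measurable_fun_mul => //.
apply: measurable_fun_sub; last by apply: measurable_fun_mul => //; exact: measurable_fun_norm.
by apply: measurable_fun_add; apply: measurable_fun_norm;
  [exact: measurable_fun_add|exact: measurable_fun_sub].
Qed.

Lemma measurable_fun_indic (A : set R) f : measurable A -> measurable_fun D f ->
  measurable_fun D (fun x => \1_A (f x) : R).
Proof.
move=> mA mf; apply: (measurable_comp (F := setT) (f := \1_A : R -> R)) => //.
Qed.

End MeasurableFunctions.

Ltac meas := repeat first
  [ assumption | exact: measurable_cst | exact: measurable_id
  | apply: measurable_fun_tri | apply: measurable_fun_inv | apply: measurable_fun_sub | apply: measurable_fun_add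
  | apply: measurable_fun_opp
  | apply: measurable_fun_norm | apply: measurable_fun_cos | apply: measurable_fun_sin
  | apply: measurable_fun_exp | apply: measurable_fun_max | apply: measurable_fun_min
  | apply: measurable_funX | apply: measurable_fun_mul | apply: measurable_fun_powR
  | apply/measurable_EFinP ].

(** * Elementary trigonometric inequalities *)

Section Trigonometry.
Context {R : realType}.
Implicit Types x y u : R.

Lemma sin_sub_le x y : `|sin x - sin y| <= `|x - y|.
Proof.
wlog xy : x y / y <= x.
  move=> H; have [|/ltW xy] := leP y x; first exact: H.
  by rewrite distrC (distrC x); exact: H.
have [c _ ->] : exists2 c, c \in `[y, x]%R & sin x - sin y = cos c * (x - y).
  apply: (@MVT_segment R (@sin R) (@cos R) y x xy).
  by apply: continuous_subspaceT => z; exact: continuous_sin.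
by rewrite normrM ler_piMl// cos_max.
Qed.

Lemma abs_sin_le x : `|sin x| <= `|x|.
Proof. by have := sin_sub_le x 0; rewrite sin0 !subr0. Qed.

Lemma one_sub_cosE x : 1 - cos x = 2 * sin (x / 2) ^+ 2.
Proof.
have e : x = (x / 2) *+ 2 by rewrite -mulr_natr -mulrA mulVf ?mulr1// pnatr_eq0.
rewrite {1}e cos_mulr2n cos2sin2; ring.
Qed.

Lemma one_sub_cos_ge0 x : 0 <= 1 - cos x.
Proof. by rewrite subr_ge0 cos_le1. Qed.

Lemma one_sub_cos_le2 x : 1 - cos x <= 2.
Proof. by have := cos_geN1 x; lra. Qed.

Lemma one_sub_cos_le_sqr x : 1 - cos x <= x ^+ 2 / 2.
Proof.
rewrite one_sub_cosE.
have h : `|sin (x / 2)| ^+ 2 <= `|x / 2| ^+ 2.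
  by rewrite lerXn2r ?nnegrE ?normr_ge0//; exact: abs_sin_le.
rewrite !real_normK ?num_real// in h.
by rewrite expr_div_n in h; lra.
Qed.

Lemma one_sub_cos_le_abs x : 1 - cos x <= `|x|.
Proof.
have h1 := one_sub_cos_le_sqr x; have h2 := one_sub_cos_le2 x.
have x0 := normr_ge0 x; rewrite -(@real_normK _ x) ?num_real// in h1.
have [x2|x2] := leP `|x| 2; last lra.
by rewrite expr2 in h1; nra.
Qed.

Lemma sin_sub_id_le x : `|sin x - x| <= x ^+ 2.
Proof.
wlog x0 : x / 0 <= x.
  move=> H; have [|/ltW xy] := leP 0 x; first exact: H.
  rewrite -normrN opprB -sqrrN.
  have -> : x - sin x = sin (- x) - - x by rewrite sinN; ring.
  by apply: H; rewrite oppr_ge0.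
have [c cx] : exists2 c, c \in `[0, x]%R &
    (sin x - x) - (sin 0 - 0) = (cos c - 1) * (x - 0).
  apply: (@MVT_segment R (fun z => @sin R z - z) (fun z => cos z - 1) 0 x x0).
  by apply: continuous_subspaceT => z; apply: cvgB; [exact: continuous_sin|exact: cvg_id].
rewrite sin0 !subr0 => ->; rewrite normrM (ger0_norm x0) expr2.
apply: ler_wpM2r => //; rewrite distrC ger0_norm ?one_sub_cos_ge0//.
apply: (le_trans (one_sub_cos_le_abs c)).
by move: cx; rewrite in_itv/= => /andP[c0 cx]; rewrite ger0_norm.
Qed.

(** One integrable majorant for the whole half-line: the quadratic bound serves when [u ^+ 2 <= 1],
    the bound 2 otherwise. *)
Lemma one_sub_cos_div_le u : (1 - cos u) / u ^+ 2 <= 4 * (oneDsqr u)^-1.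
Proof.
rewrite /oneDsqr; have [->|u0] := eqVneq u 0.
  by rewrite expr0n/= invr0 mulr0 addr0 invr1; lra.
have u2 : 0 < u ^+ 2 by rewrite exprn_even_gt0.
rewrite ler_pdivrMr// -mulrA (mulrC _ (u ^+ 2)) mulrA ler_pdivlMr; last lra.
have h1 := one_sub_cos_le_sqr u; have h2 := one_sub_cos_le2 u.
have h3 := one_sub_cos_ge0 u.
have [|] := leP (u ^+ 2) 1; nra.
Qed.

End Trigonometry.

(** * Cosine representation of the absolute value and of the hat function *)

Section AbsKernel.
Context {R : realType}.
Local Notation mu := (@lebesgue_measure R).

(** By uniqueness of Lebesgue measure: [k] times its image under multiplication by [k] gives every
    half-open interval its length. *)
Lemma ge0_integral_scale (k : R) (f : R -> \bar R) : 0 < k ->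
  measurable_fun [set: R] f -> (forall r, 0 <= f r)%E ->
  (\int[mu]_(u in `]0%R, +oo[) f (k * u)%R = (k^-1)%:E * \int[mu]_(u in `]0%R, +oo[) f u)%E.
Proof.
move=> k0 mf f0.
have mk : measurable_fun [set: R] ( *%R k : measurableTypeR R -> measurableTypeR R).
  exact: measurable_funM.
pose nu := mscale (NngNum (ltW k0)) (push_measure mu mk).
have munu A : measurable A -> mu A = nu A.
  move=> mA; apply: lebesgue_measure_unique => //= _ [[a b]] _ <- /=.
  rewrite /nu /mscale/= /pushforward/=.
  have -> : *%R k @^-1` `]a, b]%classic = `](k^-1 * a), (k^-1 * b)]%classic.
    by apply/seteqP; split => x /=; rewrite !in_itv/= ltr_pdivrMl// ler_pdivlMl.
  rewrite !lebesgue_measure_itv/= !lte_fin ltr_pM2l ?invr_gt0//.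
  case: ifPn => ab; last by rewrite mule0.
  by rewrite -!EFinB -EFinM -mulrBr mulrA divff ?mul1r// gt_eqF.
have -> : (\int[mu]_(u in `]0%R, +oo[) f u = \int[nu]_(u in `]0%R, +oo[) f u)%E.
  by apply: eq_measure_integral => A mA _; exact: munu.
rewrite ge0_integral_mscale//; last exact: measurable_funTS.
rewrite muleA -EFinM/= mulVf ?gt_eqF// mul1e.
rewrite ge0_integral_pushforward//; last exact: measurable_funTS.
by congr (integral _ _ _); apply/seteqP; split => x /=; rewrite !in_itv/= !andbT pmulr_rgt0.
Qed.

Lemma integral_oneDsqr_oo :
  (\int[mu]_(u in `]0%R, +oo[) (oneDsqr u)^-1%:E = (pi / 2)%:E)%E.
Proof.
rewrite -integral0y_oneDsqr integral_itv_obnd_cbnd//.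
by apply: measurable_funTS; apply/measurable_EFinP; apply: continuous_measurable_fun;
  exact: continuous_oneDsqrV.
Qed.

Lemma measurable_one_sub_cos_div y :
  measurable_fun [set: R] (fun u => (1 - cos (u * y)) / u ^+ 2).
Proof. by meas. Qed.

(** The value is $\pi/2$. The constant is divided out of every identity, so what is proved about it
    is finiteness and positivity. *)
Definition abs_kernel_cst : R :=
  fine (\int[mu]_(u in `]0%R, +oo[) ((1 - cos u) / u ^+ 2)%:E).
Local Notation c := abs_kernel_cst.

Lemma one_sub_cos_div_ge0 (u y : R) : 0 <= (1 - cos (u * y)) / u ^+ 2.
Proof. by rewrite divr_ge0 ?one_sub_cos_ge0 ?sqr_ge0. Qed.

Lemma integral_one_sub_cos_div :
  (\int[mu]_(u in `]0%R, +oo[) ((1 - cos u) / u ^+ 2)%:E = c%:E)%E.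
Proof.
have me := measurable_one_sub_cos_div 1.
rewrite (_ : (fun u => _) = (fun u => (1 - cos u) / u ^+ 2)) in me; last first.
  by apply/funext => u; rewrite mulr1.
rewrite /c fineK// ge0_fin_numE; last first.
  by apply: integral_ge0 => u _; have := one_sub_cos_div_ge0 u 1; rewrite mulr1 lee_fin.
apply: (@le_lt_trans _ _ (\int[mu]_(u in `]0%R, +oo[) (4 * (oneDsqr u)^-1)%:E)%E).
  apply: ge0_le_integral => //.
  - by move=> u _; have := one_sub_cos_div_ge0 u 1; rewrite mulr1 lee_fin.
  - by apply: measurable_funTS; exact/measurable_EFinP.
  - apply: measurable_funTS; apply/measurable_EFinP; apply: measurable_funM => //.
    by apply: continuous_measurable_fun; exact: continuous_oneDsqrV.
  - by move=> u _; rewrite lee_fin one_sub_cos_div_le.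
under eq_integral do rewrite EFinM.
rewrite ge0_integralZl//.
- by rewrite integral_oneDsqr_oo -EFinM ltry.
- apply: measurable_funTS; apply/measurable_EFinP.
  by apply: continuous_measurable_fun; exact: continuous_oneDsqrV.
Qed.

(** The integrand is at least [(1 - cos 1) / 4] on [[1, 2]], where the cosine decreases because
    [2 <= pi]. *)
Lemma abs_kernel_cst_gt0 : 0 < c.
Proof.
have me := measurable_one_sub_cos_div 1.
rewrite (_ : (fun u => _) = (fun u => (1 - cos u) / u ^+ 2)) in me; last first.
  by apply/funext => u; rewrite mulr1.
have e0 : 0 < 1 - cos (1 : R).
  have p2 := @pi_ge2 R; rewrite subr_gt0 -[ltRHS](@cos0 R).
  by rewrite ltr_cos ?in_itv/= ?lexx//; lra.
rewrite -lte_fin -integral_one_sub_cos_div.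
apply: (@lt_le_trans _ _ (\int[mu]_(u in `[1%R, 2%R]) ((1 - cos 1) / 4)%:E)%E).
  rewrite integral_cst//= lebesgue_measure_itv/= lte_fin ltr1n/= -EFinB -EFinM lte_fin.
  by rewrite mulr_gt0 ?divr_gt0//; lra.
apply: (@le_trans _ _ (\int[mu]_(u in `[1%R, 2%R]) ((1 - cos u) / u ^+ 2)%:E)%E).
  apply: ge0_le_integral => //.
  - by apply: measurable_funTS; exact/measurable_EFinP.
  - move=> u /=; rewrite in_itv/= => /andP[u1 u2]; rewrite lee_fin.
    have cu : cos u <= cos 1.
      have [->//|nu] := eqVneq u 1.
      have p2 := @pi_ge2 R.
      by apply/ltW; rewrite ltr_cos ?in_itv/= ?(lt_neqAle 1) 1?eq_sym ?nu//; lra.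
    have u4 : 0 < u ^+ 2 <= 4 by rewrite expr2; apply/andP; split; nra.
    case/andP: u4 => u0 u4; rewrite ler_pdivrMr// mulrAC ler_pdivlMr//.
    by move: (u ^+ 2) u0 u4 => v v0 v4; nra.
apply: ge0_subset_integral => //.
- by apply: measurable_funTS; exact/measurable_EFinP.
- by move=> u _; have := one_sub_cos_div_ge0 u 1; rewrite mulr1 lee_fin.
- by move=> u /=; rewrite !in_itv/= => /andP[u1 _]; rewrite andbT (lt_le_trans _ u1).
Qed.

Lemma integral_abs_kernel (x : R) :
  (\int[mu]_(u in `]0%R, +oo[) ((1 - cos (u * x)) / u ^+ 2)%:E = (c * `|x|)%:E)%E.
Proof.
have [->|x0] := eqVneq x 0.
  rewrite normr0 mulr0; under eq_integral do rewrite mulr0 cos0 subrr mul0r.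
  by rewrite integral0.
have nx : 0 < `|x| by rewrite normr_gt0.
have me := measurable_one_sub_cos_div 1.
rewrite (_ : (fun u => _) = (fun u => (1 - cos u) / u ^+ 2)) in me; last first.
  by apply/funext => u; rewrite mulr1.
pose f := fun u : R => ((1 - cos u) / u ^+ 2)%:E.
have f0 u : (0 <= f u)%E by have := one_sub_cos_div_ge0 u 1; rewrite mulr1 lee_fin.
transitivity (\int[mu]_(u in `]0%R, +oo[) ((`|x| ^+ 2)%:E * f (`|x| * u)%R))%E.
  apply: eq_integral => u _; rewrite /f -EFinM; congr EFin.
  have -> : cos (u * x) = cos (`|x| * u).
    by rewrite -[in LHS]cos_norm normrM mulrC -[in RHS]cos_norm normrM normr_id.
  rewrite exprMn (invfM (`|x| ^+ 2)) (mulrCA (1 - _)) (mulrA (`|x| ^+ 2)) divff ?mul1r//.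
  by rewrite expf_neq0// gt_eqF.
rewrite ge0_integralZl//.
- rewrite ge0_integral_scale//; last exact/measurable_EFinP.
  rewrite integral_one_sub_cos_div -!EFinM; congr EFin; rewrite mulrA expr2 mulfK ?gt_eqF//.
  by rewrite mulrC.
- apply: measurable_funTS; apply/measurable_EFinP.
  by apply: (measurableT_comp me); exact: measurable_funM.
Qed.

(** By product-to-sum, $(1-\cos uy)(1-\cos u)$ equals $(1-\cos uy)+(1-\cos u)$ minus half of $1-\cos
    u(y+1)$ and half of $1-\cos u(y-1)$. Integrating each term against $u^{-2}$ leaves
    $c\,(|y|+1-(|y+1|+|y-1|)/2)$. *)
Lemma integral_tri_kernel (y : R) :
  (\int[mu]_(u in `]0%R, +oo[) ((1 - cos (u * y)) * (1 - cos u) / u ^+ 2)%:E =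
   (c * (1 - tri y))%:E)%E.
Proof.
have mI z : measurable_fun [set: R] (fun u => (1 - cos (u * z)) / u ^+ 2).
  exact: measurable_one_sub_cos_div.
pose g z := fun u : R => ((1 - cos (u * z)) / u ^+ 2)%:E.
have mg z : measurable_fun (`]0%R, +oo[%classic : set R) (g z).
  by apply: measurable_funTS; exact/measurable_EFinP.
have g0 z u : (0 <= g z u)%E by rewrite lee_fin one_sub_cos_div_ge0.
set I := (\int[mu]_(u in _) _)%E.
(* The identity is stated with additions only, so that every integrand is nonnegative; [I] is shown
   finite afterwards and only then isolated. *)
have e : (I + ((2^-1)%:E * \int[mu]_(u in `]0%R, +oo[) g (y + 1)%R u +
   (2^-1)%:E * \int[mu]_(u in `]0%R, +oo[) g (y - 1)%R u) =
   \int[mu]_(u in `]0%R, +oo[) g y u + \int[mu]_(u in `]0%R, +oo[) g 1%R u)%E.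
  have h0 : (0 <= (2^-1 : R)%:E)%E by rewrite lee_fin; lra.
  rewrite -!ge0_integralZl//.
  have mgh z : measurable_fun (`]0%R, +oo[%classic : set R) (fun u => (2^-1)%:E * g z u)%E.
    by apply: measurable_funTS; rewrite /g; under eq_fun do rewrite -EFinM; meas.
  have gh0 z u : (0 <= (2^-1)%:E * g z u)%E by rewrite mule_ge0.
  rewrite -!ge0_integralD//.
  - apply: eq_integral => u _; rewrite /g -!EFinM -!EFinD; congr EFin.
    have -> : u * (y + 1) = u * y + u by ring.
    have -> : u * (y - 1) = u * y - u by ring.
    rewrite cosD cosB mulr1.
    by move: (u ^- 2) (cos (u * y)) (cos u) (sin (u * y)) (sin u) => i a b d e'; field.
  - exact: mg.
  - exact: mg.
  - by move=> u _; rewrite lee_fin !mulr_ge0 ?one_sub_cos_ge0// invr_ge0 sqr_ge0.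
  - by apply: measurable_funTS; meas.
  - by move=> u _; rewrite adde_ge0.
  - by apply: emeasurable_funD; exact: mgh.
  - exact: mgh.
  - exact: mgh.
  - exact: mg.
  - exact: mg.
have If : I \is a fin_num.
  rewrite ge0_fin_numE; last first.
    apply: integral_ge0 => u _; rewrite lee_fin !mulr_ge0 ?one_sub_cos_ge0//.
    by rewrite invr_ge0 sqr_ge0.
  apply: (@le_lt_trans _ _ (\int[mu]_(u in `]0%R, +oo[) g y u + \int[mu]_(u in `]0%R, +oo[) g 1%R u)%E).
    rewrite -e leeDl// adde_ge0// mule_ge0// ?lee_fin ?invr_ge0//;
    by apply: integral_ge0.
  by rewrite !integral_abs_kernel -EFinD ltry.
move: e; rewrite !integral_abs_kernel normr1 -(fineK If) -!EFinM -!EFinD => -[e].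
by congr EFin; rewrite /tri; lra.
Qed.

End AbsKernel.

Ltac nneg := move=> *; rewrite ?lee_fin;
  repeat first [ assumption | exact: one_sub_cos_ge0 | exact: tri_ge0 | exact: expR_ge0
   | exact: sqr_ge0 | exact: powR_ge0 | exact: normr_ge0
   | by rewrite subr_ge0 tri_le1 | apply: mulr_ge0 | apply: addr_ge0
   | rewrite invr_ge0 | apply: mule_ge0 | rewrite lee_fin | apply: integral_ge0 => ? _].

Ltac side := try solve [ by meas | by apply: measurable_funTS; meas | by nneg ].

Section CosPositive.
Context {R : realType}.
Implicit Types x y : R.

Lemma one_sub_cos_gt0 x : 0 < x <= 2 -> 0 < 1 - cos x.
Proof.
move=> /andP[x0 x2]; have p2 := @pi_ge2 R; rewrite subr_gt0 -[ltRHS](@cos0 R).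
by rewrite ltr_cos ?in_itv/= ?lexx//; lra.
Qed.

End CosPositive.

(** * Small-time limits of the marginal laws *)

Section WeightedLimit.
Context {R : realType}.
Variables (P_ : nat -> probability (measurableTypeR R) R) (r : nat -> R).
Variable Pi : {measure set (measurableTypeR R) -> \bar R}.
Hypothesis r_ge0 : forall j, 0 <= r j.
Hypothesis sfPi : sigma_finite setT Pi.
Hypothesis finPi : (\int[Pi]_x (1 - cos x)%:E < +oo)%E.
Hypothesis trig_cvg : forall th be : R,
  ((r j)%:E * \int[P_ j]_x ((1 - cos x) * (1 - cos (th * x - be)))%:E)%E @[j --> \oo] -->
  (\int[Pi]_x ((1 - cos x) * (1 - cos (th * x - be)))%:E)%E.
Local Notation leb := (@lebesgue_measure R).
Local Notation c := (@abs_kernel_cst R).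

(** At frequency 0 and phase [pi] the second factor of [trig_cvg] is the constant 2. *)
Let mass_cvg : ((r j)%:E * \int[P_ j]_x (1 - cos x)%:E)%E @[j --> \oo] -->
  (\int[Pi]_x (1 - cos x)%:E)%E.
Proof.
have h2 : (2^-1%:E : \bar R) \is a fin_num by [].
have := cvgeZl h2 (@trig_cvg 0 pi).
have e (m : {measure set (measurableTypeR R) -> \bar R}) :
   (\int[m]_x ((1 - cos x) * (1 - cos (0 * x - pi)))%:E = 2%:E * \int[m]_x (1 - cos x)%:E)%E.
  rewrite -ge0_integralZl//; side.
  apply: eq_integral => x _; rewrite -EFinM; congr EFin.
  by rewrite mul0r add0r cosN cospi; ring.
have e2 (y : \bar R) : ((2^-1)%:E * (2%:E * y) = y)%E.
  by rewrite muleA -EFinM mulVf ?pnatr_eq0// mul1e.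
rewrite e e2; apply: cvg_trans; apply: near_eq_cvg; apply: nearW => j /=.
by rewrite e (muleCA _ 2%:E) e2.
Qed.

Let I (m : {measure set (measurableTypeR R) -> \bar R}) (a b u : R) :=
  (\int[m]_x ((1 - cos x) * (1 - cos (u * (a * x - b))))%:E)%E.

Let I_le m a b u : (0 <= I m a b u <= 2%:E * \int[m]_x (1 - cos x)%:E)%E.
Proof.
apply/andP; split.
  by apply: integral_ge0 => x _; rewrite lee_fin mulr_ge0 ?one_sub_cos_ge0.
rewrite -ge0_integralZl//; side.
apply: ge0_le_integral => //; side.
move=> x _; rewrite -EFinM lee_fin mulrC ler_wpM2r ?one_sub_cos_ge0//.
exact: one_sub_cos_le2.
Qed.

(** Averaging over the frequency [u] with weight [(1 - cos u) / u ^+ 2] replaces the cosine factor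
    by [1 - tri], up to the constant [c]. *)
Let I_tonelli (m : {measure set (measurableTypeR R) -> \bar R}) a b :
  sigma_finite setT m ->
  (c%:E * \int[m]_x ((1 - cos x) * (1 - tri (a * x - b)))%:E =
   \int[leb]_(u in `]0%R, +oo[) (((1 - cos u) / u ^+ 2)%:E * I m a b u))%E.
Proof.
have c0 := @abs_kernel_cst_gt0 R.
move=> sm; rewrite -ge0_integralZl//; side; last by rewrite lee_fin ltW.
rewrite [RHS]integral_mkcond.
pose f (z : (measurableTypeR R * measurableTypeR R)%type) : \bar R :=
  ((1 - cos z.1) * ((1 - cos (z.2 * (a * z.1 - b))) * (1 - cos z.2) / z.2 ^+ 2) *
   \1_(`]0%R, +oo[%classic : set R) z.2)%:E.
have m1 : measurable_fun [set: (measurableTypeR R * measurableTypeR R)%type]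
    (fun z : (measurableTypeR R * measurableTypeR R)%type => z.1 : R).
  exact: measurable_fst.
have m2 : measurable_fun [set: (measurableTypeR R * measurableTypeR R)%type]
    (fun z : (measurableTypeR R * measurableTypeR R)%type => z.2 : R).
  exact: measurable_snd.
have mf : measurable_fun setT f.
  rewrite /f; apply/measurable_EFinP; apply: measurable_fun_mul.
    by apply: measurable_fun_mul; [|apply: measurable_fun_mul; [apply: measurable_fun_mul|]]; meas.
  exact: measurable_fun_indic.
have f0 z : (0 <= f z)%E.
  by rewrite lee_fin !mulr_ge0 ?one_sub_cos_ge0// ?invr_ge0 ?sqr_ge0 ?indicE.
have sl : sigma_finite setT leb by exact: sigma_finiteT.
have := tonelli_sigma_finite sm sl mf f0.
rewrite /f /=.
under eq_integral => x _.
  rewrite (_ : (\int[_]_y _)%E = (c%:E * ((1 - cos x) * (1 - tri (a * x - b)))%:E)%E); last first.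
    rewrite -[RHS]EFinM mulrCA EFinM -integral_tri_kernel.
    rewrite -ge0_integralZl//; side.
    rewrite [RHS]integral_mkcond; apply: eq_integral => u _.
    rewrite patchE indicE -EFinM; case: ifPn => _; by rewrite ?mulr1 ?mulr0.
  over.
rewrite /= => ->; apply: eq_integral => u _; rewrite patchE.
case: ifPn => uI; last first.
  by rewrite integral0_eq// => x _; rewrite indicE (negbTE uI) mulr0.
rewrite /I -ge0_integralZl//; side.
apply: eq_integral => x _; rewrite indicE uI mulr1 -EFinM; congr EFin.
by move: (u ^- 2) => i; ring.
Qed.

(** Dominated convergence in the frequency: for fixed [u] the limit is [trig_cvg] at [th = u * a],
    [be = u * b], and the weighted total masses, being convergent, supply the majorant. *)
Let co_tri_cvg a b :
  ((r j)%:E * \int[P_ j]_x ((1 - cos x) * (1 - tri (a * x - b)))%:E)%E @[j --> \oo] -->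
  (\int[Pi]_x ((1 - cos x) * (1 - tri (a * x - b)))%:E)%E.
Proof.
have c0 := @abs_kernel_cst_gt0 R.
have cfin : ((c^-1)%:E : \bar R) \is a fin_num by [].
suff : (c%:E * ((r j)%:E * \int[P_ j]_x ((1 - cos x) * (1 - tri (a * x - b)))%:E))%E @[j --> \oo] -->
  (c%:E * \int[Pi]_x ((1 - cos x) * (1 - tri (a * x - b)))%:E)%E.
  have e2 (y : \bar R) : ((c^-1)%:E * (c%:E * y) = y)%E.
    by rewrite muleA -EFinM mulVf ?gt_eqF// mul1e.
  move=> /(cvgeZl cfin); rewrite e2; apply: cvg_trans; apply: near_eq_cvg.
  by apply: nearW => j /=; rewrite e2.
rewrite (I_tonelli _ _ sfPi).
rewrite (_ : (fun j => _) = (fun j => (r j)%:E * \int[leb]_(u in `]0%R, +oo[)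
    (((1 - cos u) / u ^+ 2)%:E * I (P_ j) a b u))%E); last first.
  by apply/funext => j; rewrite muleCA (I_tonelli _ _ (sigma_finiteT _)).
have [L PiL] : exists L : R, (\int[Pi]_x (1 - cos x)%:E = L%:E)%E.
  exists (fine (\int[Pi]_x (1 - cos x)%:E)); rewrite fineK// ge0_fin_numE//.
  by apply: integral_ge0 => x _; rewrite lee_fin one_sub_cos_ge0.
have [N _ HN] : \forall j \near \oo, ((r j)%:E * \int[P_ j]_x (1 - cos x)%:E <= (L + 1)%:E)%E.
  have mc := mass_cvg; rewrite PiL in mc.
  have := @open_ereal_lt' R L%:E (L + 1)%:E; rewrite lte_fin ltrDl ltr01 => /(_ isT) h0.
  have h : \forall j \near \oo, ((r j)%:E * \int[P_ j]_x (1 - cos x)%:E < (L + 1)%:E)%E := mc _ h0.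
  by apply: filterS h => j /ltW.
(* The majorant has to hold at every index, and the masses are bounded from [N] on. *)
rewrite -(cvg_shiftn N).
pose F j (u : R) := ((r (j + N)%N)%:E * (((1 - cos u) / u ^+ 2)%:E * I (P_ (j + N)%N) a b u))%E.
have mI (m : {measure set (measurableTypeR R) -> \bar R}) : sigma_finite setT m ->
    measurable_fun (`]0%R, +oo[%classic : set R) (I m a b).
  move=> sm; apply: measurable_funTS.
  pose b1 := isSFinite.Build _ _ _ (m : set _ -> \bar R) (sfinite_measure_sigma_finite sm).
  pose a1 := isSigmaFinite.Build _ _ _ (m : set _ -> \bar R) sm.
  pose m' : {sigma_finite_measure set (measurableTypeR R) -> \bar R} := HB.pack (Measure.sort m) b1 a1.
  pose f (z : (measurableTypeR R * measurableTypeR R)%type) : \bar R :=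
    ((1 - cos z.2) * (1 - cos (z.1 * (a * z.2 - b))))%:E.
  have m1 : measurable_fun [set: (measurableTypeR R * measurableTypeR R)%type]
      (fun z : (measurableTypeR R * measurableTypeR R)%type => z.1 : R).
    exact: measurable_fst.
  have m2 : measurable_fun [set: (measurableTypeR R * measurableTypeR R)%type]
      (fun z : (measurableTypeR R * measurableTypeR R)%type => z.2 : R).
    exact: measurable_snd.
  apply: (@measurable_fun_fubini_tonelli_F _ _ _ _ _ m' f).
    by rewrite /f; meas.
  by move=> z; rewrite lee_fin mulr_ge0 ?one_sub_cos_ge0.
have mk : measurable_fun (`]0%R, +oo[%classic : set R) (fun u : R => ((1 - cos u) / u ^+ 2)%:E).
  by apply: measurable_funTS; meas.
have k0 (u : R) : (0 <= ((1 - cos u) / u ^+ 2)%:E)%E.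
  by rewrite lee_fin divr_ge0 ?one_sub_cos_ge0 ?sqr_ge0.
have I0 m u : (0 <= I m a b u)%E by case/andP: (I_le m a b u).
suff : (\int[leb]_(u in `]0%R, +oo[) F j u)%E @[j --> \oo] -->
   (\int[leb]_(u in `]0%R, +oo[) (((1 - cos u) / u ^+ 2)%:E * I Pi a b u))%E.
  apply: cvg_trans; apply: near_eq_cvg; apply: nearW => j /=.
  rewrite /F ge0_integralZl//.
  - by apply: emeasurable_funM => //; apply: mI; exact: sigma_finiteT.
  - by move=> u _; rewrite mule_ge0.
  - by rewrite lee_fin.
have := @dominated_convergence _ _ _ leb (`]0%R, +oo[%classic) _ F
  (fun u => ((1 - cos u) / u ^+ 2)%:E * I Pi a b u)%E
  (fun u => (2 * (L + 1))%:E * ((1 - cos u) / u ^+ 2)%:E)%E.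
case => //.
- move=> j; rewrite /F; apply: emeasurable_funM => //.
  by apply: emeasurable_funM => //; apply: mI; exact: sigma_finiteT.
- by apply: emeasurable_funM => //; exact: mI.
- apply: aeW => u _; rewrite /F.
  have e (m : {measure set (measurableTypeR R) -> \bar R}) :
    (\int[m]_x ((1 - cos x) * (1 - cos (u * a * x - u * b)))%:E)%E = I m a b u.
    apply: eq_integral => x _; congr EFin; congr (_ * (1 - cos _)); ring.
  have h0 : ((r j)%:E * I (P_ j) a b u)%E @[j --> \oo] --> I Pi a b u.
    rewrite -e; apply: cvg_trans (@trig_cvg (u * a) (u * b)).
    by apply: near_eq_cvg; apply: nearW => j /=; rewrite e.
  have h1 : ((r (j + N)%N)%:E * I (P_ (j + N)%N) a b u)%E @[j --> \oo] --> I Pi a b u.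
    by rewrite (cvg_shiftn N (fun j => (r j)%:E * I (P_ j) a b u)%E).
  have kf : ((1 - cos u) / u ^+ 2)%:E \is a fin_num by [].
  apply: cvg_trans (cvgeZl kf h1); apply: near_eq_cvg; apply: nearW => j /=.
  by rewrite /F muleCA.
- apply: integrableZl => //; apply/integrableP; split => //.
  under eq_integral do rewrite gee0_abs//.
  by rewrite integral_one_sub_cos_div ltry.
- apply: aeW => u j _; rewrite /F gee0_abs; last by apply: mule_ge0; [rewrite lee_fin|apply: mule_ge0].
  rewrite muleCA muleC; apply: lee_wpmul2r => //.
  case/andP: (I_le (P_ (j + N)%N) a b u) => _ h.
  apply: (@le_trans _ _ ((r (j + N)%N)%:E * (2%:E * \int[P_ (j + N)%N]_x (1 - cos x)%:E))%E).
    by apply: lee_wpmul2l; rewrite ?lee_fin.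
  rewrite muleCA EFinM; apply: lee_wpmul2l; rewrite ?lee_fin//.
  by apply: HN; rewrite /= leq_addl.
Qed.

(** Complement of [co_tri_cvg] inside the weight [1 - cos x]; the subtraction is licit because the
    weighted masses are finite. *)
Lemma tri_cvg a b :
  ((r j)%:E * \int[P_ j]_x ((1 - cos x) * tri (a * x - b))%:E)%E @[j --> \oo] -->
  (\int[Pi]_x ((1 - cos x) * tri (a * x - b))%:E)%E.
Proof.
have e (m : {measure set (measurableTypeR R) -> \bar R}) :
   (\int[m]_x (1 - cos x)%:E = \int[m]_x ((1 - cos x) * tri (a * x - b))%:E +
      \int[m]_x ((1 - cos x) * (1 - tri (a * x - b)))%:E)%E.
  rewrite -ge0_integralD//; side.
  by apply: eq_integral => x _; rewrite -EFinD; congr EFin; ring.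
have fin (m : {measure set (measurableTypeR R) -> \bar R}) :
    (\int[m]_x (1 - cos x)%:E < +oo)%E ->
    (\int[m]_x ((1 - cos x) * (1 - tri (a * x - b)))%:E)%E \is a fin_num.
  move=> h; rewrite ge0_fin_numE; last first.
    by apply: integral_ge0 => x _; rewrite lee_fin mulr_ge0 ?one_sub_cos_ge0// subr_ge0 tri_le1.
  apply: le_lt_trans h; rewrite e leeDr//.
  by apply: integral_ge0 => x _; rewrite lee_fin mulr_ge0 ?one_sub_cos_ge0// tri_ge0.
have e' (m : {measure set (measurableTypeR R) -> \bar R}) :
    (\int[m]_x (1 - cos x)%:E < +oo)%E ->
    (\int[m]_x ((1 - cos x) * tri (a * x - b))%:E = \int[m]_x (1 - cos x)%:E -
     \int[m]_x ((1 - cos x) * (1 - tri (a * x - b)))%:E)%E.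
  by move=> h; rewrite e addeK// fin.
have finP j : (\int[P_ j]_x (1 - cos x)%:E < +oo)%E.
  apply: (@le_lt_trans _ _ (\int[P_ j]_x 2%:E)%E).
    apply: ge0_le_integral => //; side.
    by move=> x _; rewrite lee_fin one_sub_cos_le2.
  by rewrite integral_cst// -[X in (_ * X)%E]/(P_ j setT) probability_setT mule1 ltry.
rewrite e'//.
rewrite (_ : (fun j => _) = (fun j => (r j)%:E * \int[P_ j]_x (1 - cos x)%:E -
    (r j)%:E * \int[P_ j]_x ((1 - cos x) * (1 - tri (a * x - b)))%:E)%E); last first.
  apply/funext => j; rewrite (e' _ (finP j)) muleBr// fin_num_adde_defl// fin_numN.
  exact: (fin _ (finP j)).
apply: cvgeB.
- by rewrite fin_num_adde_defl// fin_numN fin.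
- exact: mass_cvg.
- exact: co_tri_cvg.
Qed.

(* Only triangular functions are controlled: [g / (1 - cos)] is bounded below by a
   combination of translates of [tri] at mesh [1 / n.+2]. *)
Lemma liminf_pos_part (g : R -> R) : measurable_fun setT g ->
  (forall x, 0 <= g x) -> (forall x, 0 < x <= 1 -> {for x, continuous g}) ->
  forall C : R, (C%:E < \int[Pi]_(x in `]0%R, 1%R]) (g x)%:E)%E ->
  \forall j \near \oo, (C%:E < (r j)%:E * \int[P_ j]_(x in `]0%R, +oo[) (g x)%:E)%E.
Proof.
move=> mg g0 cg C HC.
pose f x := g x / (1 - cos x).
have f0 x : 0 <= f x by rewrite divr_ge0 ?one_sub_cos_ge0.
pose J (n k : nat) : set R := [set y | `|n.+2%:R * y - k%:R| <= 1].
pose mm n k := inf (f @` J n k).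
have J0 n k : f @` J n k !=set0.
  exists (f (k%:R / n.+2%:R)); exists (k%:R / n.+2%:R) => //=.
  by rewrite /J/= mulrC mulfVK ?pnatr_eq0// subrr normr0.
have lJ n k : lbound (f @` J n k) 0 by move=> _ [y _ <-].
have mm0 n k : 0 <= mm n k by exact: lb_le_inf.
(* Starting at [k = 2] keeps the cells [J n k] away from 0; stopping at [n.+3] lets the hats still
   add up to 1 as far as [x = 1]. *)
pose G n x := \sum_(2 <= k < n.+4) mm n k * tri (n.+2%:R * x - k%:R).
have tri0 n k y : ~ J n k y -> tri (n.+2%:R * y - k%:R) = 0.
  by move=> /negP; rewrite -ltNge => /ltW; exact: tri_eq0.
have Gle n x : 0 < x -> G n x <= f x.
  move=> x0; apply: (@le_trans _ _ (\sum_(2 <= k < n.+4) f x * tri (n.+2%:R * x - k%:R))).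
    apply: ler_sum => k _; have [Jx|nJ] := pselect (J n k x).
      by apply: ler_wpM2r; rewrite ?tri_ge0//; apply: ge_inf; [exists 0|exists x].
    by rewrite tri0// !mulr0.
  by rewrite -mulr_sumr ler_piMr// sum_tri_le1.
have G0 n x : x <= 0 -> G n x = 0.
  move=> x0; rewrite /G big_nat_cond big1// => k; rewrite andbT => /andP[k2 _].
  rewrite tri_eq0 ?mulr0// ler0_norm.
    have : 2%:R <= k%:R :> R by rewrite ler_nat.
    have : n.+2%:R * x <= 0 by rewrite mulr_ge0_le0.
    by move: (k%:R : R) (n.+2%:R * x) => a b; lra.
  have : n.+2%:R * x <= 0 by rewrite mulr_ge0_le0.
  have : 0 <= k%:R :> R by [].
  by move: (k%:R : R) (n.+2%:R * x) => a b; lra.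
have Gge0 n x : 0 <= G n x by apply: sumr_ge0 => k _; rewrite mulr_ge0 ?tri_ge0.
have wG n x : (1 - cos x) * G n x <= g x * \1_(`]0%R, +oo[%classic : set R) x.
  rewrite indicE; have [x0|x0] := leP x 0.
    by rewrite G0// mulr0 mulr_ge0.
  rewrite mem_set ?mulr1; last by rewrite /= in_itv/= x0.
  have [c1|c1] := eqVneq (1 - cos x) 0; first by rewrite c1 mul0r.
  apply: (@le_trans _ _ ((1 - cos x) * f x)).
    by apply: ler_wpM2l; [exact: one_sub_cos_ge0|exact: Gle].
  by rewrite /f mulrCA divff ?mulr1.
have mG n : measurable_fun [set: R] (G n).
  by apply: measurable_sum => k; apply: measurable_fun_mul; meas.
have wGcvg x : 0 < x <= 1 -> (((1 - cos x) * G n x)%:E @[n --> \oo] --> (g x)%:E)%E.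
  move=> /andP[x0 x1]; have w0 : 0 < 1 - cos x by apply: one_sub_cos_gt0; rewrite x0; lra.
  have -> : g x = (1 - cos x) * f x by rewrite /f mulrCA divff ?mulr1// gt_eqF.
  apply: cvg_EFin; first exact: nearW.
  rewrite /comp/=; apply: cvgMr => //.
  apply/cvgrPdist_le => e e0.
  have cf : {for x, continuous f}.
    apply: cvgM; first by apply: cg; rewrite x0.
    apply: cvgV; first by rewrite gt_eqF.
    by apply: cvgB; [exact: cvg_cst|exact: continuous_cos].
  (* Since [G n] never exceeds [f], a lower bound for [f] near [x] suffices. *)
  have /nbhs_ballP[dd /= dd0 Hd] : \forall y \near x, f x - e < f y.
    have z : f x - e < f x by rewrite gtrBl.
    exact: (@cvgr_gt _ _ _ _ f (f x) cf _ z).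
  near=> n.
  have n0 : (0 : R) < n.+2%:R by [].
  have nd : 2 < n.+2%:R * dd.
    rewrite -ltr_pdivrMr//; apply: (@lt_le_trans _ _ n%:R); last by rewrite ler_nat; do 2 apply: leqW.
    by near: n; exact: nbhs_infty_gtr.
  have nx : 2 <= n.+2%:R * x.
    rewrite -ler_pdivrMr//; apply: (@le_trans _ _ n%:R); last by rewrite ler_nat; do 2 apply: leqW.
    by near: n; exact: nbhs_infty_ger.
  rewrite ger0_norm ?subr_ge0 ?Gle// lerBlDr addrC -lerBlDr.
  have [fe|fe] := leP (f x - e) 0; first exact: le_trans (Gge0 _ _).
  have <- : \sum_(2 <= k < n.+4) (f x - e) * tri (n.+2%:R * x - k%:R) = f x - e.
    rewrite -mulr_sumr sum_tri_eq1 ?mulr1//.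
    have : n.+2%:R * x <= n.+2%:R by rewrite ler_piMr.
    have -> : n.+4%:R = n.+2%:R + 2 :> R by rewrite -natrD addn2.
    by move: (n.+2%:R : R) => a; lra.
  apply: ler_sum => k _; have [Jx|nJ] := pselect (J n k x); last by rewrite tri0// !mulr0.
  apply: ler_wpM2r; rewrite ?tri_ge0//; apply: lb_le_inf => // _ [y Jy <-].
  apply/ltW/Hd; rewrite /ball/= -(ltr_pM2l n0) (le_lt_trans _ nd)//.
  rewrite -{1}(ger0_norm (ltW n0)) -normrM mulrBr.
  move: Jx Jy; rewrite /J/=; move: (n.+2%:R * x) (n.+2%:R * y) (k%:R : R) => a b h Ja Jb.
  have -> : a - b = (a - h) - (b - h) by ring.
  by rewrite (le_trans (ler_normB _ _))//; lra.
(* Fatou's lemma provides one [n] for which the minorant already exceeds [C]. For this fixed [n] it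
   is a finite combination of hats, to which [tri_cvg] applies. *)
have : (C%:E < limn_einf (fun n => \int[Pi]_(x in `]0%R, 1%R]) ((1 - cos x) * G n x)%:E))%E.
  apply: (lt_le_trans HC).
  apply: (@le_trans _ _ (\int[Pi]_(x in `]0%R, 1%R])
     limn_einf (fun n => ((1 - cos x) * G n x)%:E))%E).
    rewrite le_eqVlt; apply/orP; left; apply/eqP.
    apply: eq_integral => x; rewrite inE/= in_itv/= => xI.
    by have [-> _] := cvg_limn_einf_sup (wGcvg x xI).
  apply: fatou => //.
  - move=> n; apply: measurable_funTS; apply/measurable_EFinP.
    by apply: measurable_fun_mul; [meas|exact: mG].
  - by move=> n x _; rewrite lee_fin mulr_ge0 ?one_sub_cos_ge0.
move=> Cn; have [n Hn] : exists n, (C%:E < \int[Pi]_(x in `]0%R, 1%R]) ((1 - cos x) * G n x)%:E)%E.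
  apply: contrapT => /forallNP nC; move: Cn; apply/negP; rewrite -leNgt.
  rewrite limn_einf_lim; apply: lime_le; first exact: is_cvg_einfs.
  apply: nearW => n; apply: ereal_inf_le; exists (\int[Pi]_(x in `]0%R, 1%R]) ((1 - cos x) * G n x)%:E)%E.
    by exists n => /=.
  by rewrite leNgt; apply/negP; exact: nC.
have ES (m : {measure set (measurableTypeR R) -> \bar R}) :
   (\int[m]_x ((1 - cos x) * G n x)%:E = \sum_(2 <= k < n.+4) (mm n k)%:E *
     \int[m]_x ((1 - cos x) * tri (n.+2%:R * x - k%:R))%:E)%E.
  transitivity (\int[m]_x (\sum_(2 <= k < n.+4) ((mm n k)%:E *
      ((1 - cos x) * tri (n.+2%:R * x - k%:R))%:E)))%E.
    apply: eq_integral => x _; rewrite /G mulr_sumr -sumEFin.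
    by apply: eq_bigr => k _; rewrite -EFinM; congr EFin; ring.
  rewrite ge0_integral_sum//; side.
  - by apply: eq_bigr => k _; rewrite ge0_integralZl//; side; rewrite lee_fin.
  - by move=> k; under eq_fun do rewrite -EFinM; meas.
have Gcvg : ((r j)%:E * \int[P_ j]_x ((1 - cos x) * G n x)%:E)%E @[j --> \oo] -->
    (\int[Pi]_x ((1 - cos x) * G n x)%:E)%E.
  rewrite ES (_ : (fun j => _) = (fun j => \sum_(2 <= k < n.+4) ((mm n k)%:E * ((r j)%:E *
     \int[P_ j]_x ((1 - cos x) * tri (n.+2%:R * x - k%:R))%:E)))%E); last first.
    apply/funext => j; rewrite ES ge0_sume_distrr.
      by apply: eq_bigr => k _; rewrite muleCA.
    by move=> k _; nneg.
  apply: cvg_nnesum.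
  - by move=> k _; apply: nearW => j; nneg.
  - by move=> k _; apply: cvgeZl => //; exact: tri_cvg.
have HC2 : (C%:E < \int[Pi]_x ((1 - cos x) * G n x)%:E)%E.
  apply: (lt_le_trans Hn); apply: ge0_subset_integral => //.
  - by apply/measurable_EFinP; apply: measurable_fun_mul; [meas|exact: mG].
  - by move=> x _; rewrite lee_fin mulr_ge0 ?one_sub_cos_ge0.
have h : \forall j \near \oo, (C%:E < (r j)%:E * \int[P_ j]_x ((1 - cos x) * G n x)%:E)%E :=
  Gcvg _ (open_ereal_gt' HC2).
apply: filterS h => j /lt_le_trans; apply; apply: lee_wpmul2l; first by rewrite lee_fin.
rewrite [leRHS]integral_mkcond; apply: ge0_le_integral => //.
- by move=> x _; rewrite lee_fin mulr_ge0 ?one_sub_cos_ge0.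
- by apply/measurable_EFinP; apply: measurable_fun_mul; [meas|exact: mG].
- by apply/(measurable_restrictT _ _).1 => //; apply: measurable_funTS; exact/measurable_EFinP.
- move=> x _; rewrite patchE; have := wG n x; rewrite indicE; case: (x \in _).
    by rewrite mulr1 lee_fin.
  by rewrite mulr0 lee_fin.
Unshelve. all: by end_near. Qed.

End WeightedLimit.

(** * Complex exponentials and linear combinations of integrals *)

Section ComplexExp.
Context {R : realType}.
Local Open Scope complex_scope.

Lemma imag_mul_real (y : R) : 'i * y%:C = 0 +i* y.
Proof. by rewrite /GRing.mul/= !mul0r !mul1r subr0 add0r. Qed.

Lemma cexp_complexE (a b : R) : cexp (a +i* b) = (expR a * cos b) +i* (expR a * sin b).
Proof. by rewrite /cexp/= /GRing.mul/= !mul0r subr0 addr0. Qed.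

Lemma cexp_imag (y : R) : cexp ('i * y%:C) = cos y +i* sin y.
Proof. by rewrite imag_mul_real cexp_complexE expR0 !mul1r. Qed.

Lemma real_mul_complex (t a b : R) : t%:C * (a +i* b) = (t * a) +i* (t * b).
Proof. by rewrite /GRing.mul/= !mul0r subr0 addr0. Qed.

End ComplexExp.

Section HasInt.
Context d (T : measurableType d) (R : realType) (m : {measure set T -> \bar R}).
Variables (D : set T) (mD : measurable D).

(** Integrability and value travel together, so that a linear combination of several integrals is
    handled in one pass, as in [levy_trig_cvg]. *)
Definition has_int (f : T -> R) (l : R) :=
  m.-integrable D (EFin \o f) /\ \int[m]_(x in D) f x = l.

Lemma has_int_Rintegral (f : T -> R) : m.-integrable D (EFin \o f) ->
  has_int f (\int[m]_(x in D) f x).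
Proof. by []. Qed.

Lemma has_intD f g a b : has_int f a -> has_int g b ->
  has_int (fun x => f x + g x) (a + b).
Proof.
move=> [fi fa] [gi gb]; split; last by rewrite RintegralD// fa gb.
rewrite (_ : _ \o _ = (EFin \o f) \+ (EFin \o g))%E; first exact: integrableD.
by apply/funext => x /=; rewrite EFinD.
Qed.

Lemma has_intZ f a k : has_int f a -> has_int (fun x => k * f x) (k * a).
Proof.
move=> [fi fa]; split; last by rewrite RintegralZl// fa.
rewrite (_ : _ \o _ = fun x => k%:E * (EFin \o f) x)%E; first exact: integrableZl.
by apply/funext => x /=; rewrite EFinM.
Qed.

Lemma has_intB f g a b : has_int f a -> has_int g b ->
  has_int (fun x => f x - g x) (a - b).
Proof.
move=> hf hg; have := has_intD hf (has_intZ (-1) hg); rewrite mulN1r.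
by under [X in has_int X _]eq_fun do rewrite mulN1r.
Qed.

Lemma has_int_ext f g a b : f =1 g -> a = b -> has_int f a -> has_int g b.
Proof. by move=> /funext -> ->. Qed.

Lemma has_int_EFin f a : has_int f a -> (\int[m]_(x in D) (f x)%:E = a%:E)%E.
Proof. by move=> [fi <-]; rewrite /Rintegral fineK//; exact: integrable_fin_num. Qed.

Lemma integrable_bound (f g : T -> R) : measurable_fun D f ->
  (forall x, D x -> `|f x| <= g x) -> measurable_fun D g ->
  (\int[m]_(x in D) (g x)%:E < +oo)%E -> m.-integrable D (EFin \o f).
Proof.
move=> mf fg mg gf; apply/integrableP; split; first exact/measurable_EFinP.
apply: le_lt_trans gf; apply: ge0_le_integral => //.
- by apply: measurableT_comp => //; exact/measurable_EFinP.
- exact/measurable_EFinP.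
Qed.

End HasInt.

Lemma derive_seq (R : realType) (f : R -> R) (df : R) (h : nat -> R) :
  is_derive (0 : R) (1 : R) f df -> (forall j, h j != 0) -> h j @[j --> \oo] --> 0 ->
  (h j)^-1 * (f (h j) - f 0) @[j --> \oo] --> df.
Proof.
move=> [fd fE] hn0 h0.
have : (fun k => k^-1 *: (f (k *: 1 + 0) - f 0)) k @[k --> 0^'] --> df.
  by rewrite -fE; exact: fd.
move=> /cvgr_dnbhsP/(_ h (conj hn0 h0)) /=.
apply: cvg_trans; apply: near_eq_cvg; apply: nearW => j /=.
by rewrite addr0 /GRing.scale/= mulr1.
Qed.

(** * From the characteristic function to small-time limits of trigonometric averages *)

Section LevyCharacteristic.
Local Open Scope complex_scope.
Context (R : realType) (disp : measure_display)
    (T : measurableType disp) (P : probability T R)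
    (X : R -> {RV P >-> measurableTypeR R})
    (gamma : R) (Pi : {measure set (measurableTypeR R) -> \bar R}).
Hypothesis Pi_levy : bounded_levy_measure Pi.
Hypothesis X_triplet : has_triplet X gamma 0 Pi.

(** Minus the real part of the characteristic exponent, so that it is nonnegative. *)
Definition exponent_re (th : R) : R := \int[Pi]_(x in `[(-1)%R, 1%R]) (1 - cos (th * x)).
Definition exponent_im (th : R) : R :=
  gamma * th + \int[Pi]_(x in `[(-1)%R, 1%R]) (sin (th * x) - th * x).

Let mI : measurable (`[-1, 1]%classic : set (measurableTypeR R)).
Proof. exact: measurable_itv. Qed.

Lemma levy_measure_setC : Pi (~` `[-1, 1]%classic) = 0%E.
Proof.
apply/eqP; rewrite eq_le measure_ge0 andbT -Pi_levy.1 le_measure// ?inE.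
- exact: measurableC.
- by apply: measurableC; exact: measurableD.
- by apply: subsetC => x [].
Qed.

Lemma levy_measure_set0 : Pi [set 0] = 0%E.
Proof.
apply/eqP; rewrite eq_le measure_ge0 andbT -Pi_levy.1 le_measure// ?inE.
- exact: measurable_set1.
- by apply: measurableC; exact: measurableD.
- by move=> x ->; rewrite setCD; right.
Qed.

Lemma levy_integral_itv (f : R -> \bar R) : measurable_fun setT f ->
  (forall x, 0 <= f x)%E ->
  (\int[Pi]_x f x = \int[Pi]_(x in `[(-1)%R, 1%R]) f x)%E.
Proof.
move=> mf f0; rewrite (@ge0_negligible_integral _ _ _ Pi setT (~` `[-1, 1]%classic))//.
- by rewrite setTD setCK.
- exact: measurableC.
- exact: levy_measure_setC.
Qed.

Lemma levy_integral_sqr : (\int[Pi]_(x in `[(-1)%R, 1%R]) (x ^+ 2)%:E < +oo)%E.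
Proof.
rewrite -levy_integral_itv//; first exact: Pi_levy.2.
- by meas.
- by move=> x; rewrite lee_fin sqr_ge0.
Qed.

(** Each set [|x| >= 1 / n.+1] has finite mass by Chebyshev's inequality for the second moment, and
    the origin has mass 0. *)
Lemma levy_sigma_finite : sigma_finite setT Pi.
Proof.
exists (fun n => [set x : R | 1 <= n.+1%:R * `|x|] `|` [set 0]).
  apply/seteqP; split => // x _; have [->|x0] := eqVneq x 0; first by exists 0%N => //; right.
  have nx : 0 < `|x| by rewrite normr_gt0.
  exists (Num.bound `|x|^-1) => //; left => /=.
  rewrite -ler_pdivrMr// mul1r; apply/ltW/(lt_le_trans (archi_boundP _)).
    by rewrite invr_ge0.
  by rewrite ler_nat.
move=> n; have mA : measurable ([set x : R | 1 <= n.+1%:R * `|x|] : set (measurableTypeR R)).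
  by rewrite -[X in measurable X]setTI; apply: (@measurable_fun_ler _ _ _ setT (fun=> 1) (fun x : R => n.+1%:R * `|x|)) => //; meas.
split; first exact: measurableU.
apply: (@le_lt_trans _ _ (Pi [set x | (1 <= n.+1%:R * `|x|)%R] + Pi [set 0%R])%E).
  exact: measureU2.
rewrite levy_measure_set0 adde0 -[X in Pi X]setIT -integral_indic//.
apply: (@le_lt_trans _ _ (\int[Pi]_x (n.+1%:R ^+ 2 * x ^+ 2)%:E)%E).
  apply: ge0_le_integral => //.
  - by apply/measurable_EFinP; exact: measurable_indic.
  - by meas.
  - move=> x _; rewrite indicE lee_fin.
    have [|xA] := boolP (x \in _); last by rewrite mulr_ge0 ?sqr_ge0.
    by rewrite inE/= -exprMn -(real_normK (num_real (_ * x))) normrM ger0_norm// => h; rewrite expr_ge1.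
under eq_integral do rewrite EFinM.
rewrite ge0_integralZl//; side.
by apply: lte_mul_pinfty => //; exact: Pi_levy.2.
Qed.

Lemma levy_integral_cos : (\int[Pi]_x (1 - cos x)%:E < +oo)%E.
Proof.
apply: le_lt_trans Pi_levy.2; apply: ge0_le_integral => //; side.
move=> x _; rewrite lee_fin (le_trans (one_sub_cos_le_sqr x))//.
by have := sqr_ge0 x; lra.
Qed.

Lemma has_int_cos th :
  has_int Pi `[-1, 1]%classic (fun x => 1 - cos (th * x)) (exponent_re th).
Proof.
apply: has_int_Rintegral; apply: (integrable_bound mI (g := fun x : R => th ^+ 2 * x ^+ 2)).
- by apply: measurable_funTS; meas.
- move=> x _; rewrite ger0_norm ?one_sub_cos_ge0// (le_trans (one_sub_cos_le_sqr _))// exprMn.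
  have : 0 <= th ^+ 2 * x ^+ 2 by rewrite mulr_ge0 ?sqr_ge0.
  by move: (th ^+ 2 * x ^+ 2) => y y0; rewrite ler_pdivrMr// mulr_natr mulr2n lerDl.
- by apply: measurable_funTS; meas.
- under eq_integral do rewrite EFinM.
  rewrite ge0_integralZl//; side.
  by apply: lte_mul_pinfty => //; [rewrite lee_fin sqr_ge0|exact: levy_integral_sqr].
Qed.

Lemma has_int_sin th : has_int Pi `[-1, 1]%classic (fun x => sin (th * x) - th * x)
  (exponent_im th - gamma * th).
Proof.
rewrite /exponent_im addrC addKr.
apply: has_int_Rintegral; apply: (integrable_bound mI (g := fun x : R => th ^+ 2 * x ^+ 2)).
- by apply: measurable_funTS; meas.
- by move=> x _; rewrite -exprMn sin_sub_id_le.
- by apply: measurable_funTS; meas.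
- under eq_integral do rewrite EFinM.
  rewrite ge0_integralZl//; side.
  by apply: lte_mul_pinfty => //; [rewrite lee_fin sqr_ge0|exact: levy_integral_sqr].
Qed.

Lemma levy_exponentE th :
  levy_exponent gamma 0 Pi th = (- exponent_re th) +i* exponent_im th.
Proof.
rewrite /levy_exponent mul0r mul0r subr0 imag_mul_real.
have -> : cintegral Pi `[-1, 1]%classic
    (fun x : R => cexp ('i * (th * x)%:C) - 1 - 'i * (th * x)%:C) =
  (- exponent_re th) +i* (exponent_im th - gamma * th).
  rewrite /cintegral; congr (_ +i* _).
  - transitivity (-1 * exponent_re th); last by rewrite mulN1r.
    have [_ <-] := has_intZ mI (-1) (has_int_cos th).
    apply: eq_Rintegral => x _.
    by rewrite cexp_imag imag_mul_real /= oppr0 addr0 mulN1r opprB.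
  - have [_ <-] := has_int_sin th.
    apply: eq_Rintegral => x _.
    by rewrite cexp_imag imag_mul_real /= subr0.
by rewrite [LHS]/GRing.add/= add0r addrC subrK.
Qed.

Lemma charfunE t th : 0 <= t ->
  \int[P]_w cos (th * X t w) = expR (- (t * exponent_re th)) * cos (t * exponent_im th) /\
  \int[P]_w sin (th * X t w) = expR (- (t * exponent_re th)) * sin (t * exponent_im th).
Proof.
move=> t0; have := X_triplet th t0.
rewrite levy_exponentE real_mul_complex cexp_complexE mulrN.
have -> : cintegral P setT (fun w => cexp ('i * (th * X t w)%:C)) =
  (\int[P]_w cos (th * X t w)) +i* (\int[P]_w sin (th * X t w)).
  by rewrite /cintegral; congr (_ +i* _); apply: eq_Rintegral => w _; rewrite cexp_imag.
by case.
Qed.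

Lemma has_int_bounded (f : T -> R) (k : R) : measurable_fun setT f ->
  (forall w, `|f w| <= k) -> P.-integrable setT (EFin \o f).
Proof.
move=> mf fk; apply: (integrable_bound measurableT (g := fun=> k)) => //.
by rewrite integral_cst//= -[X in (_ * X)%E]/(P setT) probability_setT mule1 ltry.
Qed.

Lemma has_int_prob_cst (k : R) : has_int P setT (fun=> k) k.
Proof.
split; first by apply: (has_int_bounded (k := `|k|)) => //.
by rewrite Rintegral_cst// -[X in _ * fine X]/(P setT) probability_setT mulr1.
Qed.

Lemma has_int_charcos t th : 0 <= t -> has_int P setT (fun w => 1 - cos (th * X t w))
  (1 - expR (- (t * exponent_re th)) * cos (t * exponent_im th)).
Proof.
move=> t0; have mX : measurable_fun setT (X t) := measurable_funP (X t).
apply: has_intB => //; first exact: has_int_prob_cst.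
split; last by have [] := charfunE th t0.
by apply: (has_int_bounded (k := 1)); [meas|move=> w; exact: cos_max].
Qed.

Lemma has_int_charsin t th : 0 <= t -> has_int P setT (fun w => sin (th * X t w))
  (expR (- (t * exponent_re th)) * sin (t * exponent_im th)).
Proof.
move=> t0; have mX : measurable_fun setT (X t) := measurable_funP (X t).
split; last by have [] := charfunE th t0.
by apply: (has_int_bounded (k := 1)); [meas|move=> w; exact: sin_max].
Qed.

Section Rate.
Variable h : nat -> R.
Hypothesis h_gt0 : forall j, 0 < h j.
Hypothesis h_cvg0 : h j @[j --> \oo] --> 0.

Lemma rate_cos th : (h j)^-1 *
   (1 - expR (- (h j * exponent_re th)) * cos (h j * exponent_im th)) @[j --> \oo] -->
   exponent_re th.
Proof.
have := @derive_seq R (fun s => 1 - expR (- (s * exponent_re th)) * cos (s * exponent_im th))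
  (exponent_re th) h.
rewrite !mul0r oppr0 expR0 cos0 mulr1 subrr.
under [X in _ -> _ -> _ -> X @ _ --> _ ]eq_fun do rewrite subr0.
apply => //; last by move=> j; rewrite gt_eqF.
apply: is_derive_eq; rewrite !mul0r oppr0 expR0 cos0 sin0 /GRing.scale/=; ring.
Qed.

Lemma rate_sin th : (h j)^-1 *
   (expR (- (h j * exponent_re th)) * sin (h j * exponent_im th)) @[j --> \oo] -->
   exponent_im th.
Proof.
have := @derive_seq R (fun s => expR (- (s * exponent_re th)) * sin (s * exponent_im th))
  (exponent_im th) h.
rewrite !mul0r oppr0 expR0 sin0 mulr0.
under [X in _ -> _ -> _ -> X @ _ --> _ ]eq_fun do rewrite subr0.
apply => //; last by move=> j; rewrite gt_eqF.
apply: is_derive_eq; rewrite !mul0r oppr0 expR0 cos0 sin0 /GRing.scale/=; ring.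
Qed.

(** Product-to-sum makes the integrand a fixed linear combination [K] of [1 - cos (s * x)] and
    [sin (s * x)] at the frequencies [1], [th], [th + 1], [th - 1]. The coefficients of the sines
    annihilate functions linear in [s]: so [sin (s * x)] may be replaced by [sin (s * x) - s * x],
    which is integrable for [Pi], and the terms in [gamma] disappear. *)
Lemma levy_trig_cvg th be :
  (((h j)^-1)%:E * \int[distribution P (X (h j))]_x
     ((1 - cos x) * (1 - cos (th * x - be)))%:E)%E @[j --> \oo] -->
  (\int[Pi]_x ((1 - cos x) * (1 - cos (th * x - be)))%:E)%E.
Proof.
pose K (u v : R -> R) := u 1 + cos be * (u th - 2^-1 * u (th + 1) - 2^-1 * u (th - 1))
  - sin be * (v th - 2^-1 * v (th + 1) - 2^-1 * v (th - 1)).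
have KE x : (1 - cos x) * (1 - cos (th * x - be)) =
    K (fun s => 1 - cos (s * x)) (fun s => sin (s * x)).
  rewrite /K mul1r cosB.
  have -> : (th + 1) * x = th * x + x by ring.
  have -> : (th - 1) * x = th * x - x by ring.
  by rewrite cosD cosB sinD sinB; field.
have KE' x : (1 - cos x) * (1 - cos (th * x - be)) =
    K (fun s => 1 - cos (s * x)) (fun s => sin (s * x) - s * x).
  by rewrite KE /K; field.
have K_int d' (T' : measurableType d') (m : {measure set T' -> \bar R}) (D : set T')
    (mD : measurable D) (u v : R -> T' -> R) (a b : R -> R) :
    (forall s, has_int m D (u s) (a s)) -> (forall s, has_int m D (v s) (b s)) ->
    has_int m D (fun x => K (u^~ x) (v^~ x)) (K a b).
  move=> hu hv; apply: has_intB => //; first apply: has_intD => //; apply: has_intZ => //;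
  by apply: has_intB => //; [apply: has_intB => //; exact: has_intZ|exact: has_intZ].
have hP j := K_int _ _ P setT measurableT
  (fun s w => 1 - cos (s * X (h j) w)) (fun s w => sin (s * X (h j) w)) _ _
  (fun s => has_int_charcos s (ltW (h_gt0 j))) (fun s => has_int_charsin s (ltW (h_gt0 j))).
have hPi := K_int _ _ Pi `[-1, 1]%classic mI
  (fun s x => 1 - cos (s * x)) (fun s x => sin (s * x) - s * x) _ _ has_int_cos has_int_sin.
have -> : (\int[Pi]_x ((1 - cos x) * (1 - cos (th * x - be)))%:E)%E =
   (K exponent_re exponent_im)%:E.
  rewrite levy_integral_itv; [|by meas|by move=> x; nneg].
  under eq_integral do rewrite KE'.
  by rewrite (has_int_EFin mI hPi); congr EFin; rewrite /K; field.
have EP j : (((h j)^-1)%:E * \int[distribution P (X (h j))]_x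
     ((1 - cos x) * (1 - cos (th * x - be)))%:E)%E =
   (K (fun s => (h j)^-1 * (1 - expR (- (h j * exponent_re s)) * cos (h j * exponent_im s)))
      (fun s => (h j)^-1 * (expR (- (h j * exponent_re s)) * sin (h j * exponent_im s))))%:E.
  rewrite ge0_integral_distribution; [|by meas|by move=> x; nneg].
  rewrite /comp; under eq_integral do rewrite KE.
  by rewrite (has_int_EFin measurableT (hP j)) -EFinM; congr EFin; rewrite /K; ring.
apply: cvg_EFin; first by apply: nearW => j; rewrite EP.
rewrite (_ : fine \o _ = fun j =>
  K (fun s => (h j)^-1 * (1 - expR (- (h j * exponent_re s)) * cos (h j * exponent_im s)))
    (fun s => (h j)^-1 * (expR (- (h j * exponent_re s)) * sin (h j * exponent_im s)))); last first.
  by apply/funext => j; rewrite /comp EP.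
have cc := rate_cos; have cs := rate_sin.
apply: cvgB; first apply: cvgD => //; apply: cvgMr => //;
by apply: cvgB => //; [apply: cvgB => //; exact: cvgMr|exact: cvgMr].
Qed.

End Rate.

End LevyCharacteristic.

(** * The first absolute moment of small increments *)

Section AbsTonelli.
Context d (T : measurableType d) (R : realType) (m : {measure set T -> \bar R}).
Variable Y : T -> R.
Hypotheses (sm : sigma_finite setT m) (mY : measurable_fun setT Y).
Local Notation leb := (@lebesgue_measure R).

Lemma measurable_integral_cos :
  measurable_fun [set: R] (fun u : R => \int[m]_w (1 - cos (u * Y w))%:E)%E.
Proof.
pose b1 := isSFinite.Build _ _ _ (m : set _ -> \bar R) (sfinite_measure_sigma_finite sm).
pose a1 := isSigmaFinite.Build _ _ _ (m : set _ -> \bar R) sm.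
pose m' : {sigma_finite_measure set T -> \bar R} := HB.pack (Measure.sort m) b1 a1.
pose f (z : (R * T)%type) : \bar R := (1 - cos (z.1 * Y z.2))%:E.
have m1 : measurable_fun [set: (R * T)%type] (fun z : (R * T)%type => z.1 : R).
  exact: measurable_fst.
have m2 : measurable_fun [set: (R * T)%type] (fun z : (R * T)%type => Y z.2 : R).
  by apply: (measurableT_comp mY); exact: measurable_snd.
apply: (@measurable_fun_fubini_tonelli_F _ _ _ _ _ m' f).
  by rewrite /f; apply/measurable_EFinP; apply: measurable_fun_sub => //;
     apply: measurable_fun_cos; exact: measurable_fun_mul.
by move=> z; rewrite lee_fin one_sub_cos_ge0.
Qed.

Lemma integral_abs_tonelli :
  ((@abs_kernel_cst R)%:E * \int[m]_w `|Y w|%:E =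
   \int[leb]_(u in `]0%R, +oo[) ((u ^- 2)%:E * \int[m]_w (1 - cos (u * Y w))%:E))%E.
Proof.
have c0 := @abs_kernel_cst_gt0 R.
rewrite -ge0_integralZl//; side; last by rewrite lee_fin ltW.
rewrite [RHS]integral_mkcond.
pose f (z : (T * measurableTypeR R)%type) : \bar R :=
  ((1 - cos (z.2 * Y z.1)) / z.2 ^+ 2 * \1_(`]0%R, +oo[%classic : set R) z.2)%:E.
have m1 : measurable_fun [set: (T * measurableTypeR R)%type]
    (fun z : (T * measurableTypeR R)%type => Y z.1 : R).
  by apply: (measurableT_comp mY); exact: measurable_fst.
have m2 : measurable_fun [set: (T * measurableTypeR R)%type]
    (fun z : (T * measurableTypeR R)%type => z.2 : R).
  exact: measurable_snd.
have mf : measurable_fun setT f.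
  rewrite /f; apply/measurable_EFinP; apply: measurable_fun_mul.
    by apply: measurable_fun_mul; [apply: measurable_fun_sub => //; apply: measurable_fun_cos;
      exact: measurable_fun_mul|apply: measurable_fun_inv; exact: measurable_funX].
  exact: measurable_fun_indic.
have f0 z : (0 <= f z)%E.
  by rewrite lee_fin !mulr_ge0 ?one_sub_cos_ge0// ?invr_ge0 ?sqr_ge0 ?indicE.
have sl : sigma_finite setT leb by exact: sigma_finiteT.
have := tonelli_sigma_finite sm sl mf f0.
rewrite /f /=.
under eq_integral => x _.
  rewrite (_ : (\int[_]_y _)%E = ((@abs_kernel_cst R)%:E * `|Y x|%:E)%E); last first.
    rewrite -[RHS]EFinM -integral_abs_kernel.
    rewrite [RHS]integral_mkcond; apply: eq_integral => u _.
    rewrite patchE indicE; case: ifPn => _; by rewrite ?mulr1 ?mulr0.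
  over.
rewrite /= => ->; apply: eq_integral => u _; rewrite patchE.
case: ifPn => uI; last first.
  by rewrite integral0_eq// => x _; rewrite indicE (negbTE uI) mulr0.
rewrite -ge0_integralZl//; side.
  by apply: eq_integral => x _; rewrite indicE uI mulr1 mulrC -EFinM.
Qed.

End AbsTonelli.

Section LevyAbs.
Context (R : realType) (disp : measure_display)
    (T : measurableType disp) (P : probability T R)
    (X : R -> {RV P >-> measurableTypeR R})
    (gamma : R) (Pi : {measure set (measurableTypeR R) -> \bar R}).
Hypothesis Pi_levy : bounded_levy_measure Pi.
Hypothesis X_triplet : has_triplet X gamma 0 Pi.
Hypothesis Pi_abs : (\int[Pi]_x `|x|%:E < +oo)%E.
Hypothesis no_drift : drift gamma Pi = 0.
Local Notation leb := (@lebesgue_measure R).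
Local Notation Re_ := (exponent_re Pi).
Local Notation Im_ := (exponent_im gamma Pi).
Local Notation c := (@abs_kernel_cst R).

Let mI : measurable (`[-1, 1]%classic : set (measurableTypeR R)).
Proof. exact: measurable_itv. Qed.

Let abs_itv : (\int[Pi]_(x in `[(-1)%R, 1%R]) `|x|%:E < +oo)%E.
Proof. by rewrite -levy_integral_itv//; meas. Qed.

(** Zero drift says that [gamma] is the mean of [x] under [Pi], which cancels the compensator
    [th * x]. *)
Lemma exponent_imE th : has_int Pi `[-1, 1]%classic (fun x => sin (th * x)) (Im_ th).
Proof.
have hx : has_int Pi `[-1, 1]%classic (fun x : R => x) gamma.
  move: no_drift; rewrite /drift => /eqP; rewrite subr_eq0 => /eqP ->.
  apply: has_int_Rintegral; apply: (integrable_bound mI (g := fun x : R => `|x|)) => //.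
  by apply: measurable_funTS; meas.
have := has_intD mI (has_int_sin gamma Pi_levy th) (has_intZ mI th hx).
by apply: has_int_ext => [x|]; ring.
Qed.

(** $|\sin(\theta x)|\le\theta\min(|x|,1/\theta)$, and [th^-1 <= N.+1%:R^-1]. *)
Lemma exponent_im_le th (N : nat) : N.+1%:R <= th ->
  (`|Im_ th|%:E <= th%:E * \int[Pi]_(x in `[(-1)%R, 1%R]) (Num.min `|x| N.+1%:R^-1)%:E)%E.
Proof.
move=> Nth; have [si <-] := exponent_imE th.
have th0 : 0 < th by apply: lt_le_trans Nth.
rewrite -ge0_integralZl//; last 2 first.
- by apply: measurable_funTS; meas.
- by rewrite lee_fin ltW.
rewrite EFin_normr_Rintegral//.
apply: (le_trans (le_abse_integral _ _ _)) => //; first by case/integrableP: si.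
apply: ge0_le_integral => //.
- by apply: measurableT_comp => //; case/integrableP: si.
- by apply: measurable_funTS; apply: measurable_funeM; meas.
- move=> x _; rewrite /= -EFinM lee_fin -ler_pdivrMl// le_min !ler_pdivrMl//.
  apply/andP; split; first by rewrite (le_trans (abs_sin_le _))// normrM gtr0_norm.
  apply: (le_trans (sin_max _)); rewrite ler_pdivlMr// mul1r//.
Qed.

Lemma exponent_im_le_abs th : 0 <= th ->
  `|Im_ th| <= th * fine (\int[Pi]_(x in `[(-1)%R, 1%R]) `|x|%:E)%E.
Proof.
move=> th0; rewrite -lee_fin EFinM fineK; last first.
  by rewrite ge0_fin_numE//; apply: integral_ge0 => x _; rewrite lee_fin.
have [si <-] := exponent_imE th.
rewrite -ge0_integralZl//; last by apply: measurable_funTS; meas.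
rewrite EFin_normr_Rintegral//.
apply: (le_trans (le_abse_integral _ _ _)) => //; first by case/integrableP: si.
apply: ge0_le_integral => //.
- by apply: measurableT_comp => //; case/integrableP: si.
- by apply: measurable_funTS; apply: measurable_funeM; meas.
- by move=> x _; rewrite /= -EFinM lee_fin (le_trans (abs_sin_le _))// normrM ger0_norm.
Qed.

(** The integrals of [min (|x|, 1 / n.+1)] tend to 0 by dominated convergence. This sublinearity is
    what keeps a drift out of the first moment in [abs_increment_le]. *)
Lemma exponent_im_littleo (eta : R) : 0 < eta ->
  exists N : nat, forall th, N.+1%:R <= th -> `|Im_ th| <= eta * th.
Proof.
move=> eta0.
pose F (n : nat) (x : R) := (Num.min `|x| n.+1%:R^-1)%:E.
have : (\int[Pi]_(x in `[(-1)%R, 1%R]) F n x @[n --> \oo] --> 0)%E.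
  have := @dominated_convergence _ _ _ Pi `[-1, 1]%classic mI F (cst 0%E) (fun x => `|x|%:E).
  case.
  - by move=> n; apply: measurable_funTS; rewrite /F; meas.
  - exact: measurable_cst.
  - apply: aeW => x _; apply: cvg_EFin; first exact: nearW.
    apply/cvgrPdist_le => e e0; near=> n.
    rewrite sub0r normrN /= ger0_norm; last by rewrite le_min normr_ge0 invr_ge0 ler0n.
    rewrite ge_min; apply/orP; right; near: n.
    have := @cvgr_le _ _ _ _ _ _ (@cvg_harmonic R) e; apply; exact: e0.
  - apply/integrableP; split; first by apply: measurable_funTS; meas.
    by under eq_integral do rewrite gee0_abs//.
  - apply: aeW => x n _; rewrite /F gee0_abs ?lee_fin ?ge_min ?lexx//.
  by move=> _ _; rewrite integral0.
have := @open_ereal_lt' R 0%E eta%:E; rewrite lte_fin eta0 => /(_ isT) h0 hc.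
have [N _ HN] : \forall n \near \oo, (\int[Pi]_(x in `[(-1)%R, 1%R]) F n x < eta%:E)%E := hc _ h0.
exists N => th Nth; rewrite -lee_fin.
have th0 : 0 <= th by apply: le_trans Nth.
apply: (le_trans (exponent_im_le Nth)); rewrite muleC EFinM; apply: lee_wpmul2r; first by rewrite lee_fin.
by apply: ltW; apply: HN => /=.
Unshelve. all: end_near.
Qed.

Section Rate.
Variable h : nat -> R.
Hypothesis h_gt0 : forall j, 0 < h j.
Hypothesis h_cvg0 : h j @[j --> \oo] --> 0.

Let m := fine (\int[Pi]_x `|x|%:E)%E.

Let mE : (\int[Pi]_x `|x|%:E = m%:E)%E.
Proof. by rewrite /m fineK// ge0_fin_numE//; apply: integral_ge0 => x _; rewrite lee_fin. Qed.

(** One has $1-e^{-t\rho}\cos(t\iota)\le t\rho+(1-\cos(t\iota))$ for $\rho$, $\iota$ the values of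
    [exponent_re] and [exponent_im] at [u]. Against $u^{-2}$ the first term ([B1]) integrates back
    to [c * m]. The second is of order $t^2$ up to [u = N.+1], because $|\iota|\le um$ ([B2]);
    beyond, it is compared with a rescaled Cauchy density whose mass is proportional to [t * eta]
    ([B3]). *)
Lemma abs_increment_le (t eta : R) (N : nat) : 0 < t -> 0 < eta ->
  (forall th, N.+1%:R <= th -> `|Im_ th| <= eta * th) ->
  (c%:E * \int[P]_w `|X t w|%:E <= (t * (c * m + t * (m ^+ 2 / 2 * N.+1%:R) + 2 * pi * eta))%:E)%E.
Proof.
move=> t0 eta0 HN.
have mX : measurable_fun setT (X t) := measurable_funP (X t).
have c0 := @abs_kernel_cst_gt0 R.
have ET u : (\int[P]_w (1 - cos (u * X t w))%:E =
    (1 - expR (- (t * Re_ u)) * cos (t * Im_ u))%:E)%E.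
  by rewrite (has_int_EFin measurableT (has_int_charcos Pi_levy X_triplet u (ltW t0))).
have EPi u : (\int[Pi]_x (1 - cos (u * x))%:E = (Re_ u)%:E)%E.
  rewrite levy_integral_itv//; last by meas.
  by rewrite (has_int_EFin mI (has_int_cos Pi_levy u)).
have Re0 u : 0 <= Re_ u by rewrite -lee_fin -EPi; apply: integral_ge0 => x _; rewrite lee_fin one_sub_cos_ge0.
have mRe : measurable_fun [set: R] (fun u => (Re_ u)%:E).
  by under eq_fun do rewrite -EPi; apply: measurable_integral_cos => //; exact: levy_sigma_finite.
have mE' : measurable_fun [set: R] (fun u => \int[P]_w (1 - cos (u * X t w))%:E)%E.
  by apply: measurable_integral_cos => //; exact: sigma_finiteT.
rewrite integral_abs_tonelli//; last exact: sigma_finiteT.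
have k0 : 0 < t * eta by rewrite mulr_gt0.
pose B1 u : \bar R := (t%:E * ((u ^- 2)%:E * \int[Pi]_x (1 - cos (u * x))%:E))%E.
pose B2 u : \bar R := ((t ^+ 2 * (m ^+ 2 / 2)) * \1_(`]0, N.+1%:R]%classic : set R) u)%:E.
pose B3 u : \bar R := ((4 * (t * eta) ^+ 2)%:E * ((oneDsqr (t * eta * u))^-1)%:E)%E.
have mB : measurable_fun [set: R] (fun u : R => ((u ^- 2)%:E * \int[Pi]_x (1 - cos (u * x))%:E)%E).
  under eq_fun do rewrite EPi.
  by apply: emeasurable_funM => //; meas.
have m1 : measurable_fun (`]0%R, +oo[%classic : set R) B1.
  apply: measurable_funTS; rewrite /B1; apply: emeasurable_funM => //.
have m2 : measurable_fun (`]0%R, +oo[%classic : set R) B2.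
  apply: measurable_funTS; rewrite /B2; apply/measurable_EFinP; by apply: measurable_fun_mul.
have mo : measurable_fun [set: R] (fun u : R => (oneDsqr u)^-1%:E).
  by rewrite /oneDsqr; meas.
have mo' : measurable_fun [set: R] (fun u : R => (oneDsqr (t * eta * u))^-1%:E).
  by rewrite /oneDsqr; meas.
have m3 : measurable_fun (`]0%R, +oo[%classic : set R) B3.
  by apply: measurable_funTS; rewrite /B3; apply: emeasurable_funM.
have o0 (u : R) : 0 <= (oneDsqr u)^-1 by rewrite invr_ge0 (le_trans _ (oneDsqr_ge1 u)).
have B10 u : (0 <= B1 u)%E.
  rewrite /B1 EPi mule_ge0 ?lee_fin ?(ltW t0)//.
  by rewrite mulr_ge0// invr_ge0 sqr_ge0.
have B20 u : (0 <= B2 u)%E by rewrite lee_fin mulr_ge0 ?indicE// mulr_ge0 ?divr_ge0 ?sqr_ge0.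
have B30 u : (0 <= B3 u)%E by rewrite /B3 -EFinM lee_fin mulr_ge0// mulr_ge0 ?sqr_ge0.
apply: (@le_trans _ _ (\int[leb]_(u in `]0%R, +oo[) (B1 u + (B2 u + B3 u)))%E).
  apply: ge0_le_integral => //.
  - move=> u _; rewrite ET -EFinM lee_fin mulr_ge0 ?invr_ge0 ?sqr_ge0//.
    rewrite subr_ge0 (le_trans (ler_norm _))// normrM ger0_norm ?expR_ge0//.
    rewrite -[leRHS]mulr1 ler_pM ?expR_ge0 ?cos_max//.
    by rewrite -expR0 ler_expR oppr_le0 mulr_ge0// ltW.
  - by apply: emeasurable_funM; apply: measurable_funTS => //; meas.
  - by apply: emeasurable_funD => //; apply: emeasurable_funD.
  - move=> u /=; rewrite in_itv/= andbT => u0.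
    rewrite ET /B1 EPi /B2 /B3 -!EFinM -!EFinD lee_fin.
    have u2 : 0 < u ^- 2 by rewrite invr_gt0 exprn_gt0.
    have h1 : 1 - expR (- (t * Re_ u)) * cos (t * Im_ u) <= t * Re_ u + (1 - cos (t * Im_ u)).
      have e0 := expR_ge0 (- (t * Re_ u)); have e1 := expR_ge1Dx (- (t * Re_ u)).
      have e2 : expR (- (t * Re_ u)) <= 1 by rewrite -expR0 ler_expR oppr_le0 mulr_ge0// ltW.
      by have := cos_le1 (t * Im_ u); have := cos_geN1 (t * Im_ u); nra.
    apply: (le_trans (ler_wpM2l (ltW u2) h1)); rewrite mulrDr mulrCA; apply: lerD => //.
    rewrite indicE; have [uN|uN] := leP u N.+1%:R.
      rewrite mem_set ?mulr1; last by rewrite /= in_itv/= u0.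
      apply: (@le_trans _ _ (t ^+ 2 * (m ^+ 2 / 2))); last by rewrite lerDl mulr_ge0// mulr_ge0 ?sqr_ge0.
      rewrite mulrC ler_pdivrMr ?exprn_gt0//.
      apply: (le_trans (one_sub_cos_le_sqr _)).
      have : `|t * Im_ u| ^+ 2 <= (t * (u * m)) ^+ 2.
        rewrite lerXn2r ?nnegrE ?normr_ge0// ?mulr_ge0 ?(ltW t0) ?(ltW u0)//.
          by rewrite -lee_fin -mE integral_ge0// => x _; rewrite lee_fin.
        rewrite normrM gtr0_norm// ler_pM2l// (le_trans (exponent_im_le_abs (ltW u0)))//.
        rewrite ler_pM2l// /m levy_integral_itv//; by meas.
      by rewrite real_normK ?num_real// !exprMn; lra.
    rewrite memNset ?mulr0 ?add0r; last first.
      by rewrite /= in_itv/= u0/= leNgt uN.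
    have hI : `|t * Im_ u| <= t * eta * u.
      by rewrite normrM gtr0_norm// -mulrA ler_pM2l// HN// ltW.
    have : 1 - cos (t * Im_ u) <= 4 * ((t * eta * u) ^+ 2 * (oneDsqr (t * eta * u))^-1).
      have b1 := one_sub_cos_le2 (t * Im_ u).
      have b2 := one_sub_cos_le_sqr (t * Im_ u).
      have b3 : (t * Im_ u) ^+ 2 <= (t * eta * u) ^+ 2.
        rewrite -(real_normK (num_real (t * Im_ u))) lerXn2r ?nnegrE ?normr_ge0//.
        by rewrite ltW// mulr_gt0.
      rewrite /oneDsqr; move: (t * eta * u) b3 => y b3.
      rewrite mulrA ler_pdivlMr; last by have := sqr_ge0 y; lra.
      have := one_sub_cos_ge0 (t * Im_ u); have := sqr_ge0 y.
      have [|] := leP (y ^+ 2) 1; nra.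
    move=> /(ler_wpM2l (ltW u2)) /le_trans; apply.
    rewrite le_eqVlt; apply/orP; left; apply/eqP.
    rewrite (exprMn _ _ u); move: (oneDsqr _)^-1 => o.
    by rewrite -[RHS]mulr1 -(@mulVf _ (u ^+ 2)) ?gt_eqF ?exprn_gt0//; ring.
rewrite ge0_integralD//; [|by move=> u _; exact: adde_ge0|exact: emeasurable_funD].
rewrite ge0_integralD//.
have -> : (\int[leb]_(u in `]0%R, +oo[) B1 u = (t * (c * m))%:E)%E.
  rewrite /B1 ge0_integralZl//; last 3 first.
  - exact: measurable_funTS.
  - by move=> u _; rewrite EPi -EFinM lee_fin mulr_ge0// invr_ge0 sqr_ge0.
  - by rewrite lee_fin ltW.
  rewrite -(integral_abs_tonelli (m := Pi) (Y := fun x : R => x))//; last exact: levy_sigma_finite.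
  by rewrite mE -!EFinM.
have -> : (\int[leb]_(u in `]0%R, +oo[) B2 u = (t ^+ 2 * (m ^+ 2 / 2) * N.+1%:R)%:E)%E.
  rewrite /B2; under eq_integral do rewrite EFinM.
  rewrite ge0_integralZl//; last 2 first.
  - by apply/measurable_EFinP; exact: measurable_fun_indic.
  - by rewrite lee_fin mulr_ge0 ?divr_ge0 ?sqr_ge0.
  rewrite integral_indic//= setIidl; last first.
    by move=> u /=; rewrite !in_itv/= => /andP[-> _].
  by rewrite lebesgue_measure_itv/= lte_fin ltr0n/= -EFinB subr0 -EFinM.
have -> : (\int[leb]_(u in `]0%R, +oo[) B3 u = (2 * pi * (t * eta))%:E)%E.
  rewrite /B3 ge0_integralZl//; last 2 first.
  - exact: measurable_funTS.
  - by rewrite lee_fin mulr_ge0 ?sqr_ge0.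
  rewrite (ge0_integral_scale (f := fun u => (oneDsqr u)^-1%:E))//.
  rewrite integral_oneDsqr_oo -!EFinM; congr EFin.
  by move: k0; move: (t * eta) => k k0; field; rewrite gt_eqF.
rewrite -!EFinD lee_fin le_eqVlt; apply/orP; left; apply/eqP; ring.
Qed.

Lemma limsup_abs_increment (C : R) : m < C ->
  \forall j \near \oo, ((h j)^-1%:E * \int[P]_w `|X (h j) w|%:E < C%:E)%E.
Proof.
move=> mC; have c0 := @abs_kernel_cst_gt0 R.
pose e := (C - m) * c.
have e0 : 0 < e by rewrite mulr_gt0// subr_gt0.
(* Makes the last term [2 * pi * eta] of [abs_increment_le] equal to [e / 4]; the middle one will be
   below [e / 2]. *)
pose eta := e / (8 * pi).
have pi0 := @pi_gt0 R.
have eta0 : 0 < eta by rewrite divr_gt0// mulr_gt0.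
have [N HN] := exponent_im_littleo eta0.
pose K := m ^+ 2 / 2 * N.+1%:R.
have K0 : 0 <= K by rewrite mulr_ge0 ?divr_ge0 ?sqr_ge0.
have hK : h j * K @[j --> \oo] --> 0 by rewrite -(mul0r K); apply: cvgMl.
have he : \forall j \near \oo, h j * K < e / 2.
  by have := @cvgr_lt _ _ _ _ _ _ hK (e / 2); apply; rewrite divr_gt0.
apply: filterS he => j hj.
have := abs_increment_le (h_gt0 j) eta0 HN.
have hj0 := h_gt0 j.
have chj : (0 < (c * h j)^-1%:E)%E by rewrite lte_fin invr_gt0 mulr_gt0.
move=> /(lee_wpmul2l (ltW chj)); rewrite muleA -EFinM.
have -> : (c * h j)^-1 * c = (h j)^-1 by field; rewrite !gt_eqF.
move=> /le_lt_trans; apply; rewrite -EFinM lte_fin.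
have -> : (c * h j)^-1 * (h j * (c * m + h j * (m ^+ 2 / 2 * N.+1%:R) + 2 * pi * eta)) =
  m + (h j * K + 2 * pi * eta) / c by rewrite /K; field; rewrite !gt_eqF.
rewrite -ltrBrDl ltr_pdivrMr// -/e.
have -> : 2 * pi * eta = e / 4.
  rewrite /eta invfM; have : pi * pi^-1 = 1 :> R by rewrite divff// gt_eqF.
  by move: pi^-1 => ip ; nra.
by lra.
Qed.

End Rate.

End LevyAbs.

(** * Lower bounds on both half-lines *)

Section TwoSidedLimit.
Context {R : realType}.
Variables (P_ : nat -> probability (measurableTypeR R) R) (r : nat -> R).
Variable Pi : {measure set (measurableTypeR R) -> \bar R}.
Hypothesis r_ge0 : forall j, 0 <= r j.
Hypothesis sfPi : sigma_finite setT Pi.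
Hypothesis finPi : (\int[Pi]_x (1 - cos x)%:E < +oo)%E.
Hypothesis trig_cvg : forall th be : R,
  ((r j)%:E * \int[P_ j]_x ((1 - cos x) * (1 - cos (th * x - be)))%:E)%E @[j --> \oo] -->
  (\int[Pi]_x ((1 - cos x) * (1 - cos (th * x - be)))%:E)%E.

Let mopp : measurable_fun [set: measurableTypeR R] (fun x : R => (- x : measurableTypeR R)).
Proof. by apply: measurable_fun_opp. Qed.

(** Reflection at the origin: the hypotheses are stable under [x -> - x], since the cosine is even
    and only the sign of the phase [be] changes. *)
Lemma liminf_neg_part (g : R -> R) : measurable_fun setT g ->
  (forall x, 0 <= g x) -> (forall x, -1 <= x < 0 -> {for x, continuous g}) ->
  forall C : R, (C%:E < \int[Pi]_(x in `[(-1)%R, 0%R[) (g x)%:E)%E ->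
  \forall j \near \oo, (C%:E < (r j)%:E * \int[P_ j]_(x in `]-oo, 0%R[) (g x)%:E)%E.
Proof.
move=> mg g0 cg C HC.
pose n1 := isMeasurableFun.Build _ _ _ _ (fun x : measurableTypeR R => (- x : measurableTypeR R)) mopp.
pose n2 : {mfun measurableTypeR R >-> measurableTypeR R} :=
  HB.pack (fun x : measurableTypeR R => (- x : measurableTypeR R)) n1.
pose Y j : {RV (P_ j) >-> measurableTypeR R} := n2.
pose Q j : probability (measurableTypeR R) R := distribution (P_ j) (Y j).
pose Pi' := push_measure Pi mopp.
have intQ j (f : R -> \bar R) : measurable_fun setT f -> (forall x, 0 <= f x)%E ->
    (\int[Q j]_x f x = \int[P_ j]_x f (- x)%R)%E.
  by move=> mf f0; rewrite /Q ge0_integral_distribution.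
have intPi (f : R -> \bar R) : measurable_fun setT f -> (forall x, 0 <= f x)%E ->
    (\int[Pi']_x f x = \int[Pi]_x f (- x)%R)%E.
  by move=> mf f0; rewrite /Pi' ge0_integral_pushforward.
have intQD j (D D' : set (measurableTypeR R)) (f : R -> \bar R) : measurable D -> (forall x : R, D x <-> D' (- x : R)) ->
    measurable_fun setT f -> (forall x, 0 <= f x)%E ->
    (\int[Q j]_(x in D) f x = \int[P_ j]_(x in D') f (- x)%R)%E.
  move=> mD DD mf f0; rewrite integral_mkcond intQ; last 2 first.
  - by apply/(measurable_restrictT _ _).1 => //; exact: measurable_funTS.
  - by move=> x; apply: erestrict_ge0.
  rewrite [RHS]integral_mkcond; apply: eq_integral => x _.
  by rewrite !patchE; have -> : (- x \in D) = (x \in D') by apply/idP/idP; rewrite !inE => h;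
    [move/DD: h; rewrite opprK|apply/DD; rewrite opprK].
have intPiD (D D' : set (measurableTypeR R)) (f : R -> \bar R) : measurable D -> (forall x : R, D x <-> D' (- x : R)) ->
    measurable_fun setT f -> (forall x, 0 <= f x)%E ->
    (\int[Pi']_(x in D) f x = \int[Pi]_(x in D') f (- x)%R)%E.
  move=> mD DD mf f0; rewrite integral_mkcond intPi; last 2 first.
  - by apply/(measurable_restrictT _ _).1 => //; exact: measurable_funTS.
  - by move=> x; apply: erestrict_ge0.
  rewrite [RHS]integral_mkcond; apply: eq_integral => x _.
  by rewrite !patchE; have -> : (- x \in D) = (x \in D') by apply/idP/idP; rewrite !inE => h;
    [move/DD: h; rewrite opprK|apply/DD; rewrite opprK].
have := @liminf_pos_part R Q r Pi' r_ge0.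
have sf : sigma_finite setT Pi'.
  have [F FT Ff] := sfPi; exists (fun n => (fun x : R => - x) @` F n).
    apply/seteqP; split => // x _.
    have : [set: R] (- x) by [].
    rewrite FT => -[n _ Fn]; exists n => //; exists (- x) => //; exact: opprK.
  move=> n; have [mF FF] := Ff n.
  have E : (fun x : R => - x) @` F n = (fun x : R => - x) @^-1` F n.
    apply/seteqP; split => x; first by move=> [y Fy <-] /=; rewrite opprK.
    by move=> h; exists (- x) => //; exact: opprK.
  have mE : measurable ((fun x : R => - x) @` F n : set (measurableTypeR R)).
    by rewrite E -[X in measurable X]setTI; exact: mopp.
  split => //; rewrite /Pi'/= /pushforward (_ : _ @^-1` _ = F n)//.
  rewrite E; apply/seteqP; split => x /=; rewrite opprK//.
move=> /(_ sf).
have fc : (\int[Pi']_x (1 - cos x)%:E < +oo)%E.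
  rewrite intPi; [|by meas|by move=> x; rewrite lee_fin one_sub_cos_ge0].
  by under eq_integral do rewrite cosN.
move=> /(_ fc).
have tc : forall th be : R,
  ((r j)%:E * \int[Q j]_x ((1 - cos x) * (1 - cos (th * x - be)))%:E)%E @[j --> \oo] -->
  (\int[Pi']_x ((1 - cos x) * (1 - cos (th * x - be)))%:E)%E.
  move=> th be; have cE (x : R) : (1 - cos (- x)) * (1 - cos (th * - x - be)) =
      (1 - cos x) * (1 - cos (th * x - - be)).
    by rewrite cosN mulrN -opprD cosN opprK.
  have f0 (x : R) : (0 <= ((1 - cos x) * (1 - cos (th * x - be)))%:E)%E.
    by rewrite lee_fin mulr_ge0 ?one_sub_cos_ge0.
  rewrite intPi//; last by meas.
  under eq_integral do rewrite cE.
  have := @trig_cvg th (- be).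
  apply: cvg_trans; apply: near_eq_cvg; apply: nearW => j /=.
  rewrite intQ//; last by meas.
  by congr (_ * _)%E; apply: eq_integral => x _; rewrite cE.
move=> /(_ tc).
have mg' : measurable_fun [set: R] (fun x : R => g (- x)) by apply: (measurableT_comp mg).
move=> /(_ _ mg' (fun x => g0 _)).
have cg' (x : R) : 0 < x <= 1 -> {for x, continuous (fun x : R => g (- x))}.
  move=> /andP[x0 x1]; apply: (@continuous_comp _ _ _ (fun x : R => - x) g).
    exact: opp_continuous.
  by apply: cg; rewrite lerN2 oppr_lt0 x0 x1.
move=> /(_ cg' C).
have mg'' : measurable_fun [set: R] (fun x : R => (g (- x))%:E) by exact/measurable_EFinP.
have g0' (x : R) : (0 <= (g (- x))%:E)%E by rewrite lee_fin.
rewrite (intPiD _ `[(-1)%R, 0%R[%classic _ _ _ mg'' g0')//; last first.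
  by move=> x; rewrite /= !in_itv/= oppr_lt0 lerN2 andbC.
under eq_integral do rewrite opprK.
move=> /(_ HC); apply: filterS => j.
rewrite (intQD j _ `]-oo, 0%R[%classic _ _ _ mg'' g0')//; last first.
  by move=> x; rewrite /= !in_itv/= oppr_lt0 andbT.
by under eq_integral do rewrite opprK.
Qed.

(** The slack is shared evenly; an infinite term takes whatever the other one leaves. *)
Lemma ereal_lt_split (a b : \bar R) (C : R) : (0 <= a)%E -> (0 <= b)%E -> (C%:E < a + b)%E ->
  exists C1 C2 : R, [/\ (C1%:E < a)%E, (C2%:E < b)%E & C <= C1 + C2].
Proof.
case: a => [a| |]//; case: b => [b| |]//.
- rewrite !lee_fin -EFinD lte_fin => a0 b0 h.
  by exists (a - (a + b - C) / 2), (b - (a + b - C) / 2); rewrite !lte_fin; split; lra.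
- rewrite lee_fin => a0 _ _.
  by exists (a - 1), (C - a + 1); rewrite lte_fin ltry; split => //; lra.
- rewrite lee_fin => _ b0 _.
  by exists (C - b + 1), (b - 1); rewrite lte_fin ltry; split => //; lra.
- by exists C, 0; rewrite !ltry; split => //; lra.
Qed.

Lemma liminf_two_sided (g : R -> R) : measurable_fun setT g ->
  (forall x, 0 <= g x) -> (forall x, x != 0 -> {for x, continuous g}) ->
  forall C : R, (C%:E < \int[Pi]_(x in `[(-1)%R, 0%R[) (g x)%:E + \int[Pi]_(x in `]0%R, 1%R]) (g x)%:E)%E ->
  \forall j \near \oo, (C%:E < (r j)%:E * \int[P_ j]_x (g x)%:E)%E.
Proof.
move=> mg g0 cg C HC.
have [C1 [C2 [h1 h2 hC]]] : exists C1 C2 : R, [/\ (C1%:E < \int[Pi]_(x in `[(-1)%R, 0%R[) (g x)%:E)%E,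
    (C2%:E < \int[Pi]_(x in `]0%R, 1%R]) (g x)%:E)%E & C <= C1 + C2].
  by apply: ereal_lt_split => //; apply: integral_ge0 => x _; rewrite lee_fin.
have n1 : \forall j \near \oo, (C1%:E < (r j)%:E * \int[P_ j]_(x in `]-oo, 0%R[) (g x)%:E)%E.
  by apply: liminf_neg_part => // x /andP[_ x0]; apply: cg; rewrite lt_eqF.
have n2 : \forall j \near \oo, (C2%:E < (r j)%:E * \int[P_ j]_(x in `]0%R, +oo[) (g x)%:E)%E.
  by apply: (@liminf_pos_part R P_ r Pi) => // x /andP[x0 _]; apply: cg; rewrite gt_eqF.
apply: filterS2 n1 n2 => j j1 j2.
apply: (@le_lt_trans _ _ (C1%:E + C2%:E)%E); first by rewrite -EFinD lee_fin.
apply: (lt_le_trans (lteD j1 j2)); rewrite -ge0_muleDr; try by apply: integral_ge0 => x _; rewrite lee_fin.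
apply: lee_wpmul2l; first by rewrite lee_fin.
rewrite -ge0_integral_setU//.
- by apply: ge0_subset_integral => //; [exact: measurableU|exact/measurable_EFinP|by move=> x _; rewrite lee_fin].
- by apply: measurable_funTS; exact/measurable_EFinP.
- by move=> x _; rewrite lee_fin.
- apply/disj_setPS => x [] /=; rewrite !in_itv/= andbT => x0 /(lt_trans x0).
  by rewrite ltxx.
Qed.

End TwoSidedLimit.

(** * Small-time limits for the process *)

Section LevySmallTime.
Context (R : realType) (disp : measure_display)
    (T : measurableType disp) (P : probability T R)
    (X : R -> {RV P >-> measurableTypeR R})
    (gamma : R) (Pi : {measure set (measurableTypeR R) -> \bar R}).
Hypothesis Pi_levy : bounded_levy_measure Pi.
Hypothesis X_triplet : has_triplet X gamma 0 Pi.
Variable h : nat -> R.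
Hypothesis h_gt0 : forall j, 0 < h j.
Hypothesis h_cvg0 : h j @[j --> \oo] --> 0.

Lemma levy_integral_split (f : R -> \bar R) : measurable_fun setT f -> (forall x, 0 <= f x)%E ->
  (\int[Pi]_x f x = \int[Pi]_(x in `[(-1)%R, 0%R[) f x + \int[Pi]_(x in `]0%R, 1%R]) f x)%E.
Proof.
move=> mf f0.
have mU : measurable (`[(-1)%R, 0%R[%classic `|` `]0%R, 1%R]%classic : set (measurableTypeR R)).
  exact: measurableU.
rewrite -ge0_integral_setU//; last 2 first.
- exact: measurable_funTS.
- apply/disj_setPS => x [] /=; rewrite !in_itv/= => /andP[_ x0] /andP[x0' _].
  by have := lt_trans x0 x0'; rewrite ltxx.
rewrite (@ge0_negligible_integral _ _ _ Pi setT (~` (`[(-1)%R, 0%R[%classic `|` `]0%R, 1%R]%classic)))//.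
- by rewrite setTD setCK.
- exact: measurableC.
- have -> : `[(-1)%R, 0%R[%classic `|` `]0%R, 1%R]%classic = `[-1, 1]%classic `\ (0 : R); last first.
    exact: Pi_levy.1.
  apply/seteqP; split => x /=; rewrite !in_itv/=.
    move=> [/andP[a b]|/andP[a b]]; split.
    + by rewrite a/= (le_trans (ltW b)).
    + by move=> x0; rewrite x0 ltxx in b.
    + by rewrite b andbT (le_trans _ (ltW a)).
    + by move=> x0; rewrite x0 ltxx in a.
  move=> [/andP[a b] /eqP x0].
  have [x1|x1|x1] := ltgtP x 0; [left|right|]; rewrite ?a ?b//.
  by rewrite x1 eqxx in x0.
Qed.

Lemma levy_liminf (g : R -> R) : measurable_fun setT g ->
  (forall x, 0 <= g x) -> (forall x, x != 0 -> {for x, continuous g}) ->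
  forall C : R, (C%:E < \int[Pi]_x (g x)%:E)%E ->
  \forall j \near \oo, (C%:E < (h j)^-1%:E * \int[P]_w (g (X (h j) w))%:E)%E.
Proof.
move=> mg g0 cg C; rewrite levy_integral_split//; [move=> HC|exact/measurable_EFinP].
have := @liminf_two_sided R (fun j => distribution P (X (h j))) (fun j => (h j)^-1) Pi.
have r0 j : 0 <= (h j)^-1 by rewrite invr_ge0 ltW.
move=> /(_ r0 (levy_sigma_finite Pi_levy) (levy_integral_cos Pi_levy)).
move=> /(_ (levy_trig_cvg Pi_levy X_triplet h_gt0 h_cvg0) g mg g0 cg C HC).
apply: filterS => j; rewrite ge0_integral_distribution//; first exact/measurable_EFinP.
Qed.

Hypothesis Pi_abs : (\int[Pi]_x `|x|%:E < +oo)%E.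
Hypothesis no_drift : drift gamma Pi = 0.

(** A lower bound for [L * |x| - g] and an upper bound for [|x|] combine into an upper bound for
    [g]. *)
Lemma levy_limsup (g : R -> R) (L : R) : measurable_fun setT g -> 0 < L ->
  (forall x, 0 <= g x <= L * `|x|) -> (forall x, x != 0 -> {for x, continuous g}) ->
  forall C : R, (\int[Pi]_x (g x)%:E < C%:E)%E ->
  \forall j \near \oo, ((h j)^-1%:E * \int[P]_w (g (X (h j) w))%:E < C%:E)%E.
Proof.
move=> mg L0 gL cg C HC.
have g0 x : 0 <= g x by have /andP[] := gL x.
pose k x := L * `|x| - g x.
have k0 x : 0 <= k x by rewrite subr_ge0; have /andP[] := gL x.
have mk : measurable_fun [set: R] k by rewrite /k; meas.
have ck x : x != 0 -> {for x, continuous k}.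
  move=> x0; apply: cvgB; last exact: cg.
  by apply: cvgMr; exact: norm_continuous.
pose m := fine (\int[Pi]_x `|x|%:E)%E.
have mE : (\int[Pi]_x `|x|%:E = m%:E)%E.
  by rewrite /m fineK// ge0_fin_numE//; apply: integral_ge0 => x _; rewrite lee_fin.
have decomp d (S : measurableType d) (mu : {measure set S -> \bar R}) (Y : S -> R) :
   measurable_fun setT Y ->
   (L%:E * \int[mu]_w `|Y w|%:E = \int[mu]_w (g (Y w))%:E + \int[mu]_w (k (Y w))%:E)%E.
  move=> mY; rewrite -ge0_integralZl//; last 2 first.
  - by meas.
  - by rewrite lee_fin ltW.
  rewrite -ge0_integralD//.
  - by apply: eq_integral => w _; rewrite -EFinM -EFinD /k addrC subrK.
  - by move=> w _; rewrite lee_fin.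
  - by apply/measurable_EFinP; exact: (measurableT_comp mg mY).
  - by move=> w _; rewrite lee_fin.
  - by apply/measurable_EFinP; exact: (measurableT_comp mk mY).
have D := decomp _ _ Pi (fun x : R => x) (@measurable_id _ _ _).
have If : (\int[Pi]_x (g x)%:E \is a fin_num)%E.
  rewrite ge0_fin_numE; first by apply: lt_trans HC _; rewrite ltry.
  by apply: integral_ge0 => x _; rewrite lee_fin.
move: HC D; rewrite -(fineK If) mE; set I := fine _; rewrite lte_fin => IC D.
have Ek : (\int[Pi]_x (k x)%:E = (L * m - I)%:E)%E.
  rewrite EFinB EFinM D addeC; case: (\int[Pi]_x (k x)%:E)%E => [x| |]//.
  by rewrite -EFinN -!EFinD; congr EFin; lra.
(* The gap [C - I] pays for two approximations: [e] in the lower bound for [k], and [L * (e / L)] in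
   the absolute moment. *)
pose e := (C - I) / 2.
have e0 : 0 < e by rewrite divr_gt0// subr_gt0.
have n1 : \forall j \near \oo, ((L * m - I - e)%:E < (h j)^-1%:E * \int[P]_w (k (X (h j) w))%:E)%E.
  by apply: levy_liminf => //; rewrite Ek lte_fin gtrBl.
have n2 : \forall j \near \oo, ((h j)^-1%:E * \int[P]_w `|X (h j) w|%:E < (m + e / L)%:E)%E.
  apply: (limsup_abs_increment Pi_levy X_triplet Pi_abs no_drift h_gt0 h_cvg0).
  by rewrite -/m ltrDl divr_gt0.
apply: filterS2 n1 n2 => j j1 j2.
have mX : measurable_fun setT (X (h j)) := measurable_funP (X (h j)).
have := decomp _ _ P (X (h j)) mX.
have L0' : (0 < L%:E)%E by rewrite lte_fin.
have a0 : (0 <= \int[P]_w (g (X (h j) w))%:E)%E by apply: integral_ge0 => w _; rewrite lee_fin.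
move: j1 j2 a0; move: (\int[P]_w `|_|%:E)%E (\int[P]_w (g _)%:E)%E (\int[P]_w (k _)%:E)%E => A B K.
move=> j1 j2 B0 AE.
have r0 : 0 < (h j)^-1 by rewrite invr_gt0.
have : ((h j)^-1%:E * (L%:E * A) < L%:E * (m + e / L)%:E)%E by rewrite muleCA lte_pmul2l.
rewrite AE.
have r0' : (0 < (h j)^-1%:E)%E by rewrite lte_fin.
case: K AE j1 => [K| |] AE.
- case: B B0 AE => [B| |]//= B0 AE; last by rewrite addye// gt0_muley// -EFinM.
  rewrite -EFinD -!EFinM !lte_fin.
  by rewrite !mulrDr (mulrCA L) divff ?gt_eqF//; rewrite /e; lra.
- by move=> _; rewrite addey ?gt0_muley// -?EFinM//; case: B B0 AE.
- by rewrite gt0_muleNy.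
Qed.

End LevySmallTime.

(** * Independent blocks and variations along a grid *)

Section Blocks.
Context {d} {T : measurableType d} {R : realType} (P : probability T R).
Implicit Types Y : nat -> T -> R.

(** Rectangles serve as pi-systems: independence and equality of laws are checked on [cylinder] and
    [block], then extended to the generated sigma-algebras. *)
Definition cylinder (n : nat) : set (set (nat -> R)) :=
  [set E | exists2 B : nat -> set (measurableTypeR R), (forall i, measurable (B i)) &
     E = [set f | forall i, (i < n)%N -> B i (f i)]].

Definition block Y (a b : nat) : set (set T) :=
  [set A | exists2 B : nat -> set (measurableTypeR R), (forall i, measurable (B i)) &
     A = [set w | forall i, (a <= i < b)%N -> B i (Y i w)]].

Definition indep_seq (n : nat) Y := forall B : nat -> set (measurableTypeR R),
  (forall i, measurable (B i)) ->
  P [set w | forall i, (i < n)%N -> B i (Y i w)] = (\prod_(0 <= i < n) P (Y i @^-1` B i))%E.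

Lemma setI_closed_cylinder n : setI_closed (cylinder n).
Proof.
move=> _ _ [B mB ->] [C mC ->]; exists (fun i => B i `&` C i).
  by move=> i; exact: measurableI.
apply/seteqP; split => [w [h1 h2] i hi|w h]; first by split; [exact: h1|exact: h2].
by split => i hi; case: (h i hi).
Qed.

Lemma setI_closed_block Y a b : setI_closed (block Y a b).
Proof.
move=> _ _ [B mB ->] [C mC ->]; exists (fun i => B i `&` C i).
  by move=> i; exact: measurableI.
apply/seteqP; split => [w [h1 h2] i hi|w h]; first by split; [exact: h1|exact: h2].
by split => i hi; case: (h i hi).
Qed.

Lemma block_setT Y a b : block Y a b setT.
Proof. by exists (fun=> setT) => //; apply/seteqP; split. Qed.

Lemma block_measurable Y a b : (forall i, measurable_fun setT (Y i)) ->
  block Y a b `<=` measurable.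
Proof.
move=> mY _ [B mB ->].
rewrite (_ : [set w | _] = \bigcap_(i in [set i | (a <= i < b)%N]) (Y i @^-1` B i)); last first.
  by apply/seteqP; split => w h i; exact: h.
apply: bigcap_measurableType => i _.
by have := mY i measurableT _ (mB i); rewrite setTI.
Qed.

Lemma sigma_block_measurable Y a b : (forall i, measurable_fun setT (Y i)) ->
  <<s block Y a b >> `<=` measurable.
Proof.
move=> mY; apply: smallest_sub; first exact: sigma_algebra_measurable.
exact: block_measurable.
Qed.

Lemma measurable_block_coord Y a b i : (a <= i < b)%N ->
  measurable_fun [set: g_sigma_algebraType (block Y a b)] (Y i).
Proof.
move=> hi _ B mB; rewrite setTI; apply: sub_sigma_algebra.
exists (fun j => if j == i then B else setT); first by move=> j; case: ifP.
apply/seteqP; split => w /=; first by move=> h j _; case: eqP => // ->.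
by move=> /(_ i hi); rewrite eqxx.
Qed.

Lemma measurable_cylinder_coord n i : (i < n)%N ->
  measurable_fun [set: g_sigma_algebraType (cylinder n)] (fun f : nat -> R => f i).
Proof.
move=> hi _ B mB; rewrite setTI; apply: sub_sigma_algebra.
exists (fun j => if j == i then B else setT); first by move=> j; case: ifP.
apply/seteqP; split => w /=; first by move=> h j _; case: eqP => // ->.
by move=> /(_ i hi); rewrite eqxx.
Qed.

Section Independence.
Variables (n : nat) (Y : nat -> T -> R).
Hypotheses (mY : forall i, measurable_fun setT (Y i)) (iY : indep_seq n Y).

Lemma block_prob a b (B : nat -> set (measurableTypeR R)) : (a <= b <= n)%N ->
  (forall i, measurable (B i)) ->
  P [set w | forall i, (a <= i < b)%N -> B i (Y i w)] =
  (\prod_(a <= i < b) P (Y i @^-1` B i))%E.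
Proof.
move=> /andP[ab bn] mB.
pose C i := if (a <= i < b)%N then B i else setT.
have mC i : measurable (C i) by rewrite /C; case: ifP.
rewrite (_ : [set w | _] = [set w | forall i, (i < n)%N -> C i (Y i w)]); last first.
  apply/seteqP; split => w /= h i.
    by rewrite /C; case: ifP => // hi _; exact: h.
  move=> hi; have := h i; rewrite /C hi; apply.
  by case/andP: hi => _ /leq_trans; exact.
rewrite iY//.
have out i : ~~ (a <= i < b)%N -> P (Y i @^-1` C i) = 1%E.
  by move=> /negbTE hi; rewrite /C hi preimage_setT probability_setT.
rewrite (@big_cat_nat _ _ _ b)//= [X in (_ * X)%E]big1_seq ?mule1; last first.
  move=> i /=; rewrite mem_index_iota => /andP[bi _]; apply: out.
  by rewrite negb_and -[X in _ || X]leqNgt bi orbT.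
rewrite (@big_cat_nat _ _ _ a)//= [X in (X * _)%E]big1_seq ?mul1e; last first.
  move=> i /=; rewrite mem_index_iota => /andP[_ ia]; apply: out.
  by rewrite negb_and -ltnNge ia.
by apply: eq_big_nat => i hi; rewrite /C hi.
Qed.

Lemma block_indep0 k A C : (k <= n)%N -> block Y 0 k A -> block Y k n C ->
  P (A `&` C) = (P A * P C)%E.
Proof.
move=> kn [B mB ->] [D mD ->].
rewrite !block_prob ?kn ?leqnn//.
pose E i := if (i < k)%N then B i else D i.
rewrite (_ : _ `&` _ = [set w | forall i, (i < n)%N -> E i (Y i w)]); last first.
  apply/seteqP; split => w /=.
    move=> [h1 h2] i hi; rewrite /E; case: ltnP => ik; first exact: h1.
    by apply: h2; rewrite ik.
  move=> h; split => i hi.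
    by have := h i (leq_trans hi kn); rewrite /E hi.
  by case/andP: hi => ki hi; have := h i hi; rewrite /E ltnNge ki.
rewrite iY; last by move=> i; rewrite /E; case: ifP.
rewrite (@big_cat_nat _ _ _ k)//=; congr (_ * _)%E; apply: eq_big_nat => i.
  by move=> /= ik; rewrite /E ik.
by move=> /andP[ki _]; rewrite /E ltnNge ki.
Qed.

(** In [A] both sides are finite measures, the trace of [P] on [C] and [P] scaled by [P C]; agreeing
    on a pi-system, they agree on the sigma-algebra it generates. *)
Let restr_unique (G : set (set T)) (C : set T) : G `<=` measurable -> setI_closed G ->
  G setT -> measurable C -> (forall A, G A -> P (A `&` C) = (P A * P C)%E) ->
  forall A, <<s G >> A -> P (A `&` C) = (P A * P C)%E.
Proof.
move=> Gm GI GT mC h A GA.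
have fC : (P C \is a fin_num)%E by exact: fin_num_measure.
have pC0 : 0 <= fine (P C) by rewrite fine_ge0.
pose m1 : {measure set T -> \bar R} := mrestr P mC.
pose m2 : {measure set T -> \bar R} := mscale (NngNum pC0) P.
have m2E B : m2 B = (P B * P C)%E by rewrite /m2/= /mscale/= fineK// muleC.
rewrite -[LHS]/(m1 A) -m2E.
apply: (@g_sigma_algebra_measure_unique _ _ _ G Gm (fun=> setT)) => //.
- by apply/seteqP; split => // x _; exists 0%N.
- by move=> B GB; rewrite m2E; exact: h.
- move=> _; rewrite /m1/= /mrestr setTI.
  by apply: (le_lt_trans (probability_le1 _ mC)); rewrite ltry.
Qed.

(** [restr_unique] twice: in the first event with the second one fixed, then in the second with the
    first one a rectangle. *)
Lemma block_indep k A C : (k <= n)%N -> <<s block Y 0 k >> A -> <<s block Y k n >> C ->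
  P (A `&` C) = (P A * P C)%E.
Proof.
move=> kn sA sC; have mC : measurable C by exact: (sigma_block_measurable mY sC).
apply: (restr_unique (G := block Y 0 k)) => //.
- exact: block_measurable.
- exact: setI_closed_block.
- exact: block_setT.
move=> {sA}A bA; have mA : measurable A by exact: (block_measurable mY bA).
rewrite setIC muleC.
apply: (restr_unique (G := block Y k n)) => //.
- exact: block_measurable.
- exact: setI_closed_block.
- exact: block_setT.
by move=> B bB; rewrite setIC muleC; exact: (block_indep0 kn).
Qed.

End Independence.

Lemma indep_law n Y Y' : (forall i, measurable_fun setT (Y i)) ->
  (forall i, measurable_fun setT (Y' i)) -> indep_seq n Y -> indep_seq n Y' ->
  (forall i B, (i < n)%N -> measurable (B : set (measurableTypeR R)) ->
     P (Y i @^-1` B) = P (Y' i @^-1` B)) ->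
  forall E, <<s cylinder n >> E -> P [set w | E (Y ^~ w)] = P [set w | E (Y' ^~ w)].
Proof.
move=> mY mY' iY iY' eY E sE.
pose S := g_sigma_algebraType (cylinder n).
have meas Z : (forall i, measurable_fun setT (Z i)) -> measurable_fun setT (fun w : T => (Z ^~ w : S)).
  move=> mZ; apply: (@measurability _ _ _ S _ _ (cylinder n)) => // _ [_ [B mB ->] <-].
  rewrite setTI; apply: (@block_measurable Z 0 n) => //.
  by exists B.
pose m1 := push_measure P (meas _ mY); pose m2 := push_measure P (meas _ mY').
rewrite -[LHS]/(m1 E) -[RHS]/(m2 E).
apply: (@g_sigma_algebra_measure_unique _ _ S (cylinder n) _ (fun=> setT)) => //.
- exact: sub_sigma_algebra.
- by move=> _; exists (fun=> setT) => //; apply/seteqP; split.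
- by apply/seteqP; split => // x _; exists 0%N.
- exact: setI_closed_cylinder.
- move=> _ [B mB ->].
  have e Z : [set w | [set f | forall i, (i < n)%N -> B i (f i)] (Z ^~ w)] =
    [set w : T | forall i, (i < n)%N -> B i (Z i w)] by [].
  rewrite -[LHS]/(P [set w | _ (Y ^~ w)]) -[RHS]/(P [set w | _ (Y' ^~ w)]) !e iY// iY'//.
  by apply: eq_big_nat => i /= hi; exact: eY.
- by move=> _; rewrite -[X in (X < _)%E]/(P setT) probability_setT ltry.
Qed.

(** By uniqueness of product measures the joint law is the product of the two laws, and Tonelli's
    theorem factors the integral. *)
Lemma indep_expect (U V : T -> R) (f g : R -> R) :
  measurable_fun setT U -> measurable_fun setT V ->
  (forall A B : set (measurableTypeR R), measurable A -> measurable B ->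
    P (U @^-1` A `&` V @^-1` B) = (P (U @^-1` A) * P (V @^-1` B))%E) ->
  measurable_fun setT f -> measurable_fun setT g ->
  (forall x, 0 <= f x) -> (forall x, 0 <= g x) ->
  (\int[P]_w (f (U w) * g (V w))%:E = \int[P]_w (f (U w))%:E * \int[P]_w (g (V w))%:E)%E.
Proof.
move=> mU mV iUV mf mg f0 g0.
pose R_ := measurableTypeR R.
pose nU := isMeasurableFun.Build _ _ _ _ (U : T -> R_) mU.
pose nV := isMeasurableFun.Build _ _ _ _ (V : T -> R_) mV.
pose U' : {RV P >-> R_} := (HB.pack (U : T -> R_) nU : {mfun T >-> R_}).
pose V' : {RV P >-> R_} := (HB.pack (V : T -> R_) nV : {mfun T >-> R_}).
pose PU : probability R_ R := distribution P U'.
pose PV : probability R_ R := distribution P V'.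
have mUV : measurable_fun setT (fun w => (U w, V w) : R_ * R_) by exact: measurable_fun_pair.
pose m' := push_measure P mUV.
have uniq X : measurable X -> (PU \x PV)%E X = m' X.
  by apply: product_measure_unique => A B mA mB; exact: iUV.
pose F (z : R_ * R_) : \bar R := (f z.1 * g z.2)%:E.
have mF : measurable_fun setT F.
  apply/measurable_EFinP; apply: measurable_fun_mul.
    by apply: (measurableT_comp mf); exact: measurable_fst.
  by apply: (measurableT_comp mg); exact: measurable_snd.
have F0 z : (0 <= F z)%E by rewrite lee_fin mulr_ge0.
transitivity (\int[m']_z F z)%E; first by rewrite /m' ge0_integral_pushforward.
transitivity (\int[(PU \x PV)%E]_z F z)%E.
  by apply: eq_measure_integral => A mA _; symmetry; exact: uniq.
rewrite fubini_tonelli1//= /fubini_F/= /F/=.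
under eq_integral => x _.
  under eq_integral do rewrite EFinM.
  rewrite ge0_integralZl//; last 3 first.
  - exact/measurable_EFinP.
  - by move=> y _; rewrite lee_fin.
  - by rewrite lee_fin.
  over.
rewrite /= ge0_integralZr//; last 3 first.
- exact/measurable_EFinP.
- by move=> y _; rewrite lee_fin.
- by apply: integral_ge0 => y _; rewrite lee_fin.
by rewrite /PU /PV !ge0_integral_distribution//; exact/measurable_EFinP.
Qed.

Lemma indep_prod n Y (f : R -> R) : (forall i, measurable_fun setT (Y i)) -> indep_seq n Y ->
  measurable_fun setT f -> (forall x, 0 <= f x) ->
  (\int[P]_w (\prod_(0 <= i < n) f (Y i w))%:E = \prod_(0 <= i < n) \int[P]_w (f (Y i w))%:E)%E.
Proof.
move=> mY iY mf f0.
suff : forall k, (k <= n)%N ->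
  (\int[P]_w (\prod_(0 <= i < k) f (Y i w))%:E = \prod_(0 <= i < k) \int[P]_w (f (Y i w))%:E)%E.
  exact.
elim=> [_|k IH kn].
  under eq_integral do rewrite big_nil.
  by rewrite big_nil integral_cst//= mul1e -[LHS]/(P setT) probability_setT.
rewrite big_nat_recr//= -IH ?(ltnW kn)//.
under eq_integral do rewrite big_nat_recr//=.
pose U w := \prod_(0 <= i < k) f (Y i w).
have mUs : measurable_fun [set: g_sigma_algebraType (block Y 0 k)] U.
  rewrite /U.
  apply: measurable_prod => i.
    rewrite mem_index_iota => /andP[_ ik]; apply: (measurableT_comp mf).
    by apply: measurable_block_coord.
have mU : measurable_fun setT U.
  by rewrite /U; apply: measurable_prod => i _; exact: (measurableT_comp mf).
(* [indep_expect] asks for functions that are nonnegative on the whole line; [max (x, 0)] is the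
   identity on the values of [U]. *)
have Ue w : U w = Num.max (U w) 0 by rewrite max_l// prodr_ge0.
transitivity (\int[P]_w (Num.max (U w) 0 * f (Y k w))%:E)%E.
  by apply: eq_integral => w _; rewrite -Ue.
rewrite (indep_expect (f := fun x => Num.max x 0) (g := f))//.
- by congr (_ * _)%E; apply: eq_integral => w _; rewrite -Ue.
- move=> A B mA mB; apply: (block_indep mY iY (ltnW kn)).
  + by have := mUs measurableT A mA; rewrite setTI.
  + have := @measurable_block_coord Y k n k _ measurableT B mB.
    by rewrite setTI; apply; rewrite leqnn kn.
- exact: measurable_maxr.
- by move=> x; rewrite le_max lexx orbT.
Qed.

End Blocks.

Lemma sum_increment_le_TV {R : realType} (f : R -> R) (t : nat -> R) n :
  {homo t : i j / (i <= j)%N >-> i <= j} ->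
  ((\sum_(0 <= i < n) `|f (t i.+1) - f (t i)|)%:E <= total_variation (t 0%N) (t n) f)%E.
Proof.
move=> ht; elim: n => [|n IH]; first by rewrite big_nil total_variationxx.
rewrite big_nat_recr//= (@total_variationD _ _ _ (t n)) ?ht// EFinD leeD//.
by rewrite total_variation_ge// ht.
Qed.

(** $1-q\le e^{-q}$ and $1/(1-q)=1+q/(1-q)\le e^{q/(1-q)}$. *)
Lemma expr_one_sub_bounds {R : realType} (q : R) n : 0 <= q < 1 ->
  expR (- (n%:R * q / (1 - q))) <= (1 - q) ^+ n <= expR (- (n%:R * q)).
Proof.
move=> /andP[q0 q1]; have q1' : 0 < 1 - q by rewrite subr_gt0.
have e1 : expR (- (n%:R * q)) = expR (- q) ^+ n by rewrite -expRM_natl mulrN.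
have e2 : expR (- (n%:R * q / (1 - q))) = expR (- (q / (1 - q))) ^+ n.
  by rewrite -expRM_natl mulrN mulrA.
rewrite e1 e2; apply/andP; split; apply: lerXn2r; rewrite ?nnegrE ?expR_ge0 ?(ltW q1')//.
  rewrite expRN invf_ple ?posrE ?expR_gt0//.
  apply: (le_trans _ (expR_ge1Dx _)); rewrite le_eqVlt; apply/orP; left; apply/eqP.
  by field; rewrite gt_eqF.
exact: expR_ge1Dx.
Qed.

(** * Expectations of bounded variables as real numbers *)

Section Mean.
Context d (T : measurableType d) (R : realType) (P : probability T R).
Implicit Types f g : T -> R.

Definition mean f : R := fine (\int[P]_w (f w)%:E)%E.

Lemma meanE f k : measurable_fun setT f -> (forall w, 0 <= f w <= k) ->
  (\int[P]_w (f w)%:E = (mean f)%:E)%E.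
Proof.
move=> mf fk; rewrite /mean fineK// ge0_fin_numE; last first.
  by apply: integral_ge0 => w _; rewrite lee_fin; case/andP: (fk w).
apply: (@le_lt_trans _ _ (\int[P]_w k%:E)%E).
  apply: ge0_le_integral => //.
  - by move=> w _; rewrite lee_fin; case/andP: (fk w).
  - exact/measurable_EFinP.
  - by move=> w _; rewrite lee_fin; case/andP: (fk w).
by rewrite integral_cst//= -[X in (_ * X)%E]/(P setT) probability_setT mule1 ltry.
Qed.

Lemma mean_ge0 f : (forall w, 0 <= f w) -> 0 <= mean f.
Proof. by move=> f0; apply: fine_ge0; apply: integral_ge0 => w _; rewrite lee_fin. Qed.

Lemma mean_cst k : mean (fun=> k) = k.
Proof. by rewrite /mean integral_cst//= -[X in (_ * X)%E]/(P setT) probability_setT mule1. Qed.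

Lemma le_mean f g k : measurable_fun setT f -> measurable_fun setT g ->
  (forall w, 0 <= f w <= g w) -> (forall w, g w <= k) -> mean f <= mean g.
Proof.
move=> mf mg fg gk; rewrite -lee_fin -(@meanE f k)//; last first.
  by move=> w; have /andP[-> /le_trans] := fg w; apply.
rewrite -(@meanE g k)//; last first.
  by move=> w; rewrite gk andbT; case/andP: (fg w); exact: le_trans.
apply: ge0_le_integral => //.
- by move=> w _; rewrite lee_fin; case/andP: (fg w).
- exact/measurable_EFinP.
- exact/measurable_EFinP.
- by move=> w _; rewrite lee_fin; case/andP: (fg w).
Qed.

Lemma mean_le f k : measurable_fun setT f -> (forall w, 0 <= f w <= k) -> mean f <= k.
Proof. by move=> mf fk; rewrite -[leRHS]mean_cst; apply: (le_mean (k := k)) => //. Qed.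

Lemma mean_add f g k l : measurable_fun setT f -> measurable_fun setT g ->
  (forall w, 0 <= f w <= k) -> (forall w, 0 <= g w <= l) ->
  mean (fun w => f w + g w) = mean f + mean g.
Proof.
move=> mf mg fk gl; apply: EFin_inj; rewrite EFinD -(@meanE f k)// -(@meanE g l)//.
rewrite -(@meanE _ (k + l)); last 2 first.
- exact: measurable_fun_add.
- move=> w; have := fk w; have := gl w; lra.
under eq_integral do rewrite EFinD.
rewrite ge0_integralD//.
- by move=> w _; rewrite lee_fin; case/andP: (fk w).
- exact/measurable_EFinP.
- by move=> w _; rewrite lee_fin; case/andP: (gl w).
- exact/measurable_EFinP.
Qed.

Lemma mean_scale f k c : 0 <= c -> measurable_fun setT f -> (forall w, 0 <= f w <= k) ->
  mean (fun w => c * f w) = c * mean f.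
Proof.
move=> c0 mf fk; apply: EFin_inj; rewrite EFinM -(@meanE f k)//.
rewrite -(@meanE _ (c * k)); last 2 first.
- exact: measurable_fun_mul.
- by move=> w; have /andP[a b] := fk w; rewrite mulr_ge0//= ler_wpM2l.
rewrite -ge0_integralZl//.
- exact/measurable_EFinP.
- by move=> w _; rewrite lee_fin; case/andP: (fk w).
Qed.

Lemma mean_one_sub f : measurable_fun setT f -> (forall w, 0 <= f w <= 1) ->
  mean (fun w => 1 - f w) = 1 - mean f.
Proof.
move=> mf f1.
have m1 : measurable_fun [set: T] (fun w => 1 - f w) by exact: measurable_fun_sub.
have f2 w : 0 <= 1 - f w <= 1 by have := f1 w; lra.
have := mean_add m1 mf f2 f1.
rewrite (_ : (fun w => 1 - f w + f w) = fun=> 1) ?mean_cst; last by apply/funext => w; rewrite subrK.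
by move=> e; apply/eqP; rewrite eq_sym subr_eq; apply/eqP.
Qed.

Lemma mean_indic (A : set T) : measurable A -> (mean \1_A)%:E = P A.
Proof.
move=> mA; rewrite /mean integral_indic// setIT fineK//.
exact: fin_num_measure.
Qed.

End Mean.

(** * Laplace transforms of variations along a grid *)

Section LevyGrid.
Context (R : realType) (disp : measure_display)
    (T : measurableType disp) (P : probability T R)
    (X : R -> {RV P >-> measurableTypeR R}).
Hypothesis X_levy : levy_process X.

Definition incr (h : R) (j : nat) (w : T) : R := X (j.+1%:R * h) w - X (j%:R * h) w.

(** For [psi] the positive part, the negative part or the absolute value, these are the positive,
    negative and total variations along the grid of mesh [h]. *)
Definition vari (psi : R -> R) (h : R) (a b : nat) (w : T) : R :=
  \sum_(a <= j < b) psi (incr h j w).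

Lemma measurable_incr h j : measurable_fun setT (incr h j).
Proof.
have m1 : measurable_fun setT (X (j.+1%:R * h)) := measurable_funP _.
have m2 : measurable_fun setT (X (j%:R * h)) := measurable_funP _.
exact: measurable_fun_sub.
Qed.

Lemma measurable_vari psi h a b : measurable_fun setT psi -> measurable_fun setT (vari psi h a b).
Proof.
move=> mp; rewrite /vari; apply: measurable_sum => j.
by apply: (measurableT_comp mp); exact: measurable_incr.
Qed.

Lemma incr_indep h n k : 0 <= h -> indep_seq P n (fun j => incr h (k + j)).
Proof.
move=> h0 B mB.
have := @levy_indep _ _ _ _ _ X_levy n (fun j => (k + j)%:R * h).
have t0 : 0 <= (k + 0)%:R * h by rewrite mulr_ge0.
have th : {homo (fun j : nat => (k + j)%:R * h) : i j / (i <= j)%N >-> i <= j}.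
  by move=> i j ij; rewrite ler_wpM2r// ler_nat leq_add2l.
move=> /(_ t0 th (fun i => B i) (fun i => mB i)).
move=> e; rewrite big_mkord; transitivity (P (\bigcap_(i in [set: 'I_n])
        (fun w : T => X ((k + i.+1)%:R * h) w - X ((k + i)%:R * h) w) @^-1` B i)).
- congr (P _); apply/seteqP; split => w /= h1 i; first by move=> _; have := h1 i (ltn_ord i); rewrite /incr addnS.
  by move=> hi; have := h1 (Ordinal hi) I; rewrite /= /incr addnS.
- by rewrite e; apply: eq_bigr => i _; rewrite /incr addnS.
Qed.

Lemma incr_law h j (B : set (measurableTypeR R)) : 0 <= h -> measurable B ->
  P (incr h j @^-1` B) = P (X h @^-1` B).
Proof.
move=> h0 mB; rewrite -(levy_stationary X_levy (s := j%:R * h))//; last by rewrite mulr_ge0.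
by rewrite /incr -natr1 mulrDl mul1r.
Qed.

Lemma incr_integral h j (f : R -> \bar R) : 0 <= h -> measurable_fun setT f ->
  (forall x, 0 <= f x)%E -> (\int[P]_w f (incr h j w) = \int[P]_w f (X h w))%E.
Proof.
move=> h0 mf f0; pose R_ := measurableTypeR R.
pose nU := isMeasurableFun.Build _ _ _ _ (incr h j : T -> R_) (measurable_incr h j).
pose U : {RV P >-> R_} := (HB.pack (incr h j : T -> R_) nU : {mfun T >-> R_}).
transitivity (\int[distribution P U]_x f x)%E; first by rewrite ge0_integral_distribution.
transitivity (\int[distribution P (X h)]_x f x)%E; last by rewrite ge0_integral_distribution.
by apply: eq_measure_integral => A mA _; exact: incr_law.
Qed.

Section Laplace.
Variables (psi : R -> R) (la : R).
Hypotheses (mpsi : measurable_fun setT psi) (psi0 : forall x, 0 <= psi x) (la0 : 0 <= la).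

Let mexp : measurable_fun setT (fun x => expR (- (la * psi x))).
Proof. by apply: measurable_fun_exp; apply: measurable_fun_opp; exact: measurable_fun_mul. Qed.

Let exp01 x : 0 <= expR (- (la * psi x)) <= 1.
Proof. by rewrite expR_ge0 -expR0 ler_expR oppr_le0 mulr_ge0. Qed.

Lemma vari_ge0 h a b w : 0 <= vari psi h a b w.
Proof. exact: sumr_ge0. Qed.

Lemma vari_laplace h a b : (a <= b)%N -> 0 <= h ->
  mean P (fun w => expR (- (la * vari psi h a b w))) =
  mean P (fun w => expR (- (la * psi (X h w)))) ^+ (b - a).
Proof.
move=> ab h0; pose f x := expR (- (la * psi x)).
have f0 x : 0 <= f x by exact: expR_ge0.
have mX : measurable_fun setT (X h) := measurable_funP (X h).
have := indep_prod (P := P) (n := (b - a)%N) (f := f) (fun j => measurable_incr h (a + j))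
  (incr_indep (b - a)%N a h0) mexp f0.
have E w : expR (- (la * vari psi h a b w)) = \prod_(0 <= i < b - a) f (incr h (a + i) w).
  rewrite /vari -{1}(add0n a) big_addn mulr_sumr -sumrN expR_sum.
  by apply: eq_bigr => i _; rewrite addnC.
under eq_integral do rewrite -E.
have eM : (\int[P]_w (f (X h w))%:E = (mean P (fun w => f (X h w)))%:E)%E.
  by apply: (@meanE _ _ _ P _ 1); [exact: (measurableT_comp mexp)|move=> w; exact: exp01].
move=> e; rewrite {1}/mean e; under eq_bigr => i _.
  rewrite (incr_integral (a + i) (f := fun x => (f x)%:E) h0); [|exact/measurable_EFinP|by []].
  rewrite eM.
  over.
by rewrite prodEFin/= prodr_const_nat subn0.
Qed.

Lemma vari_laplace_one_sub h a b : (a <= b)%N -> 0 <= h ->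
  mean P (fun w => expR (- (la * vari psi h a b w))) =
  (1 - mean P (fun w => 1 - expR (- (la * psi (X h w))))) ^+ (b - a).
Proof.
move=> ab h0; have mX : measurable_fun setT (X h) := measurable_funP (X h).
rewrite vari_laplace// (@mean_one_sub _ _ _ P (fun w => expR (- (la * psi (X h w)))))//.
  by rewrite subKr.
exact: (measurableT_comp mexp).
Qed.

Context (gamma : R) (Pi : {measure set (measurableTypeR R) -> \bar R}).
Hypothesis Pi_levy : bounded_levy_measure Pi.
Hypothesis X_triplet : has_triplet X gamma 0 Pi.
Hypothesis Pi_abs : (\int[Pi]_x `|x|%:E < +oo)%E.
Hypothesis no_drift : drift gamma Pi = 0.
Hypothesis psi_le : forall x, psi x <= `|x|.
Hypothesis psi_cont : forall x, x != 0 -> {for x, continuous psi}.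

(** Laplace exponent of the driftless subordinator whose jumps are the images under [psi] of the
    jumps of [X]. *)
Definition laplace_exponent : R := fine (\int[Pi]_x (1 - expR (- (la * psi x)))%:E)%E.

Lemma one_sub_exp_le x : 0 <= 1 - expR (- (la * psi x)) <= la * psi x.
Proof.
have /andP[_ e1] := exp01 x; rewrite subr_ge0 e1/=.
by have := expR_ge1Dx (- (la * psi x)); lra.
Qed.

Lemma laplace_exponentE :
  (\int[Pi]_x (1 - expR (- (la * psi x)))%:E = laplace_exponent%:E)%E.
Proof.
rewrite /laplace_exponent fineK// ge0_fin_numE; last first.
  by apply: integral_ge0 => x _; rewrite lee_fin; case/andP: (one_sub_exp_le x).
apply: (@le_lt_trans _ _ (la%:E * \int[Pi]_x `|x|%:E)%E); last by rewrite lte_mul_pinfty.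
rewrite -ge0_integralZl//; last by meas.
apply: ge0_le_integral => //.
- by move=> x _; rewrite lee_fin; case/andP: (one_sub_exp_le x).
- by apply/measurable_EFinP; exact: measurable_fun_sub.
- by apply: measurable_funeM; meas.
- move=> x _; rewrite -EFinM lee_fin; have /andP[_ /le_trans] := one_sub_exp_le x; apply.
  exact: ler_wpM2l.
Qed.

Section Limit.
Variables (h : nat -> R) (a b : nat -> nat) (t : R).
Hypothesis h_gt0 : forall j, 0 < h j.
Hypothesis h_cvg0 : h j @[j --> \oo] --> 0.
Hypothesis la_gt0 : 0 < la.
Hypothesis abt : forall j, (b j - a j)%:R * h j = t.
Hypothesis ab : forall j, (a j <= b j)%N.

Let q j := mean P (fun w => 1 - expR (- (la * psi (X (h j) w)))).

Let mq j : measurable_fun setT (fun w => 1 - expR (- (la * psi (X (h j) w)))).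
Proof.
have mX : measurable_fun setT (X (h j)) := measurable_funP (X (h j)).
by apply: measurable_fun_sub => //; exact: (measurableT_comp mexp).
Qed.

Let qE j : (\int[P]_w (1 - expR (- (la * psi (X (h j) w))))%:E = (q j)%:E)%E.
Proof.
apply: (@meanE _ _ _ P _ 1) => // w.
by have := exp01 (X (h j) w); lra.
Qed.

(** [1 - exp (- la * psi)] is continuous off 0 and at most [la * |x|], so both [levy_liminf] and
    [levy_limsup] apply. *)
Lemma laplace_rate : (h j)^-1 * q j @[j --> \oo] --> laplace_exponent.
Proof.
pose g x := 1 - expR (- (la * psi x)).
have mg : measurable_fun setT g by exact: measurable_fun_sub.
have g0 x : 0 <= g x by case/andP: (one_sub_exp_le x).
have gL x : 0 <= g x <= la * `|x|.
  by rewrite g0/=; case/andP: (one_sub_exp_le x) => _ /le_trans; apply; exact: ler_wpM2l.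
have cg x : x != 0 -> {for x, continuous g}.
  move=> x0; apply: cvgB; first exact: cvg_cst.
  apply: (@continuous_comp _ _ _ (fun x => - (la * psi x)) expR); last exact: continuous_expR.
  by apply: cvgN; apply: cvgMr; exact: psi_cont.
apply/cvgrPdist_lt => e e0.
have lo : ((laplace_exponent - e)%:E < \int[Pi]_x (g x)%:E)%E.
  by rewrite laplace_exponentE lte_fin gtrBl.
have hi : (\int[Pi]_x (g x)%:E < (laplace_exponent + e)%:E)%E.
  by rewrite laplace_exponentE lte_fin ltrDl.
have n1 := levy_liminf Pi_levy X_triplet h_gt0 h_cvg0 mg g0 cg lo.
have n2 := levy_limsup Pi_levy X_triplet h_gt0 h_cvg0 Pi_abs no_drift mg la_gt0 gL cg hi.
apply: filterS2 n1 n2 => j; rewrite /g qE -!EFinM !lte_fin => j1 j2.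
by rewrite ltr_distlC j1 j2.
Qed.

(** A Poisson-type limit: the transform is [(1 - q) ^+ n] with [q] tending to 0 and [n * q] to
    [t * laplace_exponent], squeezed by [expr_one_sub_bounds]. *)
Lemma laplace_cvg :
  mean P (fun w => expR (- (la * vari psi (h j) (a j) (b j) w))) @[j --> \oo] -->
  expR (- (t * laplace_exponent)).
Proof.
have e j : mean P (fun w => expR (- (la * vari psi (h j) (a j) (b j) w))) =
    (1 - q j) ^+ (b j - a j) by rewrite vari_laplace_one_sub// ltW.
have q0 j : 0 <= q j.
  by apply: mean_ge0 => w; have := exp01 (X (h j) w); lra.
have qE' j : h j * ((h j)^-1 * q j) = q j by rewrite mulrA divff ?mul1r// gt_eqF.
have qc : q j @[j --> \oo] --> 0.
  rewrite -(mul0r laplace_exponent) -(_ : (fun j => h j * ((h j)^-1 * q j)) = q).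
    exact: cvgM h_cvg0 laplace_rate.
  exact/funext.
have nq j : (b j - a j)%:R * q j = t * ((h j)^-1 * q j) by rewrite -(abt j) -mulrA qE'.
have nqc : (b j - a j)%:R * q j @[j --> \oo] --> t * laplace_exponent.
  rewrite (_ : (fun j => _) = (fun j => t * ((h j)^-1 * q j))); last exact/funext.
  by apply: cvgMr; exact: laplace_rate.
have q1 : \forall j \near \oo, q j < 1 by apply: (@cvgr_lt _ _ _ _ _ _ qc 1); exact: ltr01.
rewrite (_ : (fun j => _) = (fun j => (1 - q j) ^+ (b j - a j))); last exact/funext.
have nb : \forall j \near \oo, expR (- ((b j - a j)%:R * q j / (1 - q j))) <=
    (1 - q j) ^+ (b j - a j) <= expR (- ((b j - a j)%:R * q j)).
  by apply: filterS q1 => j qj; apply: expr_one_sub_bounds; rewrite q0.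
apply: (squeeze_cvgr nb).
- apply: continuous_cvg; first exact: continuous_expR.
  apply: cvgN; rewrite -[X in _ --> X]mulr1 -[X in _ * X]invr1.
  apply: cvgM => //; apply: cvgV; first exact: oner_neq0.
  by rewrite -[X in _ --> X]subr0; apply: cvgB => //; exact: cvg_cst.
- apply: continuous_cvg; first exact: continuous_expR.
  exact: cvgN.
Qed.

End Limit.

End Laplace.

End LevyGrid.

(** * Probabilities as real numbers and exponential inequalities *)

Section Prob.
Context d (T : measurableType d) (R : realType) (P : probability T R).
Implicit Types A B : set T.

Definition pr A : R := fine (P A).

Lemma prE A : measurable A -> P A = (pr A)%:E.
Proof. by move=> mA; rewrite /pr fineK//; exact: fin_num_measure. Qed.

Lemma pr_ge0 A : 0 <= pr A.
Proof. exact: fine_ge0. Qed.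

Lemma pr_le1 A : measurable A -> pr A <= 1.
Proof. by move=> mA; rewrite -lee_fin -prE// probability_le1. Qed.

Lemma le_pr A B : measurable A -> measurable B -> A `<=` B -> pr A <= pr B.
Proof. by move=> mA mB AB; rewrite -lee_fin -!prE// le_measure ?inE. Qed.

Lemma pr_setC A : measurable A -> pr (~` A) = 1 - pr A.
Proof.
move=> mA; apply: EFin_inj; rewrite -prE; last exact: measurableC.
by rewrite probability_setC// prE.
Qed.

Lemma pr_setU A B : measurable A -> measurable B -> pr (A `|` B) <= pr A + pr B.
Proof.
move=> mA mB; rewrite -lee_fin EFinD -!prE//; last exact: measurableU.
exact: measureU2.
Qed.

Lemma pr_setI_ge A B : measurable A -> measurable B -> pr A + pr B - 1 <= pr (A `&` B).
Proof.
move=> mA mB; have mAB : measurable (A `&` B) by exact: measurableI.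
have := pr_setU (measurableC mA) (measurableC mB).
by rewrite -setCI !pr_setC//; lra.
Qed.

Lemma pr_bigsetU (F : nat -> set T) n : (forall i, measurable (F i)) ->
  pr (\big[setU/set0]_(i < n) F i) <= \sum_(i < n) pr (F i).
Proof.
move=> mF; elim: n => [|n IH]; first by rewrite !big_ord0 /pr measure0.
rewrite !big_ord_recr/= (le_trans (pr_setU _ _))//.
  exact: bigsetU_measurable.
by rewrite lerD2r.
Qed.

Lemma mean_indicE A : measurable A -> mean P \1_A = pr A.
Proof. by move=> mA; apply: EFin_inj; rewrite mean_indic// prE. Qed.

(** The exponential is at most 1 below the level [c] and at most [exp (- la * c)] above. Serves as a
    lower bound for the probability. *)
Lemma mean_expR_le (U : T -> R) la c : measurable_fun setT U -> (forall w, 0 <= U w) ->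
  0 <= la -> mean P (fun w => expR (- (la * U w))) <=
  pr [set w | U w <= c] + expR (- (la * c)).
Proof.
move=> mU U0 la0.
have mE : measurable_fun setT (fun w => expR (- (la * U w))).
  by apply: measurable_fun_exp; apply: measurable_fun_opp; exact: measurable_fun_mul.
have mA : measurable [set w | U w <= c].
  by rewrite -[X in measurable X]setTI; apply: (@measurable_fun_ler _ _ _ setT U (fun=> c)).
rewrite -mean_indicE// -(mean_cst P (expR (- (la * c)))).
have i01 w : 0 <= (\1_[set w | U w <= c] w : R) <= 1 by rewrite indicE; case: (_ \in _); rewrite ler01 lexx.
rewrite -(@mean_add _ _ _ P _ _ 1 (expR (- (la * c))))//; last by move=> w; rewrite expR_ge0 lexx.
apply: (@le_mean _ _ _ P _ _ (1 + expR (- (la * c)))) => //.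
- exact: measurable_fun_add.
- move=> w; rewrite expR_ge0/= indicE; have [Uc|Uc] := leP (U w) c.
    rewrite mem_set//= -[leLHS]addr0 lerD ?expR_ge0//.
    by rewrite -expR0 ler_expR oppr_le0 mulr_ge0.
  rewrite memNset ?add0r; last by apply/negP; rewrite -ltNge.
  by rewrite ler_expR lerN2 ler_wpM2l// ltW.
- by move=> w; rewrite lerD2r; case/andP: (i01 w).
Qed.

(** Chebyshev's inequality, the counterpart of [mean_expR_le]. *)
Lemma pr_le_mean_expR (U : T -> R) la c : measurable_fun setT U -> (forall w, 0 <= U w) ->
  0 <= la -> pr [set w | U w <= c] <= expR (la * c) * mean P (fun w => expR (- (la * U w))).
Proof.
move=> mU U0 la0.
have mE : measurable_fun setT (fun w => expR (- (la * U w))).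
  by apply: measurable_fun_exp; apply: measurable_fun_opp; exact: measurable_fun_mul.
have mA : measurable [set w | U w <= c].
  by rewrite -[X in measurable X]setTI; apply: (@measurable_fun_ler _ _ _ setT U (fun=> c)).
have e1 w : 0 <= expR (- (la * U w)) <= 1.
  by rewrite expR_ge0 -expR0 ler_expR oppr_le0 mulr_ge0.
rewrite -mean_indicE// -(@mean_scale _ _ _ P _ 1)//.
apply: (@le_mean _ _ _ P _ _ (expR (la * c))) => //.
- exact: measurable_fun_mul.
- move=> w; rewrite indicE; have [Uc|Uc] := boolP (w \in _); last by rewrite lexx mulr_ge0 ?expR_ge0.
  rewrite ler01/= -expRD -mulrBr -[leLHS]expR0 ler_expR mulr_ge0// subr_ge0.
  by move: Uc; rewrite inE.
- move=> w; rewrite -[leRHS]mulr1 ler_wpM2l ?expR_ge0//.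
  by case/andP: (e1 w).
Qed.

End Prob.

Definition posp {R : realType} (x : R) : R := Num.max x 0.
Definition negp {R : realType} (x : R) : R := Num.max (- x) 0.

Section Parts.
Context {R : realType}.
Implicit Types x y : R.

Lemma posp_ge0 x : 0 <= posp x. Proof. by rewrite le_max lexx orbT. Qed.
Lemma negp_ge0 x : 0 <= negp x. Proof. by rewrite le_max lexx orbT. Qed.
Lemma posp_le x : posp x <= `|x|. Proof. by rewrite ge_max ler_norm normr_ge0. Qed.
Lemma negp_le x : negp x <= `|x|. Proof. by rewrite -normrN; exact: posp_le. Qed.
Lemma posp_id x : 0 <= x -> posp x = x. Proof. by move=> x0; rewrite /posp max_l. Qed.
Lemma posp_eq0 x : x <= 0 -> posp x = 0. Proof. by move=> x0; rewrite /posp max_r. Qed.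
Lemma le_posp x : x <= posp x. Proof. by rewrite le_max lexx. Qed.
Lemma posp_negp x : x = posp x - negp x.
Proof.
rewrite /posp /negp; have [x0|x0] := leP x 0.
  by rewrite max_l ?oppr_ge0// opprK add0r.
by rewrite max_r ?oppr_le0 ?ltW// subr0.
Qed.
Lemma posp_add x y : posp (x + y) <= posp x + posp y.
Proof. by rewrite ge_max addr_ge0 ?posp_ge0// lerD// le_posp. Qed.
Lemma measurable_posp : measurable_fun setT (@posp R).
Proof. by apply: measurable_fun_max. Qed.
Lemma measurable_negp : measurable_fun setT (@negp R).
Proof. by apply: measurable_fun_max => //; exact: measurable_fun_opp. Qed.
Lemma continuous_posp : continuous (@posp R).
Proof. by move=> x; apply: continuous_max => //; exact: cvg_cst. Qed.
Lemma continuous_negp : continuous (@negp R).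
Proof. by move=> x; apply: continuous_max; [exact: opp_continuous|exact: cvg_cst]. Qed.
End Parts.

Section ExpBounds.
Context {R : realType}.

(** $1-e^{-u}\ge u/(1+u)$. *)
Lemma one_sub_exp_ge (u : R) : 0 <= u -> Num.min u 1 / 2 <= 1 - expR (- u).
Proof.
move=> u0; have e1 := expR_ge1Dx u.
have u1 : 0 < 1 + u by rewrite ltr_pwDl.
have : expR (- u) <= (1 + u)^-1 by rewrite expRN lef_pV2 ?posrE ?expR_gt0.
move=> /(lerB (lexx 1)); apply: le_trans.
rewrite -(@ler_pM2r _ (1 + u))// mulrBl mul1r mulVf ?gt_eqF// addrAC subrr add0r.
by rewrite minElt; case: ltP => ?; nra.
Qed.

Lemma expr_one_sub_le (q : R) n : 0 <= q <= 1 -> (1 - q) ^+ n <= expR (- (n%:R * q)).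
Proof.
move=> /andP[q0 q1]; rewrite -mulrN expRM_natl; apply: lerXn2r; rewrite ?nnegrE ?expR_ge0 ?subr_ge0//.
exact: expR_ge1Dx.
Qed.

End ExpBounds.

(** * Bounded variation makes |x| integrable for the Levy measure *)

Section LevyAbsIntegrable.
Context (R : realType) (disp : measure_display)
    (T : measurableType disp) (P : probability T R)
    (X : R -> {RV P >-> measurableTypeR R}).
Hypothesis X_levy : levy_process X.
Context (gamma : R) (Pi : {measure set (measurableTypeR R) -> \bar R}).
Hypothesis Pi_levy : bounded_levy_measure Pi.
Hypothesis X_triplet : has_triplet X gamma 0 Pi.

Definition mesh (t : R) (j : nat) : R := t / 2 ^+ j.

Lemma mesh_gt0 t j : 0 < t -> 0 < mesh t j.
Proof. by move=> t0; rewrite divr_gt0// exprn_gt0. Qed.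

Lemma mesh_sum t j : (2 ^ j)%:R * mesh t j = t.
Proof. by rewrite /mesh natrX mulrC mulfVK// expf_neq0. Qed.

Lemma mesh_cvg0 t : mesh t j @[j --> \oo] --> 0.
Proof.
rewrite -(mulr0 t); apply: cvgMr.
rewrite (_ : (fun j => _) = (fun j => (2^-1) ^+ j :> R)); last by apply/funext => j; rewrite exprVn.
by apply: cvg_expr; rewrite ger0_norm ?invr_ge0// invf_lt1// ltr1n.
Qed.

Lemma vari_abs_le_TV j w : ((vari X (fun x => `|x|) (mesh 1 j) 0 (2 ^ j) w)%:E <=
  total_variation 0 1 (fun s => X s w))%E.
Proof.
have := @sum_increment_le_TV R (fun s => X s w) (fun i => i%:R * mesh 1 j) (2 ^ j)%N.
rewrite mul0r mesh_sum; apply => i k ik; rewrite ler_wpM2r ?ler_nat//.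
by rewrite ltW// mesh_gt0.
Qed.

(** The total variation on [[0, 1]] is almost surely finite, hence below a constant with probability
    more than 1/2, and it dominates the variations along all meshes at once. *)
Let bounded_vari : bv X -> exists M : R, 0 < M /\
  forall j, expR (- M) / 2 <= mean P (fun w => expR (- (1 * vari X (fun x => `|x|) (mesh 1 j) 0 (2 ^ j) w))).
Proof.
move=> Xbv; pose V j := vari X (fun x => `|x|) (mesh 1 j) 0 (2 ^ j).
have mV j : measurable_fun setT (V j) by apply: measurable_vari; meas.
(* Stated through the countably many grid variations, which are measurable, and not through the
   total variation itself. *)
pose E (M : nat) : set T := \bigcap_j [set w | V j w <= M%:R].
have mE M : measurable (E M).
  apply: bigcapT_measurable => j.
  rewrite -[X in measurable X]setTI.
  exact: (@measurable_fun_ler _ _ _ setT (V j) (fun=> M%:R)).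
have ndE : nondecreasing_seq E.
  move=> n m nm; apply/subsetPset => w h j _ /=.
  by apply: (le_trans (h j I)); rewrite ler_nat.
have mUE : measurable (\bigcup_M E M) by exact: bigcupT_measurable.
have PU : P (\bigcup_M E M) = 1%E.
  have : P (~` (\bigcup_M E M)) = 0%E.
    apply/negligibleP; first exact: measurableC.
    apply: negligibleS Xbv => w /= nE bvw; apply: nE.
    have tv := (bounded_variationP (fun s => X s w) ler01).1 (bvw 1 ler01).
    exists (Num.bound (fine (total_variation 0 1 (fun s => X s w)))) => // j _ /=.
    have : V j w <= fine (total_variation 0 1 (fun s => X s w)).
      by rewrite -lee_fin fineK//; exact: vari_abs_le_TV.
    move=> /le_trans; apply; apply/ltW/archi_boundP.
    by rewrite fine_ge0// total_variation_ge0.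
  by rewrite probability_setC// => /eqP; rewrite sube_eq ?add0e ?fin_num_measure// => /eqP <-.
have cE : (P \o E) M @[M --> \oo] --> P (\bigcup_M E M) := nondecreasing_cvg_mu mE mUE ndE.
have h2 : ((2^-1)%:E < P (\bigcup_M E M))%E by rewrite PU lte_fin; lra.
have [M _ hM] : \forall M \near \oo, ((2^-1)%:E < P (E M))%E := cE _ (open_ereal_gt' h2).
exists M.+1%:R; split => // j.
have {hM} : 2^-1 < pr P (E M.+1) by rewrite -lte_fin -prE//; apply: hM => /=.
move=> hM.
have mX w : 0 <= (\1_(E M.+1) w : R) <= 1 by rewrite indicE; case: (_ \in _); rewrite ler01 lexx.
apply: (@le_trans _ _ (mean P (fun w => expR (- M.+1%:R) * \1_(E M.+1) w))).
  rewrite (@mean_scale _ _ _ P _ 1) ?expR_ge0//.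
  by rewrite mean_indicE// ler_wpM2l ?expR_ge0// ltW.
apply: (@le_mean _ _ _ P _ _ 1).
- exact: measurable_fun_mul.
- apply: measurable_fun_exp; apply: measurable_fun_opp; apply: measurable_fun_mul => //.
  exact: mV.
- move=> w; rewrite mulr_ge0 ?expR_ge0 ?indicE//=.
  have [wE|_] := boolP (w \in _); last by rewrite mulr0 expR_ge0.
  rewrite mulr1 ler_expR lerN2 mul1r.
  by move: wE; rewrite inE => /(_ j I).
- move=> w; rewrite -[leRHS]expR0 ler_expR oppr_le0 mul1r.
  by apply: sumr_ge0.
Qed.

(** Were the integral infinite, that of [1 - exp (- |x|)] would be too; the Laplace transforms at 1
    of the grid variations would then drop below any bound, against [bounded_vari]. *)
Lemma bv_levy_abs : bv X -> (\int[Pi]_x `|x|%:E < +oo)%E.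
Proof.
move=> /bounded_vari[M [M0 HM]]; rewrite ltey; apply/eqP => Poo.
pose g (x : R) := 1 - expR (- (1 * `|x|)).
have mg : measurable_fun setT g by rewrite /g; meas.
have e1 (x : R) : 0 <= expR (- (1 * `|x|)) <= 1.
  by rewrite expR_ge0/= -[leRHS]expR0 ler_expR oppr_le0 mul1r.
have g0 x : 0 <= g x by have := e1 x; rewrite /g; lra.
have goo : (\int[Pi]_x (g x)%:E = +oo)%E.
  apply/eqP; rewrite eq_le leey/= leNgt; apply/negP => glt.
  have : (\int[Pi]_x `|x|%:E < +oo)%E; last by rewrite Poo ltxx.
  rewrite (levy_integral_itv Pi_levy); [|by meas|by move=> x; rewrite lee_fin].
  apply: (@le_lt_trans _ _ (\int[Pi]_(x in `[(-1)%R, 1%R]) (2%:E * (g x)%:E))%E).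
    apply: ge0_le_integral => //.
    - by apply: measurable_funTS; meas.
    - apply: measurable_funTS; apply: measurable_funeM; exact/measurable_EFinP.
    - move=> x; rewrite /= in_itv/= -ler_norml => x1; rewrite -EFinM lee_fin.
      have := one_sub_exp_ge (normr_ge0 x); rewrite min_l// /g mul1r; lra.
  apply: (@le_lt_trans _ _ (\int[Pi]_x (2%:E * (g x)%:E))%E).
    apply: ge0_subset_integral => //.
    - apply: measurable_funeM; exact/measurable_EFinP.
    - by move=> x _; rewrite -EFinM lee_fin mulr_ge0.
  have -> : (\int[Pi]_x (2%:E * (g x)%:E) = 2%:E * \int[Pi]_x (g x)%:E)%E.
    by apply: ge0_integralZl => //; try exact/measurable_EFinP; move=> x _; rewrite lee_fin.
  by apply: lte_mul_pinfty.
have cg x : x != 0 -> {for x, continuous g}.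
  move=> x0; apply: cvgB; first exact: cvg_cst.
  apply: (@continuous_comp _ _ _ (fun x : R => - (1 * `|x|)) expR); last exact: continuous_expR.
  by apply: cvgN; apply: cvgMr; exact: norm_continuous.
(* The extra 2 beats the factor 1/2 of [bounded_vari], because [exp 2 >= 3]. *)
have hM : ((M + 2)%:E < \int[Pi]_x (g x)%:E)%E by rewrite goo ltry.
have m0 j : 0 < mesh 1 j by exact: mesh_gt0.
have [j _ Hj] := levy_liminf Pi_levy X_triplet m0 (mesh_cvg0 1) mg g0 cg hM.
have := Hj j (leqnn j); set q := mean P (fun w => g (X (mesh 1 j) w)).
have mX : measurable_fun setT (X (mesh 1 j)) := measurable_funP (X (mesh 1 j)).
have g1 x : 0 <= g x <= 1 by have := e1 x; rewrite /g; lra.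
have mgX : measurable_fun setT (fun w => g (X (mesh 1 j) w)) by exact: (measurableT_comp mg).
rewrite (@meanE _ _ _ P _ 1)// -/q -EFinM lte_fin => Mq.
have := HM j; rewrite (vari_laplace_one_sub X_levy)//; last exact: ltW.
apply/negP; rewrite -ltNge.
have q01 : 0 <= q <= 1 by rewrite mean_ge0//= (@mean_le _ _ _ P).
apply: (@le_lt_trans _ _ ((1 - q) ^+ (2 ^ j - 0))); first by [].
apply: (le_lt_trans (expr_one_sub_le _ q01)).
apply: (@lt_le_trans _ _ (expR (- (M + 2)))).
  rewrite ltr_expR ltrN2 (lt_le_trans Mq)// ler_wpM2r//; first by case/andP: q01.
  by rewrite subn0 -(ler_pM2r (m0 j)) mesh_sum mulVf// gt_eqF.
rewrite opprD expRD ler_wpM2l ?expR_ge0// expRN lef_pV2 ?posrE ?expR_gt0//.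
by apply: le_trans (expR_ge1Dx 2); lra.
Qed.


End LevyAbsIntegrable.

(** * The function A_plus and the integral K_X *)

Section APlus.
Context (R : realType) (Pi : {measure set (measurableTypeR R) -> \bar R}).
Hypothesis Pi_levy : bounded_levy_measure Pi.
Hypothesis Pi_abs : (\int[Pi]_x `|x|%:E < +oo)%E.
Local Notation leb := (@lebesgue_measure R).
Local Notation A := (A_plus Pi).

Let mmin (y : R) : measurable_fun [set: R] (fun x : R => Num.min (posp x) y).
Proof. by apply: measurable_fun_min => //; exact: measurable_posp. Qed.

Let mminE (y : R) : measurable_fun [set: R] (fun x : R => (Num.min (posp x) y)%:E).
Proof. by apply/measurable_EFinP; exact: mmin. Qed.

Let min_ge0 (x y : R) : 0 <= y -> 0 <= Num.min (posp x) y.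
Proof. by move=> y0; rewrite le_min posp_ge0 y0. Qed.

(** Tonelli on the set [0 < z <= y], [z < x]: for fixed [x] its section has length $\min(x^+,y)$.
    All properties of [A_plus] are read off this truncated mean. *)
Lemma A_plus_integral y : 0 <= y ->
  (\int[leb]_(z in `]0%R, y]) tail_plus Pi z = \int[Pi]_x (Num.min (posp x) y)%:E)%E.
Proof.
move=> y0.
pose f (z : (measurableTypeR R * measurableTypeR R)%type) : \bar R :=
  (\1_[set w : measurableTypeR R * measurableTypeR R | (0 < w.1) && ((w.1 <= y) && (w.1 < w.2))] z)%:E.
have mD : measurable [set w : measurableTypeR R * measurableTypeR R | (0 < w.1) && ((w.1 <= y) && (w.1 < w.2))].
  have m1 : measurable_fun [set: measurableTypeR R * measurableTypeR R] (fun z => z.1 : R) by exact: measurable_fst.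
  have m2 : measurable_fun [set: measurableTypeR R * measurableTypeR R] (fun z => z.2 : R) by exact: measurable_snd.
  rewrite (_ : [set w | _] = [set w | 0 < w.1] `&` ([set w | w.1 <= y] `&` [set w | w.1 < w.2])); last first.
    by apply/seteqP; split => w /= => [/and3P[]|[-> [-> ->]]].
  apply: measurableI; last apply: measurableI; rewrite -[X in measurable X]setTI.
  - exact: (@measurable_fun_ltr _ _ _ setT (fun=> 0) (fun z => z.1)).
  - exact: (@measurable_fun_ler _ _ _ setT (fun z => z.1) (fun=> y)).
  - exact: (@measurable_fun_ltr _ _ _ setT (fun z => z.1) (fun z => z.2)).
have mf : measurable_fun setT f by apply/measurable_EFinP; exact: measurable_indic.
have f0 z : (0 <= f z)%E by rewrite lee_fin indicE.
have sl : sigma_finite setT leb by exact: sigma_finiteT.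
have := tonelli_sigma_finite sl (levy_sigma_finite Pi_levy) mf f0.
have E1 z : (\int[Pi]_x f (z, x) = (tail_plus Pi \_ `]0%R, y]) z)%E.
  rewrite patchE; case: ifPn => [|zI].
    rewrite inE/= in_itv/= => zI; rewrite /tail_plus -[X in _ = Pi X]setIT -integral_indic//.
    apply: eq_integral => x _; rewrite /f !indicE; congr (_%:R%:E); congr (nat_of_bool _).
    have /andP[z0 zy] := zI.
    by apply/idP/idP; rewrite !inE/= in_itv/= andbT z0 zy.
  rewrite integral0_eq// => x _; rewrite /f indicE memNset//= => /and3P[a b c].
  by move/negP: zI; apply; rewrite inE/= in_itv/= a b.
have E2 x : (\int[leb]_z f (z, x) = (Num.min (posp x) y)%:E)%E.
  rewrite /f; pose D := [set z : R | (0 < z) && ((z <= y) && (z < x))].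
  transitivity (\int[leb]_z (\1_D z)%:E)%E.
    by apply: eq_integral => z _; rewrite !indicE; congr (_%:R%:E); congr (nat_of_bool _);
      apply/idP/idP; rewrite !inE.
  have [x0|x0] := leP x 0.
    rewrite posp_eq0// min_l// (_ : D = set0) ?indic0 ?integral0//.
    by apply/seteqP; split => // z /= /and3P[z0 _ zx]; have := lt_le_trans zx x0; rewrite ltNge ltW.
  rewrite posp_id ?ltW//; have [xy|xy] := leP x y.
    rewrite (_ : D = `]0, x[%classic).
      by rewrite integral_indic//= setIT lebesgue_measure_itv/= lte_fin x0 -EFinB subr0.
    apply/seteqP; split => z /=; rewrite in_itv/=; first by case/and3P => -> _ ->.
    move=> /andP[z0 zx].
    by rewrite /D/= z0 zx (ltW (lt_le_trans zx xy)).
  rewrite (_ : D = `]0, y]%classic).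
    rewrite integral_indic//= setIT lebesgue_measure_itv/= lte_fin.
    by case: ltP => yy; rewrite -?EFinB ?subr0//; congr EFin; apply/eqP; rewrite eq_le y0 yy.
  apply/seteqP; split => z /=; rewrite in_itv/=; first by case/and3P => -> -> _.
  move=> /andP[z0 zy].
  by rewrite /D/= z0 zy (le_lt_trans zy xy).
under eq_integral do rewrite E1.
under [X in _ = X -> _]eq_integral do rewrite E2.
by rewrite -integral_mkcond.
Qed.

Lemma A_plusE y : 0 <= y -> (\int[Pi]_x (Num.min (posp x) y)%:E = (A y)%:E)%E.
Proof.
move=> y0; rewrite /A_plus A_plus_integral// fineK// ge0_fin_numE; last first.
  by apply: integral_ge0 => x _; rewrite lee_fin min_ge0.
apply: le_lt_trans Pi_abs; apply: ge0_le_integral => //.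
- by move=> x _; rewrite lee_fin min_ge0.
- exact: mminE.
- by meas.
- by move=> x _; rewrite lee_fin (le_trans _ (posp_le x))// ge_min lexx.
Qed.

Lemma A_plus_ge0 y : 0 <= y -> 0 <= A y.
Proof. by move=> y0; rewrite -lee_fin -A_plusE// integral_ge0// => x _; rewrite lee_fin min_ge0. Qed.

Lemma A_plus_mono y z : 0 <= y <= z -> A y <= A z.
Proof.
move=> /andP[y0 yz]; have z0 := le_trans y0 yz.
rewrite -lee_fin -!A_plusE//; apply: ge0_le_integral => //.
- by move=> x _; rewrite lee_fin min_ge0.
- exact: mminE.
- exact: mminE.
- by move=> x _; rewrite lee_fin le_min !ge_min lexx yz orbT.
Qed.

(** $\min(x^+,cy)\le c\min(x^+,y)$ for $c\ge1$. This weak form of concavity yields the monotonicity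
    of [y / A y] and the continuity of [A]. *)
Lemma A_plus_scale y c : 0 <= y -> 1 <= c -> A (c * y) <= c * A y.
Proof.
move=> y0 c1; have c0 : 0 <= c by lra.
rewrite -lee_fin EFinM -!A_plusE ?mulr_ge0//.
rewrite -ge0_integralZl//; [|exact: mminE|by move=> x _; rewrite lee_fin min_ge0].
apply: ge0_le_integral => //.
- by move=> x _; rewrite lee_fin min_ge0// mulr_ge0.
- exact: mminE.
- by apply: measurable_funeM; exact: mminE.
- move=> x _; rewrite -EFinM lee_fin minr_pMr// le_min !ge_min lexx orbT andbT.
  by rewrite ler_peMl ?posp_ge0.
Qed.

Lemma A_plus_cvg0 e : 0 < e -> exists2 d, 0 < d & forall y, 0 <= y <= d -> A y < e.
Proof.
move=> e0; pose F (n : nat) (x : R) := (Num.min (posp x) n.+1%:R^-1)%:E.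
have : (\int[Pi]_x F n x @[n --> \oo] --> 0)%E.
  have := @dominated_convergence _ _ _ Pi setT measurableT F (cst 0%E) (fun x => `|x|%:E).
  case.
  - by move=> n; apply/measurable_EFinP; exact: mmin.
  - exact: measurable_cst.
  - apply: aeW => x _; apply: cvg_EFin; first exact: nearW.
    apply/cvgrPdist_le => d d0; near=> n.
    rewrite sub0r normrN /= ger0_norm ?min_ge0//.
    rewrite ge_min; apply/orP; right; near: n.
    have := @cvgr_le _ _ _ _ _ _ (@cvg_harmonic R) d; apply; exact: d0.
  - apply/integrableP; split; first by meas.
    by under eq_integral do rewrite gee0_abs//.
  - apply: aeW => x n _; rewrite /F gee0_abs ?lee_fin ?min_ge0//.
    by rewrite (le_trans _ (posp_le x))// ge_min lexx.
  by move=> _ _; rewrite integral0.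
have := @open_ereal_lt' R 0%E e%:E; rewrite lte_fin e0 => /(_ isT) h0 hc.
have [N _ HN] : \forall n \near \oo, (\int[Pi]_x F n x < e%:E)%E := hc _ h0.
exists N.+1%:R^-1; first by rewrite invr_gt0.
move=> y yN; apply: (le_lt_trans (A_plus_mono yN)).
by rewrite -lte_fin -A_plusE//; exact: HN (leqnn N).
Unshelve. all: end_near.
Qed.

(** Pointwise $1-e^{-u}\ge\min(u,1)/2$ at $u=\lambda x^+$, and $\min(\lambda
    x^+,1)=\lambda\min(x^+,1/\lambda)$. *)
Lemma laplace_exponent_posp_ge la : 0 < la -> la * A la^-1 / 2 <= laplace_exponent posp la Pi.
Proof.
move=> la0; have la1 : 0 <= la^-1 by rewrite invr_ge0 ltW.
have mp := @measurable_posp R.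
rewrite -lee_fin -(laplace_exponentE mp (@posp_ge0 R) (ltW la0) Pi_abs (@posp_le R)).
rewrite mulrAC EFinM -A_plusE// -ge0_integralZl//; last 3 first.
- exact: mminE.
- by move=> x _; rewrite lee_fin min_ge0.
- by rewrite lee_fin divr_ge0// ltW.
apply: ge0_le_integral => //.
- by move=> x _; rewrite -EFinM lee_fin mulr_ge0 ?min_ge0// divr_ge0// ltW.
- by apply: measurable_funeM; exact: mminE.
- apply/measurable_EFinP; apply: measurable_fun_sub => //; apply: measurable_fun_exp.
  by apply: measurable_fun_opp; exact: measurable_fun_mul.
- move=> x _; rewrite -EFinM lee_fin.
  have lx : 0 <= la * posp x by rewrite mulr_ge0 ?posp_ge0 ?ltW.
  apply: le_trans (one_sub_exp_ge lx).
  by rewrite mulrAC minr_pMr ?(ltW la0)// divff ?gt_eqF.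
Qed.

Lemma laplace_exponent_posp_le la : 0 < la -> laplace_exponent posp la Pi <= la * A la^-1.
Proof.
move=> la0; have la1 : 0 <= la^-1 by rewrite invr_ge0 ltW.
have mp := @measurable_posp R.
rewrite -lee_fin -(laplace_exponentE mp (@posp_ge0 R) (ltW la0) Pi_abs (@posp_le R)).
rewrite EFinM -A_plusE// -ge0_integralZl//; last 3 first.
- exact: mminE.
- by move=> x _; rewrite lee_fin min_ge0.
- by rewrite lee_fin ltW.
apply: ge0_le_integral => //.
- by move=> x _; rewrite lee_fin; case/andP: (one_sub_exp_le (@posp_ge0 R) (ltW la0) x).
- apply/measurable_EFinP; apply: measurable_fun_sub => //; apply: measurable_fun_exp.
  by apply: measurable_fun_opp; exact: measurable_fun_mul.
- by apply: measurable_funeM; exact: mminE.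
- move=> x _; rewrite -EFinM lee_fin.
  rewrite minr_pMr ?(ltW la0)// divff ?gt_eqF// le_min.
  case/andP: (one_sub_exp_le (@posp_ge0 R) (ltW la0) x) => _ -> /=.
  by rewrite gerBl expR_ge0.
Qed.

End APlus.

(** * Almost sure events and sums of indicators *)

Section Eventually.
Context d (T : measurableType d) (R : realType) (P : probability T R).

Lemma ae_eventually (F : nat -> set T) (e : R) : (forall m, measurable (F m)) -> 0 < e ->
  {ae P, forall w, \forall m \near \oo, F m w} ->
  exists N, 1 - e < pr P (\bigcap_(m in [set m | (N <= m)%N]) F m).
Proof.
move=> mF e0 aeF; pose E N := \bigcap_(m in [set m | (N <= m)%N]) F m.
have mE N : measurable (E N) by exact: bigcap_measurableType.
have ndE : nondecreasing_seq E.
  move=> n m nm; apply/subsetPset => w h j /= mj; apply: h => /=; exact: leq_trans mj.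
have mUE : measurable (\bigcup_N E N) by exact: bigcupT_measurable.
have PU : P (\bigcup_N E N) = 1%E.
  have : P (~` (\bigcup_N E N)) = 0%E.
    apply/negligibleP; first exact: measurableC.
    apply: negligibleS aeF => w /= nE [N _ h]; apply: nE.
    by exists N => // m /= Nm; exact: h.
  by rewrite probability_setC// => /eqP; rewrite sube_eq ?add0e ?fin_num_measure// => /eqP <-.
have cE : (P \o E) N @[N --> \oo] --> P (\bigcup_N E N) := nondecreasing_cvg_mu mE mUE ndE.
have h2 : ((1 - e)%:E < P (\bigcup_N E N))%E by rewrite PU lte_fin gtrBl.
have [N _ hN] : \forall N \near \oo, ((1 - e)%:E < P (E N))%E := cE _ (open_ereal_gt' h2).
by exists N; rewrite -lte_fin -prE; [exact: (hN N (leqnn N))|exact: mE].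
Qed.

Lemma mean_sum_indic (c : nat -> R) (G : nat -> set T) n m : (forall i, 0 <= c i) ->
  (forall i, measurable (G i)) ->
  mean P (fun w => \sum_(n <= i < m) c i * \1_(G i) w) = \sum_(n <= i < m) c i * pr P (G i).
Proof.
move=> c0 mG; apply: EFin_inj.
have m1 i : measurable_fun [set: T] (fun w => c i * \1_(G i) w : R) by exact: measurable_fun_mul.
have b1 i w : 0 <= c i * \1_(G i) w <= c i.
  by rewrite indicE; case: (_ \in _); rewrite ?mulr1 ?mulr0 c0 lexx.
rewrite -(@meanE _ _ _ P _ (\sum_(n <= i < m) c i)); last 2 first.
- exact: measurable_sum.
- move=> w; apply/andP; split; first by apply: sumr_ge0 => i _; case/andP: (b1 i w).
  by apply: ler_sum => i _; case/andP: (b1 i w).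
under eq_integral do rewrite -sumEFin.
rewrite ge0_integral_sum//; last 2 first.
- by move=> i; exact/measurable_EFinP.
- by move=> i w _; rewrite lee_fin; case/andP: (b1 i w).
rewrite -sumEFin; apply: eq_bigr => i _.
rewrite (@meanE _ _ _ P _ (c i))// (@mean_scale _ _ _ P _ 1)//.
  by rewrite mean_indicE.
by move=> w; rewrite indicE; case: (_ \in _); rewrite ler01 lexx.
Qed.

Lemma measurable_le (f g : T -> R) : measurable_fun setT f -> measurable_fun setT g ->
  measurable [set w | f w <= g w].
Proof.
move=> mf mg; rewrite -[X in measurable X]setTI.
exact: (@measurable_fun_ler _ _ _ setT f g).
Qed.

Lemma measurable_lt (f g : T -> R) : measurable_fun setT f -> measurable_fun setT g ->
  measurable [set w | f w < g w].
Proof.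
move=> mf mg; rewrite -[X in measurable X]setTI.
exact: (@measurable_fun_ltr _ _ _ setT f g).
Qed.

End Eventually.

(** * Lower bounds for the probability of staying below a level *)

Section LevyBounds.
Context (R : realType) (disp : measure_display)
    (T : measurableType disp) (P : probability T R)
    (X : R -> {RV P >-> measurableTypeR R}).
Hypothesis X_levy : levy_process X.

(* [X 0] vanishes only almost surely. *)
Definition cent (t : R) (w : T) : R := X t w - X 0 w.

Lemma measurable_cent t : measurable_fun setT (cent t).
Proof.
have m1 : measurable_fun setT (X t) := measurable_funP _.
have m2 : measurable_fun setT (X 0) := measurable_funP _.
exact: measurable_fun_sub.
Qed.

Lemma times_indep (u : nat -> R) n : 0 <= u 0%N -> {homo u : i j / (i <= j)%N >-> i <= j} ->
  indep_seq P n (fun i w => X (u i.+1) w - X (u i) w).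
Proof.
move=> u0 hu B mB.
have e := levy_indep X_levy (n := n) u0 hu (B := fun i => B i) (fun i => mB i).
rewrite big_mkord; transitivity (P (\bigcap_(i in [set: 'I_n])
   (fun w : T => X (u i.+1) w - X (u i) w) @^-1` B i)); last by rewrite e.
congr (P _); apply/seteqP; split => w /= h1 i; first by move=> _; exact: h1.
by move=> hi; exact: (h1 (Ordinal hi) I).
Qed.

Lemma pr_stationary s t c : 0 <= s -> 0 <= t ->
  pr P [set w | X (s + t) w - X s w <= c] = pr P [set w | X t w <= c].
Proof.
move=> s0 t0; rewrite /pr; congr fine.
have mB : measurable ([set` `]-oo, c]] : set (measurableTypeR R)) by exact: measurable_itv.
have := levy_stationary X_levy s0 t0 mB.
have -> : (fun w : T => X (s + t) w - X s w) @^-1` [set` `]-oo, c]] =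
  [set w | X (s + t) w - X s w <= c] by apply/seteqP; split => w /=; rewrite in_itv.
by have -> : X t @^-1` [set` `]-oo, c]] = [set w | X t w <= c] by apply/seteqP; split => w /=; rewrite in_itv.
Qed.

Lemma pr_cent t c : 0 <= t -> pr P [set w | cent t w <= c] = pr P [set w | X t w <= c].
Proof. by move=> t0; rewrite -(pr_stationary c (lexx 0) t0) add0r. Qed.

Context (gamma : R) (Pi : {measure set (measurableTypeR R) -> \bar R}).
Hypothesis Pi_levy : bounded_levy_measure Pi.
Hypothesis X_triplet : has_triplet X gamma 0 Pi.
Hypothesis Pi_abs : (\int[Pi]_x `|x|%:E < +oo)%E.
Hypothesis no_drift : drift gamma Pi = 0.
Local Notation A := (A_plus Pi).
Local Notation phip la := (laplace_exponent posp la Pi).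

(** [posp] is subadditive, so cutting an increment into smaller ones can only increase the sum of
    positive parts. *)
Lemma vari_refine (t : R) j w :
  posp (cent t w) <= vari X posp (mesh t j) 0 (2 ^ j) w.
Proof.
have : forall n, posp (X (n%:R * mesh t j) w - X (0%:R * mesh t j) w) <= vari X posp (mesh t j) 0 n w.
  elim=> [|n IH]; first by rewrite subrr posp_id// /vari big_nil.
  rewrite /vari big_nat_recr//=.
  rewrite (_ : X (n.+1%:R * mesh t j) w - X (0%:R * mesh t j) w =
    (X (n%:R * mesh t j) w - X (0%:R * mesh t j) w) + incr X (mesh t j) n w); last first.
    by rewrite /incr [RHS]addrC addrA subrK.
  by apply: (le_trans (posp_add _ _)); rewrite lerD2r.
by move=> /(_ (2 ^ j)%N); rewrite mesh_sum mul0r.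
Qed.

Let mexp la : measurable_fun setT (fun x : R => expR (- (la * posp x))).
Proof.
apply: measurable_fun_exp; apply: measurable_fun_opp; apply: measurable_fun_mul => //.
exact: measurable_posp.
Qed.

(** [X_t] is dominated by its positive variation along every mesh, whose Laplace transform
    converges: the bound thus holds at each fixed [t], not only in the limit. *)
Lemma mean_posp_ge la t : 0 < la -> 0 < t ->
  expR (- (t * phip la)) <= mean P (fun w => expR (- (la * posp (X t w)))).
Proof.
move=> la0 t0.
have mp := @measurable_posp R.
have -> : mean P (fun w => expR (- (la * posp (X t w)))) = mean P (fun w => expR (- (la * posp (cent t w)))).
  have := incr_integral X_levy 0%N (f := fun x => (expR (- (la * posp x)))%:E) (ltW t0).
  rewrite /incr mul1r mul0r => e; rewrite /mean -e//; first exact/measurable_EFinP.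
have cp x : x != 0 -> {for x, continuous (@posp R)} by move=> _; exact: continuous_posp.
have h0 j : 0 < mesh t j by exact: mesh_gt0.
have bj j : ((2 ^ j - 0)%:R * mesh t j = t) by rewrite subn0 mesh_sum.
have cv := laplace_cvg X_levy mp (@posp_ge0 R) (ltW la0) Pi_levy X_triplet Pi_abs no_drift
  (@posp_le R) cp h0 (@mesh_cvg0 R t) la0 bj (fun=> leq0n _).
apply: (cvgr_to_le cv); apply: nearW => j.
apply: (@le_mean _ _ _ P _ _ 1).
- apply: (measurable_fun_exp); apply: measurable_fun_opp; apply: measurable_fun_mul => //.
  exact: measurable_vari.
- exact: (measurableT_comp (mexp la) (measurable_cent t)).
- move=> w; rewrite expR_ge0/= ler_expR lerN2 ler_wpM2l ?(ltW la0)//.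
  exact: vari_refine.
- by move=> w; rewrite -[leRHS]expR0 ler_expR oppr_le0 mulr_ge0 ?posp_ge0 ?ltW.
Qed.

Lemma vari_posp_ge la h k : 0 < la -> 0 < h ->
  expR (- (k%:R * h * phip la)) <= mean P (fun w => expR (- (la * vari X posp h 0 k w))).
Proof.
move=> la0 h0; rewrite (vari_laplace X_levy (@measurable_posp R) (@posp_ge0 R) (ltW la0) (leq0n k) (ltW h0)).
rewrite subn0 -mulrA -mulrN expRM_natl; apply: lerXn2r; rewrite ?nnegrE ?expR_ge0//.
  by apply: mean_ge0 => w; exact: expR_ge0.
exact: mean_posp_ge.
Qed.

Lemma exp_phip_ge t y : 0 <= t -> 0 < y -> expR (- (t * (A y / y))) <= expR (- (t * phip y^-1)).
Proof.
move=> t0 y0; rewrite ler_expR lerN2 ler_wpM2l//.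
have yi : 0 < y^-1 by rewrite invr_gt0.
have := laplace_exponent_posp_le Pi_levy Pi_abs yi.
by rewrite invrK mulrC.
Qed.

(** Laplace parameter [1 / y]: the transform of the positive part is at least [exp (- t * A y / y)],
    and at most the probability plus [exp (- c / y)]. *)
Lemma pr_X_le t y c : 0 < t -> 0 < y -> 0 <= c ->
  expR (- (t * (A y / y))) - expR (- (c / y)) <= pr P [set w | X t w <= c].
Proof.
move=> t0 y0 c0; have yi : 0 < y^-1 by rewrite invr_gt0.
have mX : measurable_fun setT (X t) := measurable_funP _.
rewrite lerBlDr; apply: (le_trans (exp_phip_ge (ltW t0) y0)).
apply: (le_trans (mean_posp_ge yi t0)).
have mU : measurable_fun setT (fun w => posp (X t w)) by exact: (measurableT_comp (@measurable_posp R) mX).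
have := mean_expR_le P c mU (fun w => posp_ge0 _) (ltW yi).
rewrite (mulrC _ c) (_ : [set w | posp (X t w) <= c] = [set w | X t w <= c])//.
by apply/seteqP; split => w /=; rewrite /posp ge_max c0 andbT.
Qed.

Lemma pr_vari_le h k y c : 0 < h -> 0 < y ->
  expR (- (k%:R * h * (A y / y))) - expR (- (c / y)) <= pr P [set w | vari X posp h 0 k w <= c].
Proof.
move=> h0 y0; have yi : 0 < y^-1 by rewrite invr_gt0.
rewrite lerBlDr; have kh : 0 <= k%:R * h by rewrite mulr_ge0// ltW.
apply: (le_trans (exp_phip_ge kh y0)).
apply: (le_trans (vari_posp_ge k yi h0)).
have := mean_expR_le P c (measurable_vari X h 0 k (@measurable_posp R)) _ (ltW yi).
rewrite (mulrC _ c); apply => w; apply: sumr_ge0 => i _; exact: posp_ge0.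
Qed.

End LevyBounds.

(** * Geometric sums *)

Section Series.
Context {R : realType}.

(** The terms grow geometrically up to [z * 2 ^+ n = 1] and then decay. For the induction from
    [2 * z] to [z] the bound depends on [z]: [4 - z] before the turning point, [2 / z] after it. *)
Lemma sum_min_geom (z : R) M : 0 < z ->
  \sum_(0 <= n < M) Num.min (z * 2 ^+ n) (z * 2 ^+ n)^-1 <= 4.
Proof.
have key : forall M (z : R), 0 < z ->
  \sum_(0 <= n < M) Num.min (z * 2 ^+ n) (z * 2 ^+ n)^-1 <= (if z < 1 then 4 - z else 2 / z).
  elim=> [|m IH] {}z z0.
    by rewrite big_nil; case: ltP => z1; [lra|rewrite divr_ge0// ltW].
  rewrite big_nat_recl// expr0 mulr1.
  rewrite (eq_bigr (fun n : nat => Num.min ((2 * z) * 2 ^+ n) ((2 * z) * 2 ^+ n)^-1)); last first.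
    by move=> n _; rewrite exprS mulrCA mulrA.
  have := IH (2 * z); rewrite mulr_gt0// => /(_ isT).
  move: (\sum_(_ <= _ < _) _) => S.
  have zi : z * z^-1 = 1 by rewrite divff// gt_eqF.
  have i0 : 0 < z^-1 by rewrite invr_gt0.
  have e2 : 2 / (2 * z) = z^-1 by rewrite invfM mulrA divff ?mul1r.
  rewrite e2; case: (ltP z 1) => z1.
    have : Num.min z z^-1 <= z by rewrite ge_min lexx.
    by case: ltP => z2; [lra|nra].
  have : Num.min z z^-1 <= z^-1 by rewrite ge_min lexx orbT.
  by case: ltP => z2; [lra|lra].
move=> z0; apply: (le_trans (key M z z0)); case: ltP => z1; first by lra.
by rewrite ler_pdivrMr//; lra.
Qed.

Lemma expr_le_expR (v : R) n : 0 <= v -> v ^+ n <= n`!%:R * expR v.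
Proof.
move=> v0; case: n => [|n]; first by rewrite expr0 fact0 mul1r -expR0 ler_expR.
have f0 : 0 < n.+1`!%:R :> R by rewrite ltr0n fact_gt0.
rewrite -ler_pdivrMl// mulrC; apply: le_trans (expR_ge1Dxn n v0).
by rewrite lerDr.
Qed.

End Series.

(** * Integrals over the cells of a geometric grid *)

Section GeometricGrid.
Context {R : realType} (q : R).
Hypothesis q01 : 0 < q < 1.
Local Notation leb := (@lebesgue_measure R).

Let q0 : 0 < q. Proof. by case/andP: q01. Qed.
Let q1 : q < 1. Proof. by case/andP: q01. Qed.
Let qk0 k : 0 < q ^+ k. Proof. exact: exprn_gt0. Qed.

Definition grid_cell (k : nat) : set R := `]q ^+ k.+1, q ^+ k]%classic.

Lemma geom_lt (e : R) : 0 < e -> exists k, q ^+ k < e.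
Proof.
move=> e0; have qc : q ^+ k @[k --> \oo] --> 0 by apply: cvg_expr; rewrite ger0_norm// ltW.
have [N _ HN] : \forall k \near \oo, q ^+ k < e by apply: (@cvgr_lt _ _ _ _ _ _ qc e).
by exists N; exact: HN (leqnn N).
Qed.

Lemma bigcup_grid_cell : \bigcup_k grid_cell k = `]0, 1]%classic.
Proof.
apply/seteqP; split => x.
  move=> [k _]; rewrite /grid_cell/= !in_itv/= => /andP[a b].
  by rewrite (lt_trans _ a)//= (le_trans b)// exprn_ile1// ltW.
rewrite /= in_itv/= => /andP[x0 x1].
have ex : exists k, q ^+ k.+1 < x.
  have [k hk] := geom_lt x0; exists k; apply: le_lt_trans hk.
  by rewrite exprS ler_piMl// ltW.
case: (ex_minnP ex) => k hk hmin; exists k => //.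
rewrite /grid_cell/= in_itv/= hk/=; case: k hk hmin => [|k] hk hmin; first by rewrite expr0.
by rewrite leNgt; apply/negP => /hmin; rewrite ltnn.
Qed.

Lemma trivIset_grid_cell : trivIset setT grid_cell.
Proof.
apply/trivIsetP => i j _ _.
have wlg k l x : (k < l)%N -> grid_cell k x -> grid_cell l x -> False.
  move=> kl; rewrite /grid_cell/= !in_itv/= => /andP[a _] /andP[_ b].
  have := lt_le_trans a b; rewrite ltNge => /negP; apply.
  by rewrite ler_wiXn2l// ltW.
move=> ij; apply/seteqP; split => // x [xi xj].
case/orP: (leq_total i j) => h.
  by apply: (wlg i j x) => //; rewrite ltn_neqAle ij.
by apply: (wlg j i x) => //; rewrite ltn_neqAle eq_sym ij.
Qed.

Lemma leb_grid_cell k : leb (grid_cell k) = (q ^+ k * (1 - q))%:E.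
Proof.
rewrite /grid_cell lebesgue_measure_itv/= lte_fin ifT.
  by rewrite -EFinB exprS; congr EFin; ring.
by rewrite exprS gtr_pMl.
Qed.

Lemma integral_grid (f : R -> \bar R) : measurable_fun setT f ->
  (forall x, 0 <= f x)%E ->
  (\int[leb]_(x in `]0%R, 1%R]) f x = \sum_(0 <= k <oo) \int[leb]_(x in grid_cell k) f x)%E.
Proof.
move=> mf f0; rewrite -bigcup_grid_cell ge0_integral_bigcup//.
- by move=> k; exact: measurable_itv.
- exact: measurable_funTS.
- exact: trivIset_grid_cell.
Qed.

End GeometricGrid.

(** * The integral K_X as a series *)

Section GridSums.
Context (R : realType) (Pi : {measure set (measurableTypeR R) -> \bar R}).
Hypothesis Pi_levy : bounded_levy_measure Pi.
Hypothesis Pi_abs : (\int[Pi]_x `|x|%:E < +oo)%E.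
Local Notation leb := (@lebesgue_measure R).
Local Notation A := (A_plus Pi).
Variable kappa : R.
Hypothesis kappa_gt1 : 1 < kappa.
Local Notation p := (kappa / (kappa - 1)).

Lemma A_plus_le0 y : y <= 0 -> A y = 0.
Proof.
move=> y0; rewrite /A_plus (_ : `]0, y]%classic = set0) ?integral_set0//.
by apply/seteqP; split => // z /=; rewrite in_itv/= => /andP[z0 /le_trans /(_ y0)]; rewrite leNgt z0.
Qed.

Lemma A_plus_homo : {homo A : x y / x <= y}.
Proof.
move=> x y xy; have [x0|x0] := leP x 0.
  rewrite A_plus_le0//; have [y0|y0] := leP y 0; first by rewrite A_plus_le0.
  by rewrite A_plus_ge0// ltW.
by apply: A_plus_mono => //; rewrite (ltW x0).
Qed.

Lemma measurable_A_plus : measurable_fun setT A.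
Proof. exact: nondecreasing_measurable A_plus_homo. Qed.

Lemma A_plus_nonneg y : 0 <= A y.
Proof.
have [y0|y0] := leP y 0; first by rewrite A_plus_le0.
by rewrite A_plus_ge0// ltW.
Qed.

Let p0 : 0 <= p. Proof. by apply: divr_ge0; [exact: le_trans (ltW kappa_gt1)|rewrite subr_ge0 ltW]. Qed.

Definition kx_integrand (d y : R) : \bar R := (y^-1 * expR (- d * (A y `^ p / y)))%:E.

Let mI d : measurable_fun setT (kx_integrand d).
Proof.
apply/measurable_EFinP; apply: measurable_fun_mul; first exact: measurable_fun_inv.
apply: measurable_fun_exp; apply: measurable_fun_mul => //; apply: measurable_fun_mul.
  by apply: measurable_fun_powR; exact: measurable_A_plus.
exact: measurable_fun_inv.
Qed.

Let nI d y : (0 <= (y \in `]0%R, 1%R]%classic)%:R%:E * kx_integrand d y)%E.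
Proof.
have [|_] := boolP (y \in _); last by rewrite mul0e.
by rewrite inE/= in_itv/= => /andP[y0 _]; rewrite mul1e lee_fin mulr_ge0 ?expR_ge0// invr_ge0 ltW.
Qed.

Definition kx_term (c q : R) (k : nat) : R := expR (- (c * (A (q ^+ k) `^ p / q ^+ k))).

Lemma K_X_grid d q : 0 < q < 1 ->
  (K_X kappa Pi d = \sum_(0 <= k <oo) \int[leb]_(y in grid_cell q k) kx_integrand d y)%E.
Proof.
move=> q01; have q0 : 0 < q by case/andP: q01.
have pos k y : grid_cell q k y -> 0 < y.
  by rewrite /grid_cell/= in_itv/= => /andP[+ _]; apply: lt_trans; exact: exprn_gt0.
(* [kx_integrand] is negative for [y < 0], while [integral_grid] wants a function nonnegative
   everywhere. *)
pose f y : \bar R := ((y \in `]0%R, 1%R]%classic)%:R%:E * kx_integrand d y)%E.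
have mf : measurable_fun setT f.
  apply: emeasurable_funM => //; apply/measurable_EFinP.
  by under eq_fun do rewrite -indicE; exact: measurable_fun_indic.
have := integral_grid q01 mf (nI d).
have -> : (\int[leb]_(x in `]0%R, 1%R]) f x = K_X kappa Pi d)%E.
  by rewrite /K_X; apply: eq_integral => y yI; rewrite /f yI mul1e.
move=> ->; apply: eq_eseriesr => k _; apply: eq_integral => y yk.
rewrite /f mem_set ?mul1e// -(bigcup_grid_cell q01); exists k => //.
by move: yk; rewrite inE.
Qed.

(** On a cell, [y] and [A y] lie between their values at two consecutive grid points; the price of
    passing to an endpoint is a factor [q] in [d]. As [d] is arbitrary, the convergence of [K_X] for
    all [d] is that of the series for all constants. *)
Lemma grid_term_le d q k : 0 < q < 1 -> 0 <= d ->
  (\int[leb]_(y in grid_cell q k) kx_integrand d y <= (q^-1 * kx_term (d * q) q k.+1)%:E)%E.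
Proof.
move=> q01 d0; have q0 : 0 < q by case/andP: q01.
have q1 : q < 1 by case/andP: q01.
have qk j : 0 < q ^+ j by exact: exprn_gt0.
have mc : measurable (grid_cell q k) by exact: measurable_itv.
apply: (@le_trans _ _ (\int[leb]_(y in grid_cell q k) ((q ^+ k.+1)^-1 * kx_term (d * q) q k.+1)%:E)%E).
  apply: ge0_le_integral => //.
  - by move=> y; rewrite /grid_cell/= in_itv/= => /andP[a _]; rewrite lee_fin mulr_ge0 ?expR_ge0// invr_ge0 ltW// (lt_trans _ a).
  - by apply: measurable_funTS; exact: mI.
  - move=> y; rewrite /grid_cell/= in_itv/= => /andP[a b].
    have y0 : 0 < y by apply: lt_trans a.
    rewrite lee_fin ler_pM ?expR_ge0 ?invr_ge0 ?(ltW y0)//.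
      by rewrite lef_pV2 ?posrE// ltW.
    rewrite /kx_term ler_expR mulNr lerN2 -mulrA ler_wpM2l//.
    rewrite ler_pdivlMr//; apply: (@le_trans _ _ (A (q ^+ k.+1) `^ p)); last first.
      by apply: ge0_ler_powR; rewrite ?nnegrE ?A_plus_nonneg//; apply: A_plus_homo; exact: ltW.
    set c := _ `^ p; have c0 : 0 <= c by exact: powR_ge0.
    have : q * y <= q ^+ k.+1 by rewrite exprS ler_pM2l.
    have i0 : 0 <= c / q ^+ k.+1 by rewrite divr_ge0// ltW.
    move=> /(ler_wpM2l i0); rewrite divfK ?gt_eqF// => h.
    by rewrite mulrAC mulrC.
rewrite integral_cst//= leb_grid_cell// -EFinM lee_fin.
have t0 : 0 <= kx_term (d * q) q k.+1 by exact: expR_ge0.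
have -> : q ^- k.+1 * kx_term (d * q) q k.+1 * (q ^+ k * (1 - q)) =
    q^-1 * kx_term (d * q) q k.+1 * (1 - q).
  by rewrite exprS; field; rewrite !gt_eqF.
by rewrite ler_piMr ?mulr_ge0 ?invr_ge0 ?(ltW q0)//; lra.
Qed.

Lemma grid_term_ge d q k : 0 < q < 1 -> 0 <= d ->
  (((1 - q) * kx_term (d / q) q k)%:E <= \int[leb]_(y in grid_cell q k) kx_integrand d y)%E.
Proof.
move=> q01 d0; have q0 : 0 < q by case/andP: q01.
have q1 : q < 1 by case/andP: q01.
have qk j : 0 < q ^+ j by exact: exprn_gt0.
have mc : measurable (grid_cell q k) by exact: measurable_itv.
apply: (@le_trans _ _ (\int[leb]_(y in grid_cell q k) ((q ^+ k)^-1 * kx_term (d / q) q k)%:E)%E).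
  rewrite integral_cst//= leb_grid_cell// -EFinM lee_fin.
  rewrite le_eqVlt; apply/orP; left; apply/eqP.
  by field; rewrite gt_eqF.
apply: ge0_le_integral => //.
- by move=> y _; rewrite lee_fin mulr_ge0 ?expR_ge0// invr_ge0 ltW.
- by apply: measurable_funTS; exact: mI.
- move=> y; rewrite /grid_cell/= in_itv/= => /andP[a b].
  have y0 : 0 < y by apply: lt_trans a.
  rewrite lee_fin ler_pM ?expR_ge0 ?invr_ge0 ?(ltW (qk k))//.
    by rewrite lef_pV2 ?posrE.
  rewrite /kx_term ler_expR mulNr lerN2 -mulrA ler_wpM2l//.
  apply: (@le_trans _ _ (A (q ^+ k) `^ p / y)).
    apply: ler_wpM2r; first by rewrite invr_ge0 ltW.
    by apply: ge0_ler_powR; rewrite ?nnegrE ?A_plus_nonneg//; exact: A_plus_homo.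
  set c := _ `^ p; have c0 : 0 <= c by exact: powR_ge0.
  rewrite mulrCA ler_wpM2l// -invfM lef_pV2 ?posrE ?mulr_gt0//.
  by rewrite -exprS ltW.
Qed.

Lemma K_X_lty d q C : 0 < q < 1 -> 0 <= d ->
  (forall M, \sum_(0 <= k < M) kx_term (d * q) q k.+1 <= C) -> (K_X kappa Pi d < +oo)%E.
Proof.
move=> q01 d0 HC; rewrite (K_X_grid d q01); have q0 : 0 < q by case/andP: q01.
have pos k : (0 <= \int[leb]_(y in grid_cell q k) kx_integrand d y)%E.
  apply: le_trans (grid_term_ge k q01 d0); rewrite lee_fin mulr_ge0 ?expR_ge0// subr_ge0.
  by rewrite ltW//; case/andP: q01.
apply: (@le_lt_trans _ _ (q^-1 * C)%:E); last by rewrite ltry.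
apply: lime_le; first exact: is_cvg_nneseries.
apply: nearW => M; apply: (@le_trans _ _ (\sum_(0 <= k < M) (q^-1 * kx_term (d * q) q k.+1)%:E)%E).
  by apply: lee_sum => k _; exact: grid_term_le.
by rewrite sumEFin lee_fin -mulr_sumr ler_wpM2l ?invr_ge0 ?(ltW q0).
Qed.

Lemma K_X_sum_le d q : 0 < q < 1 -> 0 <= d -> (K_X kappa Pi d < +oo)%E ->
  exists C, forall M, \sum_(0 <= k < M) kx_term (d / q) q k <= C.
Proof.
move=> q01 d0; rewrite (K_X_grid d q01); have q0 : 0 < q by case/andP: q01.
have q1 : 0 < 1 - q by rewrite subr_gt0; case/andP: q01.
have pos k : (0 <= \int[leb]_(y in grid_cell q k) kx_integrand d y)%E.
  by apply: le_trans (grid_term_ge k q01 d0); rewrite lee_fin mulr_ge0 ?expR_ge0// ltW.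
set S := (\sum_(_ <= _ <oo) _)%E => Soo.
have S0 : (0 <= S)%E by exact: nneseries_ge0.
have Sf : S \is a fin_num by rewrite ge0_fin_numE.
exists ((1 - q)^-1 * fine S) => M.
rewrite ler_pdivlMl// -lee_fin fineK// mulr_sumr -sumEFin.
apply: (@le_trans _ _ (\sum_(0 <= k < M) \int[leb]_(y in grid_cell q k) kx_integrand d y)%E).
  by apply: lee_sum => k _; exact: grid_term_ge.
exact: nneseries_lim_ge.
Qed.

(** Moves the second condition to [Pi] itself. Positive [x] contribute nothing, since [negp x = 0]
    there and a quotient with numerator 0 is 0. *)
Lemma Pi_minus_integral :
  (\int[Pi_minus Pi]_(x in `]0%R, 1%R]) (x / A x)%:E =
   \int[Pi]_x (negp x / A (negp x))%:E)%E.
Proof.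
have mf : measurable_fun [set: R] (fun x : R => (x / A x)%:E).
  apply/measurable_EFinP; apply: measurable_fun_mul => //; apply: measurable_fun_inv.
  exact: measurable_A_plus.
have mn : measurable_fun [set: R] (fun x : R => (negp x / A (negp x))%:E).
  exact: (measurableT_comp mf (@measurable_negp R)).
have mopp : measurable_fun [set: measurableTypeR R] (fun x : R => (- x : measurableTypeR R)).
  by apply: measurable_fun_opp.
have pos (x : R) : 0 <= x -> (0 <= (x / A x)%:E)%E by move=> x0; rewrite lee_fin divr_ge0// A_plus_nonneg.
rewrite /Pi_minus ge0_integral_pushforward//; last 2 first.
- exact: measurable_funTS.
- by move=> x; rewrite inE/= in_itv/= => /andP[x0 _]; apply: pos; exact: ltW.
have -> : (fun x : R => - x) @^-1` `]0, 1]%classic = `[(-1)%R, 0%R[%classic.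
  by apply/seteqP; split => x /=; rewrite !in_itv/= oppr_gt0 lerNl andbC.
transitivity (\int[Pi]_(x in `[(-1)%R, 0%R[) (negp x / A (negp x))%:E)%E.
  transitivity (\int[Pi]_(x in `[(-1)%R, 0%R[) (- x / A (- x))%:E)%E.
    apply: eq_measure_integral => E mE Esub.
    rewrite -[LHS]/(Pi (E `&` `]-oo, 0%R[%classic)) setIidl// => x /Esub /=.
    by rewrite !in_itv/= => /andP[].
  apply: eq_integral => x; rewrite inE/= in_itv/= => /andP[_ x0].
  by rewrite /negp max_l// oppr_ge0 ltW.
rewrite [RHS](levy_integral_split Pi_levy)//; last by move=> x; exact/pos/negp_ge0.
rewrite [X in (_ + X)%E]integral0_eq ?adde0// => x; rewrite /= in_itv/= => /andP[x0 _].
by rewrite /negp max_r ?mul0r// oppr_le0 ltW.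
Qed.

End GridSums.

(** * Necessity *)

Section ExponentialSums.
Context {R : realType}.

(** [z <= v] gives [exp (- v) <= 1 / z]. In the other inequality the power of [v] is absorbed by the
    exponential, so that [1 <= v <= C * exp v * z]. *)
Lemma expN_le_min (kappa v z : R) (J : nat) : kappa <= J%:R -> 1 <= v -> 0 < z -> z <= v ->
  v <= (4 * v) `^ kappa * z -> expR (- v) <= (4 ^+ J * J`!%:R) * Num.min z z^-1.
Proof.
move=> kJ v1 z0 zv vz; have v0 : 0 < v by lra.
set C := 4 ^+ J * J`!%:R.
have f1 : 1 <= J`!%:R :> R by rewrite ler1n fact_gt0.
have p1 : 1 <= 4 ^+ J :> R by apply: exprn_ege1; lra.
have C1 : 1 <= C by rewrite /C; move: f1 p1; move: (J`!%:R : R) (4 ^+ J : R) => a b; nra.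
have C0 : 0 < C by lra.
have e0 : 0 < expR v by exact: expR_gt0.
rewrite minr_pMr ?(ltW C0)// le_min; apply/andP; split.
  have h4 : (4 * v) `^ kappa <= C * expR v.
    apply: (@le_trans _ _ ((4 * v) `^ J%:R)); first by apply: ler_powR => //; lra.
    rewrite powR_mulrn ?exprMn; last by lra.
    by rewrite /C -mulrA; apply: ler_wpM2l; [lra|exact: expr_le_expR (ltW v0)].
  have h5 : v <= C * expR v * z by apply: (le_trans vz); apply: ler_wpM2r => //; exact: ltW.
  rewrite expRN -[leLHS]mul1r ler_pdivrMr//.
  by have := h5; move: (expR v) e0 => e e0 {}h5; nra.
have ev : expR (- v) <= z^-1.
  rewrite expRN lef_pV2 ?posrE//; apply: (le_trans zv).
  by have := expR_ge1Dx v; lra.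
by apply: (le_trans ev); rewrite ler_peMl// invr_ge0 ltW.
Qed.

(** Pathwise form of the rare overlap. Let [m] be the last index in [S], and
    [z = t m ^ kappa / eps]. For [n] in [S] one has [t m <= t n < 4 * v n * t m], so [v n] agrees
    with [z * 2 ^+ n] up to a power of [v n], and [sum_min_geom] bounds the sum. *)
Lemma sum_expN_le (kappa eps : R) (J : nat) (S : pred nat) (t v : nat -> R) (N M : nat) :
  0 < kappa <= J%:R -> 0 < eps -> (forall n, 0 < t n) -> (forall n m, (n <= m)%N -> t m <= t n) ->
  (forall n, (N <= n < M)%N -> 1 <= v n) -> (forall n, v n = t n `^ kappa * 2 ^+ n / eps) ->
  (forall n m, (N <= n < M)%N -> (N <= m < M)%N -> S n -> S m -> t n < 4 * v n * t m) ->
  \sum_(N <= n < M | S n) expR (- v n) <= 4 * (4 ^+ J * J`!%:R).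
Proof.
move=> /andP[k0 kJ] eps0 t0 tm v1 vE tS.
set C := 4 ^+ J * J`!%:R.
have C0 : 0 <= C by rewrite mulr_ge0// exprn_ge0.
have [ex|nex] := pselect (exists m, (N <= m < M)%N && S m); last first.
  rewrite big_nat_cond big1 ?mulr_ge0// => n /andP[nM Sn].
  by exfalso; apply: nex; exists n; rewrite nM.
have bnd n : (N <= n < M)%N && S n -> (n <= M)%N by move=> /andP[/andP[_ /ltnW]].
case: (ex_maxnP ex bnd) => m /andP[mNM Sm] mmax.
pose z := t m `^ kappa / eps.
have z0 : 0 < z by rewrite divr_gt0// powR_gt0.
apply: (@le_trans _ _ (\sum_(0 <= n < M) C * Num.min (z * 2 ^+ n) (z * 2 ^+ n)^-1)); last first.
  by rewrite -mulr_sumr mulrC ler_wpM2r// sum_min_geom.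
have mz n : 0 <= C * Num.min (z * 2 ^+ n) (z * 2 ^+ n)^-1.
  by rewrite mulr_ge0// le_min invr_ge0 andbb mulr_ge0 ?(ltW z0)// exprn_ge0.
apply: (@le_trans _ _ (\sum_(N <= n < M) C * Num.min (z * 2 ^+ n) (z * 2 ^+ n)^-1)); last first.
  have [NM|MN] := leqP N M; last by rewrite big_geq ?sumr_ge0// ltnW.
  by rewrite [leRHS](@big_cat_nat _ _ _ N)//= lerDr sumr_ge0.
rewrite big_mkcond/= big_nat [leRHS]big_nat; apply: ler_sum => n nNM; case: ifPn => // Sn.
have nm : (n <= m)%N by apply: mmax; rewrite nNM.
have p2 : 0 < 2 ^+ n :> R by exact: exprn_gt0.
apply: (expN_le_min kJ (v1 n nNM)).
- by rewrite mulr_gt0.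
- rewrite vE /z mulrAC ler_wpM2r ?invr_ge0 ?(ltW eps0)// ler_wpM2r ?(ltW p2)//.
  by apply: ge0_ler_powR; rewrite ?nnegrE ?(ltW k0)// ?(ltW (t0 _))//; exact: tm.
- have vn0 : 0 < v n by have := v1 n nNM; lra.
  have h : t n `^ kappa <= (4 * v n) `^ kappa * t m `^ kappa.
    rewrite -powRM ?(ltW (t0 _))//; last by rewrite mulr_ge0// ltW.
    apply: ge0_ler_powR; rewrite ?nnegrE ?(ltW k0)// ?(ltW (t0 _))//.
      by rewrite mulr_ge0 ?(ltW (t0 _))// mulr_ge0// ltW.
    by apply: ltW; exact: tS.
  have w0 : 0 <= 2 ^+ n / eps by rewrite divr_ge0 ?(ltW p2) ?(ltW eps0).
  rewrite {1}(_ : v n = t n `^ kappa * (2 ^+ n / eps)); last by rewrite vE mulrA.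
  apply: (le_trans (ler_wpM2r w0 h)).
  by rewrite /z le_eqVlt; apply/orP; left; apply/eqP; ring.
Qed.

End ExponentialSums.

(** * Necessity of the first condition *)

Section NecessityKX.
Context (R : realType) (disp : measure_display)
    (T : measurableType disp) (P : probability T R)
    (X : R -> {RV P >-> measurableTypeR R}).
Hypothesis X_levy : levy_process X.
Context (gamma : R) (Pi : {measure set (measurableTypeR R) -> \bar R}).
Hypothesis Pi_levy : bounded_levy_measure Pi.
Hypothesis X_triplet : has_triplet X gamma 0 Pi.
Hypothesis Pi_abs : (\int[Pi]_x `|x|%:E < +oo)%E.
Hypothesis no_drift : drift gamma Pi = 0.
Variable kappa : R.
Hypothesis kappa_gt1 : 1 < kappa.
Hypothesis X_lim : {ae P, forall w, X t w / t `^ kappa @[t --> 0^'+] --> +oo%R}.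
Local Notation A := (A_plus Pi).

Lemma large_along_seq (C : R) (t : nat -> R) : (forall n, 0 < t n) -> t n @[n --> \oo] --> 0 ->
  {ae P, forall w, \forall n \near \oo, C * t n `^ kappa < cent X (t n) w}.
Proof.
move=> t0 tc; have := levy_start X_levy.
apply: filterS2 X_lim => w hw w0.
have : \forall s \near 0^'+, C < X s w / s `^ kappa by move/cvgryPgt : hw; exact.
rewrite /at_right near_withinE => -[e /= e0 He].
have : \forall n \near \oo, t n < e by apply: (@cvgr_lt _ _ _ _ _ _ tc e).
apply: filterS => n tn; rewrite /cent w0 subr0.
have := He (t n); rewrite /ball/= sub0r normrN gtr0_norm// => /(_ tn (t0 n)).
by rewrite ltr_pdivlMr// powR_gt0.
Qed.

Lemma expRN_le_inv (x : R) : 0 <= x -> expR (- x) <= (1 + x)^-1.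
Proof.
by move=> x0; rewrite expRN lef_pV2 ?posrE ?expR_gt0 ?expR_ge1Dx//; lra.
Qed.

Let kappa_gt0 : 0 < kappa. Proof. exact: lt_trans kappa_gt1. Qed.

Let half01 : 0 < (2^-1 : R) < 1.
Proof. by rewrite invr_gt0 ltr0n invf_lt1// ltr1n. Qed.

Let mesh1 n : 0 < mesh (1 : R) n. Proof. exact: mesh_gt0. Qed.

(** If [A y = 0], then [pr_X_le] keeps [X] below a level [c] with probability at least
    [1 - exp (- c / y)], while by assumption the level is exceeded with probability more than
    3/4. *)
Lemma A_plus_gt0 y : 0 < y -> 0 < A y.
Proof.
move=> y0; rewrite lt_neqAle (A_plus_nonneg Pi_levy Pi_abs) andbT eq_sym; apply/negP => /eqP Ay.
pose F n := [set w | 1 * mesh 1 n `^ kappa < cent X (mesh 1 n) w].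
have mF n : measurable (F n) by apply: measurable_lt => //; exact: measurable_cent.
have e4 : 0 < 4^-1 :> R by [].
have [N] := ae_eventually mF e4 (large_along_seq 1 mesh1 (mesh_cvg0 1)).
set E := \bigcap_(m in _) _ => hE.
have mE : measurable E by exact: bigcap_measurableType.
pose c := 1 * mesh 1 N `^ kappa.
have c0 : 0 < c by rewrite /c mul1r powR_gt0.
have mL : measurable [set w | cent X (mesh 1 N) w <= c] by apply: measurable_le => //; exact: measurable_cent.
have EF : E `<=` ~` [set w | cent X (mesh 1 N) w <= c].
  by move=> w /(_ N) /= h; apply/negP; rewrite -ltNge; exact: h.
have := le_pr P mE (measurableC mL) EF; rewrite pr_setC// pr_cent ?(ltW (mesh1 _))//.
(* With [c / y' >= 3] the error [exp (- c / y')] is at most 1/4. *)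
pose y' := Num.min y (c / 3).
have y'0 : 0 < y' by rewrite lt_min y0 divr_gt0.
have Ay' : A y' = 0.
  apply/eqP; rewrite eq_le (A_plus_nonneg Pi_levy Pi_abs) andbT -Ay; apply: A_plus_homo => //.
  by rewrite ge_min lexx.
have := pr_X_le X_levy Pi_levy X_triplet Pi_abs no_drift (mesh1 N) y'0 (ltW c0).
rewrite Ay' mul0r mulr0 oppr0 expR0.
have : 3 <= c / y'.
  by rewrite ler_pdivlMr// mulrC -ler_pdivlMr// ge_min lexx orbT.
move: (c / y') => x x3.
have : expR (- x) <= (1 + x)^-1 by apply: expRN_le_inv; lra.
have : (1 + x)^-1 <= 4^-1 by rewrite lef_pV2 ?posrE; lra.
by rewrite -/c; lra.
Qed.

Lemma measurable_past (u : nat -> R) k i : (i <= k)%N ->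
  measurable_fun [set: g_sigma_algebraType (block (fun i w => X (u i.+1) w - X (u i) w) 0 k)]
   (fun w => X (u i) w - X (u 0%N) w).
Proof.
move=> ik.
have -> : (fun w => X (u i) w - X (u 0%N) w) =
    (fun w => \sum_(j < i) (X (u j.+1) w - X (u j) w)).
  apply/funext => w; rewrite -(big_mkord xpredT (fun j => X (u j.+1) w - X (u j) w)).
  by rewrite telescope_sumr.
apply: measurable_sum => j; apply: measurable_block_coord.
by rewrite (leq_trans (ltn_ord j)).
Qed.

Section Eps.
Variable eps : R.
Hypothesis eps0 : 0 < eps.
Let r := (kappa - 1)^-1.
Let y (n : nat) : R := 2^-1 ^+ n.
(** Solves [t n ^ (kappa - 1) = eps * A (y n)]: the level [c n] below is then a constant times
    [t n ^ kappa], and [c n / y n = 4 * v n]. *)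
Let t n := (eps * A (y n)) `^ r.
Let v n := t n * A (y n) / y n.
Let c n := 4 * (t n * A (y n)).
Let F n := [set w | c n < cent X (t n) w].
(** The time at which the cost [s n * A (y n) / y n] of staying low is only 1/4. *)
Let s n := t n / (4 * v n).

Let y0 n : 0 < y n. Proof. by rewrite exprn_gt0. Qed.
Let A0 n : 0 < A (y n). Proof. exact: A_plus_gt0. Qed.
Let t0 n : 0 < t n. Proof. by rewrite powR_gt0// mulr_gt0. Qed.
Let v0 n : 0 < v n. Proof. by rewrite divr_gt0// mulr_gt0. Qed.
Let s0 n : 0 < s n. Proof. by rewrite divr_gt0// mulr_gt0. Qed.
Let c0 n : 0 < c n. Proof. by rewrite mulr_gt0// mulr_gt0. Qed.
Let r0 : 0 < r. Proof. by rewrite invr_gt0 subr_gt0. Qed.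
Let y_le n m : (n <= m)%N -> y m <= y n.
Proof. by move=> nm; rewrite /y ler_wiXn2l//; case/andP: half01 => /ltW ? /ltW. Qed.
Let A_le n m : (n <= m)%N -> A (y m) <= A (y n).
Proof. by move=> nm; apply: A_plus_homo => //; exact: y_le. Qed.
Let t_le n m : (n <= m)%N -> t m <= t n.
Proof.
move=> nm; apply: ge0_ler_powR; rewrite ?nnegrE ?(ltW r0) ?mulr_ge0 ?(ltW eps0) ?(ltW (A0 _))//.
by rewrite ler_wpM2l ?(ltW eps0)// A_le.
Qed.

Let t_pow n : t n `^ (kappa - 1) = eps * A (y n).
Proof.
by rewrite /t -powRrM /r mulVf ?subr_eq0 ?gt_eqF// powRr1// mulr_ge0// ltW.
Qed.

Let t_kappa n : t n `^ kappa = t n * (eps * A (y n)).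
Proof.
rewrite -[in LHS](subrK 1 kappa) powRD; last by apply/implyP => _; rewrite gt_eqF.
by rewrite t_pow powRr1 ?(ltW (t0 _))// mulrC.
Qed.

Let c_kappa n : c n = 4 / eps * t n `^ kappa.
Proof. by rewrite t_kappa /c; field; rewrite gt_eqF. Qed.

Let v_kappa n : v n = t n `^ kappa * 2 ^+ n / eps.
Proof. by rewrite t_kappa /v /y exprVn invrK; field; rewrite gt_eqF. Qed.

Let t_cvg0 : t n @[n --> \oo] --> 0.
Proof.
apply/cvgrPdist_lt => e e0.
have ek : 0 < e `^ (kappa - 1) / eps by rewrite divr_gt0// powR_gt0.
have [d d0 Hd] := A_plus_cvg0 Pi_levy Pi_abs ek.
have [k hk] := geom_lt half01 d0.
exists k => // n /= kn; rewrite sub0r normrN gtr0_norm//.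
have : A (y n) < e `^ (kappa - 1) / eps.
  by apply: Hd; rewrite (ltW (y0 n))/= (le_trans (y_le kn))// ltW.
rewrite ltr_pdivlMr// mulrC => h.
have -> : e = (e `^ (kappa - 1)) `^ r.
  by rewrite -powRrM /r divff ?powRr1 ?(ltW e0)// subr_eq0 gt_eqF.
by apply: gt0_ltr_powR => //; rewrite nnegrE ?powR_ge0// mulr_ge0// ltW.
Qed.

Let mF n : measurable (F n).
Proof. by apply: measurable_lt => //; exact: measurable_cent. Qed.

(** The complement 1/9 has to be below 1/8 in [rate_gt1], and small enough to leave probability 1/4
    to the past in [undershoot_prob_ge]. *)
Lemma large_prob_start : exists N, 8 / 9 < pr P (\bigcap_(m in [set m | (N <= m)%N]) F m).
Proof.
have e9 : 0 < 9^-1 :> R by [].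
have h : {ae P, forall w, \forall m \near \oo, F m w}.
  have := large_along_seq (4 / eps) t0 t_cvg0.
  by apply: filterS => w; apply: filterS => n; rewrite /F /= c_kappa.
have [N hN] := ae_eventually mF e9 h.
by exists N; apply: le_lt_trans hN; lra.
Qed.

Let mcap N : measurable (\bigcap_(m in [set m | (N <= m)%N]) F m).
Proof. exact: bigcap_measurableType. Qed.

(** Otherwise [X (t n)] would stay below [c n] with probability at least 1/8. The cost [g k] at
    parameter [1 / y k] is at most 1 for [k = n] and at most doubles from one [k] to the next. If it
    ever exceeds 1, the index just before has cost in []1/2, 1]] and error at most [exp (- 2)]; if
    it never does, a large [k] makes the error negligible. *)
Lemma rate_gt1 N n : 8 / 9 < pr P (\bigcap_(m in [set m | (N <= m)%N]) F m) ->
  (N <= n)%N -> 1 < v n.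
Proof.
move=> hN Nn; rewrite ltNge; apply/negP => v1.
have mL : measurable [set w | cent X (t n) w <= c n] by apply: measurable_le => //; exact: measurable_cent.
have EF : \bigcap_(m in [set m | (N <= m)%N]) F m `<=` ~` [set w | cent X (t n) w <= c n].
  by move=> w /(_ n Nn) /= h; apply/negP; rewrite -ltNge; exact: h.
have := le_pr P (mcap N) (measurableC mL) EF; rewrite pr_setC// pr_cent ?(ltW (t0 _))//.
suff : 8^-1 <= pr P [set w | X (t n) w <= c n] by lra.
pose g k := t n * (A (y k) / y k).
have gn : g n <= 1 by rewrite /g mulrA.
have bound k : expR (- g k) - expR (- (c n / y k)) <= pr P [set w | X (t n) w <= c n].
  exact: (pr_X_le X_levy Pi_levy X_triplet Pi_abs no_drift (t0 n) (y0 k) (ltW (c0 n))).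
have e1 : 4^-1 <= (expR (- 1) : R) <= 2^-1.
  apply/andP; split; last by exact: (@expRN_le_inv 1 ler01).
  have := expR_ge1Dx (- (2^-1) : R).
  have -> : expR (- 1) = expR (- 2^-1) * expR (- 2^-1) :> R by rewrite -expRD; congr expR; lra.
  by move: (expR _) => x; nra.
have [gall|] := pselect (forall k, (n <= k)%N -> g k <= 1).
  (* [c n / y k >= 7] gives an error of at most 1/8, against [exp (- 1) >= 1 / 4]. *)
  have d0 : 0 < c n / 7 by rewrite divr_gt0.
  have [k hk] := geom_lt half01 d0.
  have := bound (maxn n k); apply: le_trans.
  have g1 : g (maxn n k) <= 1 by apply: gall; exact: leq_maxl.
  have h1 : expR (- 1) <= expR (- g (maxn n k)) by rewrite ler_expR lerN2.
  have h7 : 7 <= c n / y (maxn n k).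
    rewrite ler_pdivlMr// mulrC -ler_pdivlMr// ltW// (le_lt_trans _ hk)//.
    exact: (y_le (leq_maxr n k)).
  have h8 : expR (- (c n / y (maxn n k))) <= (1 + c n / y (maxn n k))^-1 by apply: expRN_le_inv; lra.
  have h9 : (1 + c n / y (maxn n k))^-1 <= 8^-1 by rewrite lef_pV2 ?posrE; lra.
  by lra.
move=> /existsNP[k0 /not_implyP[nk0 /negP]]; rewrite -ltNge => gk0.
have ex : exists j, 1 < g (n + j)%N by exists (k0 - n)%N; rewrite subnKC.
case: (ex_minnP ex) => [[|j]] gj jmin; first by move: gj; rewrite addn0 ltNge gn.
have gj1 : g (n + j)%N <= 1.
  by rewrite leNgt; apply/negP => /jmin; rewrite ltnn.
apply: le_trans (bound (n + j)%N).
have g2 : g (n + j.+1)%N <= 2 * g (n + j)%N.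
  have yS : (y (n + j).+1)^-1 = 2 * (y (n + j)%N)^-1 by rewrite /y exprS invfM invrK.
  rewrite /g addnS yS; have hA := A_le (leqnSn (n + j)).
  have -> : t n * (A (y (n + j).+1) * (2 * (y (n + j)%N)^-1)) =
    2 * (t n * (A (y (n + j).+1) / y (n + j)%N)) by ring.
  apply: ler_wpM2l => //; apply: ler_wpM2l; first exact: ltW.
  by apply: ler_wpM2r => //; rewrite invr_ge0 ltW.
have gh : 2^-1 < g (n + j)%N by lra.
have cg : 4 * g (n + j)%N <= c n / y (n + j)%N.
  rewrite /g /c -!mulrA ler_wpM2l// ler_wpM2l ?(ltW (t0 _))//.
  by rewrite ler_wpM2r ?invr_ge0 ?(ltW (y0 _))// A_le// leq_addr.
have h1 : expR (- 1) <= expR (- g (n + j)%N) by rewrite ler_expR lerN2.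
have h2 : expR (- (c n / y (n + j)%N)) <= expR (- 1) * expR (- 1).
  by rewrite -expRD ler_expR; lra.
by move: e1 h1 h2; move: (expR (- 1)) => x /andP[]; nra.
Qed.

(** The allowed level [c n] is shared equally between [[0, s n]] and [[s n, t n]]. The bound [m < M]
    leaves finitely many times, so that finitely many increments generate [Past]. *)
Let Past (N M n : nat) : set T := [set w | cent X (s n) w <= c n / 2] `&`
  \bigcap_(m in [set m | (N <= m < M)%N /\ t m <= s n]) F m.
Let Future (n : nat) : set T := [set w | X (t n) w - X (s n) w <= c n / 2].
Let G (N M n : nat) : set T := [set w | cent X (t n) w <= c n] `&`
  \bigcap_(m in [set m | (N <= m < M)%N /\ t m <= s n]) F m.

Let s_le_t n : 1 <= v n -> s n <= t n.
Proof.
move=> v1; have v4 : 0 < 4 * v n by rewrite mulr_gt0.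
by rewrite /s ler_pdivrMr//; have := t0 n; nra.
Qed.

Lemma past_future_indep N M n : (N <= M)%N -> 1 <= v n ->
  pr P (Past N M n `&` Future n) = pr P (Past N M n) * pr P (Future n).
Proof.
move=> NM v1; set L := (M - N)%N.
(* The times 0, then [t (M - i)] cut at [s n], then [s n], then [t n]. Cutting makes the sequence
   monotone wherever [s n] lies among the [t m], and leaves unchanged the times that [Past]
   involves. *)
pose u i := if i == 0%N then 0 else if (i <= L)%N then Num.min (t (M - i)) (s n)
  else if i == L.+1 then s n else t n.
have hu : {homo u : i j / (i <= j)%N >-> i <= j}.
  apply: homo_leq => [//|x1 x2 x3|i]; first exact: le_trans.
  rewrite /u /=; case: eqP => [_|/eqP i0].
    by case: ifP => _; [rewrite le_min !ltW|case: ifP => _; rewrite ltW].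
  case: (leqP i.+1 L) => iL; last first.
    rewrite [i.+1 == L.+1]eqSS.
    case: (leqP i L) => iL'.
      have -> : i = L by apply/eqP; rewrite eqn_leq iL'.
      by rewrite eqxx ge_min lexx orbT.
    case: eqP => [->|_]; last first.
      by rewrite gtn_eqF// lexx.
    by rewrite gtn_eqF// s_le_t.
  rewrite (ltnW iL) le_min !ge_min lexx orbT andbT t_le ?orTb//.
  exact: leq_sub2l.
have iu := times_indep X_levy L.+2 (lexx 0 : 0 <= u 0%N) hu.
pose Y i w := X (u i.+1) w - X (u i) w.
have mY i : measurable_fun setT (Y i).
  have m1 : measurable_fun setT (X (u i.+1)) := measurable_funP _.
  have m2 : measurable_fun setT (X (u i)) := measurable_funP _.
  exact: measurable_fun_sub.
have mp i : (i <= L.+1)%N -> measurable_fun [set: g_sigma_algebraType (block Y 0 L.+1)]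
   (fun w => X (u i) w - X (u 0%N) w) by exact: measurable_past.
have uL : u L.+1 = s n by rewrite /u/= ltnn eqxx.
have uL2 : u L.+2 = t n by rewrite /u/= ltnNge leqnSn/= gtn_eqF.
have sP : <<s block Y 0 L.+1 >> (Past N M n).
  rewrite -[X in X (Past _ _ _)]/(@measurable _ (g_sigma_algebraType (block Y 0 L.+1))).
  apply: measurableI.
    apply: measurable_le => //.
    by have := mp L.+1 (leqnn _); rewrite uL.
  apply: bigcap_measurableType => m [/andP[Nm mM] tms].
  apply: measurable_lt => //.
  have e0 : (M - m == 0)%N = false by rewrite subn_eq0 leqNgt mM.
  have e1 : (M - m <= L)%N by exact: leq_sub2l.
  have e2 : (M - (M - m))%N = m by rewrite subKn// ltnW.
  have um : u (M - m)%N = t m by rewrite /u e0 e1 e2; apply/min_idPl.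
  by have := mp (M - m)%N; rewrite um; apply; rewrite leqW// leq_sub2l.
have sF : <<s block Y L.+1 L.+2 >> (Future n).
  rewrite -[X in X (Future _)]/(@measurable _ (g_sigma_algebraType (block Y L.+1 L.+2))).
  apply: measurable_le => //.
  have := @measurable_block_coord _ T R Y L.+1 L.+2 L.+1.
  by rewrite /Y uL uL2 leqnn ltnSn; apply.
have := block_indep mY iu (leqnSn L.+1) sP sF.
have mPa : measurable (Past N M n) by exact: (sigma_block_measurable mY sP).
have mFu : measurable (Future n) by exact: (sigma_block_measurable mY sF).
rewrite !prE//; last exact: measurableI.
by rewrite -EFinM => -[].
Qed.

(** Past: [exp (- 1/4) - exp (- 2 v)], minus the loss 1/9, is at least 1/4. Future: the cost is
    [v - 1/4] and the error [exp (- 2 v)], which leaves at least [exp (- v) / 2]. *)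
Lemma undershoot_prob_ge N M n : 8 / 9 < pr P (\bigcap_(m in [set m | (N <= m)%N]) F m) ->
  (N <= n < M)%N -> expR (- v n) / 8 <= pr P (G N M n).
Proof.
move=> hN /andP[Nn nM]; have v1 := rate_gt1 hN Nn.
have NM : (N <= M)%N by rewrite (leq_trans Nn)// ltnW.
have mcap' : measurable (\bigcap_(m in [set m | (N <= m < M)%N /\ t m <= s n]) F m).
  exact: bigcap_measurableType.
have mS : measurable [set w | cent X (s n) w <= c n / 2].
  by apply: measurable_le => //; exact: measurable_cent.
have mFu : measurable (Future n).
  apply: measurable_le => //.
  have m1 : measurable_fun setT (X (t n)) := measurable_funP _.
  have m2 : measurable_fun setT (X (s n)) := measurable_funP _.
  exact: measurable_fun_sub.
have mPa : measurable (Past N M n) by exact: measurableI.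
have mG : measurable (G N M n).
  by apply: measurableI => //; apply: measurable_le => //; exact: measurable_cent.
apply: (@le_trans _ _ (pr P (Past N M n `&` Future n))); last first.
  apply: le_pr => //; first exact: measurableI.
  move=> w [[/= h1 h2] h3]; split => //=.
  move: h1 h3; rewrite /cent /Future/=.
  by move: (X (t n) w : R) (X (s n) w : R) (X 0 w : R) => a b d; lra.
rewrite past_future_indep ?(ltW v1)//.
have cy : c n / 2 / y n = 2 * v n by rewrite /c /v; field; rewrite gt_eqF.
have sA : s n * (A (y n) / y n) = 4^-1.
  by rewrite /s /v; field; rewrite !gt_eqF.
have tA : t n * (A (y n) / y n) = v n by rewrite mulrA.
have c2 : 0 <= c n / 2 by rewrite divr_ge0// ltW.
have hPast : 4^-1 <= pr P (Past N M n).
  have := pr_setI_ge P mS (mcap N).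
  have h1 : pr P ([set w | cent X (s n) w <= c n / 2] `&` \bigcap_(m in [set m | (N <= m)%N]) F m)
     <= pr P (Past N M n).
    apply: le_pr => //; first exact: measurableI.
    by move=> w [a b]; split => // m [/andP[Nm _] _]; exact: b.
  have h2 := pr_X_le X_levy Pi_levy X_triplet Pi_abs no_drift (s0 n) (y0 n) c2.
  rewrite sA cy in h2.
  rewrite pr_cent ?(ltW (s0 n))//.
  have h3 := expR_ge1Dx (- 4^-1 : R).
  have h4 : expR (- (2 * v n)) <= 3^-1.
    apply: (@le_trans _ _ (1 + 2 * v n)^-1); first by apply: expRN_le_inv; lra.
    by rewrite lef_pV2 ?posrE; lra.
  lra.
have hFut : expR (- v n) / 2 <= pr P (Future n).
  have ts : 0 < t n - s n.
    have v4 : 0 < 4 * v n by rewrite mulr_gt0.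
    by rewrite subr_gt0 /s ltr_pdivrMr//; have := t0 n; nra.
  have := pr_stationary X_levy (c n / 2) (ltW (s0 n)) (ltW ts).
  rewrite addrC subrK => e; rewrite /Future e.
  apply: le_trans (pr_X_le X_levy Pi_levy X_triplet Pi_abs no_drift ts (y0 n) c2).
  rewrite mulrBl sA tA cy.
  have -> : - (v n - 4^-1) = - v n + 4^-1 by lra.
  have -> : - (2 * v n) = - v n + - v n by lra.
  rewrite !expRD.
  have h3 := expR_ge1Dx (4^-1 : R).
  have h5 : expR (- v n) <= 2^-1.
    apply: (@le_trans _ _ (1 + v n)^-1); first by apply: expRN_le_inv; lra.
    by rewrite lef_pV2 ?posrE; lra.
  have := expR_gt0 (- v n); move: h3 h5; move: (expR (- v n)) (expR 4^-1) => a b; nra.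
have := pr_ge0 P (Past N M n); have := expR_gt0 (- v n).
move: hPast hFut; move: (pr P _) (pr P _) (expR _) => a b e; nra.
Qed.

(** One factor [exp (- v n)] is traded for 8 times the probability of [G N M n]; the other one
    weights the indicators, whose sum is bounded pathwise by [sum_expN_le]. If [t m <= s n], the
    event of index [n] forces the path above [c m] at [t m], which excludes the event of index
    [m]. *)
Lemma sum_exp_rate_le : exists C, forall M, \sum_(0 <= n < M) expR (- (2 * v n)) <= C.
Proof.
have [N hN] := large_prob_start.
have [J kJ] : exists J : nat, kappa <= J%:R.
  by exists (Num.bound kappa); apply/ltW/archi_boundP; exact: ltW.
pose C := 4 * (4 ^+ J * J`!%:R) : R.
have C0 : 0 <= C by rewrite mulr_ge0// mulr_ge0// exprn_ge0.
have hk : 0 < kappa <= J%:R by rewrite kJ andbT.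
have e1 n : expR (- (2 * v n)) <= 1.
  by rewrite -[leRHS]expR0 ler_expR oppr_le0 mulr_ge0// ltW.
have mG M n : measurable (G N M n).
  apply: measurableI; first by apply: measurable_le => //; exact: measurable_cent.
  exact: bigcap_measurableType.
have main M : \sum_(N <= n < M) expR (- (2 * v n)) <= 8 * C.
  apply: (@le_trans _ _ (8 * \sum_(N <= n < M) expR (- v n) * pr P (G N M n))).
    rewrite mulr_sumr big_nat [leRHS]big_nat; apply: ler_sum => n nNM.
    have := undershoot_prob_ge hN nNM; have -> : - (2 * v n) = - v n + - v n by lra.
    by rewrite expRD; have := expR_gt0 (- v n); move: (expR _) (pr _ _) => a b; nra.
  rewrite ler_pM2l//.
  rewrite -(mean_sum_indic P N M (fun n => expR_ge0 (- v n)) (mG M)).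
  apply: mean_le.
  - by apply: measurable_sum => n; apply: measurable_fun_mul.
  - move=> w; apply/andP; split; first by apply: sumr_ge0 => n _; rewrite mulr_ge0 ?expR_ge0 ?indicE.
    pose S n := w \in G N M n.
    rewrite (eq_bigr (fun n => if S n then expR (- v n) else 0)); last first.
      by move=> n _; rewrite indicE /S; case: (_ \in _); rewrite ?mulr1 ?mulr0.
    rewrite -big_mkcond.
    apply: (@sum_expN_le _ kappa eps J S t v N M hk eps0 t0 t_le) => //.
    + by move=> n /andP[Nn _]; rewrite ltW// (rate_gt1 hN).
    + move=> n m nNM mNM; rewrite /S !inE => Gn Gm.
      have : ~~ (t m <= s n).
        apply/negP => tms; have [_ /(_ m)] := Gn.
        move=> /(_ (conj mNM tms)); rewrite /F/= ltNge => /negP; apply.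
        by case: Gm.
      have v4 : 0 < 4 * v n by rewrite mulr_gt0.
      by rewrite -ltNge /s ltr_pdivrMr// mulrC.
exists (N%:R + 8 * C) => M.
have [NM|MN] := leqP N M.
  rewrite (@big_cat_nat _ _ _ N)//= lerD//.
  apply: (@le_trans _ _ (\sum_(0 <= n < N) 1)); first by apply: ler_sum => n _; exact: e1.
  by rewrite sumr_const_nat subn0.
apply: (@le_trans _ _ (\sum_(0 <= n < M) 1)); first by apply: ler_sum => n _; exact: e1.
rewrite sumr_const_nat subn0 (@le_trans _ _ N%:R)//; first by rewrite ler_nat ltnW.
by rewrite lerDl mulr_ge0.
Qed.

(** [1 < v n] reads [y n / A (y n) < t n], and [t n] tends to 0. *)
Lemma id_over_A_plus_small e : 0 < e -> exists K, 2^-1 ^+ K / A (2^-1 ^+ K) < e.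
Proof.
move=> e0; have [N hN] := large_prob_start.
have [M _ hM] : \forall n \near \oo, t n < e by apply: (@cvgr_lt _ _ _ _ _ _ t_cvg0 e).
exists (maxn N M); apply: (@le_lt_trans _ _ (t (maxn N M))); last by apply: hM; exact: leq_maxr.
have := rate_gt1 hN (leq_maxl N M); rewrite /v ltr_pdivlMr// mul1r => h.
by rewrite ler_pdivrMr// ltW.
Qed.

End Eps.

Lemma necessity_K_X d : 0 < d -> (K_X kappa Pi d < +oo)%E.
Proof.
move=> d0; pose eps := (d / 4) `^ (kappa - 1).
have eps0 : 0 < eps by rewrite powR_gt0// divr_gt0.
have [C HC] := sum_exp_rate_le eps0.
have epsr : eps `^ (kappa - 1)^-1 = d / 4.
  by rewrite -powRrM divff ?subr_eq0 ?gt_eqF// powRr1// divr_ge0// ltW.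
apply: (@K_X_lty _ _ Pi_levy Pi_abs _ kappa_gt1 d 2^-1 C half01 (ltW d0)) => M.
apply: (@le_trans _ _ (\sum_(0 <= k < M.+1) kx_term Pi kappa (d * 2^-1) 2^-1 k)).
  rewrite big_nat_recl// lerDr; exact: expR_ge0.
apply: le_trans (HC M.+1); apply: ler_sum => k _.
rewrite /kx_term ler_expR lerN2.
rewrite powRM ?(ltW eps0) ?(A_plus_nonneg Pi_levy Pi_abs)// epsr.
have -> : kappa / (kappa - 1) = (kappa - 1)^-1 + 1.
  by field; rewrite subr_eq0 gt_eqF.
rewrite powRD; last first.
  by apply/implyP => _; rewrite gt_eqF// A_plus_gt0// exprn_gt0//; case/andP: half01.
rewrite powRr1 ?(A_plus_nonneg Pi_levy Pi_abs)//.
by rewrite le_eqVlt; apply/orP; left; apply/eqP; field; rewrite expf_neq0//.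
Qed.

End NecessityKX.

(** * Regularity of A_plus *)

Section APlusMore.
Context (R : realType) (Pi : {measure set (measurableTypeR R) -> \bar R}).
Hypothesis Pi_levy : bounded_levy_measure Pi.
Hypothesis Pi_abs : (\int[Pi]_x `|x|%:E < +oo)%E.
Local Notation A := (A_plus Pi).

Lemma A_plus_ratio_mono y z : 0 < y <= z -> 0 < A y -> y / A y <= z / A z.
Proof.
move=> /andP[y0 yz] A0; have z0 : 0 < z by exact: lt_le_trans yz.
have Az : 0 < A z by apply: (lt_le_trans A0); exact: A_plus_homo.
rewrite ler_pdivrMr// mulrAC ler_pdivlMr//.
have c1 : 1 <= z / y by rewrite ler_pdivlMr// mul1r.
have := A_plus_scale Pi_levy Pi_abs (ltW y0) c1; rewrite divfK ?gt_eqF// => h.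
have := ler_wpM2l (ltW y0) h; rewrite mulrCA.
by rewrite (mulrA (z / y)) divfK ?gt_eqF.
Qed.

(** [A_plus_scale] and monotonicity give the Lipschitz constant [2 * (A y / y)] for comparing [y]
    with any point of [[y / 2, +oo[]. *)
Lemma continuous_A_plus y : 0 < y -> {for y, continuous A}.
Proof.
move=> y0; have Ay := A_plus_nonneg Pi_levy Pi_abs y.
have key z : y / 2 <= z -> `|A z - A y| <= 2 * (A y / y) * `|z - y|.
  move=> yz2; have z0 : 0 < z by lra.
  have r0 : 0 <= A y / y by rewrite divr_ge0// ltW.
  have Ayy : A y / y * y = A y by rewrite divfK// gt_eqF.
  have [yz|zy] := leP y z.
    have h := A_plus_homo Pi_levy Pi_abs yz.
    rewrite !ger0_norm ?subr_ge0//.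
    have c1 : 1 <= z / y by rewrite ler_pdivlMr// mul1r.
    have := A_plus_scale Pi_levy Pi_abs (ltW y0) c1; rewrite divfK ?gt_eqF//.
    have -> : z / y * A y = z * (A y / y) by ring.
    by move: r0 Ayy yz; move: (A y / y) => r; nra.
  have h := A_plus_homo Pi_levy Pi_abs (ltW zy).
  rewrite (distrC (A z)) (distrC z) !ger0_norm ?subr_ge0// ?(ltW zy)//.
  have c1 : 1 <= y / z by rewrite ler_pdivlMr// mul1r ltW.
  have := A_plus_scale Pi_levy Pi_abs (ltW z0) c1; rewrite divfK ?gt_eqF//.
  have -> : y / z * A z = A z / z * y by ring.
  have Azz : A z / z * z = A z by rewrite divfK// gt_eqF.
  have rz0 : 0 <= A z / z by rewrite divr_ge0 ?(ltW z0)// (A_plus_nonneg Pi_levy Pi_abs).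
  have rz : A z / z <= 2 * (A y / y).
    rewrite ler_pdivrMr//; apply: (le_trans h).
    by move: r0 Ayy; move: (A y / y) => r; nra.
  by move: rz0 Azz rz; move: (A z / z) => r; nra.
apply/cvgrPdist_lt => e e0.
have r0 : 0 <= A y / y by rewrite divr_ge0// ltW.
have k0 : 0 < 2 * (A y / y) + 1 by lra.
have d0 : 0 < Num.min (y / 2) (e / (2 * (A y / y) + 1)) by rewrite lt_min !divr_gt0.
near=> z.
have : `|y - z| < Num.min (y / 2) (e / (2 * (A y / y) + 1)) by near: z; exact: cvgr_dist_lt.
rewrite lt_min => /andP[z1 z2]; rewrite distrC.
have yz : y / 2 <= z by move: z1; rewrite ltr_distlC => /andP[]; lra.
apply: (le_lt_trans (key z yz)); rewrite ltr_pdivlMr// distrC in z2 *.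
by move: z2; have := normr_ge0 (z - y); move: `|z - y| (A y / y) => a b; nra.
Unshelve. all: end_near.
Qed.

End APlusMore.

(** * Necessity of the second condition *)

Section NecessityNegativeJumps.
Context (R : realType) (disp : measure_display)
    (T : measurableType disp) (P : probability T R)
    (X : R -> {RV P >-> measurableTypeR R}).
Hypothesis X_levy : levy_process X.

(** Weaker than nonnegativity of the path started at [a], because negative increments are not
    accumulated. It depends on the increments from [a] on only, so it is independent of earlier
    steps and its law is invariant under shifts. *)
Definition nonneg_steps (h : R) (a n : nat) : set T :=
  [set w | forall i, (a <= i < n)%N -> 0 <= vari X posp h a i w + incr X h i w].

Definition negative_step (h : R) (i : nat) : set T := [set w | vari X posp h 0 i w + incr X h i w < 0].

Lemma vari_shift psi h a i w : vari X psi h a (a + i) w = \sum_(0 <= l < i) psi (incr X h (a + l) w).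
Proof. by rewrite /vari -{1}(add0n a) big_addn addKn; apply: eq_bigr => l _; rewrite addnC. Qed.

Let mv h a i : measurable_fun setT (vari X posp h a i).
Proof. exact: measurable_vari (@measurable_posp R). Qed.

Let mi h i : measurable_fun setT (incr X h i).
Proof. exact: measurable_incr. Qed.

Lemma measurable_nonneg_steps h a n : measurable (nonneg_steps h a n).
Proof.
rewrite (_ : nonneg_steps h a n = \bigcap_(i in [set i | (a <= i < n)%N])
   [set w | 0 <= vari X posp h a i w + incr X h i w]); last first.
  by apply/seteqP; split => w hw i; exact: hw.
apply: bigcap_measurableType => i _; apply: measurable_le => //.
exact: measurable_fun_add.
Qed.

Lemma measurable_negative_step h i : measurable (negative_step h i).
Proof. by apply: measurable_lt => //; exact: measurable_fun_add. Qed.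

Lemma pr_nonneg_steps h a n : 0 <= h -> (a <= n)%N -> pr P (nonneg_steps h a n) = pr P (nonneg_steps h 0 (n - a)).
Proof.
move=> h0 an; pose m := (n - a)%N.
pose E : set (nat -> R) := [set f : nat -> R | forall i : nat, (i < m)%N -> 0 <= \sum_(l < i) posp (f l) + f i].
have sE : <<s cylinder m >> E.
  rewrite -[X in X E]/(@measurable _ (g_sigma_algebraType (cylinder m))).
  rewrite (_ : E = \bigcap_(i in [set i | (i < m)%N])
     [set f : g_sigma_algebraType (cylinder m) | 0 <= \sum_(l < i) posp (f l) + f i]); last first.
    by apply/seteqP; split => f hf i; exact: hf.
  apply: bigcap_measurableType => i /= im; apply: measurable_le => //.
  apply: measurable_fun_add; last exact: measurable_cylinder_coord.
  apply: measurable_sum => l; apply: (measurableT_comp (@measurable_posp R)).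
  by apply: measurable_cylinder_coord; rewrite (ltn_trans (ltn_ord l)).
have := indep_law (P := P) (n := m) (fun l => mi h (a + l)) (fun l => mi h (0 + l))
  (incr_indep X_levy m a h0) (incr_indep X_levy m 0 h0) _ sE.
rewrite /pr => e; congr fine.
have -> : nonneg_steps h a n = [set w | E (fun l => incr X h (a + l) w)].
  apply/seteqP; split => w hw i.
    move=> im; have := hw (a + i)%N; rewrite vari_shift leq_addr/= big_mkord; apply.
    by rewrite -ltn_subRL.
  move=> /andP[ai iN]; have := hw (i - a)%N; rewrite -(big_mkord xpredT (fun l => posp (incr X h (a + l) w))) -vari_shift subnKC//; apply.
  by rewrite /m ltn_sub2r// (leq_ltn_trans ai).
have -> : nonneg_steps h 0 (n - a) = [set w | E (fun l => incr X h (0 + l) w)].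
  apply/seteqP; split => w hw i.
    by move=> im; have := hw i; rewrite leq0n im /vari big_mkord; apply.
  by move=> /andP[_ im]; rewrite /vari big_mkord; exact: hw.
by apply: e => i B im mB; rewrite !(incr_law X_levy).
Qed.

Lemma nonneg_steps_anti h n m : (n <= m)%N -> nonneg_steps h 0 m `<=` nonneg_steps h 0 n.
Proof. by move=> nm w hw i /andP[_ ni]; apply: hw; rewrite (leq_trans ni). Qed.

Lemma negative_step_indep h i n : 0 <= h -> (i < n)%N ->
  pr P (negative_step h i `&` nonneg_steps h i.+1 n) = pr P (negative_step h i) * pr P (nonneg_steps h i.+1 n).
Proof.
move=> h0 iN; have iu := incr_indep X_levy n 0 h0.
pose Y l := incr X h (0 + l).
have mY l : measurable_fun setT (Y l) by exact: mi.
have sB : <<s block Y 0 i.+1 >> (negative_step h i).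
  rewrite -[X in X (negative_step _ _)]/(@measurable _ (g_sigma_algebraType (block Y 0 i.+1))).
  apply: measurable_lt => //; apply: measurable_fun_add; last first.
    by apply: (@measurable_block_coord _ T R Y); rewrite ltnSn.
  rewrite /vari; under eq_fun do rewrite big_mkord.
  apply: measurable_sum => l; apply: (measurableT_comp (@measurable_posp R)).
  by apply: (@measurable_block_coord _ T R Y); rewrite leqW// ltn_ord.
have sN : <<s block Y i.+1 n >> (nonneg_steps h i.+1 n).
  rewrite -[X in X (nonneg_steps _ _ _)]/(@measurable _ (g_sigma_algebraType (block Y i.+1 n))).
  rewrite (_ : nonneg_steps h i.+1 n = \bigcap_(j in [set j | (i.+1 <= j < n)%N])
     [set w | 0 <= vari X posp h i.+1 j w + incr X h j w]); last first.
    by apply/seteqP; split => w hw j; exact: hw.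
  apply: bigcap_measurableType => j /= /andP[ij jn].
  apply: measurable_le => //; apply: measurable_fun_add; last first.
    by apply: (@measurable_block_coord _ T R Y); rewrite ij.
  have -> : vari X posp h i.+1 j = (fun w => \sum_(l < j - i.+1) posp (incr X h (i.+1 + l) w)).
    by apply/funext => w; rewrite -{1}(subnKC ij) vari_shift big_mkord.
  apply: measurable_sum => l; apply: (measurableT_comp (@measurable_posp R)).
  have lj : (i.+1 + l < j)%N by rewrite -ltn_subRL ltn_ord.
  by apply: (@measurable_block_coord _ T R Y); rewrite leq_addr; exact: ltn_trans lj jn.
have := block_indep mY iu iN sB sN.
rewrite !prE; last 3 first.
- exact: measurable_nonneg_steps.
- exact: measurable_negative_step.
- by apply: measurableI; [exact: measurable_negative_step|exact: measurable_nonneg_steps].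
by rewrite -EFinM => -[].
Qed.

(** Decomposition at the last negative step: a step negative with respect to the whole positive
    variation is also negative with respect to a shorter one, so the [D i] are disjoint. By
    independence each keeps at least half of the probability of its negative step. *)
Lemma sum_negative_step_le h n : 0 <= h -> 2^-1 <= pr P (nonneg_steps h 0 n) ->
  \sum_(0 <= i < n) pr P (negative_step h i) <= 2.
Proof.
move=> h0 hn.
pose D i := if (i < n)%N then negative_step h i `&` nonneg_steps h i.+1 n else set0.
have mD i : measurable (D i).
  rewrite /D; case: ifP => // _.
  by apply: measurableI; [exact: measurable_negative_step|exact: measurable_nonneg_steps].
have tD : trivIset setT D.
  have wlg i j w : (i < j)%N -> D i w -> D j w -> False.
    rewrite /D => ij; case: ifP => // iN [_ nb]; case: ifP => // jN [bj _].
    have := nb j; rewrite ij jN => /(_ isT); rewrite leNgt => /negP; apply.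
    apply: le_lt_trans bj; rewrite lerD2r /vari [leRHS](@big_cat_nat _ _ _ i.+1)//=.
    by rewrite lerDr sumr_ge0// => l _; exact: posp_ge0.
  apply/trivIsetP => i j _ _ ij; apply/seteqP; split => // w [wi wj].
  case/orP: (leq_total i j) => h1.
    by apply: (wlg i j w) => //; rewrite ltn_neqAle ij.
  by apply: (wlg j i w) => //; rewrite ltn_neqAle eq_sym ij.
have := measure_bigsetU P mD tD n.
have le1 : (P (\big[setU/set0]_(i < n) D i) <= 1)%E by apply: probability_le1; exact: bigsetU_measurable.
move=> e; move: le1; rewrite e.
have -> : (\sum_(i < n) P (D i) = (\sum_(0 <= i < n) pr P (negative_step h i) * pr P (nonneg_steps h i.+1 n))%:E)%E.
  rewrite big_mkord -sumEFin; apply: eq_bigr => i _.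
  rewrite /D ltn_ord prE ?negative_step_indep//.
  by have := mD i; rewrite /D ltn_ord.
rewrite lee_fin => le1.
have : \sum_(0 <= i < n) pr P (negative_step h i) * 2^-1 <= 1.
  apply: le_trans le1; rewrite big_nat [leRHS]big_nat; apply: ler_sum => i /= iN.
  apply: ler_wpM2l; first exact: pr_ge0.
  rewrite pr_nonneg_steps//; apply: (le_trans hn); apply: le_pr.
  - exact: measurable_nonneg_steps.
  - exact: measurable_nonneg_steps.
  - by apply: nonneg_steps_anti; exact: leq_subr.
by rewrite -mulr_suml ler_pdivrMr// mul1r.
Qed.

Context (gamma : R) (Pi : {measure set (measurableTypeR R) -> \bar R}).
Hypothesis Pi_levy : bounded_levy_measure Pi.
Hypothesis X_triplet : has_triplet X gamma 0 Pi.
Hypothesis Pi_abs : (\int[Pi]_x `|x|%:E < +oo)%E.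
Hypothesis no_drift : drift gamma Pi = 0.
Variable kappa : R.
Hypothesis kappa_gt1 : 1 < kappa.
Hypothesis X_lim : {ae P, forall w, X t w / t `^ kappa @[t --> 0^'+] --> +oo%R}.
Local Notation A := (A_plus Pi).

Let b (k : nat) : R := 2^-1 ^+ k.
Let b0 k : 0 < b k. Proof. by rewrite exprn_gt0. Qed.
Let bS k : b k = 2 * b k.+1. Proof. by rewrite /b exprS mulrA divff ?mul1r. Qed.
Let Apos y : 0 < y -> 0 < A y.
Proof. exact: (A_plus_gt0 X_levy Pi_levy X_triplet Pi_abs no_drift X_lim). Qed.

(** With probability more than 1/2 the path is nonnegative at all grid times up to [delta], for
    every mesh simultaneously, and the path is dominated by its positive variation. *)
Lemma nonneg_steps_start : exists2 delta : R, 0 < delta &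
  forall j, 2^-1 <= pr P (nonneg_steps (mesh delta j) 0 (2 ^ j)).
Proof.
pose F N : set T := \bigcap_j \bigcap_(i in [set i | (1 <= i <= 2 ^ j)%N])
  [set w | 0 <= cent X (i%:R * mesh (mesh 1 N) j) w].
have mF N : measurable (F N).
  apply: bigcapT_measurable => j; apply: bigcap_measurableType => i _.
  by apply: measurable_le => //; exact: measurable_cent.
have aeF : {ae P, forall w, \forall N \near \oo, F N w}.
  have := levy_start X_levy; apply: filterS2 X_lim => w hw w0.
  have : \forall s \near 0^'+, 0 < X s w / s `^ kappa by move/cvgryPgt : hw; exact.
  rewrite /at_right near_withinE => -[e /= e0 He].
  have : \forall n \near \oo, mesh 1 n < e.
    by apply: (@cvgr_lt _ _ _ _ _ _ (@mesh_cvg0 R 1) e).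
  apply: filterS => N Ne j _ i /= /andP[i1 ij]; rewrite /cent w0 subr0.
  have m0 : 0 < mesh (mesh (1 : R) N) j by rewrite /mesh !divr_gt0// exprn_gt0.
  have s0 : 0 < i%:R * mesh (mesh (1 : R) N) j by rewrite mulr_gt0// ltr0n.
  have se : i%:R * mesh (mesh (1 : R) N) j < e.
    apply: le_lt_trans Ne; rewrite -[leRHS](mesh_sum _ j) ler_wpM2r ?ler_nat//; exact: ltW.
  have := He (i%:R * mesh (mesh 1 N) j); rewrite /ball/= sub0r normrN gtr0_norm//.
  move=> /(_ se s0); rewrite pmulr_lgt0 ?invr_gt0 ?powR_gt0//; exact: ltW.
have e2 : 0 < 2^-1 :> R by [].
have [N hN] := ae_eventually mF e2 aeF.
exists (mesh 1 N); first exact: mesh_gt0.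
move=> j; apply: (@le_trans _ _ (pr P (\bigcap_(m in [set m | (N <= m)%N]) F m))).
  by apply: ltW; apply: le_lt_trans hN; lra.
apply: le_pr.
- exact: bigcap_measurableType.
- exact: measurable_nonneg_steps.
move=> w /(_ N (leqnn N)) /(_ j I) hw i /andP[_ ij].
have := hw i.+1; rewrite /= ij => /(_ isT) /le_trans; apply.
have key : forall l, cent X (l%:R * mesh (mesh 1 N) j) w <= vari X posp (mesh (mesh 1 N) j) 0 l w.
  elim=> [|l IH]; first by rewrite mul0r /cent subrr /vari big_nil.
  rewrite /vari big_nat_recr//=.
  apply: le_trans (lerD IH (le_posp _)).
  by rewrite /cent /incr [leRHS]addrC addrA subrK.
apply: le_trans (lerD (key i) (lexx _)).
by rewrite /cent /incr [leRHS]addrC addrA subrK.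
Qed.

(** While [i * h <= w / 4], the cost at parameter [1 / bb] is at most 1/4, and
    [exp (- 1/4) - exp (- 1) >= 1/4]. At least [w / (4 * h)] indices qualify. *)
Lemma sum_small_vari_ge h n bb w : 0 < h -> 0 < bb -> 0 <= w -> w <= n%:R * h -> w <= bb / A bb ->
  w / (16 * h) <= \sum_(0 <= i < n) pr P [set u | vari X posp h 0 i u <= bb].
Proof.
move=> h0 bb0 w0 wn wA; have A0 := Apos bb0.
have ex : exists m : nat, w / (4 * h) <= m%:R.
  exists (Num.bound (w / (4 * h))); apply/ltW/archi_boundP.
  by rewrite divr_ge0// mulr_ge0// ltW.
case: (ex_minnP ex) => m hm hmin.
have h4 : 0 < 4 * h by rewrite mulr_gt0.
have mn : (m <= n)%N.
  apply: hmin; rewrite ler_pdivrMr//; apply: (le_trans wn).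
  have : 0 <= n%:R * h by rewrite mulr_ge0// ltW.
  by move=> ?; lra.
rewrite (@big_cat_nat _ _ _ m)//=.
apply: (@le_trans _ _ (\sum_(0 <= i < m) pr P [set u | vari X posp h 0 i u <= bb])); last first.
  by rewrite lerDl sumr_ge0// => i _; exact: pr_ge0.
apply: (@le_trans _ _ (\sum_(0 <= i < m) 4^-1)).
  rewrite sumr_const_nat subn0 -[leRHS]mulr_natr.
  have -> : w / (16 * h) = 4^-1 * (w / (4 * h)) by field; rewrite gt_eqF.
  exact: ler_wpM2l.
rewrite big_nat [leRHS]big_nat; apply: ler_sum => i /= im.
apply: le_trans (pr_vari_le X_levy Pi_levy X_triplet Pi_abs no_drift i bb h0 bb0).
have iw : i%:R * h * 4 <= w.
  have : ~~ (w / (4 * h) <= i%:R) by apply/negP => /hmin; rewrite leqNgt im.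
  by rewrite -ltNge ltr_pdivlMr// => /ltW; lra.
have q1 : i%:R * h * (A bb / bb) <= 4^-1.
  have : i%:R * h * 4 <= bb / A bb by exact: le_trans iw wA.
  rewrite ler_pdivlMr// mulrA ler_pdivrMr//; lra.
rewrite divff ?gt_eqF//.
have e1 : expR (- 1) <= 2^-1 :> R by exact: (@expRN_le_inv R 1 ler01).
have e2 : expR (- 4^-1) <= expR (- (i%:R * h * (A bb / bb))) by rewrite ler_expR lerN2.
have := expR_ge1Dx (- 4^-1 : R); lra.
Qed.

(** Dyadic cells of the negative half-line. Cell 0 is unbounded below, because increments, unlike
    jumps, are not confined to [[-1, 1]]. *)
Let C (k : nat) : set R := [set x | (x < - b k.+1) && ((k == 0%N) || (- b k <= x))].

Let mC k : measurable (C k : set (measurableTypeR R)).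
Proof.
rewrite (_ : C k = [set x | x < - b k.+1] `&` (if k == 0%N then setT else [set x | - b k <= x])); last first.
  rewrite /C; apply/seteqP; split => x /=; case: eqP => //= _.
  - by rewrite andbT => ->.
  - by move=> /andP[-> ->].
  - by move=> [-> _].
  - by move=> [-> ->].
apply: measurableI.
  by apply: (@measurable_lt _ (measurableTypeR R) _ (fun x : R => x) (fun=> - b k.+1)).
case: ifP => // _.
by apply: (@measurable_le _ (measurableTypeR R) _ (fun=> - b k) (fun x : R => x)).
Qed.

Let tC : trivIset setT C.
Proof.
have wlg i j x : (i < j)%N -> C i x -> C j x -> False.
  rewrite /C/= => ij /andP[x1 _] /andP[_ /orP[/eqP j0|x2]]; first by rewrite j0 ltn0 in ij.
  have := lt_le_trans x1 (lexx _); rewrite ltNge => /negP; apply.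
  apply: le_trans x2; rewrite lerN2 /b ler_wiXn2l//; lra.
apply/trivIsetP => i j _ _ ij; apply/seteqP; split => // x [xi xj].
case/orP: (leq_total i j) => h1.
  by apply: (wlg i j x) => //; rewrite ltn_neqAle ij.
by apply: (wlg j i x) => //; rewrite ltn_neqAle eq_sym ij.
Qed.

(** An increment in cell [k] is below [- b k.+1], hence a negative step as soon as the earlier
    positive variation, which is independent of it, is at most [b k.+1]. The cells being disjoint,
    the probabilities add up. *)
Lemma negative_step_prob_ge h i K n : 0 <= h -> (i < n)%N ->
  \sum_(0 <= k < K) pr P [set w | vari X posp h 0 i w <= b k.+1] * pr P (X h @^-1` C k) <=
  pr P (negative_step h i).
Proof.
move=> h0 iN.
pose V k := [set w | vari X posp h 0 i w <= b k.+1].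
pose D k := V k `&` incr X h i @^-1` C k.
have mV k : measurable (V k) by apply: measurable_le.
have mI k : measurable (incr X h i @^-1` C k).
  by have := @mi h i measurableT _ (mC k); rewrite setTI.
have mD k : measurable (D k) by exact: measurableI.
have tD : trivIset setT D.
  apply/trivIsetP => k l _ _ kl; apply/seteqP; split => // w [[_ wk] [_ wl]].
  have /trivIsetP/(_ k l I I kl) := tC; move/seteqP => [/(_ (incr X h i w)) + _].
  by apply; split.
have iu := incr_indep X_levy n 0 h0.
pose Y l := incr X h (0 + l).
have mY l : measurable_fun setT (Y l) by exact: mi.
have prD k : pr P (D k) = pr P (V k) * pr P (X h @^-1` C k).
  have sV : <<s block Y 0 i >> (V k).
    rewrite -[X in X (V _)]/(@measurable _ (g_sigma_algebraType (block Y 0 i))).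
    apply: measurable_le => //.
    rewrite /vari; under eq_fun do rewrite big_mkord.
    apply: measurable_sum => l; apply: (measurableT_comp (@measurable_posp R)).
    by apply: (@measurable_block_coord _ T R Y); rewrite ltn_ord.
  have sI : <<s block Y i n >> (incr X h i @^-1` C k).
    have := @measurable_block_coord _ T R Y i n i _ measurableT _ (mC k).
    by rewrite setTI; apply; rewrite leqnn iN.
  have := block_indep mY iu (ltnW iN) sV sI.
  have -> : P (incr X h i @^-1` C k) = P (X h @^-1` C k) by exact: (incr_law X_levy).
  rewrite -/(D k) !prE//; first by rewrite -EFinM => -[].
  have mX : measurable_fun setT (X h) := measurable_funP _.
  by have := mX measurableT _ (mC k); rewrite setTI.
have mU : measurable (\big[setU/set0]_(k < K) D k) by exact: bigsetU_measurable.
have -> : \sum_(0 <= k < K) pr P [set w | vari X posp h 0 i w <= b k.+1] * pr P (X h @^-1` C k) =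
    pr P (\big[setU/set0]_(k < K) D k).
  apply: EFin_inj; rewrite -prE// (measure_bigsetU P mD tD) big_mkord -sumEFin.
  by apply: eq_bigr => k _; rewrite -prD -prE.
apply: le_pr => //; first exact: measurable_negative_step.
rewrite -bigcup_mkord => w [k /= _ [/= h1 h2]].
move: h2; rewrite /C/= /negative_step/= => /andP[h2 _].
by rewrite /V/= in h1; lra.
Qed.

(** At most 2 negative steps are expected, and cell [k] accounts for its probability times its
    weight over [16 * h]; hence [32 = 2 * 16]. *)
Lemma sum_cell_prob_le delta : 0 < delta -> (forall j, 2^-1 <= pr P (nonneg_steps (mesh delta j) 0 (2 ^ j))) ->
  forall j K, \sum_(0 <= k < K) Num.min delta (b k.+1 / A (b k.+1)) * pr P (X (mesh delta j) @^-1` C k) <=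
    32 * mesh delta j.
Proof.
move=> d0 hd j K; set h := mesh delta j; have h0 : 0 < h by exact: mesh_gt0.
have := sum_negative_step_le (ltW h0) (hd j).
have : \sum_(0 <= i < 2 ^ j) \sum_(0 <= k < K)
    pr P [set w | vari X posp h 0 i w <= b k.+1] * pr P (X h @^-1` C k) <=
   \sum_(0 <= i < 2 ^ j) pr P (negative_step h i).
  rewrite big_nat [leRHS]big_nat; apply: ler_sum => i /= ij; apply: (negative_step_prob_ge _ (ltW h0) ij).
rewrite exchange_big/= => h1 h2; have {h1 h2} := le_trans h1 h2.
move=> hs; rewrite -ler_pdivrMr//.
rewrite -(ler_pM2r (_ : 0 < 16^-1 :> R))// (_ : 32 * 16^-1 = 2 :> R); last by field.
apply: le_trans hs; rewrite mulrAC mulr_suml mulr_suml; apply: ler_sum => k _.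
rewrite -mulr_suml.
have wA : Num.min delta (b k.+1 / A (b k.+1)) <= b k.+1 / A (b k.+1) by rewrite ge_min lexx orbT.
have w0 : 0 <= Num.min delta (b k.+1 / A (b k.+1)).
  by rewrite le_min (ltW d0) divr_ge0// ltW// Apos.
have wn : Num.min delta (b k.+1 / A (b k.+1)) <= (2 ^ j)%:R * h by rewrite mesh_sum ge_min lexx.
have := sum_small_vari_ge h0 (b0 k.+1) w0 wn wA.
move=> /(ler_wpM2r (pr_ge0 P (X h @^-1` C k))); apply: le_trans.
rewrite le_eqVlt; apply/orP; left; apply/eqP; field; rewrite gt_eqF//.
Qed.

Let cut (y : R) : R := Num.min y 1.
(** The ratio of the second condition made bounded, so that [levy_liminf] can be used with the mean
    bounds: [delta] is the length of the time interval, and cutting [negp x] at 1 matches the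
    unbounded cell 0. *)
Let gb (delta x : R) : R := Num.min delta (cut (negp x) / A (cut (negp x))).

Let cut_ge0 x : 0 <= cut (negp x).
Proof. by rewrite le_min negp_ge0 ler01. Qed.

Let gb_ge0 delta x : 0 < delta -> 0 <= gb delta x.
Proof.
move=> d0; rewrite le_min (ltW d0) divr_ge0//.
exact: A_plus_nonneg.
Qed.

Let measurable_gb delta : measurable_fun setT (gb delta).
Proof.
apply: measurable_fun_min => //.
have mc : measurable_fun setT (fun x : R => cut (negp x)).
  by apply: measurable_fun_min => //; exact: measurable_negp.
apply: measurable_fun_mul => //; apply: measurable_fun_inv.
exact: (measurableT_comp (measurable_A_plus Pi_levy Pi_abs) mc).
Qed.

Let continuous_gb delta x : x != 0 -> {for x, continuous (gb delta)}.
Proof.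
move=> x0; apply: continuous_min; first exact: cvg_cst.
have [xn|xp|xe] := ltgtP x 0; last by rewrite xe eqxx in x0.
  have cp : 0 < cut (negp x) by rewrite lt_min ltr01 andbT /negp lt_max oppr_gt0 xn.
  have cc : {for x, continuous (fun x : R => cut (negp x))}.
    by apply: continuous_min; [exact: continuous_negp|exact: cvg_cst].
  apply: cvgM => //; apply: cvgV; first by rewrite gt_eqF// Apos.
  apply: (@continuous_comp _ _ _ (fun x : R => cut (negp x)) A) => //.
  exact: continuous_A_plus.
have gx z : 0 <= z -> cut (negp z) / A (cut (negp z)) = 0.
  by move=> z0; rewrite /negp max_r ?oppr_le0// /cut min_l// mul0r.
rewrite /prop_for /continuous_at gx ?(ltW xp)//.
apply: cvg_near_cst; near=> z; rewrite gx//.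
apply: ltW; near: z; exact: (@cvgr_gt _ _ _ _ _ x cvg_id 0 xp).
Unshelve. all: end_near.
Qed.

(** On cell [k] the ratio is at most its value at [b k], which is at most twice its value at
    [b k.+1]. *)
Let gb_cell delta K x : 0 < delta -> b K.+1 < negp x ->
  gb delta x <= \sum_(0 <= k < K.+1) 2 * Num.min delta (b k.+1 / A (b k.+1)) * \1_(C k) x.
Proof.
move=> d0 xK.
have w0 k : 0 <= Num.min delta (b k.+1 / A (b k.+1)).
  by rewrite le_min (ltW d0) divr_ge0 ?(ltW (b0 _))// ltW// Apos.
have x0 : 0 < negp x by apply: lt_trans xK.
have xn : negp x = - x.
  rewrite /negp; case: leP => // h; move: x0; rewrite /negp max_r ?ltxx//; exact: ltW.
rewrite xn in xK x0.
have [k [kK kx kb]] : exists k, [/\ (k < K.+1)%N, C k x & Num.min (- x) 1 <= b k].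
  have [x1|x1] := ltP (b 1) (- x).
    exists 0%N; split => //; first by rewrite /C/= andbT; lra.
    by rewrite /b expr0 ge_min lexx orbT.
  have ex : exists k, b k.+1 < - x by exists K.
  case: (ex_minnP ex) => [[|k]] hk hmin; first by move: hk; rewrite ltNge x1.
  have xk : - x <= b k.+1 by rewrite leNgt; apply/negP => /hmin; rewrite ltnn.
  exists k.+1; split; first by rewrite ltnS hmin.
    by rewrite /C/=; apply/andP; split; lra.
  by rewrite ge_min xk.
have h1 : gb delta x <= 2 * Num.min delta (b k.+1 / A (b k.+1)).
  rewrite /gb xn; set cx := cut (- x).
  have cx0 : 0 < cx by rewrite lt_min x0 ltr01.
  have : cx / A cx <= 2 * (b k.+1 / A (b k.+1)).
    apply: (@le_trans _ _ (b k / A (b k))).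
      by apply: A_plus_ratio_mono => //; [rewrite cx0|exact: Apos].
    rewrite mulrA -bS ler_wpM2l ?(ltW (b0 _))// lef_pV2 ?posrE ?Apos//.
    by apply: A_plus_homo => //; rewrite (bS k) ler_peMl ?(ltW (b0 _))//; lra.
  move: (cx / A cx) (b k.+1 / A _) => u v uv.
  by rewrite minr_pMr// le_min !ge_min uv orbT andbT; apply/orP; left; lra.
apply: (le_trans h1).
rewrite big_mkord (bigD1 (Ordinal kK))//= indicE mem_set// mulr1 lerDl.
by apply: sumr_ge0 => l _; rewrite mulr_ge0 ?indicE// mulr_ge0.
Qed.

(** The cells contribute at most [64 * h] to the mean of [gb]. Increments with [negp x <= b K]
    contribute at most [h], since [b K / A (b K) < h] for large [K]. Dividing by [h], [levy_liminf]
    bounds the integral of [gb] by 65. *)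
Lemma necessity_negative_jumps : (\int[Pi]_x (negp x / A (negp x))%:E < +oo)%E.
Proof.
have [delta d0 hd] := nonneg_steps_start.
have mg := measurable_gb delta.
have mean_le j : mean P (fun w => gb delta (X (mesh delta j) w)) <= 65 * mesh delta j.
  set h := mesh delta j; have h0 : 0 < h by exact: mesh_gt0.
  have [K' hK'] := id_over_A_plus_small X_levy Pi_levy X_triplet Pi_abs no_drift kappa_gt1 X_lim ltr01 h0.
  pose K := K'.+1.
  have hK : b K / A (b K) < h.
    apply: le_lt_trans hK'; apply: A_plus_ratio_mono => //; last exact: Apos.
    by rewrite b0/= -/(b K') (bS K') ler_peMl ?(ltW (b0 _))//; lra.
  have mX : measurable_fun setT (X h) := measurable_funP _.
  pose S x : R := \sum_(0 <= k < K) 2 * Num.min delta (b k.+1 / A (b k.+1)) * \1_(C k) x.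
  have w0 k : 0 <= Num.min delta (b k.+1 / A (b k.+1)).
    by rewrite le_min (ltW d0) divr_ge0 ?(ltW (b0 _))// ltW// Apos.
  have S0 x : 0 <= S x.
    by apply: sumr_ge0 => l _; rewrite mulr_ge0 ?indicE// mulr_ge0.
  have gS x : gb delta x <= S x + h.
    have [xK|xK] := ltP (b K) (negp x).
      by apply: (le_trans (gb_cell d0 xK)); rewrite lerDl ltW.
    apply: (@le_trans _ _ h); last by rewrite lerDr.
    rewrite /gb ge_min; apply/orP; right.
    have [->|c0] := eqVneq (cut (negp x)) 0; first by rewrite mul0r ltW.
    have {}c0 : 0 < cut (negp x) by rewrite lt_neqAle eq_sym c0/=.
    apply: ltW; apply: le_lt_trans hK; apply: A_plus_ratio_mono => //; last exact: Apos.
    by rewrite c0/= ge_min xK.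
  have mCX k : measurable (X h @^-1` C k) by have := mX measurableT _ (mC k); rewrite setTI.
  have eS w : S (X h w) = \sum_(0 <= k < K) 2 * Num.min delta (b k.+1 / A (b k.+1)) * \1_(X h @^-1` C k) w.
    by [].
  have mS : mean P (fun w => S (X h w)) <= 64 * h.
    under [X in mean P X]eq_fun do rewrite eS.
    rewrite (mean_sum_indic P 0 K (c := fun k => 2 * Num.min delta (b k.+1 / A (b k.+1))))//; last first.
      by move=> k; rewrite mulr_ge0.
    under eq_bigr do rewrite -mulrA.
    rewrite -mulr_sumr; have := sum_cell_prob_le d0 hd j K; rewrite -/h; lra.
  pose B := \sum_(0 <= k < K) 2 * Num.min delta (b k.+1 / A (b k.+1)).
  have SB x : S x <= B.
    apply: ler_sum => k _; rewrite ler_piMr// ?mulr_ge0// indicE; case: (_ \in _) => //.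
  have mSX : measurable_fun setT (fun w => S (X h w)).
    under eq_fun do rewrite eS.
    by apply: measurable_sum => k; apply: measurable_fun_mul => //; exact: measurable_indic.
  apply: (@le_trans _ _ (mean P (fun w => S (X h w) + h))).
    apply: (@le_mean _ _ _ P _ _ (B + h)).
    - exact: (measurableT_comp mg).
    - exact: measurable_fun_add.
    - by move=> w; rewrite gb_ge0//= gS.
    - by move=> w; rewrite lerD2r.
  rewrite (@mean_add _ _ _ P _ _ B h)//; last 2 first.
  - by move=> w; rewrite S0 SB.
  - by move=> w; rewrite (ltW h0) lexx.
  by rewrite mean_cst; lra.
have gle : (\int[Pi]_x (gb delta x)%:E <= 65%:E)%E.
  rewrite leNgt; apply/negP => hlt.
  have m0 j : 0 < mesh delta j by exact: mesh_gt0.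
  have [j _ hj] := levy_liminf Pi_levy X_triplet m0 (@mesh_cvg0 R delta) mg
    (fun x => gb_ge0 x d0) (@continuous_gb delta) hlt.
  have := hj j (leqnn j).
  have mX : measurable_fun setT (X (mesh delta j)) := measurable_funP _.
  rewrite (@meanE _ _ _ P _ delta)//; last 2 first.
  - exact: (measurableT_comp mg).
  - by move=> w; rewrite gb_ge0//= /gb ge_min lexx.
  rewrite -EFinM lte_fin ltNge => /negP; apply.
  by rewrite ler_pdivrMl// mulrC.
pose rho := 1 / A 1; have rho0 : 0 < rho by rewrite divr_gt0// Apos.
(* On [[-1, 1]] the ratio is at most [rho], so the cap at [delta] costs at most the factor [k]. *)
pose k := Num.max 1 (rho / delta).
have k0 : 0 <= k by rewrite le_max ler01.
have mf : measurable_fun [set: R] (fun x : R => (negp x / A (negp x))%:E).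
  apply/measurable_EFinP; apply: measurable_fun_mul; first exact: measurable_negp.
  apply: measurable_fun_inv; apply: (measurableT_comp (measurable_A_plus Pi_levy Pi_abs)).
  exact: measurable_negp.
have f0 x : (0 <= (negp x / A (negp x))%:E)%E.
  by rewrite lee_fin divr_ge0 ?negp_ge0// (A_plus_nonneg Pi_levy Pi_abs).
rewrite (levy_integral_itv Pi_levy)//.
apply: (@le_lt_trans _ _ (\int[Pi]_(x in `[(-1)%R, 1%R]) (k%:E * (gb delta x)%:E))%E).
  apply: ge0_le_integral => //.
  - exact: measurable_funTS.
  - by apply: measurable_funTS; apply: measurable_funeM; exact/measurable_EFinP.
  - move=> x; rewrite /= in_itv/= => /andP[x1 _]; rewrite -EFinM lee_fin.
    have n1 : negp x <= 1 by rewrite ge_max ler01 andbT; lra.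
    rewrite /gb /cut (min_l n1).
    have rr : negp x / A (negp x) <= rho.
      have [->|n0] := eqVneq (negp x) 0; first by rewrite mul0r ltW.
      have {}n0 : 0 < negp x by rewrite lt_neqAle eq_sym n0 negp_ge0.
      by apply: A_plus_ratio_mono => //; [rewrite n0|exact: Apos].
    have r0 := f0 x; rewrite lee_fin in r0.
    have k1 : 1 <= k by rewrite le_max lexx.
    have k2 : rho <= k * delta by rewrite -ler_pdivrMr// le_max lexx orbT.
    by rewrite minr_pMr// le_min (le_trans rr k2)/= ler_peMl.
apply: (@le_lt_trans _ _ (\int[Pi]_x (k%:E * (gb delta x)%:E))%E).
  apply: ge0_subset_integral => //.
  - by apply: measurable_funeM; exact/measurable_EFinP.
  - by move=> x _; rewrite -EFinM lee_fin mulr_ge0// gb_ge0.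
have -> : (\int[Pi]_x (k%:E * (gb delta x)%:E) = k%:E * \int[Pi]_x (gb delta x)%:E)%E.
  apply: ge0_integralZl => //; first exact/measurable_EFinP.
  by move=> x _; rewrite lee_fin gb_ge0.
apply: lte_mul_pinfty => //; apply: (le_lt_trans gle); exact: ltry.
Qed.

End NecessityNegativeJumps.

(** * Sufficiency: summability over scales *)

Section Sums.
Context {R : realType}.

Lemma sum_uniq_le (g : nat -> R) (l s : seq nat) : (forall n, 0 <= g n) -> uniq l ->
  {subset l <= s} -> \sum_(n <- l) g n <= \sum_(n <- s) g n.
Proof.
move=> g0; elim: l s => [|x l IH] s /=.
  by move=> _ _; rewrite big_nil sumr_ge0.
move=> /andP[xl ul] ls; have xs : x \in s by apply: ls; rewrite mem_head.
rewrite big_cons (perm_big _ (perm_to_rem xs))/= big_cons lerD2l; apply: IH => // y yl.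
apply: rem_mem; first by apply: contraNneq xl => <-.
by apply: ls; rewrite inE yl orbT.
Qed.

(** For bounds at scale [i] that are the term of a convergent series at a level [f i], distinct
    scales having distinct levels. *)
Lemma sum_inj_le (g : nat -> R) (f : nat -> nat) (S : pred nat) I C : (forall n, 0 <= g n) ->
  (forall i j, (i < I)%N -> (j < I)%N -> S i -> S j -> f i = f j -> i = j) ->
  (forall B, \sum_(0 <= n < B) g n <= C) -> \sum_(0 <= i < I | S i) g (f i) <= C.
Proof.
move=> g0 fi gC; pose l := [seq i <- iota 0 I | S i].
have -> : \sum_(0 <= i < I | S i) g (f i) = \sum_(n <- map f l) g n.
  by rewrite big_map big_filter /index_iota subn0.
pose B := (\max_(n <- map f l) n).+1.
apply: (le_trans _ (gC B)); apply: sum_uniq_le => //.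
  rewrite map_inj_in_uniq; first by rewrite filter_uniq// iota_uniq.
  move=> i j; rewrite !mem_filter !mem_iota !add0n/= => /andP[Si iI] /andP[Sj jI].
  exact: fi.
by move=> n nl; rewrite mem_index_iota/= ltnS (@leq_bigmax_seq _ _ _ id).
Qed.

End Sums.

(** * Small positive variations: consequences of the first condition *)

Section SlowStartSummability.
Context (R : realType) (Pi : {measure set (measurableTypeR R) -> \bar R}).
Hypothesis Pi_levy : bounded_levy_measure Pi.
Hypothesis Pi_abs : (\int[Pi]_x `|x|%:E < +oo)%E.
Variable kappa : R.
Hypothesis kappa_gt1 : 1 < kappa.
Hypothesis HK : forall d, 0 < d -> (K_X kappa Pi d < +oo)%E.
Local Notation A := (A_plus Pi).
Local Notation p := (kappa / (kappa - 1)).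

Let k10 : 0 < kappa - 1. Proof. by rewrite subr_gt0. Qed.
Let k0 : 0 < kappa. Proof. exact: lt_trans kappa_gt1. Qed.
Let p0 : 0 < p. Proof. by rewrite divr_gt0. Qed.
Let Age0 y : 0 <= A y. Proof. exact: A_plus_nonneg. Qed.
Let Ale x y : x <= y -> A x <= A y. Proof. exact: A_plus_homo. Qed.

Lemma kx_term_sum c q : 0 < q < 1 -> 0 < c ->
  exists C, forall M, \sum_(0 <= k < M) kx_term Pi kappa c q k <= C.
Proof.
move=> q01 c0; have q0 : 0 < q by case/andP: q01.
have d0 : 0 < c * q by rewrite mulr_gt0.
have [C HC] := K_X_sum_le Pi_levy Pi_abs kappa_gt1 q01 (ltW d0) (HK d0).
by exists C => M; have := HC M; rewrite mulfK// gt_eqF.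
Qed.

(** If [A] vanished near 0, the terms of the series comparable with [K_X] would eventually equal
    1. *)
Lemma K_X_A_gt0 y : 0 < y -> 0 < A y.
Proof.
move=> y0; rewrite lt_neqAle Age0 andbT eq_sym; apply/negP => /eqP Ay.
have h01 : 0 < (2^-1 : R) < 1 by rewrite invr_gt0 ltr0n invf_lt1// ltr1n.
have [C HC] := kx_term_sum h01 ltr01.
have [k hk] := geom_lt h01 y0.
have t1 j : (k <= j)%N -> kx_term Pi kappa 1 2^-1 j = 1.
  move=> kj; rewrite /kx_term (_ : A (2^-1 ^+ j) = 0).
    by rewrite powR0 ?gt_eqF// mul0r mulr0 oppr0 expR0.
  apply/eqP; rewrite eq_le Age0 andbT -Ay Ale// (le_trans _ (ltW hk))//.
  by rewrite ler_wiXn2l//; lra.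
have := HC (k + (Num.bound `|C|).+1)%N.
rewrite (@big_cat_nat _ _ _ k)//= ?leq_addr//.
have -> : \sum_(k <= j < k + (Num.bound `|C|).+1) kx_term Pi kappa 1 2^-1 j = (Num.bound `|C|).+1%:R.
  rewrite big_nat (eq_bigr (fun=> 1)); last by move=> j /andP[kj _]; exact: t1.
  by rewrite -big_nat sumr_const_nat addKn.
have s0 : 0 <= \sum_(0 <= j < k) kx_term Pi kappa 1 2^-1 j by apply: sumr_ge0 => j _; exact: expR_ge0.
have := archi_boundP (normr_ge0 C); have := ler_norm C.
by rewrite -natr1; move: s0; move: (\sum_(_ <= _ < _) _) ((Num.bound `|C|)%:R : R) `|C| => u v z; lra.
Qed.

Let s (i : nat) : R := 2^-1 ^+ i.+1.
Let s0 i : 0 < s i. Proof. by rewrite exprn_gt0. Qed.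

(** [1 / y] is the Laplace parameter for time [s i]. Here [y] is the last point of the grid [q ^+ k]
    with [A y >= th i = 4 * C * s i ^ (kappa - 1)], so that the gain in the exponent is at least
    twice the loss [C * s i ^ kappa / y]. With [q = 2 ^ (1 - kappa)], [th] is multiplied by [q] from
    one scale to the next while [A (q * x) >= q * A x]: the grid index strictly increases, and
    distinct scales use distinct terms of the series. *)
Lemma K_X_small_prob C : 0 < C -> exists kap : nat -> R, exists i0 : nat, exists S : R,
  [/\ (forall i, 0 <= kap i), (forall I, \sum_(0 <= i < I) kap i <= S) &
   forall i, (i0 <= i)%N -> exists2 y, 0 < y &
     expR (C * s i `^ kappa / y - s i * (A y / (2 * y))) <= kap i].
Proof.
have aux (u v w : R) : 2 * u <= v -> w <= u -> u - v <= - w by lra.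
move=> C0; pose q := (2^-1 : R) `^ (kappa - 1).
have q01 : 0 < q < 1.
  rewrite powR_gt0//=; have h : (2^-1 : R) < 1 by rewrite invf_lt1// ltr1n.
  have := @gt0_ltr_powR R (kappa - 1) k10 2^-1 1; rewrite powR1; apply => //; rewrite nnegrE//.
have q0 : 0 < q by case/andP: q01.
have q1 : q < 1 by case/andP: q01.
have qk0 k : 0 < q ^+ k by exact: exprn_gt0.
pose th i := 4 * C * q ^+ i.+1.
have th0 i : 0 < th i by rewrite !mulr_gt0.
have sk i : s i `^ (kappa - 1) = q ^+ i.+1.
  have h2 : 0 <= (2^-1 : R) by rewrite invr_ge0 ler0n.
  by rewrite /s /q -(powR_mulrn i.+1 h2) -(powR_mulrn i.+1 (powR_ge0 _ _)) -!powRrM mulrC.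
have [i0 hi0] : exists i0, q ^+ i0 < A 1 / (4 * C).
  by apply: geom_lt => //; rewrite divr_gt0 ?K_X_A_gt0// mulr_gt0.
have th1 i : (i0 <= i)%N -> th i <= A 1.
  move=> ii; have : q ^+ i.+1 <= q ^+ i0 by rewrite ler_wiXn2l ?(ltW q0) ?(ltW q1)// (leq_trans ii).
  move: hi0; rewrite ltr_pdivlMr ?mulr_gt0// /th => h1 h2.
  have c4 : 0 <= 4 * C by rewrite mulr_ge0// ltW.
  by have := ler_wpM2l c4 h2; rewrite mulrC in h1; lra.
have A0c e : 0 < e -> exists k, A (q ^+ k) < e.
  move=> e0; have [d d0 Hd] := A_plus_cvg0 Pi_levy Pi_abs e0.
  have [k hk] := geom_lt q01 d0; exists k; apply: Hd.
  by rewrite (ltW (qk0 k)) ltW.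
have exk i : exists k, A (q ^+ k) < th i by exact: A0c.
pose kk i := ex_minn (exk i).
have kk1 i : A (q ^+ kk i) < th i by rewrite /kk; case: ex_minnP.
have kk2 i k : (k < kk i)%N -> th i <= A (q ^+ k).
  rewrite /kk; case: ex_minnP => m _ hm km; rewrite leNgt; apply/negP => /hm.
  by rewrite leqNgt km.
have kpos i : (i0 <= i)%N -> (0 < kk i)%N.
  move=> ii; rewrite lt0n; apply/negP => /eqP e; have := kk1 i; rewrite e expr0.
  by rewrite ltNge th1.
have kinc i j : (i < j)%N -> (i0 <= i)%N -> (kk i < kk j)%N.
  move=> ij ii; rewrite ltnNge; apply/negP => kji.
  have kj0 : (0 < kk j)%N by apply: kpos; rewrite (leq_trans ii)// ltnW.
  have h1 : th i <= A (q ^+ (kk j).-1) by apply: kk2; rewrite prednK.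
  have h2 : q * A (q ^+ (kk j).-1) <= A (q ^+ kk j).
    have c1 : 1 <= q^-1 by rewrite invf_ge1// ltW.
    have := A_plus_scale Pi_levy Pi_abs (ltW (qk0 (kk j))) c1.
    have -> : q^-1 * q ^+ kk j = q ^+ (kk j).-1.
      by rewrite -{1}(prednK kj0) exprS mulrA mulVf ?mul1r// gt_eqF.
    by rewrite mulrC ler_pdivlMr// mulrC.
  have h3 : th j <= q * th i.
    rewrite /th mulrCA -exprS ler_wpM2l ?mulr_ge0 ?(ltW C0)//.
    by rewrite ler_wiXn2l ?(ltW q0) ?(ltW q1).
  have := kk1 j; have := ler_wpM2l (ltW q0) h1; lra.
(* Normalised so that [A (q * y) < th i] bounds the exponent of the series term by
   [C * s i ^ kappa / y]; note that the power [p] of [q ^+ i.+1] is [s i ^ kappa]. *)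
pose c := C * q / (4 * C) `^ p.
have C4 : 0 < 4 * C by rewrite mulr_gt0.
have c0 : 0 < c by rewrite divr_gt0 ?powR_gt0// mulr_gt0.
have [S HS] := kx_term_sum q01 c0.
pose kap i := if (i0 <= i)%N then kx_term Pi kappa c q (kk i) else 0.
exists kap, i0, S; split.
- by move=> i; rewrite /kap; case: ifP => // _; exact: expR_ge0.
- move=> I; rewrite -big_mkcond.
  apply: (sum_inj_le (g := kx_term Pi kappa c q)) => //.
  + by move=> n; exact: expR_ge0.
  + move=> i j _ _ ii ij e; case: (ltngtP i j) => // h.
      by have := kinc _ _ h ii; rewrite e ltnn.
    by have := kinc _ _ h ij; rewrite e ltnn.
- move=> i ii; rewrite /kap ii; have kp := kpos i ii.
  exists (q ^+ (kk i).-1) => //; set y := q ^+ _.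
  have y0 : 0 < y by exact: qk0.
  have qy : q ^+ kk i = q * y by rewrite /y -exprS prednK.
  have Ay : th i <= A y by apply: kk2; rewrite prednK.
  rewrite /kx_term ler_expR qy.
  have sE : s i `^ kappa = s i * q ^+ i.+1.
    rewrite -{1}(subrK 1 kappa) powRD; last by apply/implyP => _; rewrite gt_eqF.
    by rewrite sk powRr1 ?(ltW (s0 _))// mulrC.
  have sp : s i `^ kappa = (q ^+ i.+1) `^ p.
    by rewrite -sk -powRrM; congr (_ `^ _); field; rewrite gt_eqF.
  have h1 : 2 * C * s i `^ kappa / y <= s i * (A y / (2 * y)).
    have -> : 2 * C * s i `^ kappa / y = s i * (th i / (2 * y)).
      by rewrite sE /th; field; rewrite gt_eqF.
    apply: ler_wpM2l; first exact: ltW.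
    by apply: ler_wpM2r => //; rewrite invr_ge0 mulr_ge0// ltW.
  have h2 : c * (A (q * y) `^ p / (q * y)) <= C * s i `^ kappa / y.
    have -> : c * (A (q * y) `^ p / (q * y)) = C * (A (q * y) `^ p / (4 * C) `^ p) / y.
      by rewrite /c; field; rewrite !gt_eqF// powR_gt0.
    apply: ler_wpM2r; first by rewrite invr_ge0 ltW.
    apply: ler_wpM2l; first exact: ltW.
    rewrite ler_pdivrMr ?powR_gt0// sp -powRM ?(ltW C4)// ?(ltW (qk0 _))//.
    apply: ge0_ler_powR; rewrite ?nnegrE ?Age0 ?(ltW p0)//.
      by rewrite mulr_ge0 ?(ltW C4)// ltW.
    by rewrite -qy mulrC; exact: ltW (kk1 i).
  have e : 2 * C * s i `^ kappa / y = 2 * (C * s i `^ kappa / y) by ring.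
  by rewrite e in h1; exact: aux h1 h2.
Qed.

End SlowStartSummability.

(** * Finite integrals of nonnegative functions as real numbers *)

Section NonnegIntegral.
Context d (T : measurableType d) (R : realType) (m : {measure set T -> \bar R}).
Implicit Types f g : T -> R.

Definition nnint f : R := fine (\int[m]_x (f x)%:E)%E.

Definition nnintegrable f := [/\ measurable_fun setT f, (forall x, 0 <= f x) &
  (\int[m]_x (f x)%:E < +oo)%E].

Lemma nnintE f : nnintegrable f -> (\int[m]_x (f x)%:E = (nnint f)%:E)%E.
Proof.
move=> [_ f0 fi]; rewrite /nnint fineK// ge0_fin_numE//.
by apply: integral_ge0 => x _; rewrite lee_fin.
Qed.

Lemma nnint_ge0 f : (forall x, 0 <= f x) -> 0 <= nnint f.
Proof. by move=> f0; apply: fine_ge0; apply: integral_ge0 => x _; rewrite lee_fin. Qed.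

Lemma nnintegrable_le f g : measurable_fun setT f -> (forall x, 0 <= f x <= g x) ->
  nnintegrable g -> nnintegrable f.
Proof.
move=> mf fg [mg g0 gi]; split => //; first by move=> x; case/andP: (fg x).
apply: le_lt_trans gi; apply: ge0_le_integral => //.
- by move=> x _; rewrite lee_fin; case/andP: (fg x).
- exact/measurable_EFinP.
- exact/measurable_EFinP.
- by move=> x _; rewrite lee_fin; case/andP: (fg x).
Qed.

Lemma nnintegrable_scale c f : 0 <= c -> nnintegrable f -> nnintegrable (fun x => c * f x).
Proof.
move=> c0 [mf f0 fi]; split; first exact: measurable_fun_mul.
  by move=> x; rewrite mulr_ge0.
under eq_integral do rewrite EFinM.
have -> : (\int[m]_x (c%:E * (f x)%:E) = c%:E * \int[m]_x (f x)%:E)%E.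
  by apply: ge0_integralZl => //; [exact/measurable_EFinP|move=> x _; rewrite lee_fin].
exact: lte_mul_pinfty.
Qed.

Lemma nnint_scale c f : 0 <= c -> nnintegrable f -> nnint (fun x => c * f x) = c * nnint f.
Proof.
move=> c0 df; apply: EFin_inj; rewrite EFinM -!nnintE//; last exact: nnintegrable_scale.
have [mf f0 _] := df; under eq_integral do rewrite EFinM.
by apply: ge0_integralZl => //; [exact/measurable_EFinP|move=> x _; rewrite lee_fin].
Qed.

Lemma nnint_addE f g : nnintegrable f -> nnintegrable g ->
  (\int[m]_x (f x + g x)%:E = (nnint f + nnint g)%:E)%E.
Proof.
move=> df dg; rewrite EFinD -!nnintE//.
have [mf f0 _] := df; have [mg g0 _] := dg.
under eq_integral do rewrite EFinD.
apply: ge0_integralD => //.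
- by move=> x _; rewrite lee_fin.
- exact/measurable_EFinP.
- by move=> x _; rewrite lee_fin.
- exact/measurable_EFinP.
Qed.

Lemma nnintegrable_add f g : nnintegrable f -> nnintegrable g -> nnintegrable (fun x => f x + g x).
Proof.
move=> df dg; have [mf f0 _] := df; have [mg g0 _] := dg.
split; [exact: measurable_fun_add|by move=> x; rewrite addr_ge0|].
by rewrite nnint_addE// ltry.
Qed.

Lemma nnint_add f g : nnintegrable f -> nnintegrable g ->
  nnint (fun x => f x + g x) = nnint f + nnint g.
Proof. by move=> df dg; rewrite {1}/nnint nnint_addE. Qed.

Lemma le_nnint f g : nnintegrable f -> nnintegrable g -> (forall x, f x <= g x) ->
  nnint f <= nnint g.
Proof.
move=> df dg fg; rewrite -lee_fin -!nnintE//.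
have [mf f0 _] := df; have [mg g0 _] := dg.
apply: ge0_le_integral => //.
- by move=> x _; rewrite lee_fin.
- exact/measurable_EFinP.
- exact/measurable_EFinP.
- by move=> x _; rewrite lee_fin.
Qed.

Lemma nnint_sum (f : nat -> T -> R) n k : (forall i, nnintegrable (f i)) ->
  nnintegrable (fun x => \sum_(n <= i < k) f i x) /\
  nnint (fun x => \sum_(n <= i < k) f i x) = \sum_(n <= i < k) nnint (f i).
Proof.
move=> df.
have e : (\int[m]_x (\sum_(n <= i < k) f i x)%:E = (\sum_(n <= i < k) nnint (f i))%:E)%E.
  under eq_integral do rewrite -sumEFin.
  rewrite ge0_integral_sum//.
  - by rewrite -sumEFin; apply: eq_bigr => i _; rewrite nnintE.
  - by move=> i; apply/measurable_EFinP; have [] := df i.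
  - by move=> i x _; rewrite lee_fin; have [_ ->] := df i.
split; last by rewrite {1}/nnint e.
split.
- by apply: measurable_sum => i; have [] := df i.
- by move=> x; apply: sumr_ge0 => i _; have [_ ->] := df i.
- by rewrite e ltry.
Qed.

End NonnegIntegral.

(** * Levels at which the truncated mean of the negative jumps is large *)

Section NegativeJumps.
Context (R : realType) (Pi : {measure set (measurableTypeR R) -> \bar R}).
Hypothesis Pi_levy : bounded_levy_measure Pi.
Hypothesis Pi_abs : (\int[Pi]_x `|x|%:E < +oo)%E.
Local Notation A := (A_plus Pi).
Hypothesis Apos : forall y, 0 < y -> 0 < A y.
Hypothesis Hb : (\int[Pi]_x (negp x / A (negp x))%:E < +oo)%E.

Let b (n : nat) : R := 2^-1 ^+ n.
Let b0 n : 0 < b n. Proof. by rewrite exprn_gt0. Qed.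
Let s (i : nat) : R := b i.+1.

Definition trunc_mean (a : R) : R := nnint Pi (fun x => negp x * (negp x <= a)%R%:R).
Let r (x : R) : R := negp x / A (negp x).
Let mneg : measurable_fun setT (@negp R). Proof. exact: measurable_negp. Qed.
Let Age0 y : 0 <= A y. Proof. exact: A_plus_nonneg. Qed.
Let Ale x y : x <= y -> A x <= A y. Proof. exact: A_plus_homo. Qed.

Let mr : measurable_fun setT r.
Proof.
apply: measurable_fun_mul => //; apply: measurable_fun_inv.
exact: (measurableT_comp (measurable_A_plus Pi_levy Pi_abs) mneg).
Qed.

Let r0 x : 0 <= r x. Proof. by rewrite divr_ge0 ?negp_ge0. Qed.

Lemma nnint_ratio : nnintegrable Pi r.
Proof. by split. Qed.

Lemma nnint_negp : nnintegrable Pi (@negp R).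
Proof.
apply: (@nnintegrable_le _ _ _ Pi _ (fun x : R => `|x|)) => //.
  by move=> x; rewrite negp_ge0 negp_le.
by split => //; meas.
Qed.

Let mle a : measurable_fun [set: R] (fun x : R => (negp x <= a)%R%:R : R).
Proof.
have mA : measurable [set x : measurableTypeR R | (negp x : R) <= a].
  by apply: (@measurable_le _ (measurableTypeR R) _ (fun x : R => negp x) (fun=> a)).
have -> : (fun x : R => (negp x <= a)%R%:R : R) = \1_[set x : measurableTypeR R | (negp x : R) <= a].
  apply/funext => x; rewrite indicE; case: (boolP (negp x <= a)) => h; first by rewrite mem_set.
  by rewrite memNset// => /=; apply/negP.
exact: measurable_indic.
Qed.

Lemma nnint_cut (f : R -> R) a : nnintegrable Pi f -> nnintegrable Pi (fun x => f x * (negp x <= a)%R%:R).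
Proof.
move=> df; have [mf f0 _] := df; apply: (nnintegrable_le _ _ df).
  by apply: measurable_fun_mul => //; exact: mle.
by move=> x; rewrite mulr_ge0//=; case: (negp x <= a); rewrite ?mulr1 ?mulr0.
Qed.

Lemma trunc_mean_ge0 a : 0 <= trunc_mean a.
Proof. by apply: nnint_ge0 => x; rewrite mulr_ge0// negp_ge0. Qed.

Lemma trunc_mean_mono a c : a <= c -> trunc_mean a <= trunc_mean c.
Proof.
move=> ac; apply: le_nnint; [exact/nnint_cut/nnint_negp|exact/nnint_cut/nnint_negp|].
move=> x; rewrite ler_wpM2l ?negp_ge0//; case: (leP (negp x) a) => h //.
by rewrite (le_trans h ac).
Qed.

Lemma trunc_mean_le a : trunc_mean a <= nnint Pi (@negp R).
Proof.
apply: le_nnint; [exact/nnint_cut/nnint_negp|exact: nnint_negp|].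
by move=> x; case: (negp x <= a); rewrite ?mulr1 ?mulr0 ?negp_ge0.
Qed.

Let xi a := nnint Pi (fun x => r x * (negp x <= a)%R%:R).

Let xi_ge0 a : 0 <= xi a.
Proof. by apply: nnint_ge0 => x; rewrite mulr_ge0. Qed.

Let xi_mono a c : a <= c -> xi a <= xi c.
Proof.
move=> ac; apply: le_nnint; [exact/nnint_cut/nnint_ratio|exact/nnint_cut/nnint_ratio|].
move=> x; rewrite ler_wpM2l//; case: (leP (negp x) a) => h //.
by rewrite (le_trans h ac).
Qed.

Let xi_cvg0 e : 0 < e -> exists N, xi (b N) < e.
Proof.
move=> e0; pose F (n : nat) (x : R) := (r x * (negp x <= b n)%R%:R)%:E.
have : (\int[Pi]_x F n x @[n --> \oo] --> 0)%E.
  have := @dominated_convergence _ _ _ Pi setT measurableT F (cst 0%E) (fun x => (r x)%:E).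
  case.
  - by move=> n; apply/measurable_EFinP; apply: measurable_fun_mul => //; exact: mle.
  - exact: measurable_cst.
  - apply: aeW => x _; apply: cvg_near_cst.
    have [nx|nx] := leP (negp x) 0.
      apply: nearW => n; rewrite /F /r; have -> : negp x = 0 by apply/eqP; rewrite eq_le nx negp_ge0.
      by rewrite mul0r mul0r.
    have h01 : 0 < (2^-1 : R) < 1 by rewrite invr_gt0 ltr0n invf_lt1// ltr1n.
    have [k hk] := geom_lt h01 nx.
    exists k => // n /= kn; rewrite /F leNgt (le_lt_trans _ hk) ?mulr0//.
    by rewrite /b ler_wiXn2l//; lra.
  - apply/integrableP; split; first exact/measurable_EFinP.
    have -> : (\int[Pi]_x `|(r x)%:E| = \int[Pi]_x (r x)%:E)%E.
      by apply: eq_integral => x _; rewrite gee0_abs// lee_fin.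
    exact: Hb.
  - apply: aeW => x n _; rewrite /F; have p0 : 0 <= r x * (negp x <= b n)%R%:R by exact: mulr_ge0.
    rewrite gee0_abs ?lee_fin//.
    by case: (negp x <= b n); rewrite ?mulr1 ?mulr0.
  by move=> _ _; rewrite integral0.
have := @open_ereal_lt' R 0%E e%:E; rewrite lte_fin e0 => /(_ isT) h0 hc.
have [N _ HN] : \forall n \near \oo, (\int[Pi]_x F n x < e%:E)%E := hc _ h0.
exists N; rewrite -lte_fin -nnintE; last exact/nnint_cut/nnint_ratio.
exact: HN (leqnn N).
Qed.

Lemma nnint_shell y a : nnintegrable Pi (fun x => r x * ((negp x <= a)%R && (y < negp x)%R)%:R).
Proof.
apply: (nnintegrable_le _ _ (nnint_cut a nnint_ratio)).
  have -> : (fun x : R => r x * ((negp x <= a)%R && (y < negp x)%R)%:R) =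
     (fun x => r x * ((negp x <= a)%R%:R * (1 - (negp x <= y)%R%:R))).
    apply/funext => x; congr (_ * _); rewrite ltNge; case: (negp x <= a); case: (negp x <= y) => /=; lra.
  by apply: measurable_fun_mul => //; apply: measurable_fun_mul; [exact: mle|apply: measurable_fun_sub; [by []|exact: mle]].
move=> x; rewrite mulr_ge0//= ler_wpM2l//.
by case: (negp x <= a); case: (y < negp x).
Qed.

(** Write [negp x] as [A (negp x) * r x] and bound the first factor by [A y] on jumps up to [y], by
    [A a] on the shell above. *)
Lemma trunc_mean_le_A y a : 0 <= y <= a ->
  trunc_mean a <= A y * xi y + A a * nnint Pi (fun x => r x * ((negp x <= a)%R && (y < negp x)%R)%:R).
Proof.
move=> /andP[y0 ya].
have d1 := nnint_cut y nnint_ratio.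
have d2 := nnint_shell y a.
rewrite /xi -!nnint_scale// -nnint_add; try exact: nnintegrable_scale.
apply: le_nnint; [exact/nnint_cut/nnint_negp|by apply: nnintegrable_add; exact: nnintegrable_scale|].
move=> x; have nE : negp x = A (negp x) * r x.
  rewrite /r; have [->|n0] := eqVneq (negp x) 0; first by rewrite mul0r mulr0.
  by rewrite mulrCA divff ?mulr1// gt_eqF// Apos// lt_neqAle eq_sym n0 negp_ge0.
rewrite {1}nE; have [xa|xa] := leP (negp x) a; last first.
  by rewrite mulr0 addr_ge0// mulr_ge0// mulr_ge0.
rewrite /= mulr1; have [xy|xy] := leP (negp x) y.
  by rewrite mulr1 mulr0 mulr0 addr0 ler_wpM2r// Ale.
by rewrite mulr0 mulr0 add0r mulr1 ler_wpM2r// Ale.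
Qed.

(* Negation of the condition under which [block_jump_prob] bounds, at time [s i], the
   probability that the negative variation exceeds [b n / 4]. *)
Definition heavy (i n : nat) : bool :=
  (0 < n)%N && (b n / 32 < s i * trunc_mean (b n / 4))%R.

(** Paired with the 256 in [lev]: as [256 / 512 = 1 / 2], jumps below the chosen level carry at most
    half of the truncated mean, and [lev_ge] holds already at level 0. *)
Let small_a : exists N, forall n, (N <= n)%N -> xi (b n / 4) <= 512^-1.
Proof.
have e0 : 0 < 512^-1 :> R by rewrite invr_gt0 ltr0n.
have [N hN] := xi_cvg0 e0; exists N => n Nn; apply/ltW/(le_lt_trans _ hN)/xi_mono.
apply: (@le_trans _ _ (b n)).
  by rewrite ler_pdivrMr// ler_peMr ?(ltW (b0 n))// ler1n.
by rewrite /b ler_wiXn2l// ?invf_le1// ler1n.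
Qed.

(** The truncated means are bounded, so at short times a heavy level must have a large index. *)
Let heavy_large N : exists i0, forall i n, (i0 <= i)%N -> heavy i n -> (N < n)%N.
Proof.
pose M := nnint Pi (@negp R) + 1.
have M0 : 0 < M by rewrite ltr_wpDl// nnint_ge0// => x; exact: negp_ge0.
have h01 : 0 < (2^-1 : R) < 1 by rewrite invr_gt0 ltr0n invf_lt1// ltr1n.
have e0 : 0 < b N / 32 / M by rewrite !divr_gt0.
have [i0 hi] := geom_lt h01 e0.
exists i0 => i n ii /andP[n0 hn]; rewrite ltnNge; apply/negP => nN.
move: hn; apply/negP; rewrite -leNgt.
apply: (@le_trans _ _ (s i * M)).
  have hm : trunc_mean (b n / 4) <= M by apply: (le_trans (trunc_mean_le _)); rewrite /M lerDl.
  exact: (ler_wpM2l (ltW (b0 i.+1)) hm).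
apply: (@le_trans _ _ (b N / 32)).
  rewrite -ler_pdivlMr//; apply: ltW; apply: le_lt_trans hi.
  by rewrite /s /b ler_wiXn2l ?leqW//; lra.
apply: ler_wpM2r => //; rewrite /b ler_wiXn2l//; lra.
Qed.

Let level_ex (a : R) : 0 < trunc_mean a -> exists k, A (2^-1 ^+ k.+1 * a) < 256 * trunc_mean a.
Proof.
move=> m0; have e0 : 0 < 256 * trunc_mean a by rewrite pmulr_rgt0 ?ltr0n.
have [d d0 Hd] := A_plus_cvg0 Pi_levy Pi_abs e0.
have h01 : 0 < (2^-1 : R) < 1 by rewrite invr_gt0 ltr0n invf_lt1// ltr1n.
have a1 : 0 < d / (`|a| + 1) by rewrite divr_gt0// ltr_wpDl.
have [k hk] := geom_lt h01 a1; exists k.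
apply: (@le_lt_trans _ _ (A (2^-1 ^+ k * `|a|))).
  apply: Ale; apply: (@le_trans _ _ (2^-1 ^+ k.+1 * `|a|)).
    by rewrite ler_wpM2l ?ler_norm// exprn_ge0.
  by rewrite ler_wpM2r// ler_wiXn2l//; lra.
apply: Hd; rewrite mulr_ge0 ?exprn_ge0//=.
move: hk; rewrite ltr_pdivlMr ?ltr_wpDl// => /ltW; apply: le_trans.
by rewrite ler_wpM2l ?exprn_ge0// lerDl.
Qed.

(* The last dyadic level, going down from [b n / 4], at which [A] still dominates the
   truncated mean. *)
Let lev (n : nat) : nat :=
  match pselect (0 < trunc_mean (b n / 4)) with
  | left h => ex_minn (level_ex h)
  | right _ => 0%N
  end.

Let lev_lt n : 0 < trunc_mean (b n / 4) ->
  A (2^-1 ^+ (lev n).+1 * (b n / 4)) < 256 * trunc_mean (b n / 4).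
Proof.
move=> h; rewrite /lev; case: pselect => // h'.
by case: ex_minnP.
Qed.

Let lev_ge N n : (forall n, (N <= n)%N -> xi (b n / 4) <= 512^-1) -> (N <= n)%N ->
  0 < trunc_mean (b n / 4) -> 256 * trunc_mean (b n / 4) <= A (2^-1 ^+ lev n * (b n / 4)).
Proof.
move=> HN Nn h; rewrite /lev; case: pselect => // h'.
case: ex_minnP => -[|k] _ hk.
  rewrite expr0 mul1r; set a := b n / 4.
  have a0 : 0 < a by rewrite divr_gt0.
  have ha : 0 <= a <= a by rewrite (ltW a0) lexx.
  have := trunc_mean_le_A ha.
  rewrite [X in _ <= _ + A a * X](_ : _ = 0) ?mulr0 ?addr0; last first.
    rewrite /nnint integral0_eq// => x _.
    by case: (leP (negp x) a) => /=; rewrite mulr0.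
  have := HN n Nn; rewrite -/a => h1 h2.
  have := ler_wpM2l (Age0 a) h1; have := Age0 a; lra.
by rewrite leNgt; apply/negP => /hk; rewrite ltnn.
Qed.

Let u (n : nat) : R := 2 ^+ lev n.
Let level_bound (N n : nat) : R :=
  if (N <= n)%N && (0 < trunc_mean (b n / 4)) then expR (- (8 * u n)) else 0.

(** Spreads [r x] over the levels [n] with [2 ^- n] near [4 * negp x]: the sum over [n] is at most
    [256 * r x], so quantities bounded by the integrals of these kernels are summable in [n]. *)
Definition dyadic_kernel n x := r x * (64 * Num.min (4 * negp x * 2 ^+ n) (4 * negp x * 2 ^+ n)^-1).

Lemma dyadic_kernel_ge0 n x : 0 <= dyadic_kernel n x.
Proof.
rewrite mulr_ge0// mulr_ge0// le_min invr_ge0 andbb mulr_ge0 ?exprn_ge0//.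
by rewrite mulr_ge0// negp_ge0.
Qed.

Lemma dyadic_kernel_sum x M : \sum_(0 <= n < M) dyadic_kernel n x <= 256 * r x.
Proof.
rewrite -mulr_sumr -mulr_sumr mulrC.
have [n0|n0] := eqVneq (negp x) 0; first by rewrite /r n0 mul0r !mulr0.
apply: ler_wpM2r => //.
have z0 : 0 < 4 * negp x by rewrite mulr_gt0// lt_neqAle eq_sym n0 negp_ge0.
by have := sum_min_geom M z0; lra.
Qed.

Lemma nnint_dyadic_kernel n : nnintegrable Pi (dyadic_kernel n).
Proof.
apply: (@nnintegrable_le _ _ _ Pi _ (fun x => 256 * r x)).
- apply: measurable_fun_mul => //; apply: measurable_fun_mul => //.
  apply: measurable_fun_min.
    by apply: measurable_fun_mul => //; apply: measurable_fun_mul.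
  by apply: measurable_fun_inv; apply: measurable_fun_mul => //; apply: measurable_fun_mul.
- move=> x; rewrite dyadic_kernel_ge0/=; apply: le_trans (dyadic_kernel_sum x n.+1).
  by rewrite big_nat_recr//= lerDr sumr_ge0// => i _; exact: dyadic_kernel_ge0.
- exact: (nnintegrable_scale (ler0n R 256) nnint_ratio).
Qed.

(** With [a = b n / 4] and [Y = a / (2 * u n)], jumps up to [Y] carry at most half of
    [trunc_mean a], because [A Y < 256 * trunc_mean a]. As [A a <= 2 * u n * A Y], the shell []Y,
    a]] has ratio mass [z >= 1 / (1024 * u n)]. Then [exp (- 8 u) <= 1 / (32 u^2) <= (32 / u) * z],
    and on the shell [32 / u < 64 * negp x / a], which is the weight in the kernel. *)
Let level_bound_le N n : (forall n, (N <= n)%N -> xi (b n / 4) <= 512^-1) ->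
  level_bound N n <= nnint Pi (dyadic_kernel n).
Proof.
have aux (m X Y Z xY xi1 u1 : R) : 0 < m -> 0 < u1 -> 0 <= X -> X < 256 * m -> 0 <= xY -> xY <= 512^-1 ->
    m <= X * xY + Y * Z -> Y <= 2 * u1 * X -> 0 <= Z -> 1 <= 1024 * u1 * Z.
  move=> m0 u0 X0 Xm y0 y1 h hY Z0.
  have h1 : X * xY <= 256 * m * 512^-1 by apply: ler_pM => //; exact: ltW.
  have h2 : Y * Z <= 2 * u1 * (256 * m) * Z.
    by rewrite ler_wpM2r// (le_trans hY)// ler_wpM2l ?mulr_ge0 ?(ltW u0)// ltW.
  have h3 : 0 <= m * (1024 * u1 * Z - 1) by move: h h1 h2; lra.
  by move: h3; rewrite pmulr_rge0// subr_ge0.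
move=> HN; rewrite /level_bound.
case: ifP => [/andP[Nn m0]|_]; last first.
  by apply: nnint_ge0 => x; exact: dyadic_kernel_ge0.
pose a := b n / 4; have a0 : 0 < a by rewrite divr_gt0.
rewrite -/a in m0; set Y := 2^-1 ^+ (lev n).+1 * a.
have u0 : 0 < u n by exact: exprn_gt0.
have Y0 : 0 < Y by rewrite mulr_gt0// exprn_gt0.
have aY : a = 2 * u n * Y.
  by rewrite /Y /u mulrA -exprS -exprMn divff// expr1n mul1r.
have u1 : 1 <= u n by rewrite /u exprn_ege1// ler1n.
have Ya : 0 <= Y <= a by rewrite (ltW Y0)/= aY ler_peMl ?(ltW Y0)//; move: u1; lra.
set z := nnint Pi (fun x => r x * ((negp x <= a)%R && (Y < negp x)%R)%:R).
have z0 : 0 <= z by apply: nnint_ge0 => x; rewrite mulr_ge0.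
have xiY : xi Y <= xi a by apply: xi_mono; case/andP: Ya.
have hz : 1 <= 1024 * u n * z.
  apply: (aux (trunc_mean a) (A Y) (A a) z (xi Y) 0) => //.
  - exact: lev_lt.
  - exact: (le_trans xiY (HN n Nn)).
  - exact: trunc_mean_le_A.
  - rewrite {1}aY; apply: A_plus_scale => //; first exact: ltW.
    by move: u1; lra.
have hE : expR (- (8 * u n)) <= 32 / u n * z.
  rewrite expRN; apply: (@le_trans _ _ ((32 * u n ^+ 2)^-1 * (1024 * u n * z))).
    rewrite -[leLHS]mulr1; apply: ler_pM => //.
    rewrite lef_pV2 ?posrE ?expR_gt0 ?mulr_gt0 ?exprn_gt0//.
    have := @expR_ge1Dxn R (8 * u n) 1.
    have -> : (8 * u n) ^+ 2 / 2`!%:R = 32 * u n ^+ 2 by rewrite exprMn (_ : 2`! = 2%N)//; field.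
    have u8 : 0 <= 8 * u n by rewrite mulr_ge0 ?(ltW u0).
    by move=> /(_ u8); apply: le_trans; rewrite lerDr.
  by rewrite le_eqVlt; apply/orP; left; apply/eqP; field; rewrite gt_eqF.
apply: (le_trans hE).
have c0 : 0 <= 32 / u n by rewrite divr_ge0// ltW.
have dz : nnintegrable Pi (fun x => r x * ((negp x <= a)%R && (Y < negp x)%R)%:R) by exact: nnint_shell.
rewrite -nnint_scale//; apply: le_nnint; [exact: nnintegrable_scale|exact: nnint_dyadic_kernel|].
move=> x; have [xa|xa] := leP (negp x) a; last by rewrite mulr0 mulr0 dyadic_kernel_ge0.
have [xY|xY] := leP (negp x) Y; first by rewrite mulr0 mulr0 dyadic_kernel_ge0.
rewrite /= mulr1 mulrC /dyadic_kernel ler_wpM2l//.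
have zE : 4 * negp x * 2 ^+ n = negp x / a.
  rewrite /a /b exprVn invfM invrK invrK; ring.
have x0 : 0 < negp x by exact: lt_trans xY.
have z1 : negp x / a <= 1 by rewrite ler_pdivrMr ?mul1r.
have z0' : 0 < negp x / a by rewrite divr_gt0.
rewrite zE min_l; last by rewrite (le_trans z1)// invf_ge1.
rewrite ler_pdivrMr// mulrA mulrAC ler_pdivlMr//.
move: xY; rewrite -(@ltr_pM2l _ (2 * u n)) ?mulr_gt0// -aY => xY; move: xY; move: (u n) => v; lra.
Qed.

(** At the first heavy level [n], with [a = b n / 4] and [y] chosen by [lev], [A y] is at least 256
    times the truncated mean. Heaviness makes the gain in the exponent at least [16 * a / y],
    against the loss [2 * b n / y = 8 * a / y]. What remains is [exp (- 8 * u n)]. *)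
Lemma heavy_small_prob : exists beta : nat -> R, exists i0 : nat, exists S : R,
  [/\ (forall i, 0 <= beta i), (forall I, \sum_(0 <= i < I) beta i <= S) &
   forall i n, (i0 <= i)%N -> heavy i n -> (forall k, heavy i k -> (n <= k)%N) ->
    exists2 y, 0 < y & expR (2 * b n / y - s i * (A y / (2 * y))) <= beta i].
Proof.
have [N HN] := small_a.
have [i0 Hi] := heavy_large N.+1.
pose first i : nat := match pselect (exists n, heavy i n) with
  | left h => ex_minn h | right _ => 0%N end.
pose ok i : bool := (i0 <= i)%N && `[< exists n, heavy i n >].
have firstP i : ok i -> heavy i (first i) /\ (forall k, heavy i k -> (first i <= k)%N).
  move=> /andP[_ /asboolP h]; rewrite /first; case: pselect => // h'.
  by case: ex_minnP.
(* If level [n.+1] is heavy at a later scale, level [n] is heavy at an earlier one: [b] and, at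
   least, [s] double while the truncated mean does not decrease. So the first heavy levels of
   distinct scales differ. *)
have inc i j : (i < j)%N -> ok i -> ok j -> (first i < first j)%N.
  move=> ij oi oj; have [hi mi] := firstP i oi; have [hj mj] := firstP j oj.
  have i0j : (i0 <= j)%N by case/andP: oj.
  have fj : (N.+1 < first j)%N by exact: Hi hj.
  rewrite -(ltn_predK fj) ltnS; apply: mi.
  have [n En] : exists n, first j = n.+1 by exists (first j).-1; rewrite (ltn_predK fj).
  move: hj fj; rewrite En /= /heavy => /andP[_ hj] fj.
  apply/andP; split; first by rewrite ltnS in fj; exact: leq_ltn_trans fj.
  have bn : b n = 2 * b n.+1 by rewrite /b exprS mulrA divff ?mul1r.
  have sj : 2 * s j <= s i.
    have -> : s i = 2 * s i.+1 by rewrite /s /b (exprS _ i.+1) mulrA divff ?mul1r.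
    by rewrite ler_wpM2l// /s /b ler_wiXn2l//; lra.
  have m1 : trunc_mean (b n.+1 / 4) <= trunc_mean (b n / 4).
    by apply: trunc_mean_mono; rewrite ler_wpM2r// bn ler_peMl ?(ltW (b0 _))//; lra.
  have m0 := trunc_mean_ge0 (b n.+1 / 4).
  have s0 : 0 < s j by exact: b0.
  apply: (@lt_le_trans _ _ (2 * (s j * trunc_mean (b n.+1 / 4)))).
    by rewrite bn; lra.
  rewrite mulrA; apply: ler_pM => //; rewrite mulr_ge0// ltW//.
pose beta i := if ok i then level_bound N (first i) else 0.
have g0 n : 0 <= level_bound N n by rewrite /level_bound; case: ifP => // _; exact: expR_ge0.
exists beta, i0, (256 * nnint Pi r); split.
- by move=> i; rewrite /beta; case: ifP.
- move=> I; rewrite -big_mkcond/=; apply: sum_inj_le => //.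
    move=> i j _ _ oi oj e; case: (ltngtP i j) => // h.
      by have := inc _ _ h oi oj; rewrite e ltnn.
    by have := inc _ _ h oj oi; rewrite e ltnn.
  move=> B; apply: (@le_trans _ _ (\sum_(0 <= n < B) nnint Pi (dyadic_kernel n))).
    by apply: ler_sum => n _; exact: level_bound_le.
  have [d1 <-] := nnint_sum 0 B nnint_dyadic_kernel.
  rewrite -(nnint_scale (ler0n R 256) nnint_ratio).
  apply: (le_nnint d1 (nnintegrable_scale (ler0n R 256) nnint_ratio)) => x; exact: dyadic_kernel_sum.
- move=> i n ii hin hmin.
  have oi : ok i by rewrite /ok ii/=; apply/asboolP; exists n.
  have fn : first i = n.
    have [h1 h2] := firstP i oi; apply/eqP; rewrite eqn_leq h2//=; exact: hmin.
  have Nn : (N <= n)%N by apply: ltnW; apply: ltnW; exact: Hi hin.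
  have /andP[n0 hh] := hin.
  have s0 : 0 < s i by exact: b0.
  have m0 : 0 < trunc_mean (b n / 4).
    have : 0 < s i * trunc_mean (b n / 4) by apply: lt_trans hh; rewrite divr_gt0.
    by rewrite pmulr_rgt0.
  rewrite /beta oi fn /level_bound Nn m0/=.
  pose a := b n / 4; have a0 : 0 < a by rewrite divr_gt0.
  exists (2^-1 ^+ lev n * a); first by rewrite mulr_gt0// exprn_gt0.
  rewrite ler_expR; set y := _ * a.
  have ua : u n = a / y by rewrite /u /y exprVn invfM invrK mulrCA divff ?mulr1// gt_eqF.
  have y0 : 0 < y by rewrite mulr_gt0// exprn_gt0.
  have hA := lev_ge HN Nn m0; rewrite -/a -/y in hA.
  rewrite ua.
  have e1 : 2 * b n / y = 8 * (a / y) by rewrite /a; field; rewrite gt_eqF.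
  have e2 : 16 * (a / y) <= s i * (A y / (2 * y)).
    have -> : s i * (A y / (2 * y)) = (s i * A y / 2) / y by field; rewrite gt_eqF.
    rewrite mulrA ler_wpM2r ?invr_ge0 ?(ltW y0)//.
    have := ler_wpM2l (ltW s0) hA; rewrite -/a in hh.
    have -> : s i * (256 * trunc_mean a) = 256 * (s i * trunc_mean a) by ring.
    have : b n = 4 * a by rewrite /a; field.
    move: hh; move: (s i * trunc_mean a) (s i * A y) => v w; rewrite /a; lra.
  rewrite e1; move: e2; move: (a / y) (s i * _) => v w; lra.
Qed.

End NegativeJumps.

(** * A smooth truncated second moment of the negative jumps *)

Section SquareJumps.
Context (R : realType) (Pi : {measure set (measurableTypeR R) -> \bar R}).
Hypothesis Pi_levy : bounded_levy_measure Pi.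
Hypothesis Pi_abs : (\int[Pi]_x `|x|%:E < +oo)%E.
Local Notation A := (A_plus Pi).

Let b (n : nat) : R := 2^-1 ^+ n.
Let b0 n : 0 < b n. Proof. by rewrite exprn_gt0. Qed.
Let s (i : nat) : R := b i.+1.
Let s0 i : 0 < s i. Proof. exact: b0. Qed.
Let mneg : measurable_fun setT (@negp R). Proof. exact: measurable_negp. Qed.

Let exp_gap (v : R) : 0 <= v -> 0 <= 1 - expR (- v) <= Num.min v 1.
Proof.
move=> v0; have := expR_ge1Dx (- v); have := expR_ge0 (- v).
have : expR (- v) <= 1 by rewrite -[leRHS]expR0 ler_expR oppr_le0.
by rewrite le_min; move: (expR (- v)) => e; lra.
Qed.

(** Equals $2\phi(1/a)-\phi(2/a)$ for the Laplace exponent $\phi$ of the negative jumps; in this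
    form it governs the variance of [exp (- Z / a)] in [block_jump_prob]. *)
Definition jump_square (a : R) : R := nnint Pi (fun x => (1 - expR (- (negp x / a))) ^+ 2).

Lemma nnint_jump_square a : 0 < a -> nnintegrable Pi (fun x => (1 - expR (- (negp x / a))) ^+ 2).
Proof.
move=> a0; apply: (@nnintegrable_le _ _ _ Pi _ (fun x => a^-1 * negp x)).
- have m1 : measurable_fun [set: R] (fun x : R => 1 - expR (- (negp x / a))).
    apply: measurable_fun_sub => //; apply: measurable_fun_exp; apply: measurable_fun_opp.
    exact: measurable_fun_mul.
  by under eq_fun do rewrite expr2; exact: measurable_fun_mul.
- move=> x; have v0 : 0 <= negp x / a by rewrite divr_ge0 ?negp_ge0 ?ltW.
  have := exp_gap v0; rewrite le_min => /andP[h1 /andP[h2 h3]].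
  rewrite exprn_ge0//= (mulrC a^-1) expr2 -[leRHS]mulr1; exact: ler_pM.
- by apply: nnintegrable_scale; [rewrite invr_ge0 ltW|exact: nnint_negp].
Qed.

Lemma jump_square_ge0 a : 0 <= jump_square a.
Proof. by apply: nnint_ge0 => x; rewrite sqr_ge0. Qed.

Let Q n := jump_square (b n / 4).

Lemma jump_square_mono a c : 0 < a <= c -> jump_square c <= jump_square a.
Proof.
move=> /andP[a0 ac]; have c0 : 0 < c by exact: lt_le_trans ac.
apply: le_nnint; [exact: nnint_jump_square|exact: nnint_jump_square|].
move=> x; have v0 : 0 <= negp x / c by rewrite divr_ge0 ?negp_ge0 ?ltW.
apply: lerXn2r; rewrite ?nnegrE.
- by case/andP: (exp_gap v0).
- have v1 : 0 <= negp x / a by rewrite divr_ge0 ?negp_ge0 ?ltW.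
  by case/andP: (exp_gap v1).
rewrite lerD2l lerN2 ler_expR lerN2 ler_wpM2l ?negp_ge0// lef_pV2 ?posrE//.
Qed.

(** With $E=e^{-u}$ the difference of squares is $(2+E)(1-E)^2E\le3u^2E$, and the exponential
    absorbs the remaining polynomial. The factor [1 + 4 / u] is the loss in [square_step]. *)
Let exp_step (u : R) : 0 < u ->
  (1 + 4 / u) * ((1 - expR (- (2 * u))) ^+ 2 - (1 - expR (- u)) ^+ 2) <= 48 * Num.min u u^-1.
Proof.
move=> u0; have := exp_gap (ltW u0); rewrite le_min => /andP[h1 /andP[h2 _]].
have -> : expR (- (2 * u)) = expR (- u) ^+ 2 by rewrite -expRM_natl mulrN.
have E0 := expR_gt0 (- u).
have EV : expR (- u) * expR u = 1 by rewrite -expRD addNr expR0.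
have F1 := expR_ge1Dx u.
have F2 := expr_le_expR 2 (ltW u0); rewrite (_ : 2`! = 2%N)// in F2.
have F3 := expr_le_expR 3 (ltW u0); rewrite (_ : 3`! = 6%N)// in F3.
move: h1 h2 E0 EV F1 F2 F3; move: (expR (- u)) (expR u) => E F h1 h2 E0 EV F1 F2 F3.
have D3 : (1 - E ^+ 2) ^+ 2 - (1 - E) ^+ 2 <= 3 * u ^+ 2 * E.
  have -> : (1 - E ^+ 2) ^+ 2 - (1 - E) ^+ 2 = (2 + E) * (1 - E) ^+ 2 * E by ring.
  rewrite ler_wpM2r ?(ltW E0)//; apply: ler_pM; [lra|exact: sqr_ge0|lra|].
  by apply: lerXn2r => //; rewrite nnegrE ltW.
have c0 : 0 <= 1 + 4 / u by rewrite addr_ge0// divr_ge0// ltW.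
apply: (le_trans (ler_wpM2l c0 D3)).
have -> : (1 + 4 / u) * (3 * u ^+ 2 * E) = 3 * (u ^+ 2 + 4 * u) * E by field; rewrite gt_eqF.
have key z : u ^+ 2 + 4 * u <= 16 * z * F -> 3 * (u ^+ 2 + 4 * u) * E <= 48 * z.
  move=> h; have := ler_wpM2r (ltW E0) h.
  rewrite -[16 * z * F * E]mulrA (mulrC F) EV mulr1; lra.
rewrite minr_pMr// le_min; apply/andP; split; apply: key.
  have := ler_wpM2l (ltW u0) F1; rewrite expr2; move: u0 F1; move: (u * F) => G; nra.
rewrite -(ler_pM2l u0) mulrDr -exprS.
have -> : u * (16 * u^-1 * F) = 16 * F by field; rewrite gt_eqF.
move: F2 F3; rewrite !exprS expr0 !mulr1; nra.
Qed.

Section Levels.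
Hypothesis Apos : forall y, 0 < y -> 0 < A y.
Hypothesis Hb : (\int[Pi]_x (negp x / A (negp x))%:E < +oo)%E.

Let r (x : R) : R := negp x / A (negp x).

(** Pointwise with [u = negp x / (b n / 4)]: [b n / A (b n)] is at most [r x] for jumps of size at
    least [b n], and at most [r x * (4 / u)] for smaller ones. Then [exp_step] applies, and
    [16 * 48 = 12 * 64]. *)
Let square_step n :
  16 * (b n / A (b n)) * (Q n.+1 - Q n) <= 12 * nnint Pi (dyadic_kernel Pi n).
Proof.
have c0 : 0 <= 16 * (b n / A (b n)) by rewrite mulr_ge0// divr_ge0// ltW// Apos.
rewrite mulrBr lerBlDl.
have d1 := nnint_jump_square (divr_gt0 (b0 n.+1) (ltr0n R 4)).
have d2 := nnint_jump_square (divr_gt0 (b0 n) (ltr0n R 4)).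
have dk := nnint_dyadic_kernel Pi_levy Pi_abs Hb n.
have c12 : 0 <= 12 :> R by rewrite ler0n.
have i1 := nnintegrable_scale c0 d1; have i2 := nnintegrable_scale c0 d2.
have i3 := nnintegrable_scale c12 dk.
rewrite /Q /jump_square -(nnint_scale c0 d1) -(nnint_scale c0 d2) -(nnint_scale c12 dk) -(nnint_add i2 i3).
apply: (le_nnint i1 (nnintegrable_add i2 i3)).
move=> x; have [n0|n0] := eqVneq (negp x) 0.
  rewrite n0 !mul0r oppr0 expR0 subrr expr0n/= mulr0 add0r mulr_ge0//; exact: dyadic_kernel_ge0.
have x0 : 0 < negp x by rewrite lt_neqAle eq_sym n0 negp_ge0.
pose u := 4 * negp x * 2 ^+ n; have u0 : 0 < u by rewrite !mulr_gt0 ?exprn_gt0.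
have -> : negp x / (b n / 4) = u by rewrite /u /b exprVn invfM !invrK; ring.
have -> : negp x / (b n.+1 / 4) = 2 * u by rewrite /u /b exprVn invfM !invrK exprS; ring.
have rat : b n / A (b n) <= r x * (1 + 4 / u).
  have r1 : 0 <= r x by rewrite divr_ge0 ?negp_ge0 ?ltW ?Apos.
  have [xb|xb] := leP (b n) (negp x).
    apply: (@le_trans _ _ (r x)).
      by apply: A_plus_ratio_mono => //; [rewrite b0|exact: Apos].
    by rewrite ler_peMr// lerDl divr_ge0// ltW.
  apply: (@le_trans _ _ (r x * (4 / u))).
    have -> : r x * (4 / u) = b n / A (negp x).
      rewrite /r /u /b exprVn; field; rewrite !gt_eqF ?exprn_gt0//; exact: Apos.
    rewrite ler_wpM2l ?(ltW (b0 _))// lef_pV2 ?posrE ?Apos//.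
    by apply: A_plus_homo => //; exact: ltW.
  by rewrite ler_wpM2l// lerDr.
rewrite -lerBlDl -mulrBr /dyadic_kernel -/u -/(r x).
have h := exp_step u0.
set D := _ - _ in h *.
have D0 : 0 <= D.
  rewrite subr_ge0; apply: lerXn2r; rewrite ?nnegrE.
  - by case/andP: (exp_gap (ltW u0)).
  - have u2 : 0 <= 2 * u by rewrite mulr_ge0// ltW.
    by case/andP: (exp_gap u2).
  by rewrite lerD2l lerN2 ler_expR lerN2; move: u0; lra.
apply: (@le_trans _ _ (16 * (r x * (1 + 4 / u)) * D)).
  by rewrite ler_wpM2r// ler_wpM2l.
have r1 : 0 <= 16 * r x by rewrite mulr_ge0// divr_ge0 ?negp_ge0 ?ltW ?Apos.
have := ler_wpM2l r1 h; move: (Num.min _ _) => m; lra.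
Qed.

(** With [v = s i * phi] running through a geometric progression, $ve^{-v}\le2\min(v,1/v)$ and
    [sum_min_geom] applies. *)
Let exp_sum (phi : R) I : 0 < phi -> \sum_(0 <= i < I) s i * expR (- (s i * phi)) <= 8 / phi.
Proof.
move=> p0; have z0 : 0 < 2 / phi by rewrite divr_gt0.
apply: (@le_trans _ _ (2 / phi * \sum_(0 <= i < I) Num.min (2 / phi * 2 ^+ i) (2 / phi * 2 ^+ i)^-1)); last first.
  have -> : 8 / phi = 2 / phi * 4 by field; rewrite gt_eqF.
  by apply: ler_wpM2l; [exact: ltW|exact: sum_min_geom].
rewrite mulr_sumr; apply: ler_sum => i _.
have vE : 2 / phi * 2 ^+ i = (s i * phi)^-1.
  rewrite /s /b exprVn invfM invrK exprS; ring.
rewrite vE invrK; set v := s i * phi.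
have v0 : 0 < v by rewrite mulr_gt0.
have -> : s i = v / phi by rewrite mulfK// gt_eqF.
have -> : v / phi * expR (- v) = 2 / phi * (v * expR (- v) / 2) by field; rewrite gt_eqF.
apply: ler_wpM2l; first exact: ltW.
have vE' : v ^+ 2 <= 2 * expR v by have := expr_le_expR 2 (ltW v0); rewrite (_ : 2`! = 2%N).
have e1 : expR (- v) <= 1 by rewrite -[leRHS]expR0 ler_expR oppr_le0 ltW.
rewrite le_min; apply/andP; split.
  rewrite -(ler_pM2l v0) divff ?gt_eqF// mulrA mulrA -expr2 expRN.
  by rewrite ler_pdivrMr// ler_pdivrMr ?expR_gt0// mul1r.
by move: e1 (expR_ge0 (- v)); move: (expR (- v)) => e; nra.
Qed.

(** After exchanging the sums, the scales contribute [8 / phi n <= 16 * (b n / A (b n))] at each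
    level; [square_step] turns this into kernels, which sum to a multiple of the integral of the
    second condition. *)
Lemma level_sum_le (l : nat -> nat) I :
  \sum_(0 <= i < I) \sum_(1 <= n < l i)
    s i * expR (- (s i * laplace_exponent posp (b n)^-1 Pi)) * (Q n.+1 - Q n) <=
  12 * 256 * nnint Pi r.
Proof.
have Qm n : 0 <= Q n.+1 - Q n.
  rewrite subr_ge0; apply: jump_square_mono; rewrite divr_gt0//= ler_wpM2r//.
  by rewrite /b exprS ler_piMl ?(ltW (b0 n))//; lra.
pose B := \max_(0 <= i < I) l i.
pose phi n := laplace_exponent posp (b n)^-1 Pi.
have phiA n : A (b n) / (2 * b n) <= phi n.
  have bi : 0 < (b n)^-1 by rewrite invr_gt0.
  have := laplace_exponent_posp_ge Pi_levy Pi_abs bi; rewrite invrK.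
  rewrite (_ : _ * _ / 2 = A (b n) / (2 * b n))//; field; rewrite gt_eqF//.
have phi0 n : 0 < phi n by apply: lt_le_trans (phiA n); rewrite divr_gt0 ?Apos// mulr_gt0.
apply: (@le_trans _ _ (\sum_(0 <= i < I) \sum_(0 <= n < B) s i * expR (- (s i * phi n)) * (Q n.+1 - Q n))).
  rewrite big_nat [leRHS]big_nat; apply: ler_sum => i /andP[_ iI].
  have t0 n : 0 <= s i * expR (- (s i * phi n)) * (Q n.+1 - Q n).
    by rewrite mulr_ge0// mulr_ge0 ?expR_ge0 ?(ltW (s0 i)).
  have lB : (l i <= B)%N.
    by rewrite /B big_mkord; apply: (@leq_bigmax_cond _ _ (fun i : 'I_I => l i) (Ordinal iI)).
  apply: sum_uniq_le => //; first exact: iota_uniq.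
  by move=> n; rewrite !mem_index_iota => /andP[_ nl]; rewrite (leq_trans nl).
rewrite exchange_big/=.
apply: (@le_trans _ _ (\sum_(0 <= n < B) 12 * nnint Pi (dyadic_kernel Pi n))).
  apply: ler_sum => n _; apply: (le_trans _ (square_step n)).
  rewrite -mulr_suml ler_wpM2r//; apply: (le_trans (exp_sum I (phi0 n))).
  have -> : 16 * (b n / A (b n)) = 8 / (A (b n) / (2 * b n)).
    by field; rewrite !gt_eqF// Apos.
  by rewrite ler_wpM2l// lef_pV2 ?posrE// divr_gt0 ?Apos// mulr_gt0.
rewrite -mulr_sumr -mulrA ler_wpM2l//.
have dk := nnint_dyadic_kernel Pi_levy Pi_abs Hb.
have dr : nnintegrable Pi r by exact: nnint_ratio.
have [d1 <-] := nnint_sum 0 B dk.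
have c1 : 0 <= 256 :> R by rewrite ler0n.
rewrite -(nnint_scale c1 dr).
apply: (le_nnint d1 (nnintegrable_scale c1 dr)).
by move=> x; exact: dyadic_kernel_sum.
Qed.

End Levels.

End SquareJumps.

Lemma cvg_affine {R : realType} (f g : nat -> R) (l m a b c : R) :
  f j @[j --> \oo] --> l -> g j @[j --> \oo] --> m ->
  a + b * g j - c * f j @[j --> \oo] --> a + b * m - c * l.
Proof.
move=> fl gm; apply: cvgB; last by apply: cvgMr.
by apply: cvgD; [exact: cvg_cst|apply: cvgMr].
Qed.

(** * Tails of the two variations over one block *)

Section BlockTails.
Context (R : realType) (disp : measure_display)
    (T : measurableType disp) (P : probability T R)
    (X : R -> {RV P >-> measurableTypeR R}) (gamma : R)
    (Pi : {measure set (measurableTypeR R) -> \bar R}).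
Hypothesis X_levy : levy_process X.
Hypothesis Pi_levy : bounded_levy_measure Pi.
Hypothesis X_triplet : has_triplet X gamma 0 Pi.
Hypothesis Pi_abs : (\int[Pi]_x `|x|%:E < +oo)%E.
Hypothesis no_drift : drift gamma Pi = 0.
Local Notation A := (A_plus Pi).
Local Notation q := (jump_square Pi).
Local Notation phi la := (laplace_exponent posp la Pi).

Definition grid_blocks (s : R) (h : nat -> R) (a b : nat -> nat) : Prop :=
  [/\ (forall j, 0 < h j), h j @[j --> \oo] --> 0,
      (forall j, (b j - a j)%:R * h j = s) & (forall j, (a j <= b j)%N)].

Let posp_laplace_cvg s h a b la : grid_blocks s h a b -> 0 < la ->
  mean P (fun w => expR (- (la * vari X posp (h j) (a j) (b j) w))) @[j --> \oo] -->
  expR (- (s * phi la)).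
Proof.
move=> [h0 hc hs ab] la0.
by apply: (laplace_cvg X_levy (@measurable_posp R) (@posp_ge0 R) (ltW la0) Pi_levy X_triplet
  Pi_abs no_drift (@posp_le R) _ h0 hc la0 hs ab) => x _; exact: continuous_posp.
Qed.

Let negp_laplace_cvg s h a b la : grid_blocks s h a b -> 0 < la ->
  mean P (fun w => expR (- (la * vari X negp (h j) (a j) (b j) w))) @[j --> \oo] -->
  expR (- (s * laplace_exponent negp la Pi)).
Proof.
move=> [h0 hc hs ab] la0.
by apply: (laplace_cvg X_levy (@measurable_negp R) (@negp_ge0 R) (ltW la0) Pi_levy X_triplet
  Pi_abs no_drift (@negp_le R) _ h0 hc la0 hs ab) => x _; exact: continuous_negp.
Qed.

Let mU h a b : measurable_fun setT (vari X posp h a b).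
Proof. exact: measurable_vari (@measurable_posp R). Qed.

Let mZ h a b : measurable_fun setT (vari X negp h a b).
Proof. exact: measurable_vari (@measurable_negp R). Qed.

Let U0 h a b w : 0 <= vari X posp h a b w. Proof. by apply: vari_ge0 => x; exact: posp_ge0. Qed.
Let Z0 h a b w : 0 <= vari X negp h a b w. Proof. by apply: vari_ge0 => x; exact: negp_ge0. Qed.

Let grid_ge0 s h a b : grid_blocks s h a b -> 0 <= s.
Proof. by move=> [h0 _ hs _]; rewrite -(hs 0%N) mulr_ge0// ltW. Qed.

(** Chebyshev's inequality at parameter [la]; [eta] absorbs the distance of the Laplace transform to
    its limit. *)
Lemma block_le_prob s h a b la c eta : grid_blocks s h a b -> 0 < la -> 0 < eta ->
  \forall j \near \oo, pr P [set w | vari X posp (h j) (a j) (b j) w <= c] <=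
    expR (la * c - s * phi la) + eta.
Proof.
move=> gb la0 eta0.
have hc := posp_laplace_cvg gb la0.
have e0 : 0 < expR (la * c) by exact: expR_gt0.
have lt1 : expR (- (s * phi la)) < expR (- (s * phi la)) + eta / expR (la * c).
  by rewrite ltrDl divr_gt0.
have n1 := @cvgr_lt _ _ _ _ _ _ hc _ lt1.
apply: filterS (n1 eventually_filter) => j hj.
apply: (le_trans (pr_le_mean_expR P c (mU _ _ _) (U0 _ _ _) (ltW la0))).
have := ler_wpM2l (ltW e0) (ltW hj); rewrite mulrDr -expRD.
by rewrite mulrCA divff ?mulr1// gt_eqF.
Qed.

Lemma block_le_prob_A s h a b y c eta : grid_blocks s h a b -> 0 < y -> 0 < eta ->
  \forall j \near \oo, pr P [set w | vari X posp (h j) (a j) (b j) w <= c] <=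
    expR (c / y - s * (A y / (2 * y))) + eta.
Proof.
move=> gb y0 eta0; have yi : 0 < y^-1 by rewrite invr_gt0.
apply: filterS (block_le_prob c gb yi eta0) => j /le_trans; apply.
rewrite lerD2r ler_expR mulrC lerD2l lerN2 ler_wpM2l ?(grid_ge0 gb)//.
have := laplace_exponent_posp_ge Pi_levy Pi_abs yi; rewrite invrK.
by rewrite (_ : _ * _ / 2 = A y / (2 * y))//; field; rewrite gt_eqF.
Qed.

(** [exp (- U) <= 1 / 2] when [U > 1], so the probability is at most twice the deficit of the
    Laplace transform at 1. *)
Lemma block_gt1_prob s h a b eta : grid_blocks s h a b -> 0 < eta ->
  \forall j \near \oo, pr P [set w | 1 < vari X posp (h j) (a j) (b j) w] <=
    2 * (s * phi 1) + eta.
Proof.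
move=> gb eta0; have hc := posp_laplace_cvg gb ltr01.
have lt1 : expR (- (s * phi 1)) - eta / 2 < expR (- (s * phi 1)).
  by rewrite ltrBlDr ltrDl divr_gt0.
have n1 := @cvgr_gt _ _ _ _ _ _ hc _ lt1.
apply: filterS (n1 eventually_filter) => j hj.
set U := vari _ _ _ _ _ in hj *.
have mU1 : measurable_fun setT U by exact: mU.
have mA : measurable [set w | U w <= 1] by exact: measurable_le.
have -> : [set w | 1 < U w] = ~` [set w | U w <= 1].
  by apply/seteqP; split => w /=; rewrite ltNge => /negP.
rewrite pr_setC//.
have i01 w : 0 <= (\1_[set w | U w <= 1] w : R) <= 1 by rewrite indicE; case: (_ \in _); rewrite ler01 lexx.
have h1 : mean P (fun w => expR (- (1 * U w))) <= 2^-1 + 2^-1 * pr P [set w | U w <= 1].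
  rewrite -(mean_indicE P mA) -(@mean_scale _ _ _ P _ 1)// -{1}(mean_cst P 2^-1).
  rewrite -(@mean_add _ _ _ P _ _ 1 1)//; last 3 first.
  - by apply: measurable_fun_mul.
  - by move=> w; rewrite invr_ge0 ler0n invf_le1// ler1n.
  - by move=> w; have := i01 w; move: (\1__ w : R) => v; lra.
  apply: (@le_mean _ _ _ P _ _ 1).
  - by apply: measurable_fun_exp; apply: measurable_fun_opp; exact: measurable_fun_mul.
  - by apply: measurable_fun_add => //; exact: measurable_fun_mul.
  - move=> w; rewrite expR_ge0/= mul1r indicE; have [Uc|Uc] := leP (U w) 1.
      rewrite mem_set//=; have : expR (- U w) <= 1 by rewrite -[leRHS]expR0 ler_expR oppr_le0 U0.
      by move: (expR _) => e; lra.
    rewrite memNset ?mulr0 ?addr0; last by apply/negP; rewrite -ltNge.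
    rewrite expRN lef_pV2 ?posrE ?expR_gt0//; apply: (le_trans _ (expR_ge1Dx _)).
    by move: Uc; lra.
  - by move=> w; have := i01 w; move: (\1__ w : R) => v; lra.
have e2 := expR_ge1Dx (- (s * phi 1)).
have h3 := lt_le_trans (le_lt_trans (lerB e2 (lexx (eta / 2))) hj) h1.
by move: h3; move: (pr _ _) (s * _) => v z; lra.
Qed.

Lemma block_jump_prob s h a b y eta : grid_blocks s h a b -> 0 < y -> 0 < eta ->
  s * trunc_mean Pi y <= y / 8 ->
  \forall j \near \oo, pr P [set w | y < vari X negp (h j) (a j) (b j) w] <=
    32 * (s * q y) + eta.
Proof.
move=> gb y0 eta0 hm; have s0 := grid_ge0 gb.
have mA j : measurable [set w | y < vari X negp (h j) (a j) (b j) w] by apply: measurable_lt => //; exact: mZ.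
have yi : 0 < y^-1 by rewrite invr_gt0.
have y2 : 0 < 2 / y by rewrite divr_gt0.
set p1 := laplace_exponent negp y^-1 Pi; set p2 := laplace_exponent negp (2 / y) Pi.
have dE la : 0 < la -> nnintegrable Pi (fun x => 1 - expR (- (la * negp x))).
  move=> la0; apply: (@nnintegrable_le _ _ _ Pi _ (fun x => la * negp x)).
  - apply: measurable_fun_sub => //; apply: measurable_fun_exp; apply: measurable_fun_opp.
    by apply: measurable_fun_mul => //; exact: measurable_negp.
  - by move=> x; apply: one_sub_exp_le => //; [exact: negp_ge0|exact: ltW].
  - exact: (nnintegrable_scale (ltW la0) (nnint_negp Pi_abs)).
have pge0 la : 0 < la -> 0 <= laplace_exponent negp la Pi.
  by move=> la0; apply: nnint_ge0 => x; case/andP: (one_sub_exp_le (@negp_ge0 R) (ltW la0) x).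
have dq := nnint_jump_square Pi_abs y0.
have q0 := jump_square_ge0 Pi y.
(* Integral of $2(1-e)=(1-e^2)+(1-e)^2$ at $e=\exp(-x^-/y)$. *)
have eq12 : p2 + q y = 2 * p1.
  rewrite -[p1]/(nnint Pi (fun x => 1 - expR (- (y^-1 * negp x)))) -(nnint_scale (ler0n R 2) (dE _ yi)).
  rewrite -[p2]/(nnint Pi (fun x => 1 - expR (- (2 / y * negp x)))) -(nnint_add (dE _ y2) dq).
  congr nnint; apply/funext => x.
  rewrite (_ : expR (- (2 / y * negp x)) = expR (- (y^-1 * negp x)) ^+ 2); last first.
    by rewrite -expRM_natl mulrN mulrA.
  rewrite (mulrC (negp x)); ring.
(* When [s * p1 > 1 / 4] the bound is trivial: the truncated mean accounts for at most 1/8 of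
   [s * p1], so [4 * s * q y > 1 / 8] and the right-hand side exceeds 1. *)
have [hs|hs] := leP (s * p1) (1 / 4); last first.
  have dm := nnint_cut y (nnint_negp Pi_abs).
  have p1le : p1 <= y^-1 * trunc_mean Pi y + 4 * q y.
    rewrite -(nnint_scale (ltW yi) dm) -(nnint_scale (ler0n R 4) dq).
    have i1 := nnintegrable_scale (ltW yi) dm; have i2 := nnintegrable_scale (ler0n R 4) dq.
    rewrite -(nnint_add i1 i2); apply: (le_nnint (dE _ yi) (nnintegrable_add i1 i2)) => x.
    have := one_sub_exp_le (@negp_ge0 R) (ltW yi) x; rewrite (_ : negp x / y = y^-1 * negp x); last exact: mulrC.
    have [xy|xy] := leP (negp x) y.
      rewrite mulr1 => /andP[_ h1]; apply: (le_trans h1).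
      by rewrite lerDl mulr_ge0// sqr_ge0.
    rewrite mulr0 mulr0 add0r => _.
    have : expR (- (y^-1 * negp x)) <= 2^-1.
      rewrite expRN lef_pV2 ?posrE ?expR_gt0//; apply: (le_trans _ (expR_ge1Dx _)).
      have : 1 <= y^-1 * negp x by rewrite mulrC ler_pdivlMr// mul1r ltW.
      lra.
    have := expR_ge0 (- (y^-1 * negp x)); move: (expR _) => e; nra.
  have h2 := ler_wpM2l s0 p1le.
  have h3 : s * (y^-1 * trunc_mean Pi y) <= 1 / 8.
    by rewrite mulrCA mulrC ler_pdivrMr//; move: hm; lra.
  apply: nearW => j; apply: (le_trans (pr_le1 P (mA j))).
  move: h2 h3 hs; rewrite mulrDr (mulrCA s 4); lra.
(* Chebyshev: on [y < Z], [exp (- Z / y) <= 1 / 2] is at distance at least 1 / 4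
   from its limiting mean [c], while its variance tends to at most [s * q y]. *)
set c := expR (- (s * p1)).
have c34 : 3 / 4 <= c by have := expR_ge1Dx (- (s * p1)); rewrite -/c; lra.
have c0 : 0 <= c by exact: expR_ge0.
have hc1 := negp_laplace_cvg gb yi; rewrite -/p1 -/c in hc1.
have hc2 := negp_laplace_cvg gb y2; rewrite -/p2 in hc2.
set c2 := expR _ in hc2.
have c2c : c2 - c ^+ 2 <= s * q y.
  have -> : c ^+ 2 = c2 * expR (- (s * q y)).
    rewrite /c /c2 -expRM_natl -expRD; congr expR; rewrite mulrN mulrCA -eq12; ring.
  have c21 : c2 <= 1.
    rewrite -[leRHS]expR0 ler_expR oppr_le0 mulr_ge0//.
    exact: pge0 y2.
  have := expR_ge1Dx (- (s * q y)); have : 0 <= c2 by exact: expR_ge0.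
  have : 0 <= s * q y by exact: mulr_ge0.
  move: c21; move: (c2) (expR (- (s * q y))) (s * q y) => x e z; nra.
(* The expectation of [16 * (c - exp (- Z / y)) ^+ 2], expanded so that each term has a known
   limit. *)
have lim : 16 * c ^+ 2 + 16 * mean P (fun w => expR (- (2 / y * vari X negp (h j) (a j) (b j) w))) -
    32 * c * mean P (fun w => expR (- (y^-1 * vari X negp (h j) (a j) (b j) w))) @[j --> \oo] -->
    16 * c ^+ 2 + 16 * c2 - 32 * c * c.
  exact: cvg_affine hc1 hc2.
have lt1 : 16 * c ^+ 2 + 16 * c2 - 32 * c * c < 32 * (s * q y) + eta.
  have : 0 <= s * q y by exact: mulr_ge0.
  by move: c2c; rewrite -mulrA -expr2; move: (c ^+ 2) (s * q y) => u v; lra.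
have n1 := @cvgr_lt _ _ _ _ _ _ lim _ lt1.
apply: filterS (n1 eventually_filter) => j hj; apply: ltW; apply: le_lt_trans hj.
have mA1 := mA j; set Z := vari _ _ _ _ _ in mA1 *.
have mE la : measurable_fun setT (fun w => expR (- (la * Z w))).
  by apply: measurable_fun_exp; apply: measurable_fun_opp; apply: measurable_fun_mul => //; exact: mZ.
set B := [set w | _] in mA1 *.
have i01 w : 0 <= (\1_B w : R) <= 1 by rewrite indicE; case: (_ \in _); rewrite ler01 lexx.
have E01 la w : 0 < la -> 0 <= expR (- (la * Z w)) <= 1.
  move=> la0; have z0 : 0 <= Z w by exact: Z0.
  by rewrite expR_ge0 -[leRHS]expR0 ler_expR oppr_le0 mulr_ge0 ?(ltW la0).
have c32 : 0 <= 32 * c by exact: mulr_ge0.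
have c1 : c <= 1 by rewrite -[leRHS]expR0 ler_expR oppr_le0 mulr_ge0//; exact: pge0 yi.
have cc : 0 <= 16 * c ^+ 2 by rewrite mulr_ge0// sqr_ge0.
rewrite lerBrDr -(mean_indicE P mA1) -(@mean_scale _ _ _ P _ 1 (32 * c))//; last by move=> w; exact: E01.
rewrite -(@mean_scale _ _ _ P _ 1 16)//; last by move=> w; exact: E01.
rewrite -[X in _ <= X + _](mean_cst P).
rewrite -(@mean_add _ _ _ P _ _ 1 (32 * c))//; last 2 first.
- by apply: measurable_fun_mul.
- by move=> w; have /andP[e0 e1] := E01 _ w yi; rewrite mulr_ge0//= ler_piMr.
rewrite -(@mean_add _ _ _ P _ _ (16 * c ^+ 2) 16)//; last 3 first.
- by apply: measurable_fun_mul.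
- by move=> w; rewrite cc lexx.
- by move=> w; have /andP[e0 e1] := E01 _ w y2; rewrite mulr_ge0//= ler_piMr.
apply: (@le_mean _ _ _ P _ _ (16 * c ^+ 2 + 16)).
- by apply: measurable_fun_add => //; exact: measurable_fun_mul.
- by apply: measurable_fun_add => //; exact: measurable_fun_mul.
- move=> w; have := i01 w; have := E01 _ w yi.
  have -> : expR (- (2 / y * Z w)) = expR (- (y^-1 * Z w)) ^+ 2.
    by rewrite -expRM_natl mulrN mulrA.
  move=> /andP[e0 e1] /andP[i0 i1]; apply/andP; split.
    by rewrite addr_ge0// mulr_ge0.
  rewrite indicE; have [wB|wB] := boolP (w \in B); last first.
    move: (expR (- (y^-1 * Z w))) => e.
    have := sqr_ge0 (c - e); rewrite sqrrB /=; move: (c ^+ 2) (e ^+ 2) => x z; rewrite -mulr_natl; lra.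
  have eh : expR (- (y^-1 * Z w)) <= 2^-1.
    rewrite expRN lef_pV2 ?posrE ?expR_gt0//; apply: (le_trans _ (expR_ge1Dx _)).
    have : 1 <= y^-1 * Z w by rewrite mulrC ler_pdivlMr// mul1r ltW//; rewrite inE in wB.
    by lra.
  move: e0 eh; move: (expR (- (y^-1 * Z w))) => e e0 eh /=; move: c34; move: (c) => c'; nra.
- by move=> w; have := E01 _ w y2; lra.
Qed.

End BlockTails.

(** Summation by parts: only [F] itself is bounded by [E], not its decrements, so the differences
    are first moved from [F] to the increasing sequence [Q]. *)
Lemma abel_le {R : realType} (F G Q E : nat -> R) (k e1 e2 : R) l :
  (forall n, 0 <= F n) -> F 0%N <= 1 -> (forall n, F n.+1 <= F n) ->
  (forall n, 0 <= Q n) -> (forall n, Q n <= Q n.+1) -> 0 <= k -> 0 <= e1 -> 0 <= e2 ->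
  (forall n, (0 < n <= l)%N -> G n <= k * Q n + e1 /\ F n <= E n + e2) ->
  \sum_(0 <= n < l) (F n - F n.+1) * G n.+1 <=
    k * (Q 1%N + \sum_(1 <= n < l) E n * (Q n.+1 - Q n) + e2 * Q l) + e1.
Proof.
move=> F0 F1 Fd Q0 Qi k0 e10 e20 GF.
case: l GF => [|l] GF.
  rewrite big_nil big_geq// addr0; have := Q0 0%N; have := Q0 1%N => h1 h2.
  by rewrite addr_ge0// mulr_ge0// addr_ge0// mulr_ge0.
have FE m : \sum_(0 <= n < m) (F n - F n.+1) = F 0%N - F m.
  by elim: m => [|m IH]; [rewrite big_nil subrr|rewrite big_nat_recr//= IH; ring].
have QE m : \sum_(1 <= n < m.+1) (Q n.+1 - Q n) = Q m.+1 - Q 1%N.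
  by elim: m => [|m IH]; [rewrite big_geq// subrr|rewrite big_nat_recr//= IH; ring].
have AE m : \sum_(0 <= n < m.+1) (F n - F n.+1) * Q n.+1 + F m.+1 * Q m.+1 =
    F 0%N * Q 1%N + \sum_(1 <= n < m.+1) F n * (Q n.+1 - Q n).
  elim: m => [|m IH]; first by rewrite big_nat1 (@big_geq _ _ _ 1 1)//; ring.
  rewrite big_nat_recr//= (@big_nat_recr _ _ _ m.+1 1)//=.
  have -> : \sum_(0 <= n < m.+1) (F n - F n.+1) * Q n.+1 =
      F 0%N * Q 1%N + \sum_(1 <= n < m.+1) F n * (Q n.+1 - Q n) - F m.+1 * Q m.+1.
    by rewrite -IH addrK.
  ring.
apply: (@le_trans _ _ (\sum_(0 <= n < l.+1) (F n - F n.+1) * (k * Q n.+1 + e1))).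
  rewrite big_nat [leRHS]big_nat; apply: ler_sum => n /andP[_ nl].
  by rewrite ler_wpM2l ?subr_ge0//; have [] := GF n.+1; rewrite ?nl.
have -> : \sum_(0 <= n < l.+1) (F n - F n.+1) * (k * Q n.+1 + e1) =
    k * \sum_(0 <= n < l.+1) (F n - F n.+1) * Q n.+1 + (F 0%N - F l.+1) * e1.
  rewrite -FE mulr_suml mulr_sumr -big_split/=; apply: eq_bigr => n _; ring.
apply: lerD; last by rewrite ler_piMl//; have := F0 l.+1; lra.
apply: ler_wpM2l => //.
apply: (@le_trans _ _ (F 0%N * Q 1%N + \sum_(1 <= n < l.+1) F n * (Q n.+1 - Q n))).
  by rewrite -AE lerDl mulr_ge0.
rewrite -addrA; apply: lerD; first by rewrite ler_piMl.
apply: (@le_trans _ _ (\sum_(1 <= n < l.+1) (E n * (Q n.+1 - Q n) + e2 * (Q n.+1 - Q n)))).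
  rewrite big_nat [leRHS]big_nat; apply: ler_sum => n /andP[n0 nl].
  rewrite -mulrDl ler_wpM2r ?subr_ge0//.
  by have [] := GF n; rewrite // n0 ltnW.
rewrite big_split/= lerD2l -mulr_sumr QE ler_wpM2l// lerBlDr lerDl; exact: Q0.
Qed.

(** * Comparison of two independent variables along dyadic levels *)

Section LevelDecomposition.
Context {R : realType} {d : measure_display} {T : measurableType d} (P : probability T R).
Variables (U Z : T -> R).
Hypotheses (mU : measurable_fun setT U) (mZ : measurable_fun setT Z).
Hypothesis UZ : forall B C : set (measurableTypeR R), measurable B -> measurable C ->
  P (U @^-1` B `&` Z @^-1` C) = (P (U @^-1` B) * P (Z @^-1` C))%E.

Let b (n : nat) : R := 2^-1 ^+ n.
Let b0 n : 0 < b n. Proof. by rewrite exprn_gt0. Qed.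
Let bS n : b n.+1 <= b n.
Proof. by rewrite /b exprS ler_piMl ?(ltW (b0 n))//; lra. Qed.
Let F n := pr P [set w | U w <= b n].
Let G n := pr P [set w | b n / 4 < Z w].
Let mF c : measurable [set w | U w <= c]. Proof. exact: measurable_le. Qed.
Let mG c : measurable [set w | c < Z w]. Proof. exact: measurable_lt. Qed.
Let S n := [set w | U w <= b n /\ b n.+1 < U w] `&` [set w | b n.+1 / 4 < Z w].

Let mS1 n : measurable [set w | U w <= b n /\ b n.+1 < U w].
Proof.
have -> : [set w | U w <= b n /\ b n.+1 < U w] = [set w | U w <= b n] `&` [set w | b n.+1 < U w].
  by apply/seteqP; split.
by apply: measurableI => //; exact: measurable_lt.
Qed.

Let pr_S n : pr P (S n) = (F n - F n.+1) * G n.+1.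
Proof.
have mB : measurable (`]b n.+1, b n]%classic : set (measurableTypeR R)) by exact: measurable_itv.
have mC : measurable (`]b n.+1 / 4, +oo[%classic : set (measurableTypeR R)) by exact: measurable_itv.
have := UZ mB mC.
have -> : U @^-1` `]b n.+1, b n] = [set w | U w <= b n /\ b n.+1 < U w].
  by apply/seteqP; split => w /=; rewrite in_itv/=; [move=> /andP[h1 h2]|move=> [-> ->]].
have -> : Z @^-1` `]b n.+1 / 4, +oo[ = [set w | b n.+1 / 4 < Z w].
  by apply/seteqP; split => w /=; rewrite in_itv/= andbT.
rewrite -/(S n) (prE _ (measurableI _ _ (mS1 n) (mG _))) (prE _ (mS1 n)) (prE _ (mG _)) -EFinM => -[->].
congr (_ * _).
have e : F n = pr P [set w | U w <= b n /\ b n.+1 < U w] + F n.+1.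
  apply: EFin_inj; rewrite EFinD -!prE// -measureU//.
    congr (P _); apply/seteqP; split => w /=.
      by move=> h; have [h1|h1] := leP (U w) (b n.+1); [right|left].
    by case=> [[]//|/le_trans]; apply.
  by apply/seteqP; split => // w /= -[[_ h1] h2]; move: h1; rewrite ltNge h2.
by rewrite e addrK.
Qed.

(** If [b n.+1 < U <= b n] and [U / 4 < Z], then [Z > b n.+1 / 4], and independence factors the
    probability of each level. The cases [U <= b l] and [U > 1] are set apart. *)
Lemma level_prob_le l : pr P [set w | U w / 4 < Z w] <=
  F l + pr P [set w | 1 < U w] + \sum_(0 <= n < l) (F n - F n.+1) * G n.+1.
Proof.
have mS n : measurable (S n) by exact: measurableI.
have m1 : measurable [set w | 1 < U w] by exact: measurable_lt.
have mD : measurable [set w | U w / 4 < Z w] by apply: measurable_lt => //; exact: measurable_fun_mul.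
have mb : measurable (\big[setU/set0]_(n < l) S n) by exact: bigsetU_measurable.
apply: (@le_trans _ _ (pr P (([set w | U w <= b l] `|` [set w | 1 < U w]) `|` \big[setU/set0]_(n < l) S n))).
  apply: le_pr => //; first by apply: measurableU => //; exact: measurableU.
  move=> w /= UZw; have [U1|U1] := leP (U w) 1; last by left; right.
  have [Ul|Ul] := leP (U w) (b l); first by left; left.
  right; rewrite -bigcup_mkord.
  have [n nl [h1 h2]] : exists2 n, (n < l)%N & b n.+1 < U w /\ U w <= b n.
    clear mb; elim: l Ul => [|m IH] Ul; first by move: Ul; rewrite ltNge U1.
    have [Um|Um] := leP (U w) (b m); first by exists m.
    by have [n nm h] := IH Um; exists n => //; rewrite ltnS ltnW.
  exists n => //; split => //=; apply: le_lt_trans UZw.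
  by rewrite ler_wpM2r// ltW.
apply: (le_trans (pr_setU _ (measurableU _ _ (mF _) m1) mb)).
apply: lerD; first exact: pr_setU.
apply: (le_trans (pr_bigsetU _ _ mS)); rewrite big_mkord.
by apply: ler_sum => n _; rewrite pr_S.
Qed.

End LevelDecomposition.

(** * Probability that negative variation exceeds a quarter of positive variation *)

Section JumpOver.
Context (R : realType) (disp : measure_display)
    (T : measurableType disp) (P : probability T R)
    (X : R -> {RV P >-> measurableTypeR R}) (gamma : R)
    (Pi : {measure set (measurableTypeR R) -> \bar R}).
Hypothesis X_levy : levy_process X.
Hypothesis Pi_levy : bounded_levy_measure Pi.
Hypothesis X_triplet : has_triplet X gamma 0 Pi.
Hypothesis Pi_abs : (\int[Pi]_x `|x|%:E < +oo)%E.
Hypothesis no_drift : drift gamma Pi = 0.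
Local Notation A := (A_plus Pi).
Local Notation phi la := (laplace_exponent posp la Pi).

Let b (n : nat) : R := 2^-1 ^+ n.
Let b0 n : 0 < b n. Proof. by rewrite exprn_gt0. Qed.
Let bS n : b n.+1 <= b n.
Proof. by rewrite /b exprS ler_piMl ?(ltW (b0 n))//; lra. Qed.
Let Q n := jump_square Pi (b n / 4).

Definition indep_blocks (h : nat -> R) (a b a' b' : nat -> nat) : Prop :=
  forall j (B C : set (measurableTypeR R)), measurable B -> measurable C ->
  P (vari X posp (h j) (a j) (b j) @^-1` B `&` vari X negp (h j) (a' j) (b' j) @^-1` C) =
  (P (vari X posp (h j) (a j) (b j) @^-1` B) * P (vari X negp (h j) (a' j) (b' j) @^-1` C))%E.

(** At each level up to [l], [block_jump_prob] bounds the negative tail and Chebyshev at parameter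
    [1 / b n], whence the factor [exp 1], the positive one. [abel_le] then produces the double sum
    that [level_sum_le] controls. *)
Lemma jump_over_prob s h a c a' c' l eta : grid_blocks s h a c -> grid_blocks s h a' c' ->
  indep_blocks h a c a' c' -> 0 < eta ->
  (forall n, (0 < n <= l)%N -> s * trunc_mean Pi (b n / 4) <= b n / 32) ->
  \forall j \near \oo,
    pr P [set w | vari X posp (h j) (a j) (c j) w / 4 < vari X negp (h j) (a' j) (c' j) w] <=
    pr P [set w | vari X posp (h j) (a j) (c j) w <= b l] + 2 * (s * phi 1) +
    32 * (s * Q 1%N) +
    32 * expR 1 * (\sum_(1 <= n < l) s * expR (- (s * phi (b n)^-1)) * (Q n.+1 - Q n)) + eta.
Proof.
have aux (f p g x y z v e : R) : g <= y + z + v + e -> p <= x + e -> v <= e ->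
    f + p + g <= f + x + y + z + 3 * e by lra.
move=> gb gb' ind eta0 hl.
have s0 : 0 <= s by case: gb => h0 _ hs _; rewrite -(hs 0%N) mulr_ge0// ltW.
have Q0 n : 0 <= Q n by exact: jump_square_ge0.
have Qi n : Q n <= Q n.+1.
  by apply: (jump_square_mono Pi_abs); rewrite divr_gt0//= ler_wpM2r.
have k0 : 0 <= 32 * s by rewrite mulr_ge0.
pose e1 := eta / 3; have e10 : 0 < e1 by rewrite divr_gt0.
have kQ : 0 < 32 * s * Q l + 1 by rewrite ltr_wpDl// mulr_ge0.
(* In [abel_le] this error is multiplied by [32 * s * Q l], and the product must stay below [e1]. *)
pose e2 := e1 / (32 * s * Q l + 1); have e20 : 0 < e2 by rewrite divr_gt0.
have n1 := block_gt1_prob X_levy Pi_levy X_triplet Pi_abs no_drift gb e10.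
have n2 : \forall j \near \oo, forall i : 'I_l,
    pr P [set w | b i.+1 / 4 < vari X negp (h j) (a' j) (c' j) w] <= 32 * (s * Q i.+1) + e1 /\
    pr P [set w | vari X posp (h j) (a j) (c j) w <= b i.+1] <= expR 1 * expR (- (s * phi (b i.+1)^-1)) + e2.
  apply: filter_forall => i.
  have y0 : 0 < b i.+1 / 4 by rewrite divr_gt0.
  have hm : s * trunc_mean Pi (b i.+1 / 4) <= b i.+1 / 4 / 8.
    by apply: (le_trans (hl i.+1 (ltn_ord i))); rewrite -mulrA -invfM -natrM.
  have m1 := block_jump_prob X_levy Pi_levy X_triplet Pi_abs no_drift gb' y0 e10 hm.
  have bi : 0 < (b i.+1)^-1 by rewrite invr_gt0.
  have m2 := block_le_prob X_levy Pi_levy X_triplet Pi_abs no_drift (b i.+1) gb bi e20.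
  apply: filterS2 m1 m2 => j h1 h2; split => //.
  by move: h2; rewrite mulVf ?gt_eqF// expRD.
apply: filterS2 n1 n2 => j h1 h2.
set U := vari X posp _ _ _ in h1 h2 *; set Z := vari X negp _ _ _ in h2 *.
have mU : measurable_fun setT U by apply: measurable_vari; exact: measurable_posp.
have mZ : measurable_fun setT Z by apply: measurable_vari; exact: measurable_negp.
apply: (le_trans (level_prob_le mU mZ (ind j) l)).
pose F n := pr P [set w | U w <= b n]; pose G n := pr P [set w | b n / 4 < Z w].
have mF x : measurable [set w | U w <= x] by exact: measurable_le.
have F0 n : 0 <= F n by exact: pr_ge0.
have F1 : F 0%N <= 1 by exact: pr_le1.
have Fd n : F n.+1 <= F n by apply: le_pr => // w /= /le_trans; apply.
have GF n : (0 < n <= l)%N -> G n <= 32 * s * Q n + e1 /\ F n <= expR 1 * expR (- (s * phi (b n)^-1)) + e2.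
  by case: n => // n nl; rewrite -mulrA; exact: (h2 (Ordinal nl)).
have := abel_le F0 F1 Fd Q0 Qi k0 (ltW e10) (ltW e20) GF.
rewrite -/(F l).
have e2Q : 32 * s * (e2 * Q l) <= e1.
  rewrite mulrCA /e2 mulrAC ler_pdivrMr// ler_wpM2l ?(ltW e10)// lerDl ler01//.
set S1 := \sum_(1 <= n < l) _ => hS.
have -> : \sum_(1 <= n < l) s * expR (- (s * phi (b n)^-1)) * (Q n.+1 - Q n) = s / expR 1 * S1.
  rewrite /S1 mulr_sumr; apply: eq_bigr => n _; rewrite !mulrA divfK// gt_eqF// expR_gt0.
have -> : 32 * expR 1 * (s / expR 1 * S1) = 32 * s * S1 by field; rewrite gt_eqF// expR_gt0.
have -> : eta = 3 * e1 by rewrite /e1; field.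
apply: (aux _ _ _ _ _ _ (32 * s * (e2 * Q l))) => //.
by move: hS; rewrite !mulrDr -[32 * s * Q 1%N]mulrA.
Qed.

End JumpOver.

(** * Bounds summable over the scales *)

Section Summability.
Context (R : realType) (disp : measure_display)
    (T : measurableType disp) (P : probability T R)
    (X : R -> {RV P >-> measurableTypeR R}) (gamma : R)
    (Pi : {measure set (measurableTypeR R) -> \bar R}).
Hypothesis X_levy : levy_process X.
Hypothesis Pi_levy : bounded_levy_measure Pi.
Hypothesis X_triplet : has_triplet X gamma 0 Pi.
Hypothesis Pi_abs : (\int[Pi]_x `|x|%:E < +oo)%E.
Hypothesis no_drift : drift gamma Pi = 0.
Variable kappa : R.
Hypothesis kappa_gt1 : 1 < kappa.
Local Notation A := (A_plus Pi).
Hypothesis HK : forall d, 0 < d -> (K_X kappa Pi d < +oo)%E.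
Hypothesis Hb : (\int[Pi]_x (negp x / A (negp x))%:E < +oo)%E.
Local Notation phi la := (laplace_exponent posp la Pi).

Let b (n : nat) : R := 2^-1 ^+ n.
Let b0 n : 0 < b n. Proof. by rewrite exprn_gt0. Qed.
Let s (i : nat) : R := b i.+1.
Let s0 i : 0 < s i. Proof. exact: b0. Qed.
Let Q n := jump_square Pi (b n / 4).

Lemma jump_over_summable C : 0 < C -> exists p : nat -> R, exists i1 : nat, exists S : R,
  [/\ (forall i, 0 <= p i), (forall I, \sum_(0 <= i < I) p i <= S) &
   forall i h a c a' c', (i1 <= i)%N -> grid_blocks (s i) h a c -> grid_blocks (s i) h a' c' ->
     indep_blocks X h a c a' c' -> \forall j \near \oo,
     pr P [set w | vari X posp (h j) (a j) (c j) w / 4 < vari X negp (h j) (a' j) (c' j) w] <= p i /\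
     pr P [set w | vari X posp (h j) (a j) (c j) w <= C * s i `^ kappa] <= p i].
Proof.
have aux1 (x k v u1 u2 u3 z : R) : x <= k + v + z -> 0 <= z ->
  x + u1 + u2 + u3 + z <= k + v + u1 + u2 + u3 + 2 * z by lra.
have aux2 (x y k v u1 u2 u3 z : R) : x <= y + z -> y <= k -> 0 <= v -> 0 <= u1 -> 0 <= u2 -> 0 <= u3 ->
  0 <= z -> x <= k + v + u1 + u2 + u3 + 2 * z by lra.
move=> C0.
have Apos y : 0 < y -> 0 < A y by exact: (K_X_A_gt0 Pi_levy Pi_abs kappa_gt1 HK).
have [kap [i2 [S2 [kap0 kapS kapP]]]] := K_X_small_prob Pi_levy Pi_abs kappa_gt1 HK C0.
have [beta [i3 [S3 [beta0 betaS betaP]]]] := heavy_small_prob Pi_levy Pi_abs Apos Hb.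
have h01 : 0 < (2^-1 : R) < 1 by rewrite invr_gt0 ltr0n invf_lt1// ltr1n.
(* The cut-off is the level just before the first heavy one, where the bound [2 * b n] of
   [heavy_small_prob] applies; if no level is heavy, it is any level below [C * s i ^ kappa], and
   the first condition takes over. *)
have lex i : exists l, (forall n, (0 < n <= l)%N -> s i * trunc_mean Pi (b n / 4) <= b n / 32) /\
    ((i3 <= i)%N -> (exists2 y, 0 < y & expR (b l / y - s i * (A y / (2 * y))) <= beta i) \/
      b l <= C * s i `^ kappa).
  have [hv|hv] := pselect (exists n, heavy Pi i n).
    case: (ex_minnP hv) => N hN Nmin; have N0 : (0 < N)%N by case/andP: hN.
    exists N.-1; split.
      move=> n /andP[n0 nN]; have nl : (n < N)%N by rewrite -(prednK N0) ltnS.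
      rewrite leNgt; apply/negP => hn.
      have : heavy Pi i n by rewrite /heavy n0.
      by move/Nmin; rewrite leqNgt nl.
    move=> ii; left; have [y y0 hy] := betaP i N ii hN Nmin; exists y => //.
    have -> : b N.-1 = 2 * 2^-1 ^+ N by rewrite -{2}(prednK N0) exprS mulrA divff ?mul1r.
    exact: hy.
  have e0 : 0 < C * s i `^ kappa by rewrite mulr_gt0// powR_gt0.
  have [k hk] := geom_lt h01 e0; exists k; split; last by right; exact: ltW.
  move=> n /andP[n0 _]; rewrite leNgt; apply/negP => hn; apply: hv; exists n.
  by rewrite /heavy n0.
have [l lP] := choice lex.
pose L i := \sum_(1 <= n < l i) s i * expR (- (s i * phi (b n)^-1)) * (Q n.+1 - Q n).
pose e1 := 32 * expR 1 : R.
have e10 : 0 <= e1 by rewrite mulr_ge0 ?expR_ge0.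
have Q0 n : 0 <= Q n by exact: jump_square_ge0.
have L0 i : 0 <= L i.
  apply: sumr_ge0 => n _; rewrite mulr_ge0//; first by rewrite mulr_ge0 ?expR_ge0 ?(ltW (s0 _)).
  rewrite subr_ge0; apply: (jump_square_mono Pi_abs); rewrite divr_gt0//= ler_wpM2r//.
  by rewrite /b exprS ler_piMl ?(ltW (b0 n))//; lra.
have p10 : 0 <= phi 1.
  by apply: nnint_ge0 => x; case/andP: (one_sub_exp_le (@posp_ge0 R) ler01 x).
pose p i := kap i + beta i + 2 * (s i * phi 1) + 32 * (s i * Q 1%N) + e1 * L i + 2 * s i.
have sS I : \sum_(0 <= i < I) s i <= 1.
  suff -> : \sum_(0 <= i < I) s i = 1 - b I by rewrite lerBlDr lerDl ltW.
  elim: I => [|I IH]; first by rewrite big_nil /b expr0 subrr.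
  by rewrite big_nat_recr//= IH /s /b exprS; field.
exists p, (maxn i2 i3), (S2 + S3 + 2 * phi 1 + 32 * Q 1%N +
  e1 * (12 * 256 * nnint Pi (fun x => negp x / A (negp x))) + 2); split.
- move=> i; have si := ltW (s0 i).
  by rewrite /p !addr_ge0// mulr_ge0// mulr_ge0.
- move=> I; rewrite /p !big_split/= -!mulr_sumr -!mulr_suml.
  have LS := level_sum_le Pi_levy Pi_abs Apos Hb l I.
  do !apply: lerD => //.
  + by rewrite ler_wpM2l// ler_piMl.
  + by rewrite ler_wpM2l// ler_piMl.
  + by rewrite ler_wpM2l.
  + by rewrite ler_piMr.
- move=> i h a c a' c'; rewrite geq_max => /andP[ii2 ii3] gb gb' ind.
  have [lh lor] := lP i; have {lor}lor := lor ii3.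
  have n1 := jump_over_prob X_levy Pi_levy X_triplet Pi_abs no_drift gb gb' ind (s0 i) lh.
  have [y y0 hy] := kapP i ii2.
  have n2 := block_le_prob_A X_levy Pi_levy X_triplet Pi_abs no_drift (C * s i `^ kappa) gb y0 (s0 i).
  have n3 : \forall j \near \oo,
      pr P [set w | vari X posp (h j) (a j) (c j) w <= b (l i)] <= kap i + beta i + s i.
    case: lor => [[z z0 hz]|hz].
      have n4 := block_le_prob_A X_levy Pi_levy X_triplet Pi_abs no_drift (b (l i)) gb z0 (s0 i).
      apply: filterS n4 => j /le_trans; apply; rewrite lerD2r; apply: (le_trans hz).
      by rewrite lerDr.
    apply: filterS n2 => j h2.
    have mU : measurable_fun setT (vari X posp (h j) (a j) (c j)).
      by apply: measurable_vari; exact: measurable_posp.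
    apply: (@le_trans _ _ (pr P [set w | vari X posp (h j) (a j) (c j) w <= C * s i `^ kappa])).
      apply: le_pr; [exact: measurable_le|exact: measurable_le|].
      by move=> w /= /le_trans; apply.
    apply: (le_trans h2); rewrite lerD2r; apply: (le_trans hy).
    by rewrite lerDl.
  apply: filterS3 n1 n2 n3 => j h1 h2 h3.
  have t1 : 0 <= 2 * (s i * phi 1) by rewrite mulr_ge0// mulr_ge0// ltW.
  have t2 : 0 <= 32 * (s i * Q 1%N) by rewrite mulr_ge0// mulr_ge0// ltW.
  have t3 : 0 <= e1 * L i by exact: mulr_ge0.
  have := s0 i; have := beta0 i => t4 t5.
  split.
    exact: (le_trans h1 (aux1 _ _ _ _ _ _ _ h3 (ltW t5))).
  exact: (aux2 _ _ _ _ _ _ _ _ h2 hy t4 t1 t2 t3 (ltW t5)).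
Qed.

End Summability.

(** * Sufficiency: sample paths *)

Section BlockVariations.
Context (R : realType) (disp : measure_display)
    (T : measurableType disp) (P : probability T R)
    (X : R -> {RV P >-> measurableTypeR R}).
Hypothesis X_levy : levy_process X.

Lemma measurable_vari_block psi h a b k n : measurable_fun setT psi -> (k <= a)%N -> (b <= n)%N ->
  measurable_fun [set: g_sigma_algebraType (block (incr X h) k n)] (vari X psi h a b).
Proof.
move=> mpsi ka bn.
have -> : vari X psi h a b = (fun w => \sum_(l < b - a) psi (incr X h (l + a) w)).
  by apply/funext => w; rewrite /vari -{1}(add0n a) big_addn big_mkord.
apply: measurable_sum => l; apply: (measurableT_comp mpsi).
apply: (@measurable_block_coord _ T R (incr X h)).
rewrite (leq_trans ka (leq_addl _ _))/= (leq_trans _ bn)//.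
by rewrite addnC -ltn_subRL ltn_ord.
Qed.

Lemma vari_indep psi chi h a b a' b' (B C : set (measurableTypeR R)) : 0 <= h ->
  measurable_fun setT psi -> measurable_fun setT chi -> (b <= a')%N -> (a' <= b')%N ->
  measurable B -> measurable C ->
  P (vari X psi h a b @^-1` B `&` vari X chi h a' b' @^-1` C) =
  (P (vari X psi h a b @^-1` B) * P (vari X chi h a' b' @^-1` C))%E.
Proof.
move=> h0 mpsi mchi ba ab mB mC.
have mY := measurable_incr X h.
have iY : indep_seq P b' (incr X h) by exact: (incr_indep X_levy b' 0 h0).
apply: (block_indep mY iY ab).
  have := @measurable_vari_block psi h a b 0 a' mpsi (leq0n _) ba measurableT _ mB.
  by rewrite setTI.
have := @measurable_vari_block chi h a' b' a' b' mchi (leqnn _) (leqnn _) measurableT _ mC.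
by rewrite setTI.
Qed.

Lemma cent_vari h k w : cent X (k%:R * h) w = vari X posp h 0 k w - vari X negp h 0 k w.
Proof.
rewrite /vari -sumrB (eq_bigr (fun j => X (j.+1%:R * h) w - X (j%:R * h) w)).
  by rewrite (telescope_sumr (fun j => X (j%:R * h) w))// mul0r.
by move=> j _; rewrite -posp_negp.
Qed.

Lemma vari_cat psi h a b c w : (a <= b <= c)%N ->
  vari X psi h a c w = vari X psi h a b w + vari X psi h b c w.
Proof. by move=> /andP[ab bc]; rewrite /vari (@big_cat_nat _ _ _ b). Qed.

Lemma vari_mono psi h a b a' b' w : (forall x, 0 <= psi x) -> (a' <= a)%N -> (a <= b)%N -> (b <= b')%N ->
  vari X psi h a b w <= vari X psi h a' b' w.
Proof.
move=> psi0 aa ab bb.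
rewrite (@vari_cat psi h a' a b') ?aa ?(leq_trans ab)//.
rewrite (@vari_cat psi h a b b') ?ab//.
have := vari_ge0 X psi0 h a' a w; have := vari_ge0 X psi0 h b b' w; lra.
Qed.

End BlockVariations.

(** * Lower limits over meshes and the Borel-Cantelli lemma *)

Section Liminf.
Context {R : realType} {d : measure_display} {T : measurableType d} (P : probability T R).

(* Exceptional events are controlled only in the limit of vanishing mesh; a path outside
   their lower limit avoids them for infinitely many meshes. *)
Definition liminf_event (E : nat -> set T) : set T := \bigcup_N \bigcap_(M in [set M | (N <= M)%N]) E M.

Lemma measurable_liminf_event E : (forall n, measurable (E n)) -> measurable (liminf_event E).
Proof.
by move=> mE; apply: bigcupT_measurable => N; apply: bigcap_measurableType => M _.
Qed.

Lemma liminf_event_le (E : nat -> set T) c : (forall n, measurable (E n)) ->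
  (\forall n \near \oo, pr P (E n) <= c) -> (P (liminf_event E) <= c%:E)%E.
Proof.
move=> mE [N0 _ HN]; pose G N := \bigcap_(M in [set M | (N <= M)%N]) E M.
have mG N : measurable (G N) by apply: bigcap_measurableType => M _.
have Gi : {homo G : n m / (n <= m)%N >-> (n <= m)%O}.
  move=> n m nm; apply/subsetPset => w h M /= mM; apply: h => /=.
  exact: leq_trans mM.
have hc := @nondecreasing_cvg_mu _ _ _ P _ mG (bigcupT_measurable G mG) Gi.
apply: (cvge_to_le hc); apply: nearW => N /=.
apply: (@le_trans _ _ (P (E (maxn N N0)))).
  apply: le_measure; rewrite ?inE//.
  by move=> w; apply => /=; exact: leq_maxl.
by rewrite prE// lee_fin; apply: HN => /=; exact: leq_maxr.
Qed.

Lemma borel_cantelli (F : nat -> set T) (p : nat -> R) S : (forall n, measurable (F n)) ->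
  (\forall n \near \oo, (P (F n) <= (p n)%:E)%E) -> (forall n, 0 <= p n) ->
  (forall I, \sum_(0 <= i < I) p i <= S) ->
  {ae P, forall w, exists I, forall i, (I <= i)%N -> ~ F i w}.
Proof.
move=> mF [N _ HN] p0 pS.
pose G n := F (n + N)%N.
have mG n : measurable (G n) by exact: mF.
have PG n : (P (G n) <= (p (n + N)%N)%:E)%E by apply: HN => /=; exact: leq_addl.
have sG : (\sum_(0 <= n <oo) P (G n) < +oo)%E.
  apply: (@le_lt_trans _ _ S%:E); last exact: ltry.
  apply: lime_le; first exact: is_cvg_nneseries.
  apply: nearW => k; apply: (@le_trans _ _ (\sum_(0 <= n < k) (p (n + N)%N)%:E)%E).
    exact: lee_sum.
  rewrite sumEFin lee_fin; apply: le_trans (pS (k + N)%N).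
  have -> : \sum_(0 <= i < k) p (i + N)%N = \sum_(N <= i < k + N) p i.
    by rewrite -{2}(add0n N) big_addn addnK.
  by rewrite [leRHS](@big_cat_nat _ _ _ N)//= ?leq_addl// lerDr sumr_ge0.
have L0 := lim_sup_set_cvg0 mG sG.
exists (lim_sup_set G); split => //.
  by apply: bigcapT_measurable => n; apply: bigcup_measurable => k _.
move=> w /= hw; apply: contrapT => nw; apply: hw.
apply: contrapT => nI; apply: nw => n _.
apply: contrapT => nn; apply: nI; exists (n + N)%N => i ni Fi; apply: nn.
exists (i - N)%N => /=; first by rewrite leq_subRL 1?addnC// (leq_trans _ ni)// leq_addl.
by rewrite /G subnK// (leq_trans _ ni)// leq_addl.
Qed.

End Liminf.

(** * From good dyadic scales to the growth of the path *)

Section Sufficiency.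
Context (R : realType) (disp : measure_display)
    (T : measurableType disp) (P : probability T R)
    (X : R -> {RV P >-> measurableTypeR R}) (gamma : R)
    (Pi : {measure set (measurableTypeR R) -> \bar R}).
Hypothesis X_levy : levy_process X.
Hypothesis Pi_levy : bounded_levy_measure Pi.
Hypothesis X_triplet : has_triplet X gamma 0 Pi.
Hypothesis Pi_abs : (\int[Pi]_x `|x|%:E < +oo)%E.
Hypothesis no_drift : drift gamma Pi = 0.
Variable kappa : R.
Hypothesis kappa_gt1 : 1 < kappa.
Local Notation A := (A_plus Pi).
Hypothesis HK : forall d, 0 < d -> (K_X kappa Pi d < +oo)%E.
Hypothesis Hb : (\int[Pi]_x (negp x / A (negp x))%:E < +oo)%E.

Let b (n : nat) : R := 2^-1 ^+ n.
Let b0 n : 0 < b n. Proof. by rewrite exprn_gt0. Qed.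
Let s (i : nat) : R := b i.+1.
Let s0 i : 0 < s i. Proof. exact: b0. Qed.

Let mesh1 i j : (2 ^ j)%:R * mesh 1 (j + i.+1) = s i :> R.
Proof.
rewrite /mesh /s /b exprD invfM mul1r mulrA natrX divff ?mul1r ?exprVn// expf_neq0//.
Qed.

Let mesh_shift_cvg0 i : mesh (1 : R) (j + i.+1) @[j --> \oo] --> 0.
Proof. by rewrite (cvg_shiftn i.+1 (mesh (1 : R))); exact: mesh_cvg0. Qed.

Let blocks1 i : grid_blocks (s i) (fun j => mesh 1 (j + i.+1)) (fun=> 0%N) (fun j => (2 ^ j)%N).
Proof.
split; [by move=> j; exact: mesh_gt0|exact: mesh_shift_cvg0|by move=> j; rewrite subn0 mesh1|by []].
Qed.

Let blocks2 i : grid_blocks (s i) (fun j => mesh 1 (j + i.+1)) (fun j => (2 ^ j)%N) (fun j => (2 ^ j.+1)%N).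
Proof.
have e j : (2 ^ j.+1 = 2 ^ j + 2 ^ j)%N by rewrite expnS mul2n addnn.
split; [by move=> j; exact: mesh_gt0|exact: mesh_shift_cvg0|by move=> j; rewrite e addnK mesh1|].
by move=> j; rewrite e leq_addr.
Qed.

Let indep12 i : indep_blocks X (fun j => mesh 1 (j + i.+1)) (fun=> 0%N) (fun j => (2 ^ j)%N)
  (fun j => (2 ^ j)%N) (fun j => (2 ^ j.+1)%N).
Proof.
move=> j B C mB mC; apply: (vari_indep X_levy) => //.
- by rewrite ltW// mesh_gt0.
- exact: measurable_posp.
- exact: measurable_negp.
- by case: (blocks2 i).
Qed.

Let indep21 i : indep_blocks X (fun j => mesh 1 (j + i.+1)) (fun j => (2 ^ j)%N) (fun j => (2 ^ j.+1)%N)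
  (fun=> 0%N) (fun j => (2 ^ j)%N).
Proof.
move=> j B C mB mC; rewrite setIC muleC; apply: (vari_indep X_levy) => //.
- by rewrite ltW// mesh_gt0.
- exact: measurable_negp.
- exact: measurable_posp.
- by case: (blocks2 i).
Qed.

Let V M a c w := vari X posp (mesh 1 M) a c w.
Let W M a c w := vari X negp (mesh 1 M) a c w.
(** The number of steps of mesh [2 ^- M] in a time [s i]; correct only for [i < M], since the
    subtraction is truncated. *)
Let n1 i M := (2 ^ (M - i.+1))%N.

Definition late_jump i M := [set w | V M 0 (n1 i M) w / 4 < W M (n1 i M) (n1 i M).*2 w].
Definition early_jump i M := [set w | V M (n1 i M) (n1 i M).*2 w / 4 < W M 0 (n1 i M) w].
Definition slow_start C i M := [set w | V M 0 (n1 i M) w <= C * s i `^ kappa].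
(* Off this event the negative variation up to time [2^-i] is at most half of the
   positive variation up to time [2^-i.+1], which exceeds [C * s i `^ kappa]. *)
Definition bad_scale C i M :=
  (late_jump i M `|` slow_start C i M) `|` (late_jump i.+1 M `|` early_jump i.+1 M).

Let mV M a c : measurable_fun setT (V M a c).
Proof. by apply: measurable_vari; exact: measurable_posp. Qed.
Let mW M a c : measurable_fun setT (W M a c).
Proof. by apply: measurable_vari; exact: measurable_negp. Qed.

Let m_late i M : measurable (late_jump i M).
Proof. by apply: measurable_lt => //; exact: measurable_fun_mul. Qed.
Let m_early i M : measurable (early_jump i M).
Proof. by apply: measurable_lt => //; exact: measurable_fun_mul. Qed.
Let m_slow C i M : measurable (slow_start C i M).
Proof. exact: measurable_le. Qed.
Let m_bad C i M : measurable (bad_scale C i M).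
Proof. by apply: measurableU; exact: measurableU. Qed.

Let near_shift (Q : nat -> Prop) i : (\forall j \near \oo, Q (j + i)%N) -> \forall M \near \oo, Q M.
Proof.
move=> [N _ HN]; exists (N + i)%N => // M /= NM.
have iM : (i <= M)%N by rewrite (leq_trans _ NM)// leq_addl.
by rewrite -(subnK iM); apply: HN => /=; rewrite leq_subRL// addnC.
Qed.

Lemma bad_scale_summable C : 0 < C -> exists p : nat -> R, exists S : R,
  [/\ (forall i, 0 <= p i), (forall I, \sum_(0 <= i < I) p i <= S) &
    \forall i \near \oo, \forall M \near \oo, pr P (bad_scale C i M) <= p i].
Proof.
move=> C0.
have [p [i1 [S [p0 pS pP]]]] := jump_over_summable X_levy Pi_levy X_triplet Pi_abs no_drift kappa_gt1 HK Hb C0.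
have sp1 I : \sum_(0 <= i < I) p i.+1 <= S.
  apply: le_trans (pS I.+1); rewrite big_nat_recl//= lerDr; exact: p0.
exists (fun i => 2 * p i + 2 * p i.+1), (2 * S + 2 * S); split.
- by move=> i; rewrite addr_ge0// mulr_ge0.
- by move=> I; rewrite big_split/= -!mulr_sumr lerD// ler_wpM2l.
exists i1 => // i /= ii.
have e j i' : (2 ^ j.+1 = (n1 i' (j + i'.+1)).*2)%N by rewrite /n1 addnK expnS mul2n.
have e' j i' : (2 ^ j = n1 i' (j + i'.+1))%N by rewrite /n1 addnK.
have hl i' : (i1 <= i')%N -> \forall M \near \oo, pr P (late_jump i' M) <= p i' /\ pr P (slow_start C i' M) <= p i'.
  move=> ii'; apply: (@near_shift _ i'.+1).
  have := pP i' _ _ _ _ _ ii' (blocks1 i') (blocks2 i') (indep12 i').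
  by apply: filterS => j; rewrite /late_jump /slow_start /V /W -e' -mul2n -expnS.
have he : \forall M \near \oo, pr P (early_jump i.+1 M) <= p i.+1.
  apply: (@near_shift _ i.+2).
  have := pP i.+1 _ _ _ _ _ (leqW ii) (blocks2 i.+1) (blocks1 i.+1) (indep21 i.+1).
  by apply: filterS => j [h _]; rewrite /early_jump /V /W -e' -mul2n -expnS.
apply: filterS3 (hl i ii) (hl i.+1 (leqW ii)) he => M [h1 h2] [h3 _] h4.
have mA := measurableU _ _ (m_late i M) (m_slow C i M).
have mB := measurableU _ _ (m_late i.+1 M) (m_early i.+1 M).
apply: (le_trans (pr_setU _ mA mB)).
have := pr_setU P (m_late i M) (m_slow C i M).
have := pr_setU P (m_late i.+1 M) (m_early i.+1 M).
move: h1 h2 h3 h4; move: (pr _ (late_jump i M)) (pr _ (slow_start C i M)) (pr _ (late_jump i.+1 M)) (pr _ (early_jump i.+1 M)) => x1 x2 x3 x4.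
move: (pr _ _) (pr _ _) => x5 x6; lra.
Qed.

(** Let [V1], [V2] be the positive variations over the two halves of [[0, s i]]. The negative
    variation is at most [V2 / 4] on the first half, [V1 / 4] on the second and [(V1 + V2) / 4] on
    [[s i, 2 * s i]]: in total at most half of [V1 + V2], which exceeds [C * s i ^ kappa]. *)
Let grid_lower C i M k w : (i.+2 <= M)%N -> (n1 i M <= k <= (n1 i M).*2)%N -> ~ bad_scale C i M w ->
  C / 2 * s i `^ kappa <= cent X (k%:R * mesh 1 M) w.
Proof.
move=> iM /andP[nk kn] nb.
have h1 : W M (n1 i M) (n1 i M).*2 w <= V M 0 (n1 i M) w / 4.
  by rewrite leNgt; apply/negP => h; apply: nb; left; left.
have h2 : C * s i `^ kappa < V M 0 (n1 i M) w.
  by rewrite ltNge; apply/negP => h; apply: nb; left; right.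
have h3 : W M (n1 i.+1 M) (n1 i.+1 M).*2 w <= V M 0 (n1 i.+1 M) w / 4.
  by rewrite leNgt; apply/negP => h; apply: nb; right; left.
have h4 : W M 0 (n1 i.+1 M) w <= V M (n1 i.+1 M) (n1 i.+1 M).*2 w / 4.
  by rewrite leNgt; apply/negP => h; apply: nb; right; right.
have e : (n1 i.+1 M).*2 = n1 i M by rewrite /n1 -mul2n -expnS -subSn.
rewrite e in h3 h4.
have l1 : (n1 i.+1 M <= n1 i M)%N by rewrite -e -addnn leq_addr.
have l2 : (n1 i M <= (n1 i M).*2)%N by rewrite -addnn leq_addr.
rewrite cent_vari -/(V M 0 k w) -/(W M 0 k w).
have hV : V M 0 (n1 i M) w <= V M 0 k w by apply: vari_mono => //; exact: posp_ge0.
have hW : W M 0 k w <= W M 0 (n1 i M).*2 w by apply: vari_mono => //; exact: negp_ge0.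
have eW : W M 0 (n1 i M).*2 w = W M 0 (n1 i.+1 M) w + W M (n1 i.+1 M) (n1 i M) w + W M (n1 i M) (n1 i M).*2 w.
  by rewrite /W -vari_cat ?l1// -vari_cat.
have eV : V M 0 (n1 i M) w = V M 0 (n1 i.+1 M) w + V M (n1 i.+1 M) (n1 i M) w.
  by rewrite /V -vari_cat ?l1.
rewrite mulrAC; lra.
Qed.

Lemma dyadic_lower C I w : (forall i, (I <= i)%N -> ~ liminf_event (bad_scale C i) w) ->
  forall k N, 0 < k%:R * mesh (1 : R) N <= b I -> 0 <= C ->
  C / 2 / 2 `^ kappa * (k%:R * mesh 1 N) `^ kappa <= cent X (k%:R * mesh 1 N) w.
Proof.
move=> HI k N; set t := k%:R * mesh 1 N => /andP[t0 tI] C0.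
have h01 : 0 < (2^-1 : R) < 1 by rewrite invr_gt0 ltr0n invf_lt1// ltr1n.
have [i [Ii ti it]] : exists i, [/\ (I <= i)%N, t <= b i & b i.+1 < t].
  have ex : exists m, b m < t by exact: geom_lt.
  case: (ex_minnP ex) => m hm mmin.
  have Im : (I < m)%N.
    rewrite ltnNge; apply/negP => mI; have : b I <= b m by rewrite /b ler_wiXn2l//; lra.
    by move=> h; have := lt_le_trans hm (le_trans tI h); rewrite ltxx.
  have m0 : (0 < m)%N by exact: leq_ltn_trans Im.
  exists m.-1; rewrite (prednK m0); split=> //; first by rewrite -ltnS (prednK m0).
  rewrite leNgt; apply/negP => /mmin; rewrite -{1}(prednK m0) ltnn//.
(* Outside the lower limit some mesh finer than [2 ^- N] avoids the bad event, and the dyadic time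
   [t] lies on that finer grid as well. *)
have [M [NM iM nb]] : exists M, [/\ (N <= M)%N, (i.+2 <= M)%N & ~ bad_scale C i M w].
  apply: contrapT => h; apply: (HI i Ii); exists (maxn N i.+2) => // M /=.
  rewrite geq_max => /andP[NM iM]; apply: contrapT => nb; apply: h.
  by exists M.
pose k' := (k * 2 ^ (M - N))%N.
have tE : t = k'%:R * mesh 1 M.
  rewrite /t /k' natrM natrX /mesh -mulrA; congr (_ * _).
  by rewrite -{2}(subnK NM) exprD invfM !mul1r mulrA divff ?mul1r// expf_neq0.
have m0 : 0 < mesh (1 : R) M by exact: mesh_gt0.
have nE : (n1 i M)%:R * mesh 1 M = s i.
  have := mesh1 i (M - i.+1); rewrite subnK//; exact: ltnW.
have bE : b i = 2 * s i by rewrite /s /b exprS mulrA divff ?mul1r.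
have kn : (n1 i M <= k' <= (n1 i M).*2)%N.
  apply/andP; split.
    rewrite -(ler_nat R) -(ler_pM2r m0) -tE nE; exact: ltW.
  rewrite -(ler_nat R) -(ler_pM2r m0) -tE -mul2n natrM -mulrA nE -bE//.
rewrite tE; apply: le_trans (grid_lower iM kn nb); rewrite -tE.
rewrite -mulrA ler_wpM2l ?divr_ge0//.
rewrite ler_pdivrMl ?powR_gt0// -powRM ?(ltW (s0 _))// -bE.
apply: ge0_ler_powR; rewrite ?nnegrE ?(ltW t0) ?(ltW (b0 _))//.
by rewrite ltW// (lt_trans _ kappa_gt1).
Qed.

(** Right-continuity carries the bound from dyadic times just after [t] down to [t]; the bound
    increases with time, so nothing is lost. *)
Lemma path_lower C I w : 0 <= C -> cadlag (fun t => X t w) ->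
  (forall i, (I <= i)%N -> ~ liminf_event (bad_scale C i) w) ->
  forall t, 0 < t < b I -> C / 2 / 2 `^ kappa * t `^ kappa <= cent X t w.
Proof.
move=> C0 [cX _] HI t /andP[t0 tI].
set c := C / 2 / 2 `^ kappa.
have c0 : 0 <= c by rewrite /c !divr_ge0// powR_ge0.
rewrite /cent lerBrDr leNgt; apply/negP => hlt.
have := cX t (ltW t0) => hc.
have n3 := (@cvgr_lt _ _ _ _ _ _ hc _ hlt).
have n1' : \forall u \near t^'+, X u w < c * t `^ kappa + X 0 w by exact: n3.
have n2 : \forall u \near t^'+, u < b I by exact: nbhs_right_lt.
have [e /= e0 He] : \forall u \near t^'+, X u w < c * t `^ kappa + X 0 w /\ u < b I.
  by apply: filterS2 n1' n2 => u; split.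
have h01 : 0 < (2^-1 : R) < 1 by rewrite invr_gt0 ltr0n invf_lt1// ltr1n.
have [N hN] := geom_lt h01 e0.
have mE : mesh (1 : R) N = 2^-1 ^+ N by rewrite /mesh mul1r exprVn.
have m0 : 0 < mesh (1 : R) N by exact: mesh_gt0.
pose k := (Num.trunc (t / mesh 1 N)).+1.
have tm : 0 <= t / mesh 1 N by rewrite divr_ge0 ?ltW.
have /andP[k1 k2] := truncn_itv tm.
have ku : t < k%:R * mesh 1 N by rewrite -ltr_pdivrMr.
have kl : k%:R * mesh 1 N <= t + mesh 1 N.
  by rewrite /k -natr1 mulrDl mul1r lerD2r -ler_pdivlMr.
have [hX hI] : X (k%:R * mesh 1 N) w < c * t `^ kappa + X 0 w /\ k%:R * mesh 1 N < b I.
  apply: He => //=; rewrite distrC ger0_norm ?subr_ge0 ?(ltW ku)// ltrBlDl.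
  by apply: (le_lt_trans kl); rewrite ltrD2l mE.
have kI : 0 < k%:R * mesh (1 : R) N <= b I by rewrite (lt_trans t0 ku) ltW.
have := dyadic_lower HI kI C0; rewrite /cent lerBrDr -/c => hd.
have := le_lt_trans hd hX; rewrite ltrD2r ltNge => /negP; apply.
apply: ler_wpM2l => //; apply: ge0_ler_powR; rewrite ?nnegrE ?(ltW t0) ?(ltW ku)//.
  by rewrite ltW// (lt_trans _ kappa_gt1).
by rewrite ltW// (lt_trans t0 ku).
Qed.

Lemma sufficiency : {ae P, forall w, X t w / t `^ kappa @[t --> 0^'+] --> +oo%R}.
Proof.
have k0 : 0 < kappa by rewrite (lt_trans _ kappa_gt1).
(* Restricting the constant [C] to positive integers makes one null set serve all of them. *)
have hbad : {ae P, forall w, forall n : nat, exists I, forall i, (I <= i)%N -> ~ liminf_event (bad_scale n.+1%:R i) w}.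
  apply: ae_foralln => n.
  have n0 : 0 < n.+1%:R :> R by rewrite ltr0n.
  have [p [S [p0 pS hp]]] := bad_scale_summable n0.
  apply: (borel_cantelli (p := p) (S := S)) => //.
    by move=> i; exact: measurable_liminf_event.
  by apply: filterS hp => i hi; exact: liminf_event_le.
have hs := levy_start X_levy; have hc := levy_cadlag X_levy.
apply: filterS3 hbad hs hc => w hb X0 cw.
apply/cvgryPge => a.
pose n := Num.bound (`|a| * (2 * 2 `^ kappa)).
have q0 : 0 < 2 * 2 `^ kappa :> R by rewrite mulr_gt0// powR_gt0.
have an : a <= n.+1%:R / 2 / 2 `^ kappa.
  rewrite -mulrA -invfM ler_pdivlMr//; apply: (@le_trans _ _ (`|a| * (2 * 2 `^ kappa))).
    by rewrite ler_wpM2r ?(ltW q0)// ler_norm.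
  have hn : `|a| * (2 * 2 `^ kappa) < n%:R by apply: archi_boundP; rewrite mulr_ge0// ltW.
  by rewrite ltW// (lt_trans hn)// ltr_nat.
have [I HI] := hb n.
near=> t.
have t0 : 0 < t by near: t; exact: nbhs_right_gt.
have tI : t < b I by near: t; exact: nbhs_right_lt.
have t0I : 0 < t < b I by rewrite t0 tI.
have := path_lower (ler0n R n.+1) cw HI t0I; rewrite /cent X0 subr0 => h.
rewrite ler_pdivlMr ?powR_gt0//; apply: le_trans h.
by rewrite ler_wpM2r// powR_ge0.
Unshelve. all: by end_near.
Qed.

End Sufficiency.

Theorem theorem3p3 (R : realType) (disp : measure_display)
    (T : measurableType disp) (P : probability T R)
    (X : R -> {RV P >-> measurableTypeR R})
    (gamma sigma2 : R) (Pi : {measure set (measurableTypeR R) -> \bar R})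
    (kappa : R)
    (X_levy : levy_process X)
    (Pi_levy : bounded_levy_measure Pi)
    (X_triplet : has_triplet X gamma sigma2 Pi)
    (no_gaussian : sigma2 = 0)
    (X_bv : bv X)
    (no_drift : drift gamma Pi = 0)
    (kappa_gt1 : 1 < kappa) :
  {ae P, forall w, X t w / t `^ kappa @[t --> 0^'+] --> +oo%R} <->
  ((forall d : R, 0 < d -> (K_X kappa Pi d < +oo)%E) /\
   (\int[Pi_minus Pi]_(x in `]0%R, 1%R]) (x / A_plus Pi x)%:E < +oo)%E).
Proof.
rewrite no_gaussian in X_triplet.
have Pi_abs : (\int[Pi]_x `|x|%:E < +oo)%E by exact: (bv_levy_abs X_levy Pi_levy X_triplet X_bv).
split=> [X_lim|[HK Hb]].
  split; first exact: (necessity_K_X X_levy Pi_levy X_triplet Pi_abs no_drift kappa_gt1 X_lim).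
  by rewrite Pi_minus_integral//; exact: (necessity_negative_jumps X_levy Pi_levy X_triplet Pi_abs no_drift kappa_gt1 X_lim).
rewrite Pi_minus_integral// in Hb.
exact: (sufficiency X_levy Pi_levy X_triplet Pi_abs no_drift kappa_gt1 HK Hb).
Qed.
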